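(* (1) The equivalence class of a decomposable Monge--Ampère system with a Lagrangian pair $(E_1,E_2)$ on a contact manifold $(M,D)$ is uniquely determined by the Lagrangian contact structure $(D,E_1,E_2)$. (2) Therefore the maximal dimension of the automorphism pseudo-groups of decomposable Monge--Ampère systems with Lagrangian pairs on contact manifolds $(M,D)$ of dimension $2n+1$ is equal to $(n+2)^2-1$. The maximum is attained by the decomposable Monge--Ampère system $\mathrm{Hess}=0$ on the flat model $M=P(T^*P^{n+1})$.
   Context: All objects are $C^\infty$. A contact structure $D$ on a manifold $M$ of dimension $2n+1$ is a subbundle of $TM$ of codimension one, locally $D=\{\theta=0\}$ for a $1$-form $\theta$ such that $d\theta|_D$ is non-degenerate. A Lagrangian pair $(E_1,E_2)$ is a pair of rank-$n$ subbundles of $D$, each isotropic for $d\theta$, with $D=E_1\oplus E_2$; the triple $(D,E_1,E_2)$ is called a Lagrangian contact structure. A Monge--Ampère system $\mathcal M$ on $(M,D)$ is an exterior differential system which is locally the ideal $\langle\theta,d\theta,\omega\rangle$ generated algebraically by a contact form $\theta$ and an $n$-form $\omega$ (a local generator). It is a decomposable Monge--Ampère system with Lagrangian pair $(E_1,E_2)$ if near each point there is a local generator $\omega$ with $i_u\omega=0$ for all $u\in E_1$ and $\omega|_{E_2}$ a volume form on $E_2$. An automorphism of a decomposable Monge--Ampère system with Lagrangian pair is a (local) diffeomorphism preserving $D$, $\mathcal M$ and the associated Lagrangian pair $(E_1,E_2)$. The dimension of the automorphism pseudo-group is understood in the usual sense for finite-dimensional Lie pseudo-groups (dimension of the Lie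 algebra of germs of infinitesimal automorphisms at a point). Flat model: $P^{n+1}=P(\mathbf R^{n+2})$, and $P(T^*P^{n+1})=\{V_1\subset V_{n+1}\subset\mathbf R^{n+2}: \dim V_1=1,\dim V_{n+1}=n+1\}$ carries its canonical contact structure $D$ and the Lagrangian pair $E_1=\ker(\pi_2)_*$, $E_2=\ker(\pi_1)_*$, where $\pi_1:P(T^*P^{n+1})\to P^{n+1}$ and $\pi_2:P(T^*P^{n+1})\to P^{n+1*}$ are the projections $(V_1,V_{n+1})\mapsto V_1$, $(V_1,V_{n+1})\mapsto V_{n+1}$. In suitable local coordinates $(x_1,\dots,x_n,z,p_1,\dots,p_n)$, $D=\{dz-\sum p_idx_i=0\}$, $E_1=\{v\in D: dp_1(v)=\dots=dp_n(v)=0\}$, $E_2=\{u\in D:dx_1(u)=\dots=dx_n(u)=0\}$, and the system $\mathrm{Hess}=0$ is generated by $\theta=dz-\sum p_idx_i$, $d\theta$ and $\omega=dp_1\wedge\dots\wedge dp_n$ (corresponding to the equation $\det(\partial^2 f/\partial x_i\partial x_j)=0$). *)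

(* Defs.v *)
From HB Require Import structures.
From mathcomp Require Import all_boot all_order all_algebra.
From mathcomp Require Import all_classical all_reals all_analysis.

Set Implicit Arguments.
Unset Strict Implicit.
Unset Printing Implicit Defensive.

Import Order.TTheory GRing.Theory Num.Theory.
Import numFieldNormedType.Exports.

Local Open Scope classical_set_scope.
Local Open Scope ring_scope.

(** * Smooth maps between open subsets of R^m *)

Section Smooth.
Context {R : realType}.

Definition iter_partial m (s : seq 'I_m) (f : 'rV[R]_m -> R) : 'rV[R]_m -> R :=
  foldr (fun i g => fun x => 'D_(delta_mx 0 i) g x) f s.

(* Meant for open [A]: all iterated partial derivatives exist and are
   differentiable, hence continuous, at every point of [A]. *)
Definition smooth_on m (A : set 'rV[R]_m) (f : 'rV[R]_m -> R) : Prop :=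
  forall (s : seq 'I_m) (x : 'rV[R]_m), A x -> differentiable (iter_partial s f) x.

Definition smooth_rv_on m k (A : set 'rV[R]_m) (f : 'rV[R]_m -> 'rV[R]_k) : Prop :=
  forall j : 'I_k, smooth_on A (fun x => f x 0 j).

End Smooth.

(** * Exterior algebra of R^m *)

Section Exterior.
Context {R : realType}.

(* A possibly inhomogeneous exterior form on R^m: its degree k component is
   evaluated on the k rows of a matrix. *)
Definition eform (m : nat) : Type := forall k : nat, 'M[R]_(k, m) -> R.

Definition alternating m (f : eform m) : Prop :=
  forall k : nat,
    (forall (i : 'I_k) (a : R) (A B C : 'M[R]_(k, m)),
        row i A = a *: row i B + row i C ->
        row' i A = row' i B -> row' i A = row' i C ->
        f k A = a * f k B + f k C) /\
    (forall (i j : 'I_k) (A : 'M[R]_(k, m)),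
        i != j -> row i A = row j A -> f k A = 0).

Definition wedge_sign k (S : {set 'I_k}) : R :=
  (-1) ^+ #|[set ij : 'I_k * 'I_k |
              [&& ij.1 \in S, ij.2 \notin S & (ij.2 < ij.1)%N]]|.

(* Shuffle formula: a (p, k - p)-shuffle of the k arguments is the same as the
   set [S] of the p arguments that are fed, in increasing order, to [f]. *)
Definition wedge m (f g : eform m) : eform m := fun k v =>
  \sum_(S : {set 'I_k})
     wedge_sign S * f #|S| (rowsub (@enum_val _ (mem S)) v)
                  * g #|~: S| (rowsub (@enum_val _ (mem (~: S))) v).
#[global] Arguments wedge {m} f g k v.

Definition eform1 m : eform m := fun k _ => (k == 0%N)%:R.
#[global] Arguments eform1 {m} k v.

(* The 1-form  u |-> u *m a; for k = 1 the sum has a single term. *)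
Definition covector m (a : 'cV[R]_m) : eform m := fun k v =>
  if k == 1%N then \sum_(i < k) (v *m a) i 0 else 0.
#[global] Arguments covector {m} a k v.

Definition dcoord m (i : 'I_m) : eform m := covector (delta_mx i 0).
#[global] Arguments dcoord {m} i k v.

(* Exterior derivative on open subsets of R^m:
   d eta (v_0, .., v_r) = \sum_i (-1)^i D_{v_i} eta (v_0, .., ^v_i, .., v_r). *)
Definition ext_d m (eta : 'rV[R]_m -> eform m) : 'rV[R]_m -> eform m :=
  fun x k v =>
    \sum_(i < k) (-1) ^+ i *
       'D_(row i v) (fun y : 'rV[R]_m => eta y k.-1 (row' i v)) x.
#[global] Arguments ext_d {m} eta x k v.

End Exterior.
Arguments eform R m : clear implicits.

(** * Smooth manifolds, presented by local parametrisations *)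

(* [chart_at] selects a chart around each point; it is only used to identify
   tangent spaces with R^m. *)
Record premanifold (R : realType) (m : nat) := PreManifold {
  point :> Type;
  chart : Type;
  cdom : chart -> set 'rV[R]_m;
  par : chart -> 'rV[R]_m -> point;
  chart_at : point -> chart
}.
Arguments cdom {R m} _ _ _.
Arguments par {R m} _ _ _.
Arguments chart_at {R m} _ _.

Section Manifold.
Context {R : realType} {m : nat}.
Implicit Type M : premanifold R m.

Definition cran M (c : chart M) : set M := par M c @` cdom M c.

(* The inverse of [par M c], meaningful on [cran c]. *)
Definition crd M (c : chart M) (p : M) : 'rV[R]_m :=
  xget 0 [set x | cdom M c x /\ par M c x = p].

Definition cpre M (c : chart M) (U : set M) : set 'rV[R]_m :=
  [set x | cdom M c x /\ U (par M c x)].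

Definition mopen M (U : set M) : Prop := forall c : chart M, open (cpre c U).

Definition is_manifold M : Prop :=
  (forall c : chart M, open (cdom M c)) /\
  (forall (c : chart M) (x y : 'rV[R]_m), cdom M c x -> cdom M c y ->
     par M c x = par M c y -> x = y) /\
  (forall p : M, cran (chart_at M p) p) /\
  (forall c c' : chart M, open (cpre c (cran c')) /\
     smooth_rv_on (cpre c (cran c')) (crd c' \o par M c)) /\
  (forall p q : M, p <> q -> exists U V : set M,
     [/\ mopen U, mopen V, U p, V q & U `&` V = set0]) /\
  (exists B : nat -> set M, (forall k, mopen (B k)) /\
     forall (U : set M) (p : M), mopen U -> U p -> exists k, B k p /\ B k `<=` U).

(** The tangent space at [p] is R^m, in the coordinates of [chart_at M p];
    [to_chart c p] (resp. [of_chart c p]) is the matrix, acting on row vectors,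
    of the change from these coordinates to those of [c] (resp. back). *)
Definition to_chart M (c : chart M) (p : M) : 'M[R]_m :=
  jacobian (crd c \o par M (chart_at M p)) (crd (chart_at M p) p).

Definition of_chart M (c : chart M) (p : M) : 'M[R]_m :=
  jacobian (crd (chart_at M p) \o par M c) (crd c p).

Definition near_pt M (p : M) (P : M -> Prop) : Prop :=
  exists U : set M, [/\ mopen U, U p & forall q, U q -> P q].

(** Vector fields *)

Definition vfield M : Type := M -> 'rV[R]_m.

Definition vrep M (c : chart M) (X : vfield M) (x : 'rV[R]_m) : 'rV[R]_m :=
  X (par M c x) *m to_chart c (par M c x).

Definition smooth_vf M (U : set M) (X : vfield M) : Prop :=
  forall c : chart M, smooth_rv_on (cpre c U) (vrep c X).

Definition bracket M (X Y : vfield M) : vfield M := fun p =>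
  let c := chart_at M p in let x := crd c p in
  'D_(vrep c X x) (vrep c Y) x - 'D_(vrep c Y x) (vrep c X) x.

(** Differential forms (not necessarily homogeneous) *)

Definition dform M : Type := M -> eform R m.

Definition frep M (c : chart M) (eta : dform M) (x : 'rV[R]_m) : eform R m :=
  fun k v => eta (par M c x) k (v *m of_chart c (par M c x)).
#[global] Arguments frep {M} c eta x k v.

(* The form given in the coordinates of [c] by [f]. *)
Definition form_of_chart M (c : chart M) (f : 'rV[R]_m -> eform R m) : dform M :=
  fun p k v => f (crd c p) k (v *m to_chart c p).
#[global] Arguments form_of_chart {M} c f p k v.

Definition smooth_form M (U : set M) (eta : dform M) : Prop :=
  (forall p, U p -> alternating (eta p)) /\
  (forall (c : chart M) (k : nat) (v : 'M[R]_(k, m)),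
     smooth_on (cpre c U) (fun x => frep c eta x k v)).

Definition homog M (d : nat) (U : set M) (eta : dform M) : Prop :=
  forall p, U p -> forall (k : nat) (v : 'M[R]_(k, m)), k != d -> eta p k v = 0.

Definition hcomp M (d : nat) (eta : dform M) : dform M :=
  fun p k v => if k == d then eta p k v else 0.
#[global] Arguments hcomp {M} d eta p k v.

Definition addf M (eta zeta : dform M) : dform M :=
  fun p k v => eta p k v + zeta p k v.
#[global] Arguments addf {M} eta zeta p k v.

Definition dwedge M (eta zeta : dform M) : dform M :=
  fun p => wedge (eta p) (zeta p).
#[global] Arguments dwedge {M} eta zeta p k v.

Definition extd M (eta : dform M) : dform M := fun p =>
  let c := chart_at M p in ext_d (frep c eta) (crd c p).
#[global] Arguments extd {M} eta p k v.

Definition contract M (X : vfield M) (eta : dform M) : dform M :=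
  fun p k v => eta p (1 + k)%N (col_mx (X p) v).
#[global] Arguments contract {M} X eta p k v.

(* Cartan's formula *)
Definition lie_form M (X : vfield M) (eta : dform M) : dform M :=
  addf (contract X (extd eta)) (extd (contract X eta)).
#[global] Arguments lie_form {M} X eta p k v.

Definition form_eq_at M (p : M) (eta zeta : dform M) : Prop :=
  near_pt p (fun q => forall k (v : 'M[R]_(k, m)), eta q k v = zeta q k v).

(** Subbundles of the tangent bundle *)

Definition plane_field M : Type := M -> {vspace 'rV[R]_m}.

Definition subbundle M (r : nat) (E : plane_field M) : Prop :=
  forall p : M, exists (U : set M) (X : 'I_r -> vfield M),
    [/\ mopen U, U p, (forall i, smooth_vf U (X i)) &
        forall q, U q -> basis_of (E q) [seq X i q | i <- enum 'I_r]].

Definition section_on M (U : set M) (E : plane_field M) (X : vfield M) : Prop :=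
  smooth_vf U X /\ forall q, U q -> X q \in E q.

(** Exterior differential systems *)

(* A sheaf of differential ideals, given by its stalks: [I p eta] says that the
   germ of [eta] at [p] belongs to the stalk at [p]. *)
Definition eds M : Type := M -> dform M -> Prop.

Definition is_eds M (I : eds M) : Prop :=
  forall p : M,
    (forall eta, I p eta -> exists U : set M,
        [/\ mopen U, U p, smooth_form U eta & forall q, U q -> I q eta]) /\
    (forall eta zeta, form_eq_at p eta zeta -> I p eta -> I p zeta) /\
    I p (fun _ _ _ => 0) /\
    (forall eta zeta, I p eta -> I p zeta -> I p (addf eta zeta)) /\
    (forall d eta, I p eta -> I p (hcomp d eta)) /\
    (forall (U : set M) alpha eta, mopen U -> U p -> smooth_form U alpha ->
        I p eta -> I p (dwedge alpha eta)) /\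
    (forall eta, I p eta -> I p (extd eta)).

(* The stalk at [p] of the ideal generated algebraically by three forms. *)
Definition gen_ideal3 M (f1 f2 f3 : dform M) : eds M := fun p eta =>
  exists (U : set M) (a1 a2 a3 : dform M),
    [/\ mopen U, U p, [/\ smooth_form U a1, smooth_form U a2 & smooth_form U a3] &
        forall q, U q -> forall k (v : 'M[R]_(k, m)),
          eta q k v = addf (dwedge a1 f1) (addf (dwedge a2 f2) (dwedge a3 f3)) q k v].

End Manifold.

(** Smooth maps between manifolds *)

Section Maps.
Context {R : realType} {m m' : nat}.

Definition smooth_map (M : premanifold R m) (M' : premanifold R m')
    (U : set M) (f : M -> M') : Prop :=
  forall (c : chart M) (c' : chart M'),
    let A := cpre c (U `&` f @^-1` cran c') in
    open A /\ smooth_rv_on A (crd c' \o f \o par M c).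

(* The matrix of the differential T_p M -> T_(f p) M', acting on row vectors. *)
Definition dmap (M : premanifold R m) (M' : premanifold R m')
    (f : M -> M') (p : M) : 'M[R]_(m, m') :=
  jacobian (crd (chart_at M' (f p)) \o f \o par M (chart_at M p))
           (crd (chart_at M p) p).

Definition pullback (M : premanifold R m) (M' : premanifold R m')
    (f : M -> M') (eta : dform M') : dform M :=
  fun p k v => eta (f p) k (v *m dmap f p).
#[global] Arguments pullback {M M'} f eta p k v.

End Maps.

Section Diffeo.
Context {R : realType} {m : nat}.

Definition diffeo (M M' : premanifold R m)
    (U : set M) (U' : set M') (f : M -> M') : Prop :=
  mopen U /\ mopen U' /\ smooth_map U f /\
  exists g : M' -> M, smooth_map U' g /\
    (forall p, U p -> U' (f p) /\ g (f p) = p) /\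
    (forall q, U' q -> U (g q) /\ f (g q) = q).

End Diffeo.

(** * Lagrangian contact structures and Monge-Ampere systems *)

Section MongeAmpere.
Context {R : realType} (n : nat).
Notation dM := (n.*2.+1).
Implicit Type M : premanifold R dM.

Definition contact_form M (U : set M) (D : plane_field M) (theta : dform M) : Prop :=
  [/\ mopen U, smooth_form U theta, homog 1 U theta &
   forall q, U q ->
     (forall u : 'rV[R]_dM, u \in D q <-> theta q 1%N u = 0) /\
     (forall u : 'rV[R]_dM, u \in D q ->
        (forall v : 'rV[R]_dM, v \in D q -> extd theta q 2%N (col_mx u v) = 0) ->
        u = 0)].

Definition contact_structure M (D : plane_field M) : Prop :=
  subbundle n.*2 D /\
  forall p : M, exists (U : set M) (theta : dform M), U p /\ contact_form U D theta.

Definition isotropic M (D E : plane_field M) : Prop :=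
  forall (U : set M) (theta : dform M), contact_form U D theta ->
  forall q, U q -> forall u v : 'rV[R]_dM, u \in E q -> v \in E q ->
    extd theta q 2%N (col_mx u v) = 0.

Definition lagrangian_pair M (D E1 E2 : plane_field M) : Prop :=
  [/\ subbundle n E1, subbundle n E2, isotropic D E1, isotropic D E2 &
      forall q : M, (E1 q + E2 q)%VS = D q /\ (E1 q :&: E2 q)%VS = 0%VS].

Definition local_generator M (D : plane_field M) (I : eds M) (U : set M)
    (theta omega : dform M) : Prop :=
  [/\ contact_form U D theta, smooth_form U omega, homog n U omega &
      forall q, U q -> forall eta : dform M,
        I q eta <-> gen_ideal3 theta (extd theta) omega q eta].

Definition monge_ampere M (D : plane_field M) (I : eds M) : Prop :=
  is_eds I /\
  forall p : M, exists (U : set M) (theta omega : dform M),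
    U p /\ local_generator D I U theta omega.

Definition decomposable M (D E1 E2 : plane_field M) (I : eds M) : Prop :=
  forall p : M, exists (U : set M) (theta omega : dform M),
    [/\ U p, local_generator D I U theta omega &
     forall q, U q ->
       (forall (u : 'rV[R]_dM) k (v : 'M[R]_(k, dM)), u \in E1 q ->
          omega q (1 + k)%N (col_mx u v) = 0) /\
       (forall v : 'M[R]_(n, dM), (forall i, row i v \in E2 q) -> row_free v ->
          omega q n v != 0)].

Record lag_system := LagSystem {
  carrier :> premanifold R dM;
  Dist : plane_field carrier;
  Lag1 : plane_field carrier;
  Lag2 : plane_field carrier;
  System : eds carrier
}.
Arguments Dist : clear implicits.
Arguments Lag1 : clear implicits.
Arguments Lag2 : clear implicits.
Arguments System : clear implicits.

Definition decomposable_MA_system (S : lag_system) : Prop :=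
  [/\ is_manifold S, contact_structure (Dist S),
      lagrangian_pair (Dist S) (Lag1 S) (Lag2 S),
      monge_ampere (Dist S) (System S) &
      decomposable (Dist S) (Lag1 S) (Lag2 S) (System S)].

Definition maps_to (S S' : lag_system) (U : set S) (f : S -> S')
    (E : plane_field S) (E' : plane_field S') : Prop :=
  forall q, U q -> (linfun (mulmxr (dmap f q)) @: E q)%VS = E' (f q).

(* [U = setT], [U' = setT] is global equivalence. *)
Definition lag_contact_equivalent (S S' : lag_system) (U : set S) (U' : set S') : Prop :=
  exists f : S -> S',
    [/\ diffeo U U' f, maps_to U f (Dist S) (Dist S'),
        maps_to U f (Lag1 S) (Lag1 S') & maps_to U f (Lag2 S) (Lag2 S')].

Definition MA_equivalent (S S' : lag_system) (U : set S) (U' : set S') : Prop :=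
  exists f : S -> S',
    [/\ diffeo U U' f, maps_to U f (Dist S) (Dist S'),
        maps_to U f (Lag1 S) (Lag1 S'), maps_to U f (Lag2 S) (Lag2 S') &
        forall q, U q -> forall eta : dform S',
          System S' (f q) eta <-> System S q (pullback f eta)].

Definition preserves_dist (S : lag_system) (U : set S) (X : vfield S)
    (E : plane_field S) : Prop :=
  forall (V : set S) (Y : vfield S), mopen V -> V `<=` U -> section_on V E Y ->
  forall q, V q -> bracket X Y q \in E q.

Definition inf_automorphism (S : lag_system) (U : set S) (X : vfield S) : Prop :=
  smooth_vf U X /\
  [/\ preserves_dist U X (Dist S), preserves_dist U X (Lag1 S),
      preserves_dist U X (Lag2 S) &
      forall q, U q -> forall eta, System S q eta -> System S q (lie_form X eta)].

Definition inf_automorphism_at (S : lag_system) (p : S) (X : vfield S) : Prop :=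
  exists U : set S, [/\ mopen U, U p & inf_automorphism U X].

(* The germs at [p] of infinitesimal automorphisms form a real vector space of
   dimension [d]: there is a basis of [d] germs. *)
Definition automorphism_dim (S : lag_system) (p : S) (d : nat) : Prop :=
  exists X : 'I_d -> vfield S,
    [/\ forall i, inf_automorphism_at p (X i),
        forall a : 'I_d -> R,
          near_pt p (fun q => \sum_(i < d) a i *: X i q = 0) -> forall i, a i = 0 &
        forall Y, inf_automorphism_at p Y -> exists a : 'I_d -> R,
          near_pt p (fun q => Y q = \sum_(i < d) a i *: X i q)].

End MongeAmpere.
Arguments lag_system R n : clear implicits.
Arguments LagSystem {R n}.
Arguments Dist {R n} _ _.
Arguments Lag1 {R n} _ _.
Arguments Lag2 {R n} _ _.
Arguments System {R n} _ _ _.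

(** * The flat model *)

Section Flat.
Context (R : realType) (n : nat).
Notation V := ('rV[R]_n.+2).
Notation dM := (n.*2.+1).

Definition rowspace k N (A : 'M[R]_(k, N)) : {vspace 'rV[R]_N} :=
  limg (linfun (mulmxr A)).

Lemma dim_rowspace k N (A : 'M[R]_(k, N)) : row_free A -> \dim (rowspace A) = k.
Proof.
move=> fA; rewrite /rowspace limg_dim_eq; first by rewrite dimvf /dim /= mul1n.
apply/eqP; rewrite -subv0; apply/subvP => u /=.
rewrite memv_cap memvf /= memv_ker lfunE /= => /eqP uA0.
by rewrite memv0; apply/eqP/(row_free_inj fA); rewrite mul0mx.
Qed.

Lemma rowspace_mulS j k N (B : 'M[R]_(j, k)) (A : 'M[R]_(k, N)) :
  (rowspace (B *m A) <= rowspace A)%VS.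
Proof.
apply/subvP => _ /memv_imgP [u _ ->]; rewrite lfunE /= mulmxA.
by apply/memv_imgP; exists (u *m B); rewrite ?memvf // lfunE.
Qed.

Lemma row_free_mulg k (A : 'M[R]_(k, n.+2)) (g : 'M[R]_n.+2) :
  row_free A -> g \in unitmx -> row_free (A *m g).
Proof. by move=> fA gU; rewrite /row_free mxrankMfree // row_free_unit. Qed.

Definition GL : Type := {g : 'M[R]_n.+2 | g \in unitmx}.

Definition GL1 : GL := exist _ 1%:M (unitmx1 R n.+2).

(* Affine charts are translated by GL(n+2), so all flags are covered.
   A point is spanned by (1, w); a hyperplane is the graph of a linear form w,
   spanned by the rows of [hyp_mx w]. *)
Definition pt_mx (w : 'rV[R]_n.+1) : 'M[R]_(1, n.+2) := row_mx (1%:M : 'M[R]_1) w.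

Definition hyp_mx (w : 'rV[R]_n.+1) : 'M[R]_(n.+1, n.+2) :=
  row_mx (w^T : 'M[R]_(n.+1, 1)) (1%:M : 'M[R]_n.+1).

Lemma row_free_affine k (u : 'rV[R]_k) : row_free (row_mx (1%:M : 'M[R]_1) u).
Proof.
apply/row_freeP; exists (col_mx (1%:M : 'M[R]_1) 0).
by rewrite mul_row_col mulmx1 mulmx0 addr0.
Qed.

Lemma row_free_pt w : row_free (pt_mx w).
Proof. exact: row_free_affine. Qed.

Lemma row_free_graph k j (A : 'M[R]_(k, j)) : row_free (row_mx A 1%:M).
Proof.
apply/row_freeP; exists (col_mx 0 1%:M).
by rewrite mul_row_col mulmx1 mulmx0 add0r.
Qed.

Lemma row_free_hyp w : row_free (hyp_mx w).
Proof. exact: (@row_free_graph n.+1 1 w^T). Qed.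

Definition grass (k : nat) : Type := {W : {vspace V} | \dim W == k}.

Lemma pt_grass (g : GL) w : \dim (rowspace (pt_mx w *m val g)) == 1%N.
Proof. by apply/eqP/dim_rowspace/row_free_mulg; [exact: row_free_pt|exact: (valP g)]. Qed.

Lemma hyp_grass (g : GL) w : \dim (rowspace (hyp_mx w *m val g)) == n.+1.
Proof. by apply/eqP/dim_rowspace/row_free_mulg; [exact: row_free_hyp|exact: (valP g)]. Qed.

(* P^{n+1} *)
Definition proj_par (g : GL) (w : 'rV[R]_n.+1) : grass 1 :=
  exist _ (rowspace (pt_mx w *m val g)) (pt_grass g w).

Definition proj_space : premanifold R n.+1 := {|
  point := grass 1;
  chart := GL;
  cdom := fun _ => setT;
  par := proj_par;
  chart_at := fun L => xget GL1 [set g | exists w, proj_par g w = L] |}.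

(* P^{n+1*}, a hyperplane of P^{n+1} being a hyperplane of R^{n+2} *)
Definition dual_par (g : GL) (w : 'rV[R]_n.+1) : grass n.+1 :=
  exist _ (rowspace (hyp_mx w *m val g)) (hyp_grass g w).

Definition dual_proj_space : premanifold R n.+1 := {|
  point := grass n.+1;
  chart := GL;
  cdom := fun _ => setT;
  par := dual_par;
  chart_at := fun H => xget GL1 [set g | exists w, dual_par g w = H] |}.

(* P(T^*P^{n+1}): flags V_1 < V_{n+1} *)
Definition flag : Type := {F : {vspace V} * {vspace V} |
  [&& \dim F.1 == 1%N, \dim F.2 == n.+1 & (F.1 <= F.2)%VS]}.

(* Coordinates (x_1..x_n, z, p_1..p_n) on R^(2n+1) *)
Definition x_idx (i : 'I_n) : 'I_dM := inord i.
Definition z_idx : 'I_dM := inord n.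
Definition p_idx (i : 'I_n) : 'I_dM := inord (n.+1 + i).

Definition xs (v : 'rV[R]_dM) : 'rV[R]_n := \row_i v 0 (x_idx i).
Definition ps (v : 'rV[R]_dM) : 'rV[R]_n := \row_i v 0 (p_idx i).

(* V_{n+1} is the graph of the linear form with coefficients (z - p.x, p), and
   V_1 is spanned by the vector of this graph above (1, x), that is (z, 1, x). *)
Definition flag_hyp (v : 'rV[R]_dM) : 'M[R]_(n.+1, n.+2) :=
  hyp_mx (row_mx ((v 0 z_idx)%:M - xs v *m (ps v)^T : 'M[R]_1) (ps v)).

Definition flag_pt (v : 'rV[R]_dM) : 'M[R]_(1, n.+2) :=
  (row_mx (1%:M : 'M[R]_1) (xs v) : 'M[R]_(1, n.+1)) *m flag_hyp v.

Lemma flag_ptE v :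
  flag_pt v = row_mx ((v 0 z_idx)%:M : 'M[R]_1) 
    (row_mx (1%:M : 'M[R]_1) (xs v) : 'M[R]_(1, n.+1)).
Proof.
have mulE j (B : 'M[R]_(1, n.+1)) (C : 'M[R]_(n.+1, j)) :
  B *m row_mx C 1%:M = row_mx (B *m C) B by rewrite mul_mx_row mulmx1.
apply: etrans (mulE 1%N _ _) _; congr row_mx.
set B := row_mx _ _; set C := row_mx _ _.
apply: etrans (_ : B *m C^T = _) _ => //; rewrite {}/B {}/C.
rewrite (@tr_row_mx _ 1 1 n) mul_row_col mul1mx [(_ - _)^T]linearB /= tr_scalar_mx trmx_mul trmxK.
suff -> : ps v *m (xs v)^T = xs v *m (ps v)^T by rewrite subrK.
by apply/matrixP => i j; rewrite !mxE; apply: eq_bigr => k _; rewrite !mxE mulrC.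
Qed.

Lemma row_free_flag v : row_free (flag_pt v).
Proof.
by rewrite /flag_pt /row_free mxrankMfree ?row_free_hyp //; exact: row_free_affine.
Qed.

Lemma flag_axiom (g : GL) v :
  [&& \dim (rowspace (flag_pt v *m val g)) == 1%N,
      \dim (rowspace (flag_hyp v *m val g)) == n.+1 &
      (rowspace (flag_pt v *m val g) <= rowspace (flag_hyp v *m val g))%VS].
Proof.
apply/and3P; split; last by rewrite -mulmxA rowspace_mulS.
- by apply/eqP/dim_rowspace/row_free_mulg; [exact: row_free_flag|exact: (valP g)].
- exact: hyp_grass.
Qed.

Definition flag_par (g : GL) (v : 'rV[R]_dM) : flag :=
  exist _ (rowspace (flag_pt v *m val g), rowspace (flag_hyp v *m val g))
    (flag_axiom g v).

Definition flag_space : premanifold R dM := {|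
  point := flag;
  chart := GL;
  cdom := fun _ => setT;
  par := flag_par;
  chart_at := fun F => xget GL1 [set g | exists v, flag_par g v = F] |}.

Lemma flag_dim1 (F : flag) : \dim (val F).1 == 1%N.
Proof. by case/and3P: (valP F). Qed.

Lemma flag_dim2 (F : flag) : \dim (val F).2 == n.+1.
Proof. by case/and3P: (valP F). Qed.

Definition pi1 (F : flag_space) : proj_space := exist _ (val F).1 (flag_dim1 F).
Definition pi2 (F : flag_space) : dual_proj_space := exist _ (val F).2 (flag_dim2 F).

Definition flag_E1 : plane_field flag_space := fun F =>
  lker (linfun (mulmxr (dmap pi2 F))).

Definition flag_E2 : plane_field flag_space := fun F =>
  lker (linfun (mulmxr (dmap pi1 F))).

(* A tangent vector dw of P^{n+1} at V_1 = <(1, w) g> corresponds to the map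
   V_1 -> R^{n+2} / V_1 sending (1, w) g to the class of (0, dw) g; it is
   tangent to P(V_{n+1}) iff (0, dw) g is in V_{n+1}. The canonical contact
   structure consists of the vectors whose image by pi1 has this property. *)
Definition proj_lift (L : proj_space) : 'M[R]_(n.+1, n.+2) :=
  (row_mx (0 : 'M[R]_(n.+1, 1)) (1%:M : 'M[R]_n.+1) : 'M[R]_(n.+1, n.+2))
    *m val (chart_at proj_space L).

Definition flag_D : plane_field flag_space := fun F =>
  (linfun (mulmxr (dmap pi1 F *m proj_lift (pi1 F))) @^-1: (val F).2)%VS.

(* theta = dz - \sum_i p_i dx_i and omega = dp_1 /\ .. /\ dp_n in the chart g *)
Definition flag_theta (g : chart flag_space) : dform flag_space :=
  form_of_chart g (fun v => covector
    (delta_mx z_idx 0 - \sum_(i < n) v 0 (p_idx i) *: delta_mx (x_idx i) 0)).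

Definition flag_omega (g : chart flag_space) : dform flag_space :=
  form_of_chart g (fun=> \big[wedge/eform1]_(i < n) dcoord (p_idx i)).

(* Hess = 0 *)
Definition Hess_system : eds flag_space := fun F =>
  let g := chart_at flag_space F in
  gen_ideal3 (flag_theta g) (extd (flag_theta g)) (flag_omega g) F.

Definition flat_model : lag_system R n :=
  LagSystem flag_space flag_D flag_E1 flag_E2 Hess_system.

End Flat.

(* Main.v *)
(** The n-forms killed by E1 form a line bundle modulo theta, because a form vanishing on
    D = ker theta is divisible by theta. Two local generators are thus related by
    omega' = g omega + beta /\ theta with g nowhere zero and generate the same ideal, so the
    system is a function of (D, E1, E2) and is transported by every equivalence of these.

    For the dimension, take a frame e_i of E1, f_j of E2 and T with [e_i, f_j] = delta_ij T modulo D.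
    Two prolongations of the equations saying that X preserves D, E1 and E2 express
    all first derivatives of (n+2)^2 - 1 functions (the 2n+1 components of X, the n^2 components
    of the brackets [X, e_i] along E1, the 2n+1 components of [X, T], and the derivative along T of
    the T-component of [X, T]) linearly in these functions. A germ is therefore determined by finitely
    many values at one point, and (n+2)^2 germs are linearly dependent.

    On flags, a matrix B acts by an infinitesimal projective transformation X. It preserves E1 and
    E2, multiplies theta by a function, and maps omega to another n-form killed by E1, so the first
    paragraph shows that Hess = 0 is preserved. If X vanishes on an open set, B is
    scalar, hence zero once its first entry is. *)

From HB Require Import structures.
From mathcomp Require Import fingroup perm ring lra zify.
From mathcomp Require Import all_boot all_order all_algebra.
From mathcomp Require Import all_classical all_reals all_analysis.
Require Import Defs.

Set Implicit Arguments.
Unset Strict Implicit.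
Unset Printing Implicit Defensive.

Import Order.TTheory GRing.Theory Num.Theory.
Import numFieldNormedType.Exports.

Local Open Scope classical_set_scope.
Local Open Scope ring_scope.

(** * Smooth functions *)

Section SmoothCalculus.
Context {R : realType}.

(** Only an upper bound for the solutions of the prolonged system is needed, since the flat model
    supplies as many independent fields; so no integrability theorem enters, and uniqueness along
    segments by a Gronwall estimate suffices. The prolongation itself is pure algebra: functions are
    elements of a commutative ring with derivations along a frame, and equations are congruences
    modulo an increasing chain of three ideals, which absorb every known coefficient. Its relations
    are the components of the Jacobi identity for the field and two frame vectors. The direction T
    is reached only as a commutator of e_i and f_i; the T-derivatives of the unknowns then occur on
    both sides of the resulting congruences, with coefficients such as 4 and 3/2, and solving them
    needs 2 and 3 to be invertible. Forms are functions of all matrices at once, of mixed degree,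
    with a wedge product summed over subsets; identities between them are proved by induction on the
    degree, contracting with the first argument. *)

Lemma open_near (T : topologicalType) (A : set T) x (P : T -> Prop) :
  open A -> A x -> (forall y, A y -> P y) -> \near x, P x.
Proof. by move=> oA Ax AP; exact: filterS AP (open_nbhs_nbhs _). Qed.

(** The differential is a chosen linear map, so equality of germs has to pass through the little-o
    expansion, which determines it by [diff_unique]. *)
Lemma near_eq_differentiable (V W : normedModType R) (f g : V -> W) x :
  (\near x, f x = g x) -> differentiable f x -> differentiable g x.
Proof.
move=> fg df.
have H : g \o shift x = cst (g x) + 'd f x +o_ 0 id.
  apply/eqaddoP => _/posnumP[e].
  have /eqaddoP/(_ e%:num (gt0 e)) H := diff_locally df.
  have fg' : \forall h \near 0, f (h + x) = g (h + x).
    by move: fg; rewrite (near_shift 0 x) /=; apply: filterS => h; rewrite subr0.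
  near=> h; rewrite -(nbhs_singleton fg).
  have -> : (g \o shift x - (cst (f x) + 'd f x)) h =
            (f \o shift x - (cst (f x) + 'd f x)) h.
    by rewrite !fctE /=; congr (_ - _); rewrite /shift; apply/esym; near: h.
  by near: h.
have dgE : 'd g x = 'd f x :> (V -> W) by exact: (diff_unique (diff_continuous df) H).
apply/diff_locallyP; rewrite dgE; split; [exact: diff_continuous|exact: H].
Unshelve. all: by end_near. Qed.

Section Partial.
Context {m : nat}.
Implicit Types (f g : 'rV[R]_m -> R) (A B : set 'rV[R]_m) (x v : 'rV[R]_m).

Definition pd (i : 'I_m) f : 'rV[R]_m -> R := fun x => 'D_(delta_mx 0 i) f x.

Lemma derive_pd f x v : differentiable f x ->
  'D_v f x = \sum_i v 0 i * pd i f x.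
Proof.
move=> df; rewrite deriveE // {1}(row_sum_delta v) linear_sum /=.
by apply: eq_bigr => i _; rewrite linearZ /= /pd deriveE.
Qed.

Lemma near_eq_pd A f g x i : open A -> A x -> (forall y, A y -> f y = g y) ->
  pd i f x = pd i g x.
Proof. by move=> oA Ax fg; apply: near_eq_derive; exact: open_near fg. Qed.

(** Smoothness truncated at order [k], so that product, quotient and chain rules can be proved by
    induction on the order. The recursion peels the innermost derivative, whereas [iter_partial]
    exposes the outermost one; [smooth_onP] reconciles them through [rcons]. *)
Fixpoint Ck k A f : Prop :=
  (forall x, A x -> differentiable f x) /\
  if k is k'.+1 then forall i, Ck k' A (pd i f) else True.

Lemma smooth_onP A f : smooth_on A f <-> forall k, Ck k A f.
Proof.
split=> [sf k|Cf s].
  elim: k f sf => [|k IH] f sf /=; first by split=> // x; exact: (sf [::]).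
  split=> [x|i]; first exact: (sf [::]).
  by apply: IH => s x Ax; have := sf (rcons s i) x Ax; rewrite /iter_partial foldr_rcons.
elim/last_ind: s f Cf => [|s i IH] f Cf x Ax; first exact: (Cf 0%N).1.
have := IH (pd i f) (fun k => (Cf k.+1).2 i) x Ax.
by rewrite /iter_partial foldr_rcons.
Qed.

Lemma Ck_le k A f : Ck k.+1 A f -> Ck k A f.
Proof.
by elim: k f => [|k IH] f [df Cf]; split=> // i; exact/IH/Cf.
Qed.

Lemma smooth_on_diff A f x : smooth_on A f -> A x -> differentiable f x.
Proof. by move=> sf; exact: (sf [::]). Qed.

Lemma smooth_on_sub A B f : A `<=` B -> smooth_on B f -> smooth_on A f.
Proof. by move=> AB sf s x /AB; exact: sf. Qed.

Lemma smooth_on_pd A f i : smooth_on A f -> smooth_on A (pd i f).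
Proof. by move=> /smooth_onP sf; apply/smooth_onP => k; exact: (sf k.+1).2. Qed.

Lemma Ck_ext k A f g : open A -> (forall x, A x -> f x = g x) ->
  Ck k A f -> Ck k A g.
Proof.
move=> oA; elim: k f g => [|k IH] f g fg [df Cf]; split=> //.
- by move=> x Ax; apply: near_eq_differentiable (df x Ax); exact: open_near fg.
- by move=> x Ax; apply: near_eq_differentiable (df x Ax); exact: open_near fg.
- by move=> i; apply: IH (Cf i) => x Ax; exact: near_eq_pd fg.
Qed.

Lemma smooth_on_ext A f g : open A -> (forall x, A x -> f x = g x) ->
  smooth_on A f -> smooth_on A g.
Proof. by move=> oA fg /smooth_onP sf; apply/smooth_onP => k; exact: Ck_ext (sf k). Qed.

Lemma pd_cst c i : pd i (fun=> c) = fun=> 0.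
Proof. by apply/funext => x; exact: derive_cst. Qed.

Lemma Ck_cst k A c : Ck k A (fun=> c).
Proof.
elim: k c => [|k IH] c; (split; first by move=> x _; exact: differentiable_cst) => //.
by move=> i; rewrite pd_cst.
Qed.

Lemma smooth_on_cst A c : smooth_on A (fun=> c).
Proof. by apply/smooth_onP => k; exact: Ck_cst. Qed.

Lemma pdD f g x i : differentiable f x -> differentiable g x ->
  pd i (fun y => f y + g y) x = pd i f x + pd i g x.
Proof. by move=> df dg; apply: deriveD; exact: diff_derivable. Qed.

Lemma pdM f g x i : differentiable f x -> differentiable g x ->
  pd i (fun y => f y * g y) x = f x * pd i g x + g x * pd i f x.
Proof. by move=> df dg; apply: deriveM; exact: diff_derivable. Qed.

Lemma CkD k A f g : open A -> Ck k A f -> Ck k A g -> Ck k A (fun x => f x + g x).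
Proof.
move=> oA; elim: k f g => [|k IH] f g [df Cf] [dg Cg];
  (split; first by move=> x Ax; exact: (differentiableD (df x Ax) (dg x Ax))) => //.
move=> i; apply: (Ck_ext oA _ (IH _ _ (Cf i) (Cg i))) => x Ax.
by rewrite pdD //; [exact: df|exact: dg].
Qed.

(** By the Leibniz rule the derivative involves [f] and [g] themselves at one order lower than
    assumed; [Ck_le] supplies them. *)
Lemma CkM k A f g : open A -> Ck k A f -> Ck k A g -> Ck k A (fun x => f x * g x).
Proof.
move=> oA; elim: k f g => [|k IH] f g Cf Cg.
  case: Cf Cg => df _ [dg _]; split=> // x Ax.
  exact: (differentiableM (df x Ax) (dg x Ax)).
have Cf' := Ck_le Cf; have Cg' := Ck_le Cg; case: Cf Cg => df Cf [dg Cg].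
split=> [x Ax|i]; first exact: (differentiableM (df x Ax) (dg x Ax)).
apply: (Ck_ext oA _ (CkD oA (IH _ _ Cf' (Cg i)) (IH _ _ Cg' (Cf i)))) => x Ax.
by rewrite pdM //; [exact: df|exact: dg].
Qed.

Lemma smooth_onD A f g : open A -> smooth_on A f -> smooth_on A g ->
  smooth_on A (fun x => f x + g x).
Proof. by move=> oA /smooth_onP sf /smooth_onP sg; apply/smooth_onP => k; exact: CkD. Qed.

Lemma smooth_onM A f g : open A -> smooth_on A f -> smooth_on A g ->
  smooth_on A (fun x => f x * g x).
Proof. by move=> oA /smooth_onP sf /smooth_onP sg; apply/smooth_onP => k; exact: CkM. Qed.

Lemma smooth_onN A f : open A -> smooth_on A f -> smooth_on A (fun x => - f x).
Proof.
move=> oA sf; apply: (smooth_on_ext oA _ (smooth_onM oA (smooth_on_cst (-1)) sf)).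
by move=> x _; rewrite mulN1r.
Qed.

Lemma smooth_onB A f g : open A -> smooth_on A f -> smooth_on A g ->
  smooth_on A (fun x => f x - g x).
Proof. by move=> oA sf sg; apply: smooth_onD => //; exact: smooth_onN. Qed.

Lemma smooth_on_sum A I (r : seq I) (P : pred I) (F : I -> 'rV[R]_m -> R) :
  open A -> (forall i, P i -> smooth_on A (F i)) ->
  smooth_on A (fun x => \sum_(i <- r | P i) F i x).
Proof.
move=> oA sF; elim: r => [|i r IH].
  by apply: (smooth_on_ext oA _ (smooth_on_cst 0)) => x _; rewrite big_nil.
case Pi: (P i).
  apply: (smooth_on_ext oA _ (smooth_onD oA (sF i Pi) IH)) => x _.
  by rewrite big_cons Pi.
by apply: (smooth_on_ext oA _ IH) => x _; rewrite big_cons Pi.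
Qed.

Lemma smooth_on_prod A I (r : seq I) (P : pred I) (F : I -> 'rV[R]_m -> R) :
  open A -> (forall i, P i -> smooth_on A (F i)) ->
  smooth_on A (fun x => \prod_(i <- r | P i) F i x).
Proof.
move=> oA sF; elim: r => [|i r IH].
  by apply: (smooth_on_ext oA _ (smooth_on_cst 1)) => x _; rewrite big_nil.
case Pi: (P i).
  apply: (smooth_on_ext oA _ (smooth_onM oA (sF i Pi) IH)) => x _.
  by rewrite big_cons Pi.
by apply: (smooth_on_ext oA _ IH) => x _; rewrite big_cons Pi.
Qed.

Lemma CkV k A f : open A -> (forall x, A x -> f x != 0) -> Ck k A f ->
  Ck k A (fun x => (f x)^-1).
Proof.
move=> oA f0; elim: k => [|k IH] Cf.
  by case: Cf => df _; split=> // x Ax; exact: (differentiableV (df x Ax) (f0 x Ax)).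
have Cfi := IH (Ck_le Cf); case: Cf => df Cf.
split=> [x Ax|i]; first exact: (differentiableV (df x Ax) (f0 x Ax)).
(* The derivative of 1/f is -(1/f)^2 times that of f, and 1/f is already known to be of order
   [k]. *)
apply: (Ck_ext oA _ (CkM oA (CkM oA Cfi Cfi) (CkM oA (Ck_cst k A (-1)) (Cf i)))) => x Ax.
rewrite /pd deriveV ?f0 //; last exact/diff_derivable/df.
by rewrite mulN1r -exprVn expr2 scaleNr mulrN.
Qed.

Lemma smooth_onV A f : open A -> (forall x, A x -> f x != 0) -> smooth_on A f ->
  smooth_on A (fun x => (f x)^-1).
Proof. by move=> oA f0 /smooth_onP sf; apply/smooth_onP => k; exact: CkV. Qed.

Lemma differentiable_coor i x : differentiable (fun y : 'rV[R]_m => y 0 i) x.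
Proof. exact: differentiable_coord. Qed.

Lemma derive_coor i x v : 'D_v (fun y : 'rV[R]_m => y 0 i) x = v 0 i.
Proof.
rewrite /derive.
set F := (X in lim (X @ _)).
suff : F @ 0^' --> v 0 i by move/cvg_lim; apply.
apply: (@cvg_trans _ ((fun=> v 0 i) @ 0^')); last exact: cvg_cst.
apply: near_eq_cvg; near=> h; rewrite /F /= !mxE addrK /GRing.scale /=.
by rewrite mulrA mulVf ?mul1r //; near: h; exact: nbhs_dnbhs_neq.
Unshelve. all: by end_near. Qed.

Lemma pd_coor i j : pd i (fun y : 'rV[R]_m => y 0 j) = fun=> (i == j)%:R.
Proof. by apply/funext => x; rewrite /pd derive_coor mxE eqxx /= eq_sym. Qed.

Lemma smooth_on_coor A i : smooth_on A (fun y : 'rV[R]_m => y 0 i).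
Proof.
apply/smooth_onP => -[|k];
  (split; first by move=> x _; exact: differentiable_coor) => //.
by move=> j; rewrite pd_coor; exact: Ck_cst.
Qed.

End Partial.

Lemma differentiable_rV (V : normedModType R) k (f : V -> 'rV[R]_k) x :
  (forall j, differentiable (fun y => f y 0 j) x) -> differentiable f x.
Proof.
move=> df; have -> : f = \sum_(j < k) (fun y => f y 0 j *: delta_mx 0 j).
  by apply/funext => y; rewrite fct_sumE {1}(row_sum_delta (f y)).
by apply: differentiable_sum => j; exact: differentiableZl.
Qed.

Lemma differentiable_rVP m k (f : 'rV[R]_m -> 'rV[R]_k) x :
  differentiable f x -> forall j, differentiable (fun y => f y 0 j) x.
Proof.
move=> df j; apply: (@differentiable_comp _ _ _ _ f (fun z : 'rV[R]_k => z 0 j)) => //.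
exact: differentiable_coord.
Qed.

Lemma derive_rV m k (f : 'rV[R]_m -> 'rV[R]_k) x v j : differentiable f x ->
  ('D_v f x) 0 j = 'D_v (fun y => f y 0 j) x.
Proof.
by move=> df; rewrite derive_mx ?mxE //; exact: diff_derivable.
Qed.

Lemma derive_comp m k (f : 'rV[R]_m -> 'rV[R]_k) (g : 'rV[R]_k -> R) x v :
  differentiable f x -> differentiable g (f x) ->
  'D_v (g \o f) x = 'D_('D_v f x) g (f x).
Proof.
move=> df dg; rewrite !deriveE //; last exact: differentiable_comp.
by rewrite diff_comp.
Qed.

Lemma pd_comp m k (f : 'rV[R]_m -> 'rV[R]_k) (g : 'rV[R]_k -> R) x i :
  differentiable f x -> differentiable g (f x) ->
  pd i (g \o f) x = \sum_j pd i (fun y => f y 0 j) x * pd j g (f x).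
Proof.
move=> df dg; rewrite /pd derive_comp // derive_pd //.
by apply: eq_bigr => j _; rewrite derive_rV.
Qed.

Lemma Ck_sum m k (A : set 'rV[R]_m) I (r : seq I) (F : I -> 'rV[R]_m -> R) :
  open A -> (forall i, Ck k A (F i)) -> Ck k A (fun x => \sum_(i <- r) F i x).
Proof.
move=> oA sF; elim: r => [|i r IH].
  by apply: (Ck_ext oA _ (Ck_cst k A 0)) => x _; rewrite big_nil.
by apply: (Ck_ext oA _ (CkD oA (sF i) IH)) => x _; rewrite big_cons.
Qed.

(** The chain rule writes each partial derivative as a sum of products in which [g] is replaced by
    one of its partial derivatives, composed with the same inner map; hence an induction with [f]
    fixed and [g] varying. *)
Lemma Ck_comp q m k (A : set 'rV[R]_m) (B : set 'rV[R]_k) (f : 'rV[R]_m -> 'rV[R]_k)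
    (g : 'rV[R]_k -> R) : open A -> (forall x, A x -> B (f x)) ->
  (forall j, Ck q A (fun x => f x 0 j)) -> Ck q B g -> Ck q A (fun x => g (f x)).
Proof.
move=> oA AB; elim: q g => [|q IH] g Cf Cg.
  split=> // x Ax; apply: (@differentiable_comp _ _ _ _ f g).
    by apply: differentiable_rV => j; exact: (Cf j).1.
  exact/Cg.1/AB.
have df x : A x -> differentiable f x.
  by move=> Ax; apply: differentiable_rV => j; exact: (Cf j).1.
split=> [x Ax|i].
  by apply: (@differentiable_comp _ _ _ _ f g); [exact: df|exact/Cg.1/AB].
have H j : Ck q A (fun x => pd i (fun y => f y 0 j) x * pd j g (f x)).
  apply: CkM => //; first exact: (Cf j).2.
  by apply: IH; [move=> l; exact/Ck_le/Cf|exact: Cg.2].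
apply: (Ck_ext oA _ (Ck_sum _ oA H)) => x Ax.
by rewrite (@pd_comp _ _ f g) //; [exact: df|exact/Cg.1/AB].
Qed.

Lemma smooth_on_comp m k (A : set 'rV[R]_m) (B : set 'rV[R]_k)
    (f : 'rV[R]_m -> 'rV[R]_k) (g : 'rV[R]_k -> R) :
  open A -> (forall x, A x -> B (f x)) ->
  smooth_rv_on A f -> smooth_on B g -> smooth_on A (fun x => g (f x)).
Proof.
move=> oA AB sf /smooth_onP sg; apply/smooth_onP => q.
by apply: (Ck_comp oA AB) => // j; have /smooth_onP := sf j; exact.
Qed.

Lemma smooth_rv_diff m k (A : set 'rV[R]_m) (f : 'rV[R]_m -> 'rV[R]_k) x :
  smooth_rv_on A f -> A x -> differentiable f x.
Proof. by move=> sf Ax; apply: differentiable_rV => j; exact: smooth_on_diff (sf j) Ax. Qed.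

Lemma smooth_rv_ext m k (A : set 'rV[R]_m) (f g : 'rV[R]_m -> 'rV[R]_k) :
  open A -> (forall x, A x -> f x = g x) -> smooth_rv_on A f -> smooth_rv_on A g.
Proof. by move=> oA fg sf j; apply: smooth_on_ext (sf j) => // x /fg ->. Qed.

Lemma smooth_on_derive m (A : set 'rV[R]_m) (f : 'rV[R]_m -> R)
    (v : 'rV[R]_m -> 'rV[R]_m) : open A -> smooth_on A f -> smooth_rv_on A v ->
  smooth_on A (fun x => 'D_(v x) f x).
Proof.
move=> oA sf sv.
have H : smooth_on A (fun x => \sum_i v x 0 i * pd i f x).
  by apply: smooth_on_sum => // i _; apply: smooth_onM => //; exact: smooth_on_pd.
by apply: (smooth_on_ext oA _ H) => x Ax; rewrite -derive_pd //; exact: smooth_on_diff Ax.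
Qed.

Lemma jacobianE m k (f : 'rV[R]_m -> 'rV[R]_k) x i j : differentiable f x ->
  jacobian f x i j = pd i (fun y => f y 0 j) x.
Proof.
move=> df; rewrite -[RHS]derive_rV // deriveEjacobian //.
by move: (jacobian f x) => J; rewrite -rowE mxE.
Qed.

Lemma smooth_on_jacobian m k (A : set 'rV[R]_m) (f : 'rV[R]_m -> 'rV[R]_k) i j :
  open A -> smooth_rv_on A f -> smooth_on A (fun x => jacobian f x i j).
Proof.
move=> oA sf; apply: (smooth_on_ext oA _ (smooth_on_pd i (sf j))) => x Ax.
by rewrite jacobianE //; exact: smooth_rv_diff Ax.
Qed.

Lemma mul_jacobian m k (f : 'rV[R]_m -> 'rV[R]_k) x v : v *m jacobian f x = 'd f x v.
Proof. by rewrite /jacobian mul_rV_lin1. Qed.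

Lemma jacobian_comp m k l (f : 'rV[R]_m -> 'rV[R]_k) (g : 'rV[R]_k -> 'rV[R]_l) x :
  differentiable f x -> differentiable g (f x) ->
  jacobian (g \o f) x = jacobian f x *m jacobian g (f x).
Proof.
move=> df dg; apply/row_matrixP => i; rewrite !rowE mulmxA !mul_jacobian.
by rewrite diff_comp.
Qed.

Lemma jacobian_id m (x : 'rV[R]_m) : jacobian id x = 1%:M.
Proof.
apply/row_matrixP => i; rewrite !rowE mul_jacobian diff_val mulmx1.
by [].
Qed.

Lemma near_eq_jacobian m k (A : set 'rV[R]_m) (f g : 'rV[R]_m -> 'rV[R]_k) x :
  open A -> A x -> (forall y, A y -> f y = g y) -> differentiable f x ->
  jacobian f x = jacobian g x.
Proof.
move=> oA Ax fg df; have nfg : \near x, f x = g x by exact: open_near fg.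
have dg := near_eq_differentiable nfg df.
apply/row_matrixP => i.
rewrite [LHS]rowE [RHS]rowE [LHS]mul_jacobian [RHS]mul_jacobian.
apply: (etrans (esym (deriveE (delta_mx 0 i) df))).
apply: (etrans _ (deriveE (delta_mx 0 i) dg)).
exact: near_eq_derive.
Qed.

Lemma smooth_on_det m k (A : set 'rV[R]_m) (F : 'rV[R]_m -> 'M[R]_k) : open A ->
  (forall i j, smooth_on A (fun x => F x i j)) -> smooth_on A (fun x => \det (F x)).
Proof.
move=> oA sF; apply: smooth_on_sum => // s _; apply: smooth_onM => //.
  exact: smooth_on_cst.
exact: smooth_on_prod.
Qed.

Lemma smooth_on_invmx m k (A : set 'rV[R]_m) (F : 'rV[R]_m -> 'M[R]_k) i j : open A ->
  (forall x, A x -> F x \in unitmx) ->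
  (forall i j, smooth_on A (fun x => F x i j)) -> smooth_on A (fun x => invmx (F x) i j).
Proof.
move=> oA uF sF.
have H : smooth_on A (fun x => (\det (F x))^-1 * (\adj (F x)) i j).
  apply: smooth_onM => //.
    apply: smooth_onV => //; last exact: smooth_on_det.
    by move=> x /uF; rewrite unitmxE unitfE.
  have H : smooth_on A (fun x => (-1) ^+ (j + i) * \det (row' j (col' i (F x)))).
    apply: smooth_onM => //; first exact: smooth_on_cst.
    apply: smooth_on_det => // a b; apply: (smooth_on_ext oA _ (sF (lift j a) (lift i b))).
    by move=> x _; rewrite !mxE.
  by apply: (smooth_on_ext oA _ H) => x _; rewrite mxE.
by apply: (smooth_on_ext oA _ H) => x /uF uFx; rewrite /invmx uFx [RHS]mxE.
Qed.

Lemma smooth_on_mulmx m k l q (A : set 'rV[R]_m) (F : 'rV[R]_m -> 'M[R]_(k, l))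
    (G : 'rV[R]_m -> 'M[R]_(l, q)) i j : open A ->
  (forall i j, smooth_on A (fun x => F x i j)) ->
  (forall i j, smooth_on A (fun x => G x i j)) ->
  smooth_on A (fun x => (F x *m G x) i j).
Proof.
move=> oA sF sG.
have H : smooth_on A (fun x => \sum_a F x i a * G x a j).
  by apply: smooth_on_sum => // a _; apply: smooth_onM.
by apply: (smooth_on_ext oA _ H) => x _; rewrite mxE.
Qed.

Lemma derive1_line m (f : 'rV[R]_m -> R) (x v : 'rV[R]_m) (s : R) :
  differentiable f (x + s *: v) ->
  is_derive s 1 (fun t : R => f (x + t *: v)) ('D_v f (x + s *: v)).
Proof.
move=> df; have dl : is_diff s (fun t : R => x + t *: v) ( *:%R ^~ v).
  by apply: is_diff_eq; rewrite add0r.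
have dd : differentiable (fun t : R => x + t *: v) s by apply: ex_diff.
split.
  apply: diff_derivable.
  exact: (@differentiable_comp _ _ _ _ (fun t : R => x + t *: v) f).
rewrite !deriveE //; last exact: (@differentiable_comp _ _ _ _ (fun t : R => x + t *: v) f).
by rewrite (@diff_comp _ _ _ _ (fun t : R => x + t *: v) f) //= diff_val scale1r.
Qed.

(** The analytic half of Young's theorem: the second difference over the parallelogram spanned by h
    u and h v is h^2 times the mixed derivative up to o(h^2). The mean value theorem is applied
    once, in direction [u], and the differentiability of the first derivative at [x] does the
    rest. *)
Lemma second_difference m (A : set 'rV[R]_m) (f : 'rV[R]_m -> R) (x u v : 'rV[R]_m) : open A -> A x ->
  (forall y, A y -> differentiable f y) -> differentiable ('D_u f) x ->
  forall e : R, 0 < e -> exists2 d : R, 0 < d & forall h : R, 0 < h < d ->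
   `|f (x + h *: u + h *: v) - f (x + h *: u) - f (x + h *: v) + f x
      - h * h * 'D_v ('D_u f) x| <= e * (h * h).
Proof.
move=> oA Ax df dg e e0; set g := 'D_u f in dg *.
(* Two error terms, each at most e/c times h(|u| + |v|), are to add up to at most e h; the extra 1
   keeps [c] positive. *)
pose c := 2 * (`|u| + `|v|) + 1.
have c0 : 0 < c by rewrite /c ltr_wpDl // mulr_ge0 // addr_ge0.
have /eqaddoP/(_ _ (divr_gt0 e0 c0)) := diff_locally dg.
have nA : \forall w \near (0 : 'rV[R]_m), A (x + w).
  have := open_nbhs_nbhs (conj oA Ax); rewrite [nbhs x _](near_shift 0 x).
  by apply: filterS => w /=; rewrite subr0 addrC.
move=> H; have [d /= d0 Hd] := (nbhs_ballP _ _).1 (filterI H nA).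
exists (d / c); first exact: divr_gt0.
move=> h /andP[h0 hd].
have small s t : 0 <= s <= h -> 0 <= t <= h -> ball 0 d (s *: u + t *: v).
  move=> /andP[s0 sh] /andP[t0 th]; rewrite -ball_normE /= sub0r normrN.
  apply: le_lt_trans (ler_normD _ _) _; rewrite !normrZ !ger0_norm //.
  have : h * c < d by rewrite -ltr_pdivlMr.
  have := ler_wpM2r (normr_ge0 u) sh; have := ler_wpM2r (normr_ge0 v) th.
  have := normr_ge0 u; have := normr_ge0 v; rewrite /c.
  have : 0 <= h * `|u| by rewrite mulr_ge0 // ltW.
  have : 0 <= h * `|v| by rewrite mulr_ge0 // ltW.
  nra.
have gE s t : 0 <= s <= h -> 0 <= t <= h ->
   `|g (x + s *: u + t *: v) - g x - s * 'd g x u - t * 'd g x v| <= e / c * (h * (`|u| + `|v|)).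
  move=> sh th; have [+ _] := Hd _ (small _ _ sh th).
  rewrite /= !fctE /= /shift /=.
  have -> : 'd g x (s *: u + t *: v) = s * 'd g x u + t * 'd g x v.
    by rewrite linearD; congr (_ + _); exact: linearZ.
  rewrite [_ + x]addrC !addrA !opprD !addrA.
  move/le_trans; apply; rewrite ler_pM2l ?divr_gt0 //.
  apply: le_trans (ler_normD _ _) _; rewrite !normrZ !ger0_norm; try by case/andP: sh th => ? ? /andP[].
  by rewrite mulrDr lerD // ler_wpM2r //; [case/andP: sh|case/andP: th].
(* Values on one side of the parallelogram minus those on the opposite side; the second difference
   is the increment of [phi] over [0, h]. *)
pose phi s := f (x + h *: v + s *: u) - f (x + s *: u).
have hh : 0 <= h <= h by rewrite lexx ltW.
have hz : 0 <= (0 : R) <= h by rewrite lexx ltW.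
have dphi s : 0 <= s <= h -> is_derive s 1 phi (g (x + h *: v + s *: u) - g (x + s *: u)).
  move=> sh; apply: is_deriveB; apply: derive1_line; apply: df.
    by rewrite addrAC -addrA; exact: (Hd _ (small _ _ sh hh)).2.
  by rewrite -[s *: u]addr0 -(scale0r v); exact: (Hd _ (small _ _ sh hz)).2.
have [||xi xih phiE] := @MVT R phi (fun s => g (x + h *: v + s *: u) - g (x + s *: u)) 0 h h0.
- by move=> s; rewrite in_itv /= => /andP[/ltW s0 /ltW sh]; apply: dphi; rewrite s0.
- apply: derivable_within_continuous => s; rewrite in_itv /= => sh.
  by have [] := dphi s sh.
have xih' : 0 <= xi <= h by move: xih; rewrite in_itv /= => /andP[/ltW -> /ltW ->].
have -> : f (x + h *: u + h *: v) - f (x + h *: u) - f (x + h *: v) + f x = phi h - phi 0.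
  by rewrite /phi scale0r !addr0 [x + h *: v + _]addrAC; ring.
rewrite phiE subr0 (deriveE _ dg).
have := gE _ _ xih' hh; have := gE _ _ xih' hz; rewrite scale0r addr0 mul0r subr0.
rewrite [x + h *: v + _]addrAC.
set a := g (x + _); set b := g (x + _ + _); set p := g x.
set q := xi * _; set dv := 'd g x v => H1 H2.
have -> : (b - a) * h - h * h * dv = h * ((b - p - q - h * dv) - (a - p - q)) by ring.
rewrite normrM (gtr0_norm h0) mulrCA ler_pM2l //.
apply: le_trans (ler_normB _ _) _; apply: le_trans (lerD H2 H1) _.
have -> : e / c * (h * (`|u| + `|v|)) + e / c * (h * (`|u| + `|v|)) =
          e * h * ((2 * (`|u| + `|v|)) / c) by ring.
rewrite ler_piMr // ?mulr_ge0 ?ltW // ltr_pdivrMr // mul1r /c ltrDl //.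
Qed.

(** The second difference does not change when the two directions are exchanged, so both mixed
    derivatives are its limit after division by h^2. *)
Lemma pdC m (A : set 'rV[R]_m) f x i j : open A -> A x -> smooth_on A f ->
  pd i (pd j f) x = pd j (pd i f) x.
Proof.
move=> oA Ax sf; have df y : A y -> differentiable f y by exact: smooth_on_diff sf.
have dpd k : differentiable (pd k f) x by exact: smooth_on_diff (smooth_on_pd k sf) Ax.
apply/eqP; rewrite -subr_eq0 -normr_le0; apply/ler_addgt0Pl => e e0; rewrite addr0.
have e2 : 0 < e / 2 by rewrite divr_gt0.
have [d1 d10 H1] := second_difference (delta_mx 0 i) oA Ax df (dpd j) e2.
have [d2 d20 H2] := second_difference (delta_mx 0 j) oA Ax df (dpd i) e2.
pose h := Num.min d1 d2 / 2.
have h0 : 0 < h by rewrite divr_gt0 // lt_min d10.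
have hm : h < Num.min d1 d2 by rewrite /h ltr_pdivrMr // ltr_pMr ?lt_min ?d10 // ltr1n.
have /H1 {}H1 : 0 < h < d1 by rewrite h0 (lt_le_trans hm) // ge_min lexx.
have /H2 {}H2 : 0 < h < d2 by rewrite h0 (lt_le_trans hm) // ge_min lexx orbT.
move: H1 H2; rewrite -/(pd i (pd j f) x) -/(pd j (pd i f) x).
rewrite [x + h *: delta_mx 0 j + _]addrAC.
set P := pd i _ x; set Q := pd j _ x; set a := f (x + _ + _); set b := f (x + _); set c := f (x + _).
move=> H1 H2; have hh : 0 < h * h by rewrite mulr_gt0.
rewrite -(ler_pM2l hh) -{1}(gtr0_norm hh) -normrM.
have -> : h * h * (P - Q) = (a - c - b + f x - h * h * Q) - (a - b - c + f x - h * h * P) by ring.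
by apply: le_trans (ler_normB _ _) _; apply: le_trans (lerD H2 H1) _; rewrite -mulrDl -splitr mulrC.
Qed.

End SmoothCalculus.

(** * Exterior forms *)

Section ExteriorAlgebra.
Local Close Scope classical_set_scope.
Context {R : realType} {m : nat}.
Implicit Types (f g h : eform R m) (u w : 'rV[R]_m) (k : nat).

Lemma eform_ext f g : (forall k v, f k v = g k v) -> f = g.
Proof. by move=> fg; apply: functional_extensionality_dep => k; apply/funext => v. Qed.

(** Transport between degrees that are equal but not convertible, such as the cardinals of subsets
    in [wedge]; entries are compared through the numerical values of the row indices. *)
Lemma eform_cast f k k' (A : 'M[R]_(k, m)) (A' : 'M[R]_(k', m)) : k = k' ->
  (forall (i : 'I_k) (i' : 'I_k') j, i = i' :> nat -> A i j = A' i' j) ->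
  f k A = f k' A'.
Proof.
by move=> e; subst k' => AA; congr (f k _); apply/matrixP => i j; exact: AA.
Qed.

Definition eadd f g : eform R m := fun k v => f k v + g k v.
Definition escale (a : R) f : eform R m := fun k v => a * f k v.
Definition ezero : eform R m := fun k v => 0.
Definition ector u f : eform R m := fun k v => f (1 + k)%N (col_mx u v).
(* the grading involution *)
Definition ebar f : eform R m := fun k v => (-1) ^+ k * f k v.
Definition escalar (a : R) : eform R m := fun k v => if k == 0%N then a else 0.

#[global] Arguments eadd f g k v : clear implicits.
#[global] Arguments escale a f k v : clear implicits.
#[global] Arguments ezero k v : clear implicits.
#[global] Arguments ector u f k v : clear implicits.
#[global] Arguments ebar f k v : clear implicits.
#[global] Arguments escalar a k v : clear implicits.

(** Subsets of the [1 + k] argument positions without ([emb]) or with ([ins]) the first position.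
    Splitting [wedge] in this way is what makes contraction with the first argument computable. *)
Definition emb k (S : {set 'I_k}) : {set 'I_(1 + k)} := [set lift ord0 i | i in S].
Definition ins k (S : {set 'I_k}) : {set 'I_(1 + k)} := ord0 |: emb S.

Lemma mem_emb0 k (S : {set 'I_k}) : ord0 \in emb S = false.
Proof. by apply/imsetP => -[i _ /eqP]; rewrite -val_eqE. Qed.

Lemma mem_embS k (S : {set 'I_k}) i : (lift ord0 i \in emb S) = (i \in S).
Proof. by apply: mem_imset; exact: lift_inj. Qed.

Lemma mem_ins0 k (S : {set 'I_k}) : ord0 \in ins S.
Proof. by rewrite !inE eqxx. Qed.

Lemma mem_insS k (S : {set 'I_k}) i : (lift ord0 i \in ins S) = (i \in S).
Proof. by rewrite in_setU1 mem_embS. Qed.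

Lemma ord1kP k (i : 'I_(1 + k)) : i = ord0 \/ exists j, i = lift ord0 j.
Proof. by case: (unliftP ord0 i) => [j ->|->]; [right; exists j|left]. Qed.

Lemma setC_emb k (S : {set 'I_k}) : ~: emb S = ins (~: S).
Proof.
apply/finset.setP => i; have [->|[j ->]] := ord1kP i.
  by rewrite inE mem_emb0 mem_ins0.
by rewrite inE mem_embS mem_insS inE.
Qed.

Lemma setC_ins k (S : {set 'I_k}) : ~: ins S = emb (~: S).
Proof. by rewrite -{1}[S]finset.setCK -setC_emb finset.setCK. Qed.

Lemma big_set_ord k (F : {set 'I_(1 + k)} -> R) :
  \sum_S F S = \sum_(S : {set 'I_k}) F (ins S) + \sum_(S : {set 'I_k}) F (emb S).
Proof.
pose pre (S : {set 'I_(1 + k)}) : {set 'I_k} := [set i | lift ord0 i \in S].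
rewrite (bigID (fun S : {set 'I_(1 + k)} => ord0 \in S)) /=; congr (_ + _).
  rewrite (reindex_onto (@ins k) pre) /=; last first.
    move=> S S0; apply/finset.setP => i; have [->|[j ->]] := ord1kP i.
      by rewrite mem_ins0 S0.
    by rewrite mem_insS inE.
  apply: eq_bigl => S; rewrite mem_ins0 /=; apply/eqP/finset.setP => i.
  by rewrite inE mem_insS.
rewrite (reindex_onto (@emb k) pre) /=; last first.
  move=> S S0; apply/finset.setP => i; have [->|[j ->]] := ord1kP i.
    by rewrite mem_emb0 (negbTE S0).
  by rewrite mem_embS inE.
apply: eq_bigl => S; rewrite mem_emb0 /=; apply/eqP/finset.setP => i.
by rewrite inE mem_embS.
Qed.

Lemma card_emb k (S : {set 'I_k}) : #|emb S| = #|S|.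
Proof. by rewrite card_imset //; exact: lift_inj. Qed.

Lemma card_ins k (S : {set 'I_k}) : #|ins S| = (1 + #|S|)%N.
Proof. by rewrite cardsU1 mem_emb0 card_emb. Qed.

Definition inversions k (S : {set 'I_k}) := [set ij : 'I_k * 'I_k |
  [&& ij.1 \in S, ij.2 \notin S & (ij.2 < ij.1)%N]].

Lemma wedge_signE k (S : {set 'I_k}) : wedge_sign S = (-1) ^+ #|inversions S| :> R.
Proof.
rewrite /wedge_sign; congr (_ ^+ _); apply: eq_card => x; rewrite [RHS]inE.
by apply/idP/idP => [/set_mem|H] //; apply/mem_set.
Qed.

(** Position 0 lies below every other one, so putting it into the first factor creates no
    inversion. *)
Lemma sign_ins k (S : {set 'I_k}) : wedge_sign (ins S) = wedge_sign S :> R.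
Proof.
rewrite !wedge_signE; congr (_ ^+ _).
pose L (ij : 'I_k * 'I_k) := (lift ord0 ij.1 : 'I_(1 + k), lift ord0 ij.2 : 'I_(1 + k)).
have Li : injective L.
  move=> [a b] [c d] e; have /= /lift_inj -> := congr1 fst e.
  by have /= /lift_inj -> := congr1 snd e.
rewrite -(card_imset _ Li).
apply: eq_card => -[i j]; apply/idP/imsetP => [|[[a b] + [-> ->]]]; last first.
  by rewrite inE /= => H; rewrite inE /= !mem_insS.
rewrite inE /=; have [->|[a ->]] := ord1kP i; first by rewrite ltn0 !andbF.
have [->|[b ->]] := ord1kP j; first by rewrite mem_ins0 andbF.
by rewrite !mem_insS => H; exists (a, b); rewrite // inE.
Qed.

(** Left to the second factor, position 0 is inverted with each element of the first: these new
    inversions are the image of [Z], the old ones the image of [L]. *)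
Lemma sign_emb k (S : {set 'I_k}) :
  wedge_sign (emb S) = (-1) ^+ #|S| * wedge_sign S :> R.
Proof.
rewrite !wedge_signE -exprD; congr (_ ^+ _).
pose L (ij : 'I_k * 'I_k) := (lift ord0 ij.1 : 'I_(1 + k), lift ord0 ij.2 : 'I_(1 + k)).
have Li : injective L.
  move=> [a b] [c d] e; have /= /lift_inj -> := congr1 fst e.
  by have /= /lift_inj -> := congr1 snd e.
pose Z (i : 'I_k) := (lift ord0 i : 'I_(1 + k), ord0 : 'I_(1 + k)).
have Zi : injective Z by move=> a c e; have /= /lift_inj -> := congr1 fst e.
rewrite -(card_imset _ Li) -(card_imset S Zi).
rewrite -cardsUI; set X := _ :&: _; have -> : X = finset.set0.
  apply/finset.setP => x; rewrite !inE; apply/negP => /andP[/imsetP[a _ ->] /imsetP[b _ e]].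
  by have /(congr1 val) := congr1 snd e.
rewrite cards0 addn0; apply: eq_card => -[i j]; rewrite [RHS]inE !inE /=.
have [->|[a ->]] := ord1kP i.
  rewrite ltn0 !andbF; apply/esym/negP => /orP[] /imsetP[? _ e];
    by have /(congr1 val) := congr1 fst e.
rewrite mem_embS; have [->|[b ->]] := ord1kP j.
  rewrite mem_emb0 /= andbT -[(_, _)]/(Z a) mem_imset //.
  case: (a \in S) => //=; apply/esym/negP => /imsetP[? _ e];
    by have /(congr1 val) := congr1 snd e.
rewrite mem_embS /bump /= ltnS -[(lift _ _, _)]/(L (a, b)) (mem_imset _ _ Li) inE /=.
rewrite orbC; case: (_ && _) => //=; apply/esym/negP => /imsetP[? _ e];
    by have /(congr1 val) := congr1 snd e.
Qed.

Lemma enum_emb k (S : {set 'I_k}) :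
  enum (emb S) = [seq (lift ord0 i : 'I_(1 + k)) | i <- enum S].
Proof.
rewrite /enum_mem -!enumT enum_ordSl /= mem_emb0 filter_map; congr map.
by apply: eq_filter => i /=; rewrite mem_embS.
Qed.

Lemma enum_ins k (S : {set 'I_k}) :
  enum (ins S) = ord0 :: [seq (lift ord0 i : 'I_(1 + k)) | i <- enum S].
Proof.
rewrite /enum_mem -!enumT enum_ordSl /= mem_ins0 filter_map; congr (_ :: map _ _).
by apply: eq_filter => i /=; rewrite mem_insS.
Qed.

Lemma eform_emb f k (S : {set 'I_k}) u (v : 'M[R]_(k, m)) :
  f #|emb S| (rowsub (@enum_val _ (mem (emb S))) (col_mx u v)) =
  f #|S| (rowsub (@enum_val _ (mem S)) v).
Proof.
apply: eform_cast; first exact: card_emb.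
move=> i i' j ii'; rewrite !mxE (enum_val_nth ord0) enum_emb.
rewrite (nth_map (enum_val i')) -?cardE ?ii' // -(enum_val_nth (enum_val i') i').
set l := enum_val i'; case: splitP => a; rewrite /= /bump /= => la.
  by case: a la => -[].
by have <- : l = a by apply: ord_inj; move/eqP: la; rewrite eqn_add2l => /eqP.
Qed.

Lemma eform_ins f k (S : {set 'I_k}) u (v : 'M[R]_(k, m)) :
  f #|ins S| (rowsub (@enum_val _ (mem (ins S))) (col_mx u v)) =
  ector u f #|S| (rowsub (@enum_val _ (mem S)) v).
Proof.
apply: eform_cast; first exact: card_ins.
move=> i i' j ii'; rewrite !mxE (enum_val_nth ord0) enum_ins ii'.
case: (splitP i') => a i'a.
  rewrite i'a; case: a i'a => -[] //= a i'a.
  by case: splitP => // b _; rewrite !ord1.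
have {}i'a : i' = a.+1 :> nat by rewrite i'a.
rewrite [RHS]mxE i'a /= (nth_map (enum_val a)) -?cardE // -(enum_val_nth (enum_val a) a).
set l := enum_val a; case: splitP => b; rewrite /= /bump /= => la.
  by case: b la => -[].
by have <- : l = b by apply: ord_inj; move/eqP: la; rewrite eqn_add2l => /eqP.
Qed.

(** Contraction is an antiderivation. From here on identities are mostly checked in degree 0 and
    then after contraction with an arbitrary first argument, without opening the sum over
    subsets. *)
Lemma ector_wedge u f g :
  ector u (wedge f g) = eadd (wedge (ector u f) g) (wedge (ebar f) (ector u g)).
Proof.
apply: eform_ext => k v; rewrite /ector /wedge /eadd big_set_ord; congr (_ + _).
  apply: eq_bigr => S _; rewrite sign_ins; congr (_ * _ * _); first exact: eform_ins.
  by rewrite setC_ins; exact: eform_emb.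
apply: eq_bigr => S _; rewrite sign_emb /ebar.
have -> := eform_emb f S u v; rewrite setC_emb; have -> := eform_ins g (~: S) u v.
by rewrite /ector; ring.
Qed.

Lemma wedge0 f g v : wedge f g 0%N v = f 0%N v * g 0%N v.
Proof.
rewrite /wedge (bigD1 finset.set0) //= big1 => [|S]; last first.
  by rewrite -card_gt0 => /card_gt0P[[]].
rewrite addr0 wedge_signE; set X := inversions _; have -> : X = finset.set0.
  by apply/finset.setP => -[[]].
rewrite cards0 expr0 mul1r; congr (_ * _); apply: eform_cast => //.
- by rewrite cards0.
- by move=> i [].
- by apply: eq_card0 => -[].
- by move=> i [].
Qed.

Lemma wedgeDl f f' g : wedge (eadd f f') g = eadd (wedge f g) (wedge f' g).
Proof.
apply: eform_ext => k v; rewrite /wedge /eadd -big_split; apply: eq_bigr => S _ /=.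
by ring.
Qed.

Lemma wedgeDr f g g' : wedge f (eadd g g') = eadd (wedge f g) (wedge f g').
Proof.
apply: eform_ext => k v; rewrite /wedge /eadd -big_split; apply: eq_bigr => S _ /=.
by ring.
Qed.

Lemma wedgeZl a f g : wedge (escale a f) g = escale a (wedge f g).
Proof.
apply: eform_ext => k v; rewrite /wedge /escale big_distrr; apply: eq_bigr => S _ /=.
by ring.
Qed.

Lemma wedgeZr a f g : wedge f (escale a g) = escale a (wedge f g).
Proof.
apply: eform_ext => k v; rewrite /wedge /escale big_distrr; apply: eq_bigr => S _ /=.
by ring.
Qed.

Lemma ebarK f : ebar (ebar f) = f.
Proof.
by apply: eform_ext => k v; rewrite /ebar mulrA -exprMn mulrNN mulr1 expr1n mul1r.
Qed.

Lemma ebar_wedge f g : ebar (wedge f g) = wedge (ebar f) (ebar g).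
Proof.
apply: eform_ext => k v; rewrite /ebar /wedge big_distrr; apply: eq_bigr => S _ /=.
have : (-1) ^+ k = (-1) ^+ #|S| * (-1) ^+ #|~: S| :> R by rewrite -exprD cardsC card_ord.
by move=> ->; ring.
Qed.

Lemma ector_ebar u f : ector u (ebar f) = escale (-1) (ebar (ector u f)).
Proof. by apply: eform_ext => k v; rewrite /ector /ebar /escale exprS mulrA. Qed.

Lemma ectorD u f g : ector u (eadd f g) = eadd (ector u f) (ector u g).
Proof. by []. Qed.

Lemma ectorZ u a f : ector u (escale a f) = escale a (ector u f).
Proof. by []. Qed.

Lemma wedgeA f g h : wedge (wedge f g) h = wedge f (wedge g h).
Proof.
apply: eform_ext => k; elim: k f g h => [|k IH] f g h v; first by rewrite !wedge0 mulrA.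
rewrite -(@vsubmxK _ 1 k _ v); move: (usubmx _) (dsubmx _) => u {}v.
rewrite -[LHS]/(ector u _ k v) -[RHS]/(ector u _ k v) !ector_wedge wedgeDl wedgeDr.
by rewrite /eadd !IH ebar_wedge IH addrA.
Qed.

Lemma wedge_scalar a f : wedge (escalar a) f = escale a f.
Proof.
have e0 u b : ector u (escalar b) = escale 0 (escalar b).
  by apply: eform_ext => k v; rewrite /ector /escalar /escale mul0r.
have eb b : ebar (escalar b) = escalar b.
  apply: eform_ext => k v; rewrite /ebar /escalar; case: eqP => [->|_].
    by rewrite expr0 mul1r.
  by rewrite mulr0.
apply: eform_ext => k; elim: k f => [|k IH] f v; first by rewrite wedge0.
rewrite -(@vsubmxK _ 1 k _ v); move: (usubmx _) (dsubmx _) => u {}v.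
rewrite -[LHS]/(ector u _ k v) -[RHS]/(ector u _ k v) !ector_wedge e0 wedgeZl eb.
by rewrite /eadd {1}/escale mul0r add0r IH.
Qed.

End ExteriorAlgebra.
Arguments eadd {R m} f g k v.
Arguments escale {R m} a f k v.
Arguments ezero {R m} k v.
Arguments ector {R m} u f k v.
Arguments ebar {R m} f k v.
Arguments escalar {R m} a k v.

(** * Alternating forms and their evaluation on spanning vectors *)

Section Alternating.
Local Close Scope classical_set_scope.
Context {R : realType} {m : nat}.
Implicit Types (f g h : eform R m) (u w : 'rV[R]_m) (k : nat).

(** One degree of [alternating], separated because the inductions below know the property only in
    the current degree. *)
Definition alt_at f k :=
  (forall (i : 'I_k) (a : R) (A B C : 'M[R]_(k, m)),
      row i A = a *: row i B + row i C ->
      row' i A = row' i B -> row' i A = row' i C ->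
      f k A = a * f k B + f k C) /\
  (forall (i j : 'I_k) (A : 'M[R]_(k, m)),
      i != j -> row i A = row j A -> f k A = 0).

Lemma row'P k (i : 'I_k) (A B : 'M[R]_(k, m)) :
  row' i A = row' i B <-> forall l, l != i -> row l A = row l B.
Proof.
split=> [AB l li|AB]; last first.
  by apply/row_matrixP => l; rewrite !row_rowsub AB // eq_sym neq_lift.
case: (unliftP i l) li => [l' ->|->]; last by rewrite eqxx.
by move/(congr1 (row l')): AB; rewrite !row_rowsub.
Qed.

Definition setrow k (A : 'M[R]_(k, m)) (i : 'I_k) u : 'M[R]_(k, m) :=
  \matrix_l (if l == i then u else row l A).

Lemma row_setrow k (A : 'M[R]_(k, m)) i u l :
  row l (setrow A i u) = if l == i then u else row l A.
Proof. by rewrite rowK. Qed.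

Lemma setrow_id k (A : 'M[R]_(k, m)) i : setrow A i (row i A) = A.
Proof. by apply/row_matrixP => l; rewrite row_setrow; case: eqP => // ->. Qed.

Lemma row'_setrow k (A : 'M[R]_(k, m)) i u w :
  row' i (setrow A i u) = row' i (setrow A i w).
Proof. by apply/row'P => l /negbTE li; rewrite !row_setrow li. Qed.

Lemma alt_lin f k (A : 'M[R]_(k, m)) i a u w : alt_at f k ->
  f k (setrow A i (a *: u + w)) = a * f k (setrow A i u) + f k (setrow A i w).
Proof.
move=> [lf _]; apply: (lf i); try exact: row'_setrow.
by rewrite !row_setrow eqxx.
Qed.

Lemma alt_lin0 f k (A : 'M[R]_(k, m)) i : alt_at f k -> f k (setrow A i 0) = 0.
Proof.
move=> af; have := alt_lin A i (-1) 0 0 af.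
by rewrite scaler0 addr0 mulN1r addNr.
Qed.

Lemma alt_lin_sum f k (A : 'M[R]_(k, m)) i r (c : 'I_r -> R) (p : 'I_r -> 'rV[R]_m) :
  alt_at f k ->
  f k (setrow A i (\sum_j c j *: p j)) = \sum_j c j * f k (setrow A i (p j)).
Proof.
move=> af; elim: r c p => [|r IH] c p; first by rewrite !big_ord0 alt_lin0.
by rewrite !big_ord_recl alt_lin // IH.
Qed.

Lemma row_xrow k (A : 'M[R]_(k, m)) i j l : row l (xrow i j A) = row (tperm i j l) A.
Proof. by apply/rowP => z; rewrite !mxE. Qed.

(** Polarisation: the value with the sum of the two rows in both places vanishes, and so do the two
    diagonal terms of its expansion. *)
Lemma alt_swap f k (A : 'M[R]_(k, m)) i j : alt_at f k -> i != j ->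
  f k (xrow i j A) = - f k A.
Proof.
move=> af ij; have ji : j != i by rewrite eq_sym.
pose G u w := f k (setrow (setrow A i u) j w).
have GC u w : G u w = f k (setrow (setrow A j w) i u).
  congr (f k _); apply/row_matrixP => l; rewrite !row_setrow.
  by case: eqP => // ->; rewrite (negbTE ji).
have G0 u : G u u = 0.
  apply: (af.2 i j) => //; rewrite !row_setrow eqxx (negbTE ij).
  by rewrite eqxx.
have Gr u w w' : G u (w + w') = G u w + G u w'.
  by rewrite /G -{1}[w]scale1r alt_lin // mul1r.
have Gl u u' w : G (u + u') w = G u w + G u' w.
  by rewrite !GC -{1}[u]scale1r alt_lin // mul1r.
have := G0 (row i A + row j A); rewrite Gl !Gr !G0 add0r addr0 => /eqP.
rewrite addr_eq0 => /eqP H; apply: oppr_inj; rewrite opprK.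
have -> : A = setrow (setrow A i (row i A)) j (row j A) by rewrite !setrow_id.
rewrite -/(G _ _) H; congr (- f k _); rewrite !setrow_id.
apply/row_matrixP => l; rewrite !row_setrow row_xrow; case: eqP => [->|/eqP lj]; first by rewrite tpermR.
by case: eqP => [->|/eqP li]; rewrite ?tpermL // tpermD // eq_sym.
Qed.

Lemma alt_at_ector f k u : alt_at f (1 + k) -> alt_at (ector u f) k.
Proof.
move=> [lf af]; split=> [i a A B C AE /row'P AB /row'P AC|i j A ij AE].
  apply: (lf (rshift 1 i)).
  - by rewrite !rowKd.
  - apply/row'P => l; case: (split_ordP l) => l' ->; first by rewrite !rowKu.
    rewrite !rowKd => H; apply: AB; by apply: contraNneq H => ->.
  - apply/row'P => l; case: (split_ordP l) => l' ->; first by rewrite !rowKu.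
    rewrite !rowKd => H; apply: AC; by apply: contraNneq H => ->.
by apply: (af (rshift 1 i) (rshift 1 j)); rewrite ?rowKd // (inj_eq (@rshift_inj _ _)).
Qed.

(** Alternation in terms of contractions only: this is the induction step for products and exterior
    derivatives. A repetition among the later rows is covered by the contraction with the first; a
    repetition of the first row is moved to the second place by a swap and becomes a double
    contraction. *)
Lemma alt_at_S f k :
  (forall a u w v, f (1 + k)%N (col_mx (a *: u + w) v) =
     a * f (1 + k)%N (col_mx u v) + f (1 + k)%N (col_mx w v)) ->
  (forall u, alt_at (ector u f) k) ->
  (forall k' (e : k = (1 + k')%N) u v, ector u (ector u f) k' v = 0) ->
  alt_at f (1 + k).
Proof.
move=> lf ef zf; split=> [i a A B C|i j A ij].
  rewrite -[A]vsubmxK -[B]vsubmxK -[C]vsubmxK.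
  move: (usubmx A) (dsubmx A) (usubmx B) (dsubmx B) (usubmx C) (dsubmx C).
  move=> uA A' uB B' uC C' AE /row'P AB /row'P AC.
  case: (split_ordP i) AE AB AC => i' ->.
    rewrite !rowKu !ord1 !row_id => -> AB AC.
    have -> : A' = B'.
      apply/row_matrixP => l; have := AB (rshift 1 l); rewrite !rowKd; apply.
      by apply/eqP => /(congr1 val).
    have -> : C' = B'.
      apply/row_matrixP => l; have := AC (rshift 1 l); rewrite !rowKd => <-.
        have := AB (rshift 1 l); rewrite !rowKd; apply.
        by apply/eqP => /(congr1 val).
      by apply/eqP => /(congr1 val).
    exact: lf.
  rewrite !rowKd => AE AB AC.
  have uAB : uA = uB.
    have := AB (lshift k ord0); rewrite !rowKu !row_id; apply.
    by apply/eqP => /(congr1 val).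
  have uAC : uA = uC.
    have := AC (lshift k ord0); rewrite !rowKu !row_id; apply.
    by apply/eqP => /(congr1 val).
  rewrite -uAB -uAC; apply: (ef uA).1 AE _ _; apply/row'P => l li.
    by have := AB (rshift 1 l); rewrite !rowKd; apply; rewrite (inj_eq (@rshift_inj _ _)).
  by have := AC (rshift 1 l); rewrite !rowKd; apply; rewrite (inj_eq (@rshift_inj _ _)).
have first_row (u : 'rV[R]_m) (B : 'M[R]_(k, m)) l : u = row l B -> f (1 + k)%N (col_mx u B) = 0.
  case: k ef zf B l {i j A ij lf} => [|k] ef zf B l; first by case: l.
  move=> ul; have : ector u f _ (xrow ord0 l B) = 0.
    rewrite -(@vsubmxK _ 1 k _ (xrow _ _ _)).
    have -> : usubmx (xrow ord0 l B : 'M[R]_(1 + k, m)) = u.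
      apply/rowP => j; rewrite ul !mxE; congr (B _ _).
      by rewrite -[RHS](tpermL ord0 l); congr (tperm _ _ _); apply: val_inj.
    exact: zf.
  have [->|l0] := eqVneq ord0 l.
    by rewrite /xrow tperm1 row_perm1.
  by rewrite alt_swap // => /eqP; rewrite oppr_eq0 => /eqP.
rewrite -[A]vsubmxK; move: (usubmx A) (dsubmx A) => u B.
case: (split_ordP i) (split_ordP j) ij => i' -> [] j' ->.
- by rewrite !ord1 eqxx.
- by rewrite rowKu rowKd !ord1 row_id => _; exact: first_row.
- by rewrite rowKu rowKd !ord1 row_id => _ /esym; exact: first_row.
rewrite !rowKd (inj_eq (@rshift_inj _ _)) => ij; exact: (ef u).2.
Qed.

Lemma alt_ext_lin f (a : R) u w : alternating f ->
  ector (a *: u + w) f = eadd (escale a (ector u f)) (ector w f).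
Proof.
move=> af; apply: eform_ext => k v; rewrite /ector /eadd /escale.
apply: (af (1 + k)%N).1 (lshift k ord0) _ _ _ _ _ _ _.
- by rewrite !rowKu !row_id.
- apply/row'P => l; case: (split_ordP l) => l' ->; last by rewrite !rowKd.
  by rewrite !ord1 eqxx.
- apply/row'P => l; case: (split_ordP l) => l' ->; last by rewrite !rowKd.
  by rewrite !ord1 eqxx.
Qed.

Lemma alt_ector2 f u : alternating f -> ector u (ector u f) = ezero.
Proof.
move=> af; apply: eform_ext => k v; rewrite /ector /ezero.
apply: (af (1 + (1 + k))%N).2 (lshift _ ord0) (rshift 1 (lshift _ ord0)) _ _ _.
  by apply/eqP => /(congr1 val).
by rewrite rowKu rowKd rowKu.
Qed.

Lemma alternating_ector u f : alternating f -> alternating (ector u f).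
Proof. by move=> af k; exact: alt_at_ector. Qed.

Lemma alternating_add f g : alternating f -> alternating g -> alternating (eadd f g).
Proof.
move=> af ag k; split=> [i a A B C AE AB AC|i j A ij AE]; rewrite /eadd.
  by rewrite ((af k).1 _ _ _ _ _ AE) // ((ag k).1 _ _ _ _ _ AE) //; ring.
by rewrite ((af k).2 i j) // ((ag k).2 i j) // addr0.
Qed.

Lemma alternating_degree (c : nat -> R) f :
  alternating f -> alternating (fun k v => c k * f k v).
Proof.
move=> af k; split=> [i a A B C AE AB AC|i j A ij AE].
  by rewrite ((af k).1 _ _ _ _ _ AE) //; ring.
by rewrite ((af k).2 i j) // mulr0.
Qed.

Lemma alternating_scale a f : alternating f -> alternating (escale a f).
Proof. exact: (alternating_degree (fun=> a)). Qed.

Lemma alternating_bar f : alternating f -> alternating (ebar f).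
Proof. exact: (alternating_degree (fun k => (-1) ^+ k)). Qed.

Lemma alternating0 : alternating (ezero : eform R m).
Proof. by move=> k; split=> *; rewrite /ezero ?mulr0 ?addr0. Qed.

Lemma alternating_scalar a : alternating (escalar a : eform R m).
Proof.
move=> k; split=> [[i ik]|[i ik] j A _ _]; rewrite /escalar; case: eqP => // k0.
- by exfalso; rewrite k0 in ik.
- by move=> *; rewrite mulr0 addr0.
- by exfalso; rewrite k0 in ik.
Qed.

Lemma covector1 (a : 'cV[R]_m) u : covector a 1%N u = (u *m a) 0 0.
Proof. by rewrite /covector eqxx big_ord1. Qed.

Lemma ector_covector (a : 'cV[R]_m) u : ector u (covector a) = escalar ((u *m a) 0 0).
Proof.
apply: eform_ext => -[|k] v; rewrite /ector /escalar /= /covector //.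
rewrite (_ : (1 + 0)%N == 1%N) // big_ord1 mul_col_mx.
transitivity (col_mx (u *m a) (v *m a) (lshift 0 ord0) ord0); last by rewrite col_mxEu.
by congr (col_mx _ _ _ _); apply: val_inj.
Qed.

Lemma alternating_covector (a : 'cV[R]_m) : alternating (covector a).
Proof.
move=> [|k]; first by split=> -[].
apply: (@alt_at_S _ k) => [b u w v|u|k' _ u v].
- rewrite -!/(ector _ _ k v) !ector_covector /escalar; case: eqP => // _.
    by rewrite mulmxDl -scalemxAl !mxE.
  by rewrite mulr0 addr0.
- by rewrite ector_covector; exact: alternating_scalar.
- by rewrite ector_covector /ector /escalar.
Qed.

Lemma alternating_wedge f g : alternating f -> alternating g -> alternating (wedge f g).
Proof.
move=> + + k; elim: k f g => [|k IH] f g af ag; first by split=> -[].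
apply: (@alt_at_S _ k) => [a u w v|u|k' _ u v].
- rewrite -!/(ector _ _ k v) !ector_wedge !alt_ext_lin // !wedgeDl !wedgeDr wedgeZl wedgeZr.
  by rewrite /eadd /escale; ring.
- have H1 := IH _ _ (alternating_ector u af) ag.
  have H2 := IH _ _ (alternating_bar af) (alternating_ector u ag).
  rewrite ector_wedge; split=> [i a A B C AE AB AC|i j A ij AE]; rewrite /eadd.
    by rewrite (H1.1 _ _ _ _ _ AE) // (H2.1 _ _ _ _ _ AE) //; ring.
  by rewrite (H1.2 i j) // (H2.2 i j) // addr0.
- rewrite ector_wedge ectorD !ector_wedge ector_ebar !alt_ector2 // wedgeZl /eadd /escale.
  rewrite [X in X + _ + _](_ : _ = 0) ?[X in _ + (_ + X)](_ : _ = 0); first by ring.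
    by rewrite /wedge big1 // => S _; rewrite /ezero mulr0.
  by rewrite /wedge big1 // => S _; rewrite /ezero mulr0 mul0r.
Qed.

(** By multilinearity the rows are expanded in vectors of [P] one at a time. *)
Lemma alt_span f k (P : 'rV[R]_m -> Prop) (A : 'M[R]_(k, m)) : alt_at f k ->
  (forall i : 'I_k, exists r (c : 'I_r -> R) (p : 'I_r -> 'rV[R]_m),
     (forall j, P (p j)) /\ row i A = \sum_j c j *: p j) ->
  (forall B : 'M[R]_(k, m), (forall i, P (row i B)) -> f k B = 0) -> f k A = 0.
Proof.
move=> af AP PB.
(* Rows before [d] are still those of [A], the others already satisfy [P]; the goal is the case
   [d = k]. *)
suff H d : (d <= k)%N -> forall B : 'M[R]_(k, m),
    (forall i : 'I_k, (i < d)%N -> row i B = row i A) ->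
    (forall i : 'I_k, (d <= i)%N -> P (row i B)) -> f k B = 0.
  by apply: (H k) => // i; rewrite leqNgt ltn_ord.
elim: d => [|d IH] dk B BA BP; first by apply: PB => i; exact: BP.
have [r [c [p [Pp AE]]]] := AP (Ordinal dk).
rewrite -(setrow_id B (Ordinal dk)) BA // AE alt_lin_sum // big1 // => j _.
rewrite (IH (ltnW dk)) ?mulr0 // => i; rewrite row_setrow.
  move=> id; case: eqP => [ie|_]; first by rewrite ie /= ltnn in id.
  exact/BA/ltnW.
by case: eqP => [_ _|/eqP ie id] //; apply: BP; rewrite ltn_neqAle eq_sym ie.
Qed.

Lemma alt_front f k (A : 'M[R]_(k, m)) u i : alt_at f k ->
  (forall k' (B : 'M[R]_(k', m)), ector u f k' B = 0) -> row i A = u -> f k A = 0.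
Proof.
case: k A i => [|k] A i af uf iu; first by case: i iu.
have : f k.+1 (xrow ord0 i A) = 0.
  rewrite -(@vsubmxK _ 1 k _ (xrow _ _ _)).
  have -> : usubmx (xrow ord0 i A : 'M[R]_(1 + k, m)) = u.
    apply/rowP => j; rewrite -iu !mxE; congr (A _ _).
    by rewrite -[RHS](tpermL ord0 i); congr (tperm _ _ _); apply: val_inj.
  exact: uf.
have [<-|l0] := eqVneq ord0 i; first by rewrite /xrow tperm1 row_perm1.
by rewrite alt_swap // => /eqP; rewrite oppr_eq0 => /eqP.
Qed.

Lemma alt_perm f k (p : 'I_k -> 'rV[R]_m) (s : 'S_k) : alt_at f k ->
  f k (\matrix_i p i) = 0 -> f k (\matrix_i p (s i)) = 0.
Proof.
move=> af f0; have [ts -> _] := prod_tpermP s; elim: ts => [|[i j] ts IH].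
  by rewrite -[RHS]f0 big_nil; congr (f k _); apply/row_matrixP => i; rewrite !rowK perm1.
rewrite big_cons /=; move: (\prod_(_ <- _) _)%g IH => t IH.
have [->|ij] := eqVneq i j; first by rewrite tperm1 mul1g.
have -> : \matrix_i0 p ((tperm i j * t)%g i0) = xrow i j (\matrix_i p (t i)).
  by apply/row_matrixP => l; rewrite row_xrow !rowK permM.
by rewrite alt_swap // IH oppr0.
Qed.

(** A selection of rows is either a permutation, which only changes the sign, or repeats a row. *)
Lemma alt_tuple f k (p q : 'I_k -> 'rV[R]_m) : alt_at f k ->
  (forall i, exists j, q i = p j) ->
  f k (\matrix_i p i) = 0 -> f k (\matrix_i q i) = 0.
Proof.
move=> af /choice[s qE] f0.
have -> : \matrix_i q i = \matrix_i p (s i) by apply/row_matrixP => i; rewrite !rowK.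
have [/injectiveP si|/injectivePn[i [j ij sij]]] := boolP (injectiveb s).
  have -> : \matrix_i p (s i) = \matrix_i p (perm si i).
    by apply/row_matrixP => i; rewrite !rowK permE.
  exact: (alt_perm (perm si) af f0).
by apply: (af.2 i j) => //; rewrite !rowK sij.
Qed.

End Alternating.

(** * Differential forms on open subsets of R^m *)

Section CoordinateForms.
Context {R : realType} {m : nat}.
Implicit Types (A : set 'rV[R]_m) (f g : 'rV[R]_m -> R) (x u w : 'rV[R]_m).
Implicit Types (eta zeta : 'rV[R]_m -> eform R m).

Lemma dif_cst (a : R) x : differentiable (fun _ : 'rV[R]_m => a) x.
Proof. exact: differentiable_cst. Qed.

Lemma difM f g x : differentiable f x -> differentiable g x ->
  differentiable (fun y => f y * g y) x.
Proof. exact: differentiableM. Qed.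

Lemma derD f g u x : differentiable f x -> differentiable g x ->
  'D_u (fun y => f y + g y) x = 'D_u f x + 'D_u g x.
Proof. by move=> df dg; apply: deriveD; exact: diff_derivable. Qed.

Lemma derM f g u x : differentiable f x -> differentiable g x ->
  'D_u (fun y => f y * g y) x = f x * 'D_u g x + g x * 'D_u f x.
Proof. by move=> df dg; apply: deriveM; exact: diff_derivable. Qed.

Lemma derZ (a : R) f u x : differentiable f x ->
  'D_u (fun y => a * f y) x = a * 'D_u f x.
Proof. by move=> df; apply: deriveMl; exact: diff_derivable. Qed.

Lemma derN f u x : differentiable f x -> 'D_u (fun y => - f y) x = - 'D_u f x.
Proof. by move=> df; apply: deriveN; exact: diff_derivable. Qed.

Lemma der_cst (a : R) u x : 'D_u (fun _ : 'rV[R]_m => a) x = 0.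
Proof. exact: derive_cst. Qed.

Lemma der_lin f u w (a : R) x : differentiable f x ->
  'D_(a *: u + w) f x = a * 'D_u f x + 'D_w f x.
Proof. by move=> df; rewrite !deriveE // linearP. Qed.

Lemma derive_bigsum (I : Type) (r : seq I) (P : pred I) (F : I -> 'rV[R]_m -> R) u x :
  (forall i, differentiable (F i) x) ->
  differentiable (fun y => \sum_(i <- r | P i) F i y) x /\
  'D_u (fun y => \sum_(i <- r | P i) F i y) x = \sum_(i <- r | P i) 'D_u (F i) x.
Proof.
move=> dF; elim: r => [|i r [IHd IHe]].
  have -> : (fun y => \sum_(i <- [::] | P i) F i y) = cst 0.
    by apply/funext => y; rewrite big_nil.
  by split; [exact: differentiable_cst|rewrite derive_cst big_nil].
case Pi: (P i); last first.
  have -> : (fun y => \sum_(i <- i :: r | P i) F i y) = fun y => \sum_(i <- r | P i) F i y.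
    by apply/funext => y; rewrite big_cons Pi.
  by rewrite big_cons Pi.
have -> : (fun y => \sum_(i <- i :: r | P i) F i y) =
          F i + (fun y => \sum_(i <- r | P i) F i y).
  by apply/funext => y; rewrite big_cons Pi.
split; first exact: differentiableD.
by rewrite big_cons Pi deriveD ?IHe //; exact: diff_derivable.
Qed.

Definition smooth_e A eta := forall k v, smooth_on A (fun x => eta x k v).

Definition sform A eta := (forall x, A x -> alternating (eta x)) /\ smooth_e A eta.

(** The Lie derivative along the constant field [u]. *)
Definition Dform u eta : 'rV[R]_m -> eform R m :=
  fun x k v => 'D_u (fun y => eta y k v) x.
Arguments Dform u eta x k v : clear implicits.

Lemma alt_ector_sum (h : eform R m) u k v : alternating h ->
  ector u h k v = \sum_l u 0 l * ector ('e_l) h k v.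
Proof.
move=> ah; rewrite {1}(row_sum_delta u).
elim/big_ind2 : _ => [|a1 b1 a2 b2 <- <-|l _].
- have := alt_ext_lin (-1) 0 0 ah; rewrite scaler0 addr0 => ->.
  by rewrite /eadd /escale mulN1r addNr.
- by rewrite -{1}[b1]scale1r alt_ext_lin // /eadd /escale mul1r.
- rewrite -[u 0 l *: _]addr0 alt_ext_lin //.
  have := alt_ext_lin (-1) 0 0 ah; rewrite scaler0 addr0 => ->.
  by rewrite /eadd /escale mulN1r addNr addr0.
Qed.

Lemma smooth_e_diff A eta x k v : smooth_e A eta -> A x ->
  differentiable (fun y => eta y k v) x.
Proof. by move=> se; exact: smooth_on_diff (se k v). Qed.

Arguments smooth_e_diff {A eta x} k v _ _.

Lemma smooth_e_ext A eta zeta : open A -> (forall x, A x -> eta x = zeta x) ->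
  smooth_e A eta -> smooth_e A zeta.
Proof. by move=> oA ez se k v; apply: (smooth_on_ext oA _ (se k v)) => x /ez ->. Qed.

Lemma smooth_e_sub A B eta : A `<=` B -> smooth_e B eta -> smooth_e A eta.
Proof. by move=> AB se k v; exact: smooth_on_sub AB (se k v). Qed.

Lemma sform_ext A eta zeta : open A -> (forall x, A x -> eta x = zeta x) ->
  sform A eta -> sform A zeta.
Proof.
move=> oA ez [ae se]; split; last exact: smooth_e_ext se.
by move=> x Ax; rewrite -ez //; exact: ae.
Qed.

Lemma sform_sub A B eta : A `<=` B -> sform B eta -> sform A eta.
Proof. by move=> AB [ae se]; split; [move=> x /AB; exact: ae|exact: smooth_e_sub se]. Qed.

Lemma sform_diff A eta x k v : sform A eta -> A x -> differentiable (fun y => eta y k v) x.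
Proof. by case=> _; exact: smooth_e_diff. Qed.

Arguments sform_diff {A eta x} k v _ _.

Lemma sform_wedge A eta zeta : open A -> sform A eta -> sform A zeta ->
  sform A (fun x => wedge (eta x) (zeta x)).
Proof.
move=> oA [ae se] [az sz]; split=> [x Ax|k v].
  by apply: alternating_wedge; [exact: ae|exact: az].
apply: smooth_on_sum => // S _; apply: smooth_onM => //; apply: smooth_onM => //.
exact: smooth_on_cst.
Qed.

Lemma smooth_e_wedge A eta zeta : open A -> smooth_e A eta -> smooth_e A zeta ->
  smooth_e A (fun x => wedge (eta x) (zeta x)).
Proof.
move=> oA se sz k v.
apply: smooth_on_sum => // S _; apply: smooth_onM => //; apply: smooth_onM => //.
exact: smooth_on_cst.
Qed.

Lemma sform_add A eta zeta : open A -> sform A eta -> sform A zeta ->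
  sform A (fun x => eadd (eta x) (zeta x)).
Proof.
move=> oA [ae se] [az sz]; split=> [x Ax|k v]; last exact: smooth_onD.
by apply: alternating_add; [exact: ae|exact: az].
Qed.

Lemma sform_scale A f eta : open A -> smooth_on A f -> sform A eta ->
  sform A (fun x => escale (f x) (eta x)).
Proof.
move=> oA sf [ae se]; split=> [x Ax|k v]; last exact: smooth_onM.
by apply: alternating_scale; exact: ae.
Qed.

Lemma smooth_e_bar A eta : open A -> smooth_e A eta -> smooth_e A (fun x => ebar (eta x)).
Proof. by move=> oA se k v; apply: smooth_onM => //; exact: smooth_on_cst. Qed.

Lemma sform_bar A eta : open A -> sform A eta -> sform A (fun x => ebar (eta x)).
Proof.
move=> oA [ae se]; split=> [x Ax|]; last exact: smooth_e_bar.
by apply: alternating_bar; exact: ae.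
Qed.

Lemma smooth_e_scalar A f : smooth_on A f -> smooth_e A (fun x => escalar (f x)).
Proof.
by move=> sf k v; rewrite /escalar; case: eqP => // _; exact: smooth_on_cst.
Qed.

Lemma sform_scalar A f : smooth_on A f -> sform A (fun x => escalar (f x)).
Proof. by split=> [x Ax|]; [exact: alternating_scalar|exact: smooth_e_scalar]. Qed.

Lemma sform_ector A eta u : sform A eta -> sform A (fun x => ector u (eta x)).
Proof.
by case=> ae se; split=> [x Ax|k v]; [apply: alternating_ector; exact: ae|exact: se].
Qed.

Lemma sform_ector_vf A eta (X : 'rV[R]_m -> 'rV[R]_m) : open A -> smooth_rv_on A X ->
  sform A eta -> sform A (fun x => ector (X x) (eta x)).
Proof.
move=> oA sX [ae se]; split=> [x Ax|k v]; first by apply: alternating_ector; exact: ae.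
have H : smooth_on A (fun x => \sum_l X x 0 l * ector 'e_l (eta x) k v).
  by apply: smooth_on_sum => // l _; apply: smooth_onM => //; exact: se.
by apply: (smooth_on_ext oA _ H) => x Ax; rewrite [RHS]alt_ector_sum //; exact: ae.
Qed.

Lemma smooth_on_eval A eta k (V : 'rV[R]_m -> 'M[R]_(k, m)) : open A -> sform A eta ->
  (forall i j, smooth_on A (fun x => V x i j)) -> smooth_on A (fun x => eta x k (V x)).
Proof.
move=> oA; elim: k eta V => [|k IH] eta V se sV.
  by apply: (smooth_on_ext oA _ (se.2 0%N 0)) => x _; rewrite [V x]flatmx0.
have H : smooth_on A (fun x => ector (usubmx (V x : 'M[R]_(1 + k, m))) (eta x) k
                                (dsubmx (V x : 'M[R]_(1 + k, m)))).
  apply: (IH (fun x => ector (usubmx (V x : 'M[R]_(1 + k, m))) (eta x))).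
    apply: sform_ector_vf => // j; apply: (smooth_on_ext oA _ (sV (lshift k (0 : 'I_1)) j)).
    by move=> x _; rewrite mxE.
  move=> i j; apply: (smooth_on_ext oA _ (sV (rshift 1 i) j)).
  by move=> x _; rewrite mxE.
by apply: (smooth_on_ext oA _ H) => x _; rewrite /ector vsubmxK.
Qed.

Lemma smooth_e_D A eta u : open A -> smooth_e A eta -> smooth_e A (Dform u eta).
Proof.
move=> oA se k v; apply: (smooth_on_derive oA (se k v)) => j; exact: smooth_on_cst.
Qed.

Lemma Dform_alt A eta u x : open A -> sform A eta -> A x -> alternating (Dform u eta x).
Proof.
move=> oA se Ax k; split=> [i a B C E BE BC BD|i j B ij BE]; rewrite /Dform.
  have -> : 'D_u (fun y => eta y k B) x = 'D_u (fun y => a * eta y k C + eta y k E) x.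
    apply: near_eq_derive; apply: (open_near oA Ax) => y Ay.
    exact: (se.1 y Ay k).1 BE BC BD.
  have dC := sform_diff k C se Ax; have dE := sform_diff k E se Ax.
  by rewrite derD ?derZ //; apply: difM => //; exact: dif_cst.
have -> : 'D_u (fun y => eta y k B) x = 'D_u (fun=> 0) x.
  apply: near_eq_derive; apply: (open_near oA Ax) => y Ay.
  exact: (se.1 y Ay k).2 ij BE.
exact: der_cst.
Qed.

Lemma sform_D A eta u : open A -> sform A eta -> sform A (Dform u eta).
Proof. by move=> oA se; split=> [x|]; [exact: Dform_alt|exact: smooth_e_D se.2]. Qed.

Lemma ext_d0 eta x v : ext_d eta x 0%N v = 0.
Proof. by rewrite /ext_d big_ord0. Qed.

Lemma row0_col_mx k u (v : 'M[R]_(k, m)) : row ord0 (col_mx u v) = u.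
Proof.
transitivity (row (lshift k ord0) (col_mx u v)); last by rewrite rowKu row_id.
by congr row; apply: val_inj.
Qed.

Lemma rowS_col_mx k u (v : 'M[R]_(k, m)) i : row (lift ord0 i) (col_mx u v) = row i v.
Proof.
transitivity (row (rshift 1 i) (col_mx u v)); last by rewrite rowKd.
by congr row; apply: val_inj.
Qed.

Lemma row'0_col_mx k u (v : 'M[R]_(k, m)) : row' ord0 (col_mx u v) = v.
Proof. by apply/row_matrixP => i; rewrite row_rowsub rowS_col_mx. Qed.

Lemma row'S_col_mx k u (v : 'M[R]_(1 + k, m)) i :
  row' (lift ord0 i) (col_mx u v) = col_mx u (row' i v) :> 'M[R]_(1 + k, m).
Proof.
apply/row_matrixP => j; rewrite row_rowsub; have [->|[l ->]] := ord1kP j.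
  transitivity (row ord0 (col_mx u v)); last by rewrite !row0_col_mx.
  by congr row; apply: val_inj.
rewrite rowS_col_mx row_rowsub -(rowS_col_mx u v); congr row.
by apply: val_inj; rewrite /= /bump /= !add1n ltnS; case: (_ <= _)%N.
Qed.

(** Cartan's formula for a constant vector field; it drives every induction on the degree that
    involves [ext_d]. *)
Lemma ector_ext_d eta x u k v : ector u (ext_d eta x) k v =
  Dform u eta x k v - ext_d (fun y => ector u (eta y)) x k v.
Proof.
rewrite {1}/ector {1}/ext_d big_ord_recl /= row0_col_mx expr0 mul1r; congr (_ + _).
  by congr ('D_u _ x); apply/funext => y; congr (eta y _ _); exact: row'0_col_mx.
rewrite /ext_d -sumrN; apply: eq_bigr => i _.
rewrite exprS mulN1r mulNr rowS_col_mx; congr (- _); congr (_ * _).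
have -> // : (fun y => eta y (0 + k)%N (row' (lift ord0 i) (col_mx u v))) =
             fun y => ector u (eta y) k.-1 (row' i v).
apply/funext => y; case: k v i => [|k] v i; first by case: i.
by rewrite /ector; congr (eta y _ _); exact: row'S_col_mx.
Qed.

Lemma near_eq_ext_d A eta zeta x : open A -> A x -> (forall y, A y -> eta y = zeta y) ->
  ext_d eta x = ext_d zeta x.
Proof.
move=> oA Ax ez; apply: eform_ext => k v; apply: eq_bigr => i _; congr (_ * _).
by apply: near_eq_derive; apply: (open_near oA Ax) => y /ez ->.
Qed.

Lemma ext_dD A eta zeta x : smooth_e A eta -> smooth_e A zeta -> A x ->
  ext_d (fun y => eadd (eta y) (zeta y)) x = eadd (ext_d eta x) (ext_d zeta x).
Proof.
move=> se sz Ax; apply: eform_ext => k v; rewrite /ext_d /eadd -big_split.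
apply: eq_bigr => i _ /=; rewrite -mulrDr; congr (_ * _).
by rewrite derD //; [exact: smooth_e_diff se Ax|exact: smooth_e_diff sz Ax].
Qed.

Lemma ext_d_cst eta x a : (forall y, eta y = a) -> ext_d eta x = ezero.
Proof.
move=> ea; apply: eform_ext => k v; rewrite /ext_d big1 // => i _.
have -> : (fun y => eta y k.-1 (row' i v)) = fun=> a k.-1 (row' i v).
  by apply/funext => y; rewrite ea.
by rewrite derive_cst mulr0.
Qed.

Lemma ext_d_degree A (c : nat -> R) eta x k v : smooth_e A eta -> A x ->
  ext_d (fun y k v => c k * eta y k v) x k v = c k.-1 * ext_d eta x k v.
Proof.
move=> se Ax; rewrite /ext_d big_distrr; apply: eq_bigr => i _ /=.
by rewrite mulrCA; congr (_ * _); rewrite derZ //; exact: smooth_e_diff se Ax.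
Qed.

Lemma ext_dZ A a eta x : smooth_e A eta -> A x ->
  ext_d (fun y => escale a (eta y)) x = escale a (ext_d eta x).
Proof. by move=> se Ax; apply: eform_ext => k v; exact: (ext_d_degree (fun=> a) v se Ax). Qed.

Lemma ext_d_bar A eta x : smooth_e A eta -> A x ->
  ext_d (fun y => ebar (eta y)) x = escale (-1) (ebar (ext_d eta x)).
Proof.
move=> se Ax; apply: eform_ext => k v.
rewrite -[ext_d _ _]/(ext_d (fun y k v => (-1) ^+ k * eta y k v) x).
rewrite (ext_d_degree (fun k => (-1) ^+ k) v se Ax) /escale /ebar.
case: k v => [|k] v /=; first by rewrite ext_d0 !mulr0.
by rewrite exprS mulrA mulrA mulN1r opprK mul1r.
Qed.

Lemma DformM A eta zeta x u : open A -> smooth_e A eta -> smooth_e A zeta -> A x ->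
  Dform u (fun y => wedge (eta y) (zeta y)) x =
  eadd (wedge (Dform u eta x) (zeta x)) (wedge (eta x) (Dform u zeta x)).
Proof.
move=> oA se sz Ax; apply: eform_ext => k v; rewrite /Dform /eadd /wedge -big_split /=.
have dS (S : {set 'I_k}) : differentiable (fun y => wedge_sign S *
      eta y #|S| (rowsub (enum_val (A:=mem S)) v) *
      zeta y #|~: S| (rowsub (enum_val (A:=mem (~: S))) v)) x.
  apply: difM; last exact: smooth_e_diff sz Ax.
  by apply: difM; [exact: dif_cst|exact: smooth_e_diff se Ax].
apply: etrans (derive_bigsum _ _ _ dS).2 _; apply: eq_bigr => S _.
have d1 := smooth_e_diff #|S| (rowsub (enum_val (A:=mem S)) v) se Ax.
have d2 := smooth_e_diff #|~: S| (rowsub (enum_val (A:=mem (~: S))) v) sz Ax.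
rewrite derM // ?derZ //; first by ring.
by apply: difM => //; exact: dif_cst.
Qed.

(** Both sides are contracted with [u]: the antiderivation rule, Cartan's formula and the induction
    hypothesis for the contracted factors leave an identity of ring expressions. *)
Lemma ext_d_wedge A eta zeta x : open A -> smooth_e A eta -> smooth_e A zeta -> A x ->
  ext_d (fun y => wedge (eta y) (zeta y)) x =
  eadd (wedge (ext_d eta x) (zeta x)) (wedge (ebar (eta x)) (ext_d zeta x)).
Proof.
move=> oA se sz Ax; apply: eform_ext => k.
elim: k eta zeta se sz => [|k IH] eta zeta se sz v.
  by rewrite ext_d0 /eadd !wedge0 !ext_d0 mul0r mulr0 addr0.
rewrite -(@vsubmxK _ 1 k _ v); move: (usubmx _) (dsubmx _) => u {}v.
rewrite -![_ _ k.+1 _]/(ector u _ k v) ector_ext_d (DformM _ oA se sz Ax).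
have seu w : smooth_e A (fun y => ector w (eta y)) by move=> k' v'; exact: se.
have szu w : smooth_e A (fun y => ector w (zeta y)) by move=> k' v'; exact: sz.
have sb := smooth_e_bar oA se.
have -> : (fun y => ector u (wedge (eta y) (zeta y))) =
    fun y => eadd (wedge (ector u (eta y)) (zeta y)) (wedge (ebar (eta y)) (ector u (zeta y))).
  by apply/funext => y; rewrite ector_wedge.
rewrite (ext_dD _ _ Ax); try exact: smooth_e_wedge.
rewrite {1 2}/eadd !IH // ectorD !ector_wedge ector_ebar ebarK (ext_d_bar se Ax).
have -> : ector u (ext_d eta x) =
    eadd (Dform u eta x) (escale (-1) (ext_d (fun y => ector u (eta y)) x)).
  by apply: eform_ext => k' v'; rewrite ector_ext_d /eadd /escale mulN1r.
have -> : ector u (ext_d zeta x) =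
    eadd (Dform u zeta x) (escale (-1) (ext_d (fun y => ector u (zeta y)) x)).
  by apply: eform_ext => k' v'; rewrite ector_ext_d /eadd /escale mulN1r.
by rewrite !(wedgeDl, wedgeDr) !(wedgeZl, wedgeZr) /eadd /escale; ring.
Qed.

Lemma derive_comm A f u w x : open A -> smooth_on A f -> A x ->
  'D_u (fun y => 'D_w f y) x = 'D_w (fun y => 'D_u f y) x.
Proof.
move=> oA sf Ax.
have E u' w' : 'D_u' (fun y => 'D_w' f y) x =
    \sum_i \sum_j u' 0 i * w' 0 j * pd i (pd j f) x.
  have -> : 'D_u' (fun y => 'D_w' f y) x =
            'D_u' (fun y => \sum_j w' 0 j * pd j f y) x.
    apply: near_eq_derive; apply: (open_near oA Ax) => y Ay.
    by rewrite -derive_pd //; exact: smooth_on_diff sf Ay.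
  have dp j := smooth_on_diff (smooth_on_pd j sf) Ax.
  rewrite (derive_bigsum _ _ _ _).2; last by move=> j; apply: difM; [exact: dif_cst|exact: dp].
  rewrite exchange_big; apply: eq_bigr => j _.
  rewrite derZ; last exact: dp.
  rewrite derive_pd; last exact: dp.
  by rewrite mulr_sumr; apply: eq_bigr => i _; rewrite mulrA [w' 0 j * _]mulrC.
rewrite !E exchange_big; apply: eq_bigr => i _; apply: eq_bigr => j _.
by rewrite (pdC _ _ oA Ax sf) [w 0 i * _]mulrC.
Qed.

Lemma smooth_e_ext_d A eta : open A -> smooth_e A eta -> smooth_e A (ext_d eta).
Proof.
move=> oA se k v; apply: smooth_on_sum => // i _; apply: smooth_onM => //.
  exact: smooth_on_cst.
by apply: (smooth_on_derive oA (se _ _)) => j; exact: smooth_on_cst.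
Qed.

Lemma Dform_ext_d A eta u x : open A -> smooth_e A eta -> A x ->
  Dform u (ext_d eta) x = ext_d (Dform u eta) x.
Proof.
move=> oA se Ax; apply: eform_ext => k v; rewrite /Dform /ext_d.
have H (i : 'I_k) : smooth_on A (fun y => 'D_(row i v) (fun z => eta z k.-1 (row' i v)) y).
  by apply: (smooth_on_derive oA (se _ _)) => j; exact: smooth_on_cst.
rewrite (derive_bigsum _ _ _ _).2; last first.
  by move=> i; apply: difM; [exact: dif_cst|exact: smooth_on_diff (H i) Ax].
apply: eq_bigr => i _; rewrite derZ; last exact: smooth_on_diff (H i) Ax.
rewrite (derive_comm u (row i v) oA (se k.-1 (row' i v)) Ax).
by [].
Qed.

(** After contraction with [u] there remain D_u d and d D_u, equal because partial derivatives
    commute, and the double derivative of the contracted form, evaluated in lower degree. *)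
Lemma ext_d_ext_d A eta x : open A -> smooth_e A eta -> A x ->
  ext_d (ext_d eta) x = ezero.
Proof.
move=> oA se Ax; apply: eform_ext => k; elim: k eta se => [|k IH] eta se v.
  by rewrite ext_d0.
rewrite -(@vsubmxK _ 1 k _ v); move: (usubmx _) (dsubmx _) => u {}v.
rewrite -![_ _ k.+1 _]/(ector u _ k v) ector_ext_d (Dform_ext_d _ oA se Ax).
have seu : smooth_e A (fun y => ector u (eta y)) by move=> k' v'; exact: se.
have -> : (fun y => ector u (ext_d eta y)) = fun y => eadd (Dform u eta y)
    (escale (-1) (ext_d (fun z => ector u (eta z)) y)).
  by apply/funext => y; apply: eform_ext => k' v'; rewrite ector_ext_d /eadd /escale mulN1r.
have sD := smooth_e_D u oA se.
have sd := smooth_e_ext_d oA seu.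
rewrite (ext_dD sD _ Ax); last by move=> k' v'; apply: smooth_onM => //; exact: smooth_on_cst.
by rewrite (ext_dZ _ sd Ax) /eadd /escale IH // /ezero mulr0 addr0 subrr.
Qed.

Lemma ext_d_alt A eta x : open A -> sform A eta -> A x -> alternating (ext_d eta x).
Proof.
move=> oA se Ax k; elim: k eta se => [|k IH] eta se; first by split=> -[].
have E u : ector u (ext_d eta x) =
    eadd (Dform u eta x) (escale (-1) (ext_d (fun y => ector u (eta y)) x)).
  by apply: eform_ext => k' v'; rewrite ector_ext_d /eadd /escale mulN1r.
apply: (@alt_at_S _ _ _ k) => [a u w v|u|k' _ u v].
- rewrite -![ext_d _ _ _ _]/(ector _ (ext_d eta x) k v) !ector_ext_d.
  have dv := sform_diff k v se Ax.
  have -> : Dform (a *: u + w) eta x k v = a * Dform u eta x k v + Dform w eta x k v.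
    by rewrite /Dform der_lin.
  have -> : ext_d (fun y => ector (a *: u + w) (eta y)) x =
      ext_d (fun y => eadd (escale a (ector u (eta y))) (ector w (eta y))) x.
    apply: (near_eq_ext_d oA Ax) => y Ay; rewrite alt_ext_lin //; exact: se.1.
  have su := (sform_ector u se).2.
  rewrite (@ext_dD A) //; last exact: (sform_ector w se).2.
    by rewrite (ext_dZ _ su Ax) /eadd /escale; ring.
  by move=> k' v'; apply: smooth_onM => //; exact: smooth_on_cst.
- rewrite E; have H1 := Dform_alt u oA se Ax k; have H2 := IH _ (sform_ector u se).
  split=> [i a B C F BF BC BD|i j B ij BE]; rewrite /eadd /escale.
    by rewrite (H1.1 _ _ _ _ _ BF) // (H2.1 _ _ _ _ _ BF) //; ring.
  by rewrite (H1.2 i j) // (H2.2 i j) // mulr0 addr0.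
(* A double contraction of the derivative reduces, by Cartan's formula applied twice, to the
   derivative of i_u i_u eta, which is zero. *)
- rewrite E ectorD ectorZ /eadd /escale ector_ext_d.
  have -> : ext_d (fun y => ector u (ector u (eta y))) x = ezero.
    rewrite (@near_eq_ext_d A _ (fun=> ezero) x) //; first exact: (@ext_d_cst _ _ ezero).
    by move=> y Ay; rewrite alt_ector2 //; exact: se.1.
  by rewrite /ezero subr0 mulN1r subrr.
Qed.

Lemma sform_ext_d A eta : open A -> sform A eta -> sform A (ext_d eta).
Proof.
by move=> oA se; split=> [x|]; [exact: ext_d_alt|apply: smooth_e_ext_d => //; exact: se.2].
Qed.

End CoordinateForms.
Arguments Dform {R m} u eta x k v.
Arguments sform_diff {R m A eta x} k v _ _.
Arguments smooth_e_diff {R m A eta x} k v _ _.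

(** * Pull-back of forms and its commutation with the exterior derivative *)

Section Pullback.
Context {R : realType} {m p : nat}.
Implicit Types (A : set 'rV[R]_m) (B : set 'rV[R]_p) (x u w : 'rV[R]_m).

Definition epull (J : 'M[R]_(m, p)) (f : eform R p) : eform R m := fun k v => f k (v *m J).
Arguments epull J f k v : clear implicits.

Lemma epull_wedge J f g : epull J (wedge f g) = wedge (epull J f) (epull J g).
Proof.
apply: eform_ext => k v; apply: eq_bigr => S _.
by rewrite /epull !mul_rowsub_mx.
Qed.

Lemma ector_epull J u f : ector u (epull J f) = epull J (ector (u *m J) f).
Proof. by apply: eform_ext => k v; rewrite /ector /epull mul_col_mx. Qed.

Lemma alternating_epull J f : alternating f -> alternating (epull J f).
Proof.
move=> af k; split=> [i a B C E BE BC BD|i j B ij BE]; rewrite /epull.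
  apply: ((af k).1 i); first by rewrite !row_mul BE mulmxDl scalemxAl.
    by apply/row'P => l li; rewrite !row_mul ((row'P _ _ _).1 BC).
  by apply/row'P => l li; rewrite !row_mul ((row'P _ _ _).1 BD).
by apply: ((af k).2 i j _ ij); rewrite !row_mul BE.
Qed.

Definition pb (phi : 'rV[R]_m -> 'rV[R]_p) (eta : 'rV[R]_p -> eform R p) :
  'rV[R]_m -> eform R m := fun x => epull (jacobian phi x) (eta (phi x)).
Arguments pb phi eta x k v : clear implicits.

Lemma wedge_sumr r (c : 'I_r -> R) (f : eform R m) (g : 'I_r -> eform R m) h k v :
  (forall k v, h k v = \sum_j c j * g j k v) ->
  wedge f h k v = \sum_j c j * wedge f (g j) k v.
Proof.
move=> hE; rewrite /wedge; under eq_bigr do rewrite hE mulr_sumr.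
rewrite exchange_big; apply: eq_bigr => j _; rewrite mulr_sumr.
by apply: eq_bigr => S _; ring.
Qed.

Lemma ector_anti (h : eform R p) (u w : 'rV[R]_p) k v : alternating h ->
  ector u (ector w h) k v = - ector w (ector u h) k v.
Proof.
move=> ah; have H z : ector z (ector z h) k v = 0 by rewrite alt_ector2.
have := H (u + w); rewrite -{1 2}[u]scale1r (alt_ext_lin _ _ _ ah) ectorD ectorZ.
rewrite /eadd /escale !(alt_ext_lin _ _ _ (alternating_ector _ ah)) /eadd /escale.
rewrite !H !mul1r add0r addr0 addrC => /eqP; rewrite addr_eq0 => /eqP ->.
by [].
Qed.

Definition dscalar (a : 'rV[R]_m -> R) := ext_d (fun y => escalar (a y)).

Arguments dscalar a x k v : clear implicits.

Lemma ector_dscalar a x w : ector w (dscalar a x) = escalar ('D_w a x).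
Proof.
apply: eform_ext => k v; rewrite ector_ext_d.
have -> : ext_d (fun y => ector w (escalar (a y))) x k v = 0.
  have H y : ector w (escalar (a y)) = ezero by [].
  by rewrite (ext_d_cst x H).
rewrite subr0 /Dform /escalar; case: eqP => // _; exact: der_cst.
Qed.

Lemma dscalar0 a x v : dscalar a x 0%N v = 0.
Proof. exact: ext_d0. Qed.

Lemma ebar_dscalar a x : ebar (dscalar a x) = escale (-1) (dscalar a x).
Proof.
apply: eform_ext => -[|k] v; first by rewrite /ebar /escale dscalar0 !mulr0.
rewrite /ebar /escale -(@vsubmxK _ 1 k _ v); move: (usubmx _) (dsubmx _) => u {}v.
rewrite -[dscalar a x _ _]/(ector u _ k v) ector_dscalar /escalar.
by case: eqP => [->|_]; rewrite ?mulr0 // expr1.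
Qed.

Variables (A : set 'rV[R]_m) (B : set 'rV[R]_p) (phi : 'rV[R]_m -> 'rV[R]_p).
Hypotheses (oA : open A) (oB : open B) (sphi : smooth_rv_on A phi)
  (AB : forall x, A x -> B (phi x)).

(** These are the entries of [u *m jacobian phi y], written as derivatives so that they can be
    differentiated again. *)
Let a u l y := 'D_u (fun z => phi z 0 l) y.

Let aE u l y : A y -> (u *m jacobian phi y) 0 l = a u l y.
Proof.
move=> Ay; have d := smooth_rv_diff sphi Ay.
by rewrite mul_jacobian -deriveE // derive_rV.
Qed.

Let sa u l : smooth_on A (a u l).
Proof. by apply: (smooth_on_derive oA (sphi l)) => j; exact: smooth_on_cst. Qed.

Lemma sform_pb eta : sform B eta -> sform A (pb phi eta).
Proof.
move=> [ae se]; split=> [x Ax|k v]; first exact/alternating_epull/ae/AB.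
have sc : sform A (fun x => epull 0 (fun k _ => 0) : eform R m).
  by split=> [x _ k'|k' v']; [split=> *; rewrite /epull ?mulr0 ?addr0|exact: smooth_on_cst].
elim: k eta ae se v => [|k IH] eta ae se v.
  have H := smooth_on_comp oA AB sphi (se 0%N 0).
  by apply: (smooth_on_ext oA _ H) => x _; rewrite /pb /epull [_ *m _]flatmx0.
rewrite -(@vsubmxK _ 1 k _ v); move: (usubmx _) (dsubmx _) => u {}v.
have H : smooth_on A (fun x => \sum_l a u l x * pb phi (fun y => ector 'e_l (eta y)) x k v).
  apply: smooth_on_sum => // l _; apply: smooth_onM => //.
  by apply: IH => [y By|k' v']; [exact/alternating_ector/ae|exact: se].
apply: (smooth_on_ext oA _ H) => x Ax.
rewrite -[RHS]/(ector u (pb phi eta x) k v) /pb ector_epull /epull.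
rewrite alt_ector_sum; last exact/ae/AB.
by apply: eq_bigr => l _; rewrite aE.
Qed.

Let ector_pb eta w x k v : sform B eta -> A x ->
  ector w (pb phi eta x) k v = \sum_j a w j x * pb phi (fun y => ector 'e_j (eta y)) x k v.
Proof.
move=> se Ax; rewrite /pb ector_epull /epull alt_ector_sum; last exact/se.1/AB.
by apply: eq_bigr => l _; rewrite aE.
Qed.

(** Differentiating a pull-back along [u] also differentiates the Jacobian that acts on each
    argument; these contributions form the second sum, in which one argument has gone into the
    differential of [a u l]. *)
Lemma Dform_pb eta u x k v : sform B eta -> A x ->
  Dform u (pb phi eta) x k v =
  \sum_l a u l x * pb phi (Dform 'e_l eta) x k v +
  \sum_l wedge (dscalar (a u l) x) (pb phi (fun y => ector 'e_l (eta y)) x) k v.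
Proof.
move=> + Ax; elim: k eta v => [|k IH] eta v se.
  rewrite [X in _ + X]big1 ?addr0 => [|l _]; last by rewrite wedge0 dscalar0 mul0r.
  rewrite /Dform.
  have -> : (fun y => pb phi eta y 0%N v) = (fun z => eta z 0%N 0) \o phi.
    by apply/funext => y; rewrite /pb /epull /= [_ *m _]flatmx0.
  have d := smooth_rv_diff sphi Ax; have d2 := sform_diff 0%N 0 se (AB Ax).
  rewrite derive_comp // derive_pd //; apply: eq_bigr => l _.
  by rewrite derive_rV // /pb /epull [_ *m _]flatmx0.
rewrite -(@vsubmxK _ 1 k _ v); move: (usubmx _) (dsubmx _) => w {}v.
have sej l : sform B (fun y => ector 'e_l (eta y)) by exact: sform_ector.
pose P j y := pb phi (fun y => ector 'e_j (eta y)) y k v.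
have dP j : differentiable (P j) x by exact: sform_diff k v (sform_pb (sej j)) Ax.
have da u' l : differentiable (a u' l) x by exact: smooth_on_diff (sa u' l) Ax.
have -> : Dform u (pb phi eta) x k.+1 (col_mx w v) =
          'D_u (fun y => \sum_j a w j y * P j y) x.
  apply: near_eq_derive; apply: (open_near oA Ax) => y Ay.
  exact: (ector_pb w v se Ay).
have -> : 'D_u (fun y => \sum_j a w j y * P j y) x =
    \sum_j (a w j x * 'D_u (P j) x + P j x * 'D_u (a w j) x).
  apply: etrans (derive_bigsum _ _ _ _).2 _; first by move=> j; exact: difM.
  by apply: eq_bigr => j _; rewrite derM.
rewrite big_split /= addrC [in RHS]addrC.
have -> : \sum_l wedge (dscalar (a u l) x) (pb phi (fun y => ector 'e_l (eta y)) x)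
      k.+1 (col_mx w v) =
    \sum_l (P l x * 'D_u (a w l) x) +
    \sum_j \sum_l a w j x * wedge (dscalar (a u l) x)
         (pb phi (fun y => ector 'e_l (ector 'e_j (eta y))) x) k v.
  rewrite [X in _ = _ + X]exchange_big -big_split /=; apply: eq_bigr => l _.
  rewrite -[LHS]/(ector w _ k v) ector_wedge ector_dscalar ebar_dscalar.
  rewrite wedge_scalar wedgeZl /eadd /escale; congr (_ + _).
    (* Symmetry of the second derivatives of [phi]: the derivative of [a u l] along [w] is that of
       [a w l] along [u]. *)
    by rewrite mulrC (derive_comm w u oA (sphi l) Ax).
  rewrite (wedge_sumr _ (g := fun j => pb phi (fun y => ector 'e_j (ector 'e_l (eta y))) x)
    (c := fun j => a w j x)); last by move=> k' v'; exact: ector_pb.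
  rewrite mulN1r -sumrN; apply: eq_bigr => j _; rewrite -mulrN; congr (_ * _).
  have -> : pb phi (fun y => ector 'e_j (ector 'e_l (eta y))) x =
      escale (-1) (pb phi (fun y => ector 'e_l (ector 'e_j (eta y))) x).
    apply: eform_ext => k' v'; rewrite /pb /epull /escale mulN1r.
    exact: (ector_anti _ _ _ (se.1 _ (AB Ax))).
  by rewrite wedgeZr /escale mulN1r opprK.
rewrite -addrA; congr (_ + _).
have -> : \sum_l a u l x * pb phi (Dform 'e_l eta) x k.+1 (col_mx w v) =
    \sum_j a w j x * \sum_l a u l x * pb phi (Dform 'e_l (fun y => ector 'e_j (eta y))) x k v.
  under [RHS]eq_bigr do rewrite mulr_sumr.
  rewrite exchange_big; apply: eq_bigr => l _.
  rewrite -[pb phi (Dform 'e_l eta) x k.+1 _]/(ector w (pb phi (Dform 'e_l eta) x) k v).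
  rewrite (ector_pb w v (sform_D 'e_l oB se) Ax) mulr_sumr.
  by apply: eq_bigr => j _; rewrite mulrCA.
rewrite -big_split; apply: eq_bigr => j _ /=.
rewrite -[X in a w j x * X](_ : Dform u (pb phi (fun y => ector 'e_j (eta y))) x k v = _) //.
by rewrite -mulr_sumr -mulrDr IH // addrC.
Qed.

(** Induction on the degree with Cartan's formula on both sides. Contracting the pull-back gives a
    sum of [a u l] times pull-backs, whose exterior derivative contains exactly the terms with the
    differential of [a u l] found in [Dform_pb]; they cancel, and the induction hypothesis
    identifies the rest. *)
Lemma ext_d_pb eta x : sform B eta -> A x ->
  ext_d (pb phi eta) x = pb phi (ext_d eta) x.
Proof.
move=> + Ax; move=> se; apply: eform_ext => k; elim: k eta se => [|k IH] eta se v.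
  by rewrite /pb /epull !ext_d0.
rewrite -(@vsubmxK _ 1 k _ v); move: (usubmx _) (dsubmx _) => u {}v.
have sej l : sform B (fun y => ector 'e_l (eta y)) by exact: sform_ector.
rewrite -[LHS]/(ector u (ext_d (pb phi eta) x) k v) ector_ext_d Dform_pb //.
rewrite -[RHS]/(ector u (pb phi (ext_d eta) x) k v).
have -> : ector u (pb phi (ext_d eta) x) k v =
    \sum_l a u l x * (pb phi (Dform 'e_l eta) x k v -
                      pb phi (ext_d (fun y => ector 'e_l (eta y))) x k v).
  rewrite ector_pb //; last exact: sform_ext_d.
  by apply: eq_bigr => l _; rewrite /pb /epull ector_ext_d.
under [RHS]eq_bigr do rewrite mulrBr.
rewrite big_split /= -addrA; congr (_ + _); rewrite sumrN.
pose Q l := fun y => wedge (escalar (a u l y)) (pb phi (fun z => ector 'e_l (eta z)) y).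
have sQ l : smooth_e A (Q l).
  apply: smooth_e_wedge => //; first exact: smooth_e_scalar.
  exact: (sform_pb (sej l)).2.
have -> : ext_d (fun y => ector u (pb phi eta y)) x k v = \sum_l ext_d (Q l) x k v.
  have -> : ext_d (fun y => ector u (pb phi eta y)) x =
      ext_d (fun y k v => \sum_l Q l y k v) x.
    apply: (near_eq_ext_d oA Ax) => y Ay; apply: eform_ext => k' v'.
    rewrite ector_pb //; apply: eq_bigr => l _.
    by rewrite /Q wedge_scalar.
  rewrite /ext_d exchange_big; apply: eq_bigr => i _; rewrite -mulr_sumr.
  rewrite (derive_bigsum _ _ _ _).2 // => l; exact: smooth_e_diff (sQ l) Ax.
apply/eqP; rewrite subr_eq; apply/eqP; rewrite addrC -sumrB -[LHS]addr0.
apply/esym/eqP; rewrite addr0; apply/eqP; apply: eq_bigr => l _.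
rewrite /Q (ext_d_wedge oA _ (sform_pb (sej l)).2 Ax); last exact: smooth_e_scalar.
have -> : ebar (escalar (a u l x)) = escalar (a u l x) :> eform R m.
  apply: eform_ext => -[|k'] v'; rewrite /ebar /escalar /= ?expr0 ?mul1r //.
  by rewrite mulr0.
by rewrite wedge_scalar /eadd /escale IH // addrK.
Qed.

End Pullback.
Arguments epull {R m p} J f k v.
Arguments pb {R m p} phi eta x k v.
Arguments dscalar {R m} a x k v.

(** * Charts of a manifold *)

Lemma open_preimage_on (T U : topologicalType) (A : set T) (f : T -> U) (O : set U) :
  open A -> (forall x, A x -> {for x, continuous f}) -> open O ->
  open (A `&` f @^-1` O).
Proof.
move=> oA cf oO; rewrite openE => x [Ax Ox]; apply: filterI; first exact: open_nbhs_nbhs.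
by apply: cf => //; exact: open_nbhs_nbhs.
Qed.

Lemma smooth_rv_continuous (R : realType) m k (A : set 'rV[R]_m)
    (f : 'rV[R]_m -> 'rV[R]_k) x :
  smooth_rv_on A f -> A x -> {for x, continuous f}.
Proof. by move=> sf Ax; apply: differentiable_continuous; exact: smooth_rv_diff Ax. Qed.

Section ChartReps.
Context {R : realType}.

Section Crd.
Context {m : nat} (M : premanifold R m).
Implicit Types (c : chart M) (p : M) (U V : set M).

Lemma parK c p : cran c p -> cdom M c (crd c p) /\ par M c (crd c p) = p.
Proof. by move=> [x dx xp]; apply: (@xgetPex _ 0 [set x | cdom M c x /\ par M c x = p]); exists x. Qed.

Lemma cpreI c U V : cpre c (U `&` V) = cpre c U `&` cpre c V.
Proof.
by apply/seteqP; split=> x /=; [move=> [dx [Ux Vx]]|move=> [[dx Ux] [_ Vx]]].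
Qed.

Lemma mopenI U V : mopen U -> mopen V -> mopen (U `&` V).
Proof. by move=> oU oV c; rewrite cpreI; exact: openI. Qed.

Lemma cpre_crd c U p : cran c p -> U p -> cpre c U (crd c p).
Proof. by move=> /parK[d e] Up; split => //; rewrite e. Qed.

End Crd.

Definition mrep m m' (M : premanifold R m) (M' : premanifold R m') (f : M -> M')
  (c : chart M) (c' : chart M') : 'rV[R]_m -> 'rV[R]_m' := fun x => crd c' (f (par M c x)).

(** Smoothness near one point in fixed charts, just enough for the chain rule; it applies equally to
    [id], to equivalences and to the projections of the flag manifold. *)
Definition smooth_at m m' (M : premanifold R m) (M' : premanifold R m') (f : M -> M')
    (c : chart M) (c' : chart M') (p : M) : Prop :=
  cran c p /\ exists A : set 'rV[R]_m, [/\ open A, A (crd c p),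
    forall x, A x -> cran c' (f (par M c x)) & smooth_rv_on A (mrep f c c')].

Lemma jacobian_mrep_comp m m' m'' (M : premanifold R m) (M' : premanifold R m')
    (M'' : premanifold R m'') (f : M -> M') (g : M' -> M'') c c' c'' p :
  smooth_at f c c' p -> smooth_at g c' c'' (f p) ->
  jacobian (mrep (g \o f) c c'') (crd c p) =
  jacobian (mrep f c c') (crd c p) *m jacobian (mrep g c' c'') (crd c' (f p)).
Proof.
move=> [cp [A [oA Ap Ac sA]]] [cp' [B [oB Bp Bc sB]]].
have [dp pp] := parK cp.
have fE : mrep f c c' (crd c p) = crd c' (f p) by rewrite /mrep pp.
have df := smooth_rv_diff sA Ap.
have dg : differentiable (mrep g c' c'') (mrep f c c' (crd c p)).
  by rewrite fE; exact: smooth_rv_diff sB Bp.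
rewrite -fE; apply: (etrans _ (jacobian_comp df dg)).
apply/esym/(near_eq_jacobian oA Ap); last exact: differentiable_comp df dg.
by move=> y Ay; rewrite /mrep /= (parK (Ac y Ay)).2.
Qed.

Section Manifold.
Context {m : nat} (M : premanifold R m) (hM : is_manifold M).
Implicit Types (c : chart M) (p : M) (U V : set M).

Lemma cdom_open c : open (cdom M c). Proof. exact: hM.1. Qed.

Lemma crdK c x : cdom M c x -> crd c (par M c x) = x.
Proof.
move=> dx; have [d e] := parK (ex_intro2 _ _ x dx erefl : cran c (par M c x)).
by have [_ [inj _]] := hM; exact: inj d dx e.
Qed.

Lemma cran_par c x : cdom M c x -> cran c (par M c x).
Proof. by move=> dx; exists x. Qed.

Lemma cran_at p : cran (chart_at M p) p. Proof. exact: hM.2.2.1. Qed.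

Lemma cran_mopen c : mopen (cran c).
Proof. by move=> c'; have [_ [_ [_ [/(_ c' c) [] ]]]] := hM. Qed.

Lemma smooth_trans c c' : smooth_rv_on (cpre c (cran c')) (mrep id c c').
Proof. by have [_ [_ [_ [/(_ c c') [] ]]]] := hM. Qed.

Lemma smooth_at_id c c' p : cran c p -> cran c' p -> smooth_at id c c' p.
Proof.
move=> cp cp'; split=> //; exists (cpre c (cran c')); split=> //.
- exact: cran_mopen.
- exact: cpre_crd.
- by move=> x [].
- exact: smooth_trans.
Qed.

Lemma jacobian_trans_refl c p : cran c p -> jacobian (mrep id c c) (crd c p) = 1%:M.
Proof.
move=> cp; have := @near_eq_jacobian _ _ _ (cdom M c) id (mrep id c c) (crd c p).
rewrite jacobian_id => <- //; first exact: cdom_open.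
- exact: (parK cp).1.
- by move=> x dx; rewrite /mrep crdK.
Qed.

Lemma jacobian_trans_inv c c' p : cran c p -> cran c' p ->
  jacobian (mrep id c c') (crd c p) *m jacobian (mrep id c' c) (crd c' p) = 1%:M.
Proof.
move=> cp c'p; have h1 := smooth_at_id cp c'p; have h2 := smooth_at_id c'p cp.
exact: (etrans (esym (jacobian_mrep_comp h1 h2)) (jacobian_trans_refl cp)).
Qed.

Lemma to_chartE c p : to_chart c p = jacobian (mrep id (chart_at M p) c) (crd (chart_at M p) p).
Proof. by []. Qed.

Lemma of_chartE c p : of_chart c p = jacobian (mrep id c (chart_at M p)) (crd c p).
Proof. by []. Qed.

Lemma to_of_chart c p : cran c p -> to_chart c p *m of_chart c p = 1%:M.
Proof.
move=> cp; rewrite to_chartE of_chartE; set a := chart_at M p.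
have ap : cran a p by exact: cran_at.
rewrite -(jacobian_mrep_comp (smooth_at_id ap cp) (smooth_at_id cp ap)).
exact: jacobian_trans_refl.
Qed.

Lemma of_to_chart c c' p : cran c p -> cran c' p ->
  of_chart c p *m to_chart c' p = jacobian (mrep id c c') (crd c p).
Proof.
move=> cp cp'; rewrite to_chartE of_chartE; set a := chart_at M p.
have ap : cran a p by exact: cran_at.
by rewrite -(jacobian_mrep_comp (smooth_at_id cp ap) (smooth_at_id ap cp')).
Qed.

Lemma of_to_chart_par c c' x : cdom M c x -> cran c' (par M c x) ->
  of_chart c (par M c x) *m to_chart c' (par M c x) = jacobian (mrep id c c') x.
Proof. by move=> dx c'x; rewrite of_to_chart ?crdK //; exact: cran_par. Qed.

Lemma of_to_chart1 c p : cran c p -> of_chart c p *m to_chart c p = 1%:M.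
Proof. by move=> cp; rewrite of_to_chart // jacobian_trans_refl. Qed.

Lemma mopen_par c (O : set 'rV[R]_m) : open O -> O `<=` cdom M c -> mopen (par M c @` O).
Proof.
move=> oO Od c'.
have -> : cpre c' (par M c @` O) = cpre c' (cran c) `&` mrep id c' c @^-1` O.
  apply/seteqP; split=> y /=.
    move=> [dy [x Ox xy]]; split; last by rewrite /mrep /= -xy crdK //; exact: Od.
    by split=> //; exists x => //; exact: Od.
  move=> [[dy cy] Oy]; split=> //; exists (mrep id c' c y) => //.
  by rewrite /mrep (parK cy).2.
apply: open_preimage_on => //; first exact: cran_mopen.
move=> x; apply: smooth_rv_continuous; exact: smooth_trans.
Qed.

Lemma frepE c (eta : dform M) x : frep c eta x = epull (of_chart c (par M c x)) (eta (par M c x)).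
Proof. by []. Qed.

Lemma form_frep c (eta : dform M) p : cran c p ->
  eta p = epull (to_chart c p) (frep c eta (crd c p)).
Proof.
move=> cp; apply: eform_ext => k v; rewrite /epull /frep (parK cp).2 -mulmxA.
by rewrite to_of_chart // mulmx1.
Qed.

Lemma frep_trans c c' (eta : dform M) x : cpre c (cran c') x ->
  frep c eta x = pb (mrep id c c') (frep c' eta) x.
Proof.
move=> [dx c'x]; have cx := cran_par dx.
apply: eform_ext => k v.
change (frep c eta x k v =
        frep c' eta (crd c' (par M c x)) k (v *m jacobian (mrep id c c') x)).
rewrite /frep (parK c'x).2 -(of_to_chart_par dx c'x) -!mulmxA.
by rewrite [X in of_chart c _ *m X](to_of_chart c'x) mulmx1.
Qed.

Lemma frep_form_of_chart c f x : cdom M c x -> frep c (form_of_chart c f) x = f x.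
Proof.
move=> dx; apply: eform_ext => k v; rewrite /frep /form_of_chart crdK // -mulmxA.
by rewrite of_to_chart1 ?mulmx1 //; exact: cran_par.
Qed.

Lemma smooth_form_sform c U (eta : dform M) : smooth_form U eta -> sform (cpre c U) (frep c eta).
Proof.
move=> [ae se]; split=> [x [dx Ux]|k v]; last exact: se.
by rewrite frepE; apply: alternating_epull; exact: ae.
Qed.

Lemma smooth_form_chart c U (eta : dform M) : mopen U -> U `<=` cran c ->
  sform (cpre c U) (frep c eta) -> smooth_form U eta.
Proof.
move=> oU Uc se; split=> [p Up|c' k v].
  rewrite (form_frep _ (Uc _ Up)); apply: alternating_epull; apply: se.1.
  by apply: cpre_crd => //; exact: Uc.
have H : sform (cpre c' U) (pb (mrep id c' c) (frep c eta)).
  apply: (sform_pb (B := cpre c U)) => //.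
    by move=> j; apply: smooth_on_sub (smooth_trans (c := c') (c' := c) j) => x [dx /Uc].
  by move=> x [dx Ux]; apply: cpre_crd => //; exact: Uc.
apply: (smooth_on_ext (oU c') _ (H.2 k v)) => x [dx Ux].
by rewrite (@frep_trans c' c) //; split=> //; exact: Uc.
Qed.

(** At each point [extd] is computed in the chart selected there, which may vary from point to
    point; naturality of [ext_d] under the transition map removes this choice. *)
Lemma frep_extd c U (eta : dform M) x : mopen U -> smooth_form U eta -> cpre c U x ->
  frep c (extd eta) x = ext_d (frep c eta) x.
Proof.
move=> oU se [dx Ux]; set p := par M c x; set a := chart_at M p.
have cp : cran c p := cran_par dx; have ap : cran a p := cran_at p.
have [da pa] := parK ap.
have -> : frep c (extd eta) x = pb (mrep id c a) (ext_d (frep a eta)) x.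
  apply: eform_ext => k v.
  change (ext_d (frep a eta) (crd a p) k (v *m jacobian (mrep id c a) (crd c p)) =
          ext_d (frep a eta) (crd a p) k (v *m jacobian (mrep id c a) x)).
  by rewrite /p crdK.
have oA : open (cpre c (U `&` cran a)) by apply: mopenI => //; exact: cran_mopen.
have Ax : cpre c (U `&` cran a) x by [].
have E : ext_d (pb (mrep id c a) (frep a eta)) x = pb (mrep id c a) (ext_d (frep a eta)) x.
  apply: (ext_d_pb (A := cpre c (U `&` cran a)) (B := cpre a U)) => //.
  - by move=> j; apply: smooth_on_sub (smooth_trans (c := c) (c' := a) j) => y [dy []].
  - by move=> y [dy [Uy ay]]; apply: cpre_crd.
  - exact: smooth_form_sform.
rewrite -E; apply: (near_eq_ext_d oA Ax) => y [dy [Uy ay]].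
by rewrite (@frep_trans c a).
Qed.

Lemma frep_dwedge c (alpha eta : dform M) x :
  frep c (dwedge alpha eta) x = wedge (frep c alpha x) (frep c eta x).
Proof. by rewrite !frepE -epull_wedge. Qed.

Lemma frep_contract c (X : vfield M) (eta : dform M) x : cdom M c x ->
  frep c (contract X eta) x = ector (vrep c X x) (frep c eta x).
Proof.
move=> dx; rewrite !frepE ector_epull /vrep -mulmxA to_of_chart ?mulmx1 //.
exact: cran_par.
Qed.

Lemma vrep_trans c c' (X : vfield M) x : cpre c (cran c') x ->
  vrep c' X (mrep id c c' x) = vrep c X x *m jacobian (mrep id c c') x.
Proof.
move=> [dx c'x]; have cx := cran_par dx.
change (vrep c' X (crd c' (par M c x)) = vrep c X x *m jacobian (mrep id c c') x).
rewrite /vrep (parK c'x).2 -(of_to_chart_par dx c'x) -mulmxA.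
rewrite [X in _ = _ *m X]mulmxA.
by rewrite [X in _ = _ *m (X *m _)](to_of_chart cx) mul1mx.
Qed.

Lemma smooth_vf_chart c U (X : vfield M) : mopen U -> U `<=` cran c ->
  smooth_rv_on (cpre c U) (vrep c X) -> smooth_vf U X.
Proof.
move=> oU Uc sX c'.
have T x : cpre c' U x -> cpre c U (mrep id c' c x).
  by move=> [dx Ux]; apply: cpre_crd => //; exact: Uc.
have sT : smooth_rv_on (cpre c' U) (mrep id c' c).
  by move=> j; apply: smooth_on_sub (smooth_trans (c := c') (c' := c) j) => x [dx /Uc].
have E x : cpre c' U x ->
    vrep c X (mrep id c' c x) *m jacobian (mrep id c c') (mrep id c' c x) = vrep c' X x.
  move=> [dx Ux]; have c'p := cran_par dx; have cp := Uc _ Ux.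
  rewrite (@vrep_trans c' c); last by split=> //; exact: Uc.
  have JJ : jacobian (mrep id c' c) x *m jacobian (mrep id c c') (mrep id c' c x) = 1%:M.
    by have := jacobian_trans_inv c'p cp; rewrite crdK.
  by rewrite -mulmxA [X in _ *m X]JJ; exact: mulmx1.
apply: (smooth_rv_ext (oU c') E) => j.
apply: (smooth_on_mulmx _ _ (oU c')) => [i l|i l].
  rewrite ord1; exact: (smooth_on_comp (oU c') T sT (sX l)).
have T' x : cpre c' U x -> cpre c (cran c') (mrep id c' c x).
  by move=> [dx Ux]; apply: cpre_crd; [exact: Uc|exact: cran_par].
have s2 : smooth_on (cpre c (cran c')) (fun x => jacobian (mrep id c c') x i l).
  by apply: smooth_on_jacobian; [exact: cran_mopen|exact: smooth_trans].
exact: (smooth_on_comp (oU c') T' sT s2).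
Qed.

Definition cbracket (X Y : 'rV[R]_m -> 'rV[R]_m) (x : 'rV[R]_m) : 'rV[R]_m :=
  'D_(X x) Y x - 'D_(Y x) X x.

Lemma cbracket_coor (X Y : 'rV[R]_m -> 'rV[R]_m) x l :
  differentiable X x -> differentiable Y x -> (cbracket X Y x) 0 l =
  'D_(X x) (fun y => Y y 0 l) x - 'D_(Y x) (fun y => X y 0 l) x.
Proof. by move=> dX dY; rewrite /cbracket !mxE !derive_rV. Qed.

(** In the chain rule for one derivative of a field along the other, the second derivatives of [phi]
    enter symmetrically in the two fields, so they drop out of the difference. *)
Lemma cbracket_trans (A B : set 'rV[R]_m) (phi X Y X' Y' : 'rV[R]_m -> 'rV[R]_m) x :
  open A -> open B -> A x -> (forall y, A y -> B (phi y)) -> smooth_rv_on A phi ->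
  smooth_rv_on A X -> smooth_rv_on A Y -> smooth_rv_on B X' -> smooth_rv_on B Y' ->
  (forall y, A y -> X' (phi y) = X y *m jacobian phi y) ->
  (forall y, A y -> Y' (phi y) = Y y *m jacobian phi y) ->
  cbracket X' Y' (phi x) = cbracket X Y x *m jacobian phi x.
Proof.
move=> oA oB Ax AB sphi sX sY sX' sY' XX' YY'.
have dphi y : A y -> differentiable phi y by exact: smooth_rv_diff.
have dX := smooth_rv_diff sX Ax; have dY := smooth_rv_diff sY Ax.
have key (U V U' V' : 'rV[R]_m -> 'rV[R]_m) l : smooth_rv_on A V -> smooth_rv_on B V' ->
    (forall y, A y -> U' (phi y) = U y *m jacobian phi y) ->
    (forall y, A y -> V' (phi y) = V y *m jacobian phi y) ->
    'D_(U' (phi x)) (fun y => V' y 0 l) (phi x) =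
    \sum_k 'D_(U x) (fun y => V y 0 k) x * pd k (fun y => phi y 0 l) x +
    \sum_k \sum_j V x 0 k * U x 0 j * pd j (pd k (fun y => phi y 0 l)) x.
  move=> sV sV' UU' VV'.
  have dV' := smooth_on_diff (sV' l) (AB _ Ax).
  have dpk k := smooth_on_diff (smooth_on_pd k (sphi l)) Ax.
  have dVk k : differentiable (fun y => V y 0 k) x := smooth_on_diff (sV k) Ax.
  rewrite UU' // mul_jacobian -deriveE; last exact: dphi.
  rewrite -(derive_comp _ (dphi _ Ax) dV').
  have -> : 'D_(U x) ((fun y => V' y 0 l) \o phi) x =
      'D_(U x) (fun y => \sum_k V y 0 k * pd k (fun z => phi z 0 l) y) x.
    apply: near_eq_derive; apply: (open_near oA Ax) => y Ay /=.
    rewrite VV' // mxE; apply: eq_bigr => k _.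
    by rewrite jacobianE //; exact: dphi.
  apply: etrans (derive_bigsum _ _ _ _).2 _; first by move=> k; exact: difM.
  rewrite -big_split; apply: eq_bigr => k _ /=.
  rewrite derM // [RHS]addrC; congr (_ + _); last exact: mulrC.
  rewrite (derive_pd _ (dpk k)) mulr_sumr; apply: eq_bigr => j _.
  by rewrite mulrA.
apply/rowP => l; rewrite cbracket_coor; first last.
- exact: smooth_rv_diff sY' (AB _ Ax).
- exact: smooth_rv_diff sX' (AB _ Ax).
rewrite (key X Y X' Y') // (key Y X Y' X') // mxE.
have -> : \sum_j cbracket X Y x 0 j * (jacobian phi x) j l =
    \sum_k 'D_(X x) (fun y => Y y 0 k) x * pd k (fun y => phi y 0 l) x -
    \sum_k 'D_(Y x) (fun y => X y 0 k) x * pd k (fun y => phi y 0 l) x.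
  rewrite -sumrB; apply: eq_bigr => k _; rewrite cbracket_coor // jacobianE; last exact: dphi.
  exact: mulrBl.
set S1 := \sum_k \sum_j _; set S2 := \sum_k \sum_j _.
have -> : S1 = S2.
  rewrite /S1 exchange_big; apply: eq_bigr => k _; apply: eq_bigr => j _.
  by rewrite (pdC _ _ oA Ax (sphi l)) mulrC [Y x 0 j * _]mulrC mulrC.
by rewrite opprD addrACA subrr addr0.
Qed.

Lemma vrep_bracket c U (X Y : vfield M) x : mopen U -> smooth_vf U X -> smooth_vf U Y ->
  cpre c U x -> vrep c (bracket X Y) x = cbracket (vrep c X) (vrep c Y) x.
Proof.
move=> oU sX sY [dx Ux]; set p := par M c x; set a := chart_at M p.
have cp : cran c p := cran_par dx; have ap : cran a p := cran_at p.
have [da pa] := parK ap.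
rewrite {1}/vrep -/p /bracket -/a -/(cbracket (vrep a X) (vrep a Y) (crd a p)).
have oA : open (cpre a (U `&` cran c)) by apply: mopenI => //; exact: cran_mopen.
have oB : open (cpre c U) by exact: oU.
have Aa : cpre a (U `&` cran c) (crd a p) by apply: cpre_crd.
have sub : cpre a (U `&` cran c) `<=` cpre a U by move=> y [dy []].
have := @cbracket_trans (cpre a (U `&` cran c)) (cpre c U) (mrep id a c)
  (vrep a X) (vrep a Y) (vrep c X) (vrep c Y) (crd a p) oA oB Aa.
have mE : mrep id a c (crd a p) = x by rewrite /mrep pa crdK.
rewrite to_chartE -/a mE => E; apply/esym; apply: E.
- by move=> y [dy [Uy cy]]; exact: cpre_crd.
- by move=> j; apply: smooth_on_sub (smooth_trans (c := a) (c' := c) j) => y [dy []].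
- by move=> j; exact: smooth_on_sub sub (sX a j).
- by move=> j; exact: smooth_on_sub sub (sY a j).
- exact: (sX c).
- exact: (sY c).
- by move=> y [dy [_ cy]]; apply: vrep_trans.
- by move=> y [dy [_ cy]]; apply: vrep_trans.
Qed.

End Manifold.
End ChartReps.

(** * Ideals generated by a contact form and a decomposable form *)

Lemma open_nonzero (R : realType) m (A : set 'rV[R]_m) (f : 'rV[R]_m -> R) : open A ->
  (forall x, A x -> differentiable f x) -> open (A `&` [set x | f x != 0]).
Proof.
move=> oA df; have -> : [set x | f x != 0] = f @^-1` (~` [set r | r = 0]).
  by apply/seteqP; split=> x /eqP.
apply: open_preimage_on => //; first by move=> y Ay; exact/differentiable_continuous/df.
exact/closed_openC/closed_eq.
Qed.

Section CoordinateIdeals.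
Context {R : realType} {m : nat}.
Implicit Types (A O : set 'rV[R]_m) (x y u : 'rV[R]_m) (eta : 'rV[R]_m -> eform R m).

(** [gen_ideal3] read in one chart, where forms are functions on an open subset of R^m and can be
    compared directly. *)
Definition cideal (g1 g2 g3 : 'rV[R]_m -> eform R m) x eta : Prop :=
  exists O b1 b2 b3, [/\ open O, O x, [/\ sform O b1, sform O b2 & sform O b3] &
    forall y, O y -> eta y = eadd (wedge (b1 y) (g1 y))
                       (eadd (wedge (b2 y) (g2 y)) (wedge (b3 y) (g3 y)))].

Lemma wedge_scalarr (f : eform R m) a : wedge f (escalar a) = escale a f.
Proof.
have e0 u b : ector u (escalar b) = escale 0 (escalar b) :> eform R m.
  by apply: eform_ext => k v; rewrite /ector /escalar /escale mul0r.
apply: eform_ext => k; elim: k f => [|k IH] f v.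
  by rewrite wedge0 /escalar /escale mulrC.
rewrite -(@vsubmxK _ 1 k _ v); move: (usubmx _) (dsubmx _) => u {}v.
rewrite -[LHS]/(ector u _ k v) -[RHS]/(ector u _ k v) !ector_wedge e0 wedgeZr.
by rewrite /eadd IH /escale mul0r addr0.
Qed.

Definition degree d (f : eform R m) := forall k v, k != d -> f k v = 0.

Lemma ector_degree1 (f : eform R m) u : degree 1 f -> ector u f = escalar (f 1%N u).
Proof.
move=> df; apply: eform_ext => -[|k] v; last by rewrite /ector /escalar /= df.
rewrite /ector /escalar /=; apply: eform_cast => // i i' j ii'.
by rewrite mxE; case: splitP => a ia; [rewrite !ord1|case: a ia].
Qed.

(* Since [theta T != 0], a form vanishing on the kernel of [theta] is divisible by [theta]. *)
Lemma alt_mod_theta (theta gam : eform R m) (T : 'rV[R]_m) :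
  alternating theta -> degree 1 theta -> theta 1%N T != 0 -> alternating gam ->
  (forall k v, (forall i, theta 1%N (row i v) = 0) -> gam k v = 0) ->
  gam = wedge (escale (theta 1%N T)^-1 (ebar (ector T gam))) theta.
Proof.
move=> at_ dt t0 ag gD; set h := (theta 1%N T)^-1.
set del := wedge _ _.
pose F := eadd gam (escale (-1) del).
have adel : alternating del.
  by apply: alternating_wedge => //; apply/alternating_scale/alternating_bar/alternating_ector.
have aF : alternating F by apply: alternating_add => //; exact: alternating_scale.
have dD k v : (forall i, theta 1%N (row i v) = 0) -> del k v = 0.
  move=> v0; rewrite /del /wedge big1 // => S _.
  have [e|ne] := eqVneq #|~: S| 1%N; last by rewrite dt ?mulr0.
  suff -> : theta #|~: S| (rowsub (@enum_val _ (mem (~: S))) v) = 0 by rewrite mulr0.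
  have zE (z : 'I_#|~: S|) : z = 0%N :> nat by case: z => z /=; rewrite e; case: z.
  have [i0 _] : exists i : 'I_#|~: S|, true by rewrite e; exists ord0.
  rewrite -(v0 (enum_val i0)); apply: eform_cast => // i i' j _.
  rewrite !mxE; congr (v (enum_val _) _); apply: val_inj.
  by rewrite /= (zE i) (zE i0).
(* By the antiderivation rule the product contracts with [T] to [theta(T)] times the chosen
   coefficient, up to two grading signs that cancel; so the remainder [F] is killed by [T]. *)
have TF : ector T F = ezero.
  rewrite /F ectorD ectorZ /del ector_wedge ectorZ ector_ebar alt_ector2 //.
  rewrite (ector_degree1 T dt) wedge_scalarr.
  apply: eform_ext => k v; rewrite /eadd /escale /ezero.
  rewrite [X in _ + -1 * (X + _)](_ : _ = 0); last first.
    by rewrite /wedge big1 // => S _; rewrite /escale /ebar /ezero; ring.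
  rewrite -[ebar _ k v]/((-1) ^+ k * (h * ebar (ector T gam) k v)) /ebar add0r mulN1r.
  have e1 : (-1) ^+ k * (-1) ^+ k = 1 :> R by rewrite -exprMn mulrNN mulr1 expr1n.
  have -> : theta 1%N T * ((-1) ^+ k * (h * ((-1) ^+ k * ector T gam k v))) =
    (theta 1%N T * h) * ((-1) ^+ k * (-1) ^+ k) * ector T gam k v by ring.
  by rewrite e1 /h divff // !mul1r subrr.
have lin1 a u w : theta 1%N (a *: u + w) = a * theta 1%N u + theta 1%N w.
  have := alt_ext_lin a u w at_; rewrite !ector_degree1 // => /(congr1 (fun f => f 0%N 0)).
  by rewrite /eadd /escale /escalar.
suff F0 k v : F k v = 0.
  apply: eform_ext => k v; have := F0 k v; rewrite /F /eadd /escale mulN1r.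
  by move/eqP; rewrite subr_eq0 => /eqP.
(* Every vector is a multiple of [T] plus a vector of the kernel, so the arguments may be taken of
   these two kinds: an argument [T] gives 0 by [TF], and on the kernel both forms vanish. *)
pose P u := theta 1%N u = 0 \/ u = T.
apply: (@alt_span _ _ F k P v (aF k)) => [i|B BP].
  pose c := theta 1%N (row i v) * h.
  exists 2, (fun j : 'I_2 => if j == ord0 then 1 else c),
    (fun j : 'I_2 => if j == ord0 then row i v - c *: T else T); split.
    move=> j; case: eqP => _; [left|by right].
    by rewrite addrC -scaleNr lin1 /c mulNr -mulrA mulVf // mulr1 addNr.
  by rewrite big_ord_recl big_ord1 /= scale1r subrK.
case: (pselect (forall i, theta 1%N (row i B) = 0)) => [B0|].
  by rewrite /F /eadd /escale gD // dD // mulr0 addr0.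
move=> /existsNP[i /eqP Bi]; have [/eqP Bi'|BT] := BP i; first by rewrite Bi' in Bi.
by apply: (alt_front (aF k) _ BT) => k' C; rewrite TF.
Qed.

Section Core.
Variables (n : nat) (A : set 'rV[R]_m) (D E1 : 'rV[R]_m -> 'rV[R]_m -> Prop)
  (X : 'I_n -> 'rV[R]_m -> 'rV[R]_m).
Hypotheses (oA : open A) (sX : forall i, smooth_rv_on A (X i))
  (E1D : forall y u, A y -> E1 y u -> D y u)
  (XD : forall y i, A y -> D y (X i y))
  (Dsum : forall y u, A y -> D y u -> exists a (c : 'I_n -> R),
     E1 y a /\ u = a + \sum_i c i *: X i y).

(** Tested on vectors of [D] only: this is the condition of being killed by [E1] modulo the contact
    form, stable under adding multiples of the latter. *)
Definition killed (f : eform R m) y := forall k (v : 'M[R]_(k, m)),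
  (forall i, D y (row i v)) -> (exists i, E1 y (row i v)) -> f k v = 0.

Definition ctheta (theta : 'rV[R]_m -> eform R m) :=
  sform A theta /\ forall y, A y -> [/\ degree 1 (theta y),
    forall u, D y u <-> theta y 1%N u = 0 & exists u, theta y 1%N u != 0].

Definition cform (om : 'rV[R]_m -> eform R m) :=
  sform A om /\ forall y, A y -> degree n (om y) /\ killed (om y) y.

Definition cvolume (om : 'rV[R]_m -> eform R m) :=
  forall y, A y -> om y n (\matrix_i X i y) != 0.

Lemma cform_mod theta om om' x : ctheta theta -> cform om -> cform om' -> cvolume om' ->
  A x -> exists O (g : 'rV[R]_m -> R) (bet : 'rV[R]_m -> eform R m),
    [/\ open O, O x, O `<=` A, smooth_on O g & sform O bet] /\
    forall y, O y -> om y = eadd (escale (g y) (om' y)) (wedge (bet y) (theta y)).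
Proof.
move=> [st tP] [so oP] [so' oP'] vo' Ax.
have [dtx tDx [u0 tu0]] := tP _ Ax.
pose O := A `&` [set y | theta y 1%N u0 != 0].
have oO : open O by apply: open_nonzero => // y Ay; exact: sform_diff st Ay.
have OA : O `<=` A by move=> y [].
pose w y := om y n (\matrix_i X i y); pose w' y := om' y n (\matrix_i X i y).
have sw eta : sform A eta -> smooth_on A (fun y => eta y n (\matrix_i X i y)).
  move=> se; apply: smooth_on_eval => // i j.
  by apply: (smooth_on_ext oA _ (sX i j)) => y _; rewrite mxE.
(* The ratio of the values on the frame [X] is the only candidate, and it makes [gam] below vanish
   on that frame. *)
pose g y := w y / w' y.
have sg : smooth_on O g.
  apply: smooth_on_sub OA _; apply: smooth_onM => //; first exact: sw.
  by apply: smooth_onV => //; exact: sw.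
pose gam y := eadd (om y) (escale (- g y) (om' y)).
have sgam : sform O gam.
  apply: sform_add => //; first exact: sform_sub so.
  by apply: sform_scale => //; [exact: smooth_onN|exact: sform_sub so'].
pose bet y := escale (theta y 1%N u0)^-1 (ebar (ector u0 (gam y))).
exists O, g, bet; split; first split=> //.
  apply: sform_scale => //; last by apply: sform_bar => //; exact: sform_ector.
  apply: smooth_onV => //; first by move=> y [].
  exact: smooth_on_sub OA (st.2 _ _).
move=> y Oy; have [Ay ty0] := Oy; have [dt tD _] := tP _ Ay.
have <- : gam y = wedge (bet y) (theta y).
  apply: alt_mod_theta => //; [exact: st.1|exact: sgam.1|].
  move=> k v v0.
  have [kn|kn] := eqVneq k n; last first.
    by rewrite /gam /eadd /escale (oP _ Ay).1 // (oP' _ Ay).1 // mulr0 addr0.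
  (* Arguments in [D] reduce to vectors of [E1] and vectors of the frame. One argument from [E1]
     kills both forms; otherwise the arguments are a selection from the frame, where [gam]
     vanishes. *)
  pose P u := E1 y u \/ exists i, u = X i y.
  have PD u : P u -> D y u by case=> [/E1D|[i ->]]; [exact|exact: XD].
  apply: (@alt_span _ _ (gam y) k P v (sgam.1 _ Oy k)) => [i|B BP].
    have /(Dsum Ay)[a [c [Ea ->]]] : D y (row i v) by apply/tD.
    exists n.+1, (fun j => if unlift ord0 j is Some i then c i else 1),
      (fun j => if unlift ord0 j is Some i then X i y else a); split.
      by move=> j; case: unliftP => [l _|_]; [right; exists l|left].
    rewrite big_ord_recl unlift_none scale1r; congr (_ + _).
    by apply: eq_bigr => l _; rewrite liftK.
  case: (pselect (exists i, E1 y (row i B))) => [BE|/forallNP BE].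
    have BD i : D y (row i B) by exact/PD/BP.
    by rewrite /gam /eadd /escale (oP _ Ay).2 // (oP' _ Ay).2 // mulr0 addr0.
  subst k; have -> : B = \matrix_i row i B by apply/row_matrixP => i; rewrite rowK.
  apply: (@alt_tuple _ _ (gam y) n (fun i => X i y)) => [|i|]; first exact: sgam.1.
    by have [/BE|//] := BP i.
  rewrite /gam /eadd /escale /g -/(w y) -/(w' y) mulNr divfK ?subrr //.
  exact: vo'.
apply: eform_ext => k v; rewrite /gam /eadd /escale; ring.
Qed.

Lemma ctheta_mul theta theta' x : ctheta theta -> ctheta theta' -> A x ->
  exists O (f : 'rV[R]_m -> R), [/\ open O, O x, O `<=` A, smooth_on O f &
    forall y, O y -> theta y = wedge (escalar (f y)) (theta' y)].
Proof.
move=> [st tP] [st' tP'] Ax; have [_ _ [u0 tu0]] := tP' _ Ax.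
pose O := A `&` [set y | theta' y 1%N u0 != 0].
have oO : open O by apply: open_nonzero => // y Ay; exact: sform_diff st' Ay.
have OA : O `<=` A by move=> y [].
exists O, (fun y => (theta' y 1%N u0)^-1 * theta y 1%N u0); split=> //.
  apply: smooth_onM => //; last exact: smooth_on_sub OA (st.2 _ _).
  apply: smooth_onV => //; first by move=> y [].
  exact: smooth_on_sub OA (st'.2 _ _).
move=> y [Ay ty0]; have [dt' tD' _] := tP' _ Ay; have [dt tD _] := tP _ Ay.
rewrite {1}(@alt_mod_theta (theta' y) (theta y) u0) //; first last.
- move=> k v v0; have [e|ne] := eqVneq k 1%N; last by rewrite dt.
  subst k; apply/tD/tD'; rewrite -(v0 0); congr (theta' y _ _).
  by apply/rowP => j; rewrite mxE.
- exact: st.1.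
- exact: st'.1.
congr (wedge _ _); rewrite ector_degree1 //.
apply: eform_ext => -[|k] v; rewrite /escale /ebar /escalar /= ?mulr0 //.
by rewrite expr0 mul1r.
Qed.

Lemma cideal_sub theta theta' om om' x eta : ctheta theta -> ctheta theta' ->
  cform om -> cform om' -> cvolume om' -> A x ->
  cideal theta (ext_d theta) om x eta -> cideal theta' (ext_d theta') om' x eta.
Proof.
move=> ht ht' ho ho' vo' Ax [W [b1 [b2 [b3 [oW Wx [s1 s2 s3] etaE]]]]].
have [ O1 [f [oO1 O1x O1A sf thE]]] := ctheta_mul ht ht' Ax.
have [ O2 [g [bet [[oO2 O2x O2A sg sb] omE]]]] := cform_mod ht' ho ho' vo' Ax.
pose Q := W `&` (O1 `&` O2).
have oQ : open Q by apply: openI => //; exact: openI.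
have QO : Q `<=` W by move=> y []. have QO1 : Q `<=` O1 by move=> y [_ []].
have QO2 : Q `<=` O2 by move=> y [_ []].
have {}s1 := sform_sub QO s1; have {}s2 := sform_sub QO s2; have {}s3 := sform_sub QO s3.
have {}sf := smooth_on_sub QO1 sf; have {}sg := smooth_on_sub QO2 sg.
have {}sb := sform_sub QO2 sb.
have sdf : sform Q (dscalar f) by apply: sform_ext_d => //; exact: sform_scalar.
(* With theta = f theta', d theta = df /\ theta' + f d theta' and om = g om' + bet /\ theta', the
   three coefficients are read off by collecting the new generators. *)
exists Q, (fun y => eadd (escale (f y) (b1 y)) (eadd (wedge (b2 y) (dscalar f y)) (wedge (b3 y) (bet y)))),
  (fun y => escale (f y) (b2 y)), (fun y => escale (g y) (b3 y)); split=> //.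
  split; [|exact: sform_scale|exact: sform_scale].
  apply: sform_add => //; first exact: sform_scale.
  by apply: sform_add => //; exact: sform_wedge.
move=> y Qy; rewrite etaE ?omE; [|exact: QO2|exact: QO].
have -> : ext_d theta y = eadd (wedge (dscalar f y) (theta' y)) (escale (f y) (ext_d theta' y)).
  rewrite (near_eq_ext_d oQ Qy (zeta := fun z => wedge (escalar (f z)) (theta' z))); last first.
    by move=> z Qz; apply: thE; exact: QO1.
  rewrite (@ext_d_wedge _ _ Q) //; [|exact: smooth_e_scalar|]; last first.
    by apply: smooth_e_sub ht'.1.2 => z Qz; exact/O1A/QO1.
  have -> : ebar (escalar (f y)) = escalar (f y) :> eform R m.
    apply: eform_ext => -[|k'] v'; rewrite /ebar /escalar /= ?expr0 ?mul1r //.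
    by rewrite mulr0.
  by rewrite wedge_scalar.
rewrite (thE _ (QO1 _ Qy)) wedge_scalar !(wedgeDr, wedgeDl) !(wedgeZl, wedgeZr) !wedgeA.
by apply: eform_ext => k v; rewrite /eadd /escale; ring.
Qed.

End Core.
End CoordinateIdeals.

Section IdealTransfer.
Context {R : realType} {m : nat} (M : premanifold R m) (hM : is_manifold M).

(** Backwards, coefficients known only in coordinates are spread by [form_of_chart] over the image
    of their domain, where they are smooth in all charts. *)
Lemma gen_ideal3_chart (c : chart M) (f1 f2 f3 : dform M) p eta : cran c p ->
  gen_ideal3 f1 f2 f3 p eta <->
  cideal (frep c f1) (frep c f2) (frep c f3) (crd c p) (frep c eta).
Proof.
move=> cp; split=> [[U [a1 [a2 [a3 [oU Up [s1 s2 s3] etaE]]]]]|].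
  exists (cpre c U), (frep c a1), (frep c a2), (frep c a3); split=> //.
  - exact: cpre_crd.
  - by split; exact: smooth_form_sform.
  - by move=> y [dy Uy]; apply: eform_ext => k v; rewrite -!frep_dwedge /frep etaE.
move=> [W [b1 [b2 [b3 [oW Wx [s1 s2 s3] etaE]]]]].
have [dp pp] := parK cp.
pose O' := W `&` cdom M c.
have oO' : open O' by apply: openI => //; exact: cdom_open.
pose U := par M c @` O'.
have oU : mopen U by apply: mopen_par => // y [].
have Uc : U `<=` cran c by move=> _ [y [_ dy] <-]; exact: cran_par.
have UO y : cpre c U y -> O' y.
  by move=> [dy [z [Oz dz] zy]]; have := crdK hM dy; rewrite -zy crdK // => <-.
have H b : sform W b -> smooth_form U (form_of_chart c b).
  move=> sb; apply: (smooth_form_chart hM oU Uc).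
  apply: (sform_ext (oU c) (eta := b)); last by apply: sform_sub sb => y /UO[].
  by move=> y [dy _]; rewrite frep_form_of_chart.
exists U, (form_of_chart c b1), (form_of_chart c b2), (form_of_chart c b3); split=> //.
- by exists (crd c p) => //; split.
- by split; exact: H.
move=> q Uq k v; have cq := Uc _ Uq; have [dq pq] := parK cq.
have Oq : W (crd c q) by have [] := UO _ (cpre_crd cq Uq).
rewrite -[LHS]/(eta q k v) (form_frep hM _ cq) etaE //.
rewrite /addf (form_frep hM (dwedge _ f1) cq) (form_frep hM (dwedge _ f2) cq).
by rewrite (form_frep hM (dwedge _ f3) cq) !frep_dwedge !frep_form_of_chart.
Qed.

End IdealTransfer.

(** * Uniqueness of the system *)

Section Frames.
Context {R : realType}.

Lemma basis_enumP m r (V : {vspace 'rV[R]_m}) (X : 'I_r -> 'rV[R]_m) :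
  basis_of V [seq X i | i <- enum 'I_r] <->
  [/\ forall i, X i \in V, forall u, u \in V -> exists c : 'I_r -> R, u = \sum_i c i *: X i &
      forall c : 'I_r -> R, \sum_i c i *: X i = 0 -> forall i, c i = 0].
Proof.
pose t := [tuple X i | i < r].
have tE : [seq X i | i <- enum 'I_r] = t by [].
have nthE (i : 'I_r) : t`_i = X i by rewrite -tnth_nth tnth_mktuple.
have sE (c : 'I_r -> R) : \sum_i c i *: t`_i = \sum_i c i *: X i.
  by apply: eq_bigr => i _; rewrite nthE.
rewrite tE; split=> [/andP[/eqP sp fr]|[XV VX Xf]].
  split=> [i|u|c]; first by rewrite -sp -(nthE i); apply/memv_span/mem_nth; rewrite size_tuple.
    by rewrite -sp => /coord_span -> ; exists (fun i => coord t i u); rewrite sE.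
  by rewrite -sE; apply/freeP.
apply/andP; split; last by apply/freeP => c; rewrite sE; exact: Xf.
rewrite eqEsubv; apply/andP; split.
  by apply/span_subvP => u /tnthP[i ->]; rewrite tnth_mktuple.
apply/subvP => u /VX[c ->]; apply: memv_suml => i _; apply: memvZ.
by rewrite -(nthE i); apply/memv_span/mem_nth; rewrite size_tuple.
Qed.

Lemma row_free_rows m r (X : 'I_r -> 'rV[R]_m) :
  row_free (\matrix_i X i) <->
  forall c : 'I_r -> R, \sum_i c i *: X i = 0 -> forall i, c i = 0.
Proof.
have E (c : 'rV[R]_r) : c *m (\matrix_i X i) = \sum_i c 0 i *: X i.
  by rewrite mulmx_sum_row; apply: eq_bigr => i _; rewrite rowK.
split=> [fr c c0 i|H]; last first.
  apply: inj_row_free => v; rewrite E => /H v0.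
  by apply/rowP => i; rewrite v0 mxE.
have := row_free_inj fr (x1 := \row_i c i) (x2 := 0); rewrite mul0mx E.
have -> : \sum_i (\row_i0 c i0) 0 i *: X i = 0.
  by rewrite -[RHS]c0; apply: eq_bigr => j _; rewrite mxE.
by move=> /(_ erefl)/rowP/(_ i); rewrite !mxE.
Qed.

End Frames.

Section Adapted.
Context {R : realType} {m : nat}.
Implicit Types (A : set 'rV[R]_m) (x y u : 'rV[R]_m) (D E : 'rV[R]_m -> 'rV[R]_m -> Prop).

Definition adapted n A D E1 E2 (theta om : 'rV[R]_m -> eform R m) :=
  [/\ ctheta A D theta, cform n A D E1 om &
      forall y, A y -> forall v : 'M[R]_(n, m), (forall i, E2 y (row i v)) -> row_free v ->
        om y n v != 0].

Definition framed n A D E1 E2 (X : 'I_n -> 'rV[R]_m -> 'rV[R]_m) :=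
  [/\ open A, forall i, smooth_rv_on A (X i),
    forall y u, A y -> E1 y u \/ E2 y u -> D y u,
    forall y, A y -> (forall i, E2 y (X i y)) /\ row_free (\matrix_i X i y) &
    forall y u, A y -> D y u -> exists a (c : 'I_n -> R), E1 y a /\ u = a + \sum_i c i *: X i y].

Lemma ctheta_sub A B D theta : A `<=` B -> ctheta B D theta -> ctheta A D theta.
Proof. by move=> AB [st tP]; split; [exact: sform_sub st|move=> y /AB; exact: tP]. Qed.

Lemma cform_sub n A B D E1 om : A `<=` B -> cform n B D E1 om -> cform n A D E1 om.
Proof. by move=> AB [st tP]; split; [exact: sform_sub st|move=> y /AB; exact: tP]. Qed.

Lemma adapted_sub n A B D E1 E2 theta om :
  A `<=` B -> adapted n B D E1 E2 theta om -> adapted n A D E1 E2 theta om.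
Proof.
move=> AB [h1 h2 h3]; split; [exact: ctheta_sub h1|exact: cform_sub h2|].
by move=> y /AB; exact: h3.
Qed.

Lemma cideal_ext (f1 f2 f3 g1 g2 g3 eta zeta : 'rV[R]_m -> eform R m) A x : open A -> A x ->
  (forall y, A y -> [/\ f1 y = g1 y, f2 y = g2 y, f3 y = g3 y & eta y = zeta y]) ->
  cideal f1 f2 f3 x eta -> cideal g1 g2 g3 x zeta.
Proof.
move=> oA Ax fg [W [b1 [b2 [b3 [oW Wx [s1 s2 s3] etaE]]]]].
exists (A `&` W), b1, b2, b3; split=> //; first exact: openI.
  have sub : A `&` W `<=` W by move=> y [].
  by split; [exact: sform_sub s1|exact: sform_sub s2|exact: sform_sub s3].
by move=> y [Ay Wy]; have [<- <- <- <-] := fg y Ay; exact: etaE.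
Qed.

Lemma cideal_adapted n A D E1 E2 (X : 'I_n -> 'rV[R]_m -> 'rV[R]_m) theta om theta' om' x eta :
  framed A D E1 E2 X -> adapted n A D E1 E2 theta om -> adapted n A D E1 E2 theta' om' ->
  A x -> cideal theta (ext_d theta) om x eta -> cideal theta' (ext_d theta') om' x eta.
Proof.
move=> [oA sX ED XE Ds] [ht ho _] [ht' ho' vo'] Ax.
apply: (cideal_sub (n := n) (A := A) (D := D) (E1 := E1) (X := X)) => //.
- by move=> y u Ay Eu; apply: ED => //; left.
- by move=> y i Ay; apply: ED => //; right; exact: (XE y Ay).1.
- move=> y Ay; have [X2 fX] := XE y Ay; apply: vo' => // i; rewrite rowK; exact: X2.
Qed.

End Adapted.

Section PartOne.
Context {R : realType} (n : nat).
Notation dM := (n.*2.+1).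

(** The fibre of [E] transported to the coordinates of [c], as a predicate, so that later arguments
    take place on an open subset of R^(2n+1). *)
Definition hat (M : premanifold R dM) (c : chart M) (E : plane_field M) (y u : 'rV[R]_dM) : Prop :=
  u *m of_chart c (par M c y) \in E (par M c y).

Section OneSystem.
Variables (M : premanifold R dM) (D E1 E2 : plane_field M).
Hypotheses (hM : is_manifold M) (hD : contact_structure D) (hL : lagrangian_pair D E1 E2).

Lemma frame_chart (c : chart M) (E : plane_field M) r p : subbundle r E -> cran c p ->
  exists (U : set M) (X : 'I_r -> vfield M), [/\ mopen U, U p,
    forall i, smooth_rv_on (cpre c U) (vrep c (X i)) &
    forall y, cpre c U y -> [/\ forall i, hat c E y (vrep c (X i) y),
      row_free (\matrix_i vrep c (X i) y) &
      forall u, hat c E y u -> exists a : 'I_r -> R, u = \sum_i a i *: vrep c (X i) y]].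
Proof.
move=> /(_ p) [U [X [oU Up sX bX]]] cp; exists U, X; split=> // [i|y [dy Uy]].
  exact: sX.
have cy := cran_par dy; have [XE EX Xf] := (basis_enumP _ _).1 (bX _ Uy).
have vE i : vrep c (X i) y *m of_chart c (par M c y) = X i (par M c y).
  by rewrite /vrep -mulmxA (to_of_chart hM cy) mulmx1.
split=> [i||u].
- by rewrite /hat vE.
- apply/row_free_rows => a /(congr1 (mulmx^~ (of_chart c (par M c y)))).
  rewrite mulmx_suml mul0mx => H; apply: Xf; rewrite -[RHS]H.
  by apply: eq_bigr => i _; rewrite -scalemxAl vE.
- rewrite /hat => /EX[a ua]; exists a.
  have : u = u *m of_chart c (par M c y) *m to_chart c (par M c y).
    by rewrite -mulmxA (of_to_chart1 hM cy) mulmx1.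
  by rewrite ua mulmx_suml => ->; apply: eq_bigr => i _; rewrite -scalemxAl.
Qed.

Lemma framed_chart (c : chart M) p : cran c p ->
  exists A (X : 'I_n -> 'rV[R]_dM -> 'rV[R]_dM), A (crd c p) /\ A `<=` cdom M c /\ framed A (hat c D) (hat c E1) (hat c E2) X.
Proof.
move=> cp; have [b1 b2 _ _ hDE] := hL.
have [U [X [oU Up sX fX]]] := frame_chart b2 cp.
exists (cpre c U), (fun i => vrep c (X i)); split; first exact: cpre_crd.
split; first by move=> y [].
split=> // [y u _|y Uy|y u Uy].
- by rewrite /hat -(hDE _).1 => -[]; apply/subvP; [exact: addvSl|exact: addvSr].
- by have [h1 h2 _] := fX y Uy.
rewrite /hat -(hDE _).1 => /memv_addP[a aE [b bE uab]].
have cy := cran_par Uy.1; have [_ _ h3] := fX y Uy.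
have toof w : w *m to_chart c (par M c y) *m of_chart c (par M c y) = w.
  by rewrite -mulmxA (to_of_chart hM cy) mulmx1.
have [k bk] : exists k : 'I_n -> R, b *m to_chart c (par M c y) = \sum_i k i *: vrep c (X i) y.
  by apply: h3; rewrite /hat toof.
exists (a *m to_chart c (par M c y)), k; split; first by rewrite /hat toof.
by rewrite -bk -mulmxDl -uab -mulmxA (of_to_chart1 hM cy) mulmx1.
Qed.

(** [D] has rank 2n in dimension 2n + 1. This ensures that a contact form does not vanish at any
    point, as division by it requires. *)
Lemma not_contact_all q : exists u : 'rV[R]_dM, u \notin D q.
Proof.
apply: contrapT => /forallNP H; have [/(_ q) [U [X [_ Uq _ /(_ q Uq) bX]]] _] := hD.
have : \dim (D q) = n.*2 := size_basis (X := [tuple X i q | i < n.*2]) bX.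
have -> : D q = fullv.
  by apply/eqP; rewrite eqEsubv subvf; apply/subvP => u _; apply/negPn/negP/H.
by rewrite dimvf /dim /= mul1n; lia.
Qed.

Lemma contact_form_chart (c : chart M) U theta : contact_form U D theta ->
  ctheta (cpre c U) (hat c D) (frep c theta).
Proof.
move=> [oU st ht tD]; split; first exact: smooth_form_sform.
move=> y [dy Uy]; split=> [k v k1|u|]; first exact: ht.
  exact: (tD _ Uy).1.
have [u uD] := not_contact_all (par M c y); exists (u *m to_chart c (par M c y)).
rewrite /frep -mulmxA (to_of_chart hM (cran_par dy)) mulmx1.
by apply/eqP => /(tD _ Uy).1; apply/negP.
Qed.

Lemma adapted_chart (c : chart M) U theta om :
  contact_form U D theta -> smooth_form U om -> homog n U om ->
  (forall q, U q -> (forall (u : 'rV[R]_dM) k (v : 'M[R]_(k, dM)), u \in E1 q ->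
          om q (1 + k)%N (col_mx u v) = 0) /\
       (forall v : 'M[R]_(n, dM), (forall i, row i v \in E2 q) -> row_free v ->
          om q n v != 0)) ->
  adapted n (cpre c U) (hat c D) (hat c E1) (hat c E2) (frep c theta) (frep c om).
Proof.
move=> ct so ho oP; split; first exact: contact_form_chart.
  split; first exact: smooth_form_sform.
  move=> y [dy Uy]; split=> [k v kn|k v _ [i Ei]]; first exact: ho.
  apply: (@alt_front _ _ (om (par M c y)) k _ _ i (so.1 _ Uy k) _ erefl) => k' B.
  by apply: (oP _ Uy).1; rewrite row_mul.
move=> y [dy Uy] v vE fv; apply: (oP _ Uy).2; first by move=> i; rewrite row_mul; exact: vE.
rewrite /row_free mxrankMfree //; apply/row_freeP; exists (to_chart c (par M c y)).
by rewrite (of_to_chart1 hM (cran_par dy)).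
Qed.

Lemma decomposable_chart I p (c : chart M) : decomposable D E1 E2 I -> cran c p ->
  exists (U : set M) (theta om : dform M), [/\ mopen U, U p,
    adapted n (cpre c U) (hat c D) (hat c E1) (hat c E2) (frep c theta) (frep c om) &
    forall eta, I p eta <-> cideal (frep c theta) (ext_d (frep c theta)) (frep c om)
      (crd c p) (frep c eta)].
Proof.
move=> /(_ p) [U [theta [om [Up [ct so ho IE] oP]]]] cp.
have [oU st _ _] := ct; exists U, theta, om; split=> //; first exact: adapted_chart.
move=> eta; rewrite (IE _ Up) (gen_ideal3_chart hM _ _ _ _ cp).
have E y : cpre c U y -> frep c (extd theta) y = ext_d (frep c theta) y.
  by move=> Uy; exact: (frep_extd hM oU).
have Ux := cpre_crd cp Up.
by split; apply: (cideal_ext (oU c) Ux) => y Uy; rewrite E.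
Qed.

End OneSystem.

Lemma system_unique (M : premanifold R dM) (D E1 E2 : plane_field M) (I I' : eds M) :
  is_manifold M -> contact_structure D -> lagrangian_pair D E1 E2 ->
  decomposable D E1 E2 I -> decomposable D E1 E2 I' ->
  forall (p : M) (eta : dform M), I p eta -> I' p eta.
Proof.
move=> hM hD hL hI hI' p eta; set c := chart_at M p.
have cp : cran c p := cran_at hM p.
have [A [X [Ax [Ad [oA sX ED XE Ds]]]]] := framed_chart hM hL cp.
have [U [th [om [oU Up ad ->]]]] := decomposable_chart hM hD hI cp.
have [V [th' [om' [oV Vp ad' ->]]]] := decomposable_chart hM hD hI' cp.
pose B := A `&` (cpre c U `&` cpre c V).
have oB : open B by apply: openI => //; apply: openI; [exact: oU|exact: oV].
apply: (cideal_adapted (n := n) (A := B) (D := hat c D) (E1 := hat c E1) (E2 := hat c E2) (X := X)).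
- split=> // [i|y u [Ay _]|y [Ay _]|y u [Ay _]]; [|exact: ED|exact: XE|exact: Ds].
  by move=> j; apply: smooth_on_sub (sX i j) => y [].
- by apply: adapted_sub ad => y [_ []].
- by apply: adapted_sub ad' => y [_ []].
- by split=> //; split; exact: cpre_crd.
Qed.

End PartOne.

(** * Prolongation of the infinitesimal automorphism equations *)

Section Ideals.
Variable K : comNzRingType.
Implicit Types (G : K -> Prop) (x y a : K).

(** Membership records that an expression is a combination of the generators with coefficients not
    spelled out. As these range over the whole ring of functions, calculations with known structure
    functions become congruences. *)
Inductive ideal G : K -> Prop :=
| ideal0 : ideal G 0
| idealS a g x : G g -> ideal G x -> ideal G (a * g + x).

Lemma ideal_gen G x : G x -> ideal G x.
Proof. by move=> Gx; have := idealS 1 Gx (ideal0 G); rewrite mul1r addr0. Qed.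

Lemma idealD G x y : ideal G x -> ideal G y -> ideal G (x + y).
Proof.
by elim=> [|a g {}x Gg _ IH] Gy; rewrite ?add0r // -addrA; apply: idealS => //; exact: IH.
Qed.

Lemma idealM G a x : ideal G x -> ideal G (a * x).
Proof.
by elim=> [|b g {}x Gg _ IH]; rewrite ?mulr0; [exact: ideal0|rewrite mulrDr mulrA; exact: idealS].
Qed.

Lemma idealMr G a x : ideal G x -> ideal G (x * a).
Proof. by rewrite mulrC; exact: idealM. Qed.

Lemma idealN G x : ideal G x -> ideal G (- x).
Proof. by rewrite -mulN1r; exact: idealM. Qed.

Lemma idealB G x y : ideal G x -> ideal G y -> ideal G (x - y).
Proof. by move=> Gx /idealN; exact: idealD. Qed.

Lemma ideal_eq G x y : ideal G x -> x = y -> ideal G y. Proof. by move=> + <-. Qed.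

Lemma ideal_sum G (J : Type) (r : seq J) (P : pred J) (F : J -> K) :
  (forall j, P j -> ideal G (F j)) -> ideal G (\sum_(j <- r | P j) F j).
Proof. by move=> H; apply: big_ind => //; [exact: ideal0|exact: idealD]. Qed.

Lemma ideal_bind G G' x : (forall y, G y -> ideal G' y) -> ideal G x -> ideal G' x.
Proof.
move=> H; elim=> [|a g {}x Gg _ IH]; first exact: ideal0.
by apply: idealD => //; apply/idealM/H.
Qed.

Lemma ideal_finite (J : finType) (u : J -> K) x :
  ideal (fun y => exists j, y = u j) x -> exists c : J -> K, x = \sum_j c j * u j.
Proof.
elim=> [|a g {}x [i ->] _ [c ->]].
  by exists (fun=> 0); rewrite big1 // => j _; rewrite mul0r.
exists (fun j => (j == i)%:R * a + c j).
transitivity (\sum_j (j == i)%:R * a * u j + \sum_j c j * u j).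
  congr (_ + _); rewrite (bigD1 i) //= big1 ?eqxx ?mul1r ?addr0 // => j /negbTE->.
  by rewrite !mul0r.
by rewrite -big_split /=; apply: eq_bigr => j _; rewrite mulrDl.
Qed.

(** The prolongation step: to control all derivatives of an ideal it suffices to differentiate its
    generators, since derivatives of coefficients multiply generators again. *)
Lemma ideal_derivation (D : K -> K) G G' x :
  {morph D : x y / x + y} -> (forall x y, D (x * y) = D x * y + x * D y) ->
  (forall y, G y -> ideal G' y) -> (forall y, G y -> ideal G' (D y)) ->
  ideal G x -> ideal G' (D x).
Proof.
move=> DD DM GG' DG; have D0 : D 0 = 0 by apply: (addIr (D 0)); rewrite -DD !add0r.
elim=> [|a g {}x Gg _ IH]; first by rewrite D0; exact: ideal0.
rewrite DD DM; apply: idealD => //; apply: idealD; apply: idealM; [exact: GG'|exact: DG].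
Qed.

End Ideals.

Section Derivations.
Variables (K : comNzRingType) (D : K -> K).
Hypotheses (DD : {morph D : x y / x + y}) (DM : forall x y, D (x * y) = D x * y + x * D y).

Lemma dvn0 : D 0 = 0. Proof. by apply: (addIr (D 0)); rewrite -DD !add0r. Qed.

Lemma dvnN x : D (- x) = - D x.
Proof. by apply/eqP; rewrite -subr_eq0 opprK -DD addNr dvn0. Qed.

Lemma dvnB x y : D (x - y) = D x - D y. Proof. by rewrite DD dvnN. Qed.

Lemma dvn1 : D 1 = 0.
Proof. by have := DM 1 1; rewrite !mulr1 mul1r => H; apply: (addIr (D 1)); rewrite add0r -H. Qed.

Lemma dvn_nat k : D k%:R = 0.
Proof. by elim: k => [|k IH]; rewrite ?dvn0 // -natr1 DD IH dvn1 addr0. Qed.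

Lemma dvn_natl k x : D (k%:R * x) = k%:R * D x.
Proof. by rewrite DM dvn_nat mul0r add0r. Qed.

(** A derivation of the ring kills the inverse of an integer; this is wanted for one half, which is
    here an element of the ring and not a scalar. *)
Lemma dvn_inv k y : k%:R * y = 1 -> D y = 0.
Proof.
move=> ky; have := congr1 D ky; rewrite dvn_natl dvn1 => /(congr1 ( *%R y)).
by rewrite mulr0 mulrA [y * _]mulrC ky mul1r.
Qed.

Lemma dvn_sum (J : Type) (r : seq J) (P : pred J) (F : J -> K) :
  D (\sum_(j <- r | P j) F j) = \sum_(j <- r | P j) D (F j).
Proof. exact: (big_morph D DD dvn0). Qed.

End Derivations.

Section Prolongation.
Variables (K : comNzRingType) (n : nat).
(** The frame consists of e_1, .., e_n in the first Lagrangian bundle, f_1, .., f_n in the second,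
    and a transverse T; [fd] embeds the 2n directions of the contact distribution. *)
Definition fidx : finType := (('I_n + 'I_n) + unit)%type.
Definition fd (a : ('I_n + 'I_n)%type) : fidx := inl a.
Definition fT : fidx := inr tt.
Notation e i := (fd (inl i)).
Notation f i := (fd (inr i)).
Notation T := fT.

Lemma big_fidx (V : nmodType) (F : fidx -> V) : \sum_d F d = \sum_a F (fd a) + F T.
Proof. by rewrite big_sumType /= [X in _ + X](big_pred1 tt) // => -[]. Qed.

(** [D] derives along the frame and [c] holds its structure functions; [Dindep] says that no nonzero
    combination of the frame kills all functions, so identities between fields can be tested on
    functions. *)
Variables (D : fidx -> K -> K) (c : fidx -> fidx -> fidx -> K) (half third : K).
Hypotheses (DD : forall a, {morph D a : x y / x + y})
  (DM : forall a x y, D a (x * y) = D a x * y + x * D a y)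
  (Dcomm : forall a b x, D a (D b x) - D b (D a x) = \sum_d c a b d * D d x)
  (Dindep : forall g : fidx -> K, (forall x, \sum_d g d * D d x = 0) -> forall d, g d = 0)
  (cee : forall i j, c (e i) (e j) T = 0) (cff : forall i j, c (f i) (f j) T = 0)
  (cef : forall i j, c (e i) (f j) T = (i == j)%:R)
  (halfE : 2%:R * half = 1) (thirdE : 3%:R * third = 1) (n_gt0 : (0 < n)%N).

Let D0 a := dvn0 (DD a).
Let DN a := dvnN (DD a).
Let DB a := dvnB (DD a).
Let Dnat a := dvn_nat (DD a) (DM a).
Let Dnatl a := dvn_natl (DD a) (DM a).
Let Dsum a := dvn_sum (DD a).

Lemma c_anti a b d : c b a d = - c a b d.
Proof.
apply/eqP; rewrite -subr_eq0 opprK; apply/eqP.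
apply: (Dindep (g := fun d => c b a d + c a b d)) => x.
under eq_bigr do rewrite mulrDl.
by rewrite big_split /= -!Dcomm; ring.
Qed.

Variable X : fidx -> K.

Definition LX x := \sum_d X d * D d x.

(* [[X, W_b] = \sum_d brX b d * W_d] for the frame [W] underlying [D] *)
Definition brX b d := locked (\sum_a X a * c a b d - D b (X d)).

Lemma brXE b d : brX b d = \sum_a X a * c a b d - D b (X d).
Proof. by rewrite /brX -lock. Qed.

Lemma LX_D b x : LX (D b x) - D b (LX x) = \sum_d brX b d * D d x.
Proof.
have -> : \sum_d brX b d * D d x =
    \sum_d (\sum_a X a * c a b d) * D d x - \sum_d D b (X d) * D d x.
  by rewrite -sumrB; apply: eq_bigr => d _; rewrite brXE mulrBl.
have -> : \sum_d (\sum_a X a * c a b d) * D d x = \sum_a X a * (D a (D b x) - D b (D a x)).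
  under eq_bigr do rewrite mulr_suml.
  rewrite exchange_big /=; apply: eq_bigr => a _.
  by rewrite Dcomm mulr_sumr; apply: eq_bigr => d _; rewrite mulrA.
rewrite /LX Dsum -!sumrB; apply: eq_bigr => d _; rewrite DM; ring.
Qed.

(** The Jacobi identity for the field and two frame vectors, in components. Fields exist here only
    through their action on functions: the Lie derivative of a commutator of frame derivations is
    computed in two ways, and [Dindep] compares coefficients. *)
Lemma brX_jacobi a b d : D a (brX b d) - D b (brX a d) =
  LX (c a b d) + \sum_g c a b g * brX g d - \sum_g brX a g * c g b d - \sum_g brX b g * c a g d.
Proof.
have LXD x y : LX (x - y) = LX x - LX y.
  by rewrite /LX -sumrB; apply: eq_bigr => g _; rewrite DB; ring.
have LXM x y : LX (x * y) = LX x * y + x * LX y.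
  rewrite /LX mulr_suml mulr_sumr -big_split; apply: eq_bigr => g _.
  by rewrite /= DM; ring.
have LXs (F : fidx -> K) : LX (\sum_g F g) = \sum_g LX (F g).
  rewrite /LX exchange_big; apply: eq_bigr => g _.
  by rewrite Dsum mulr_sumr.
pose phi b x := \sum_d brX b d * D d x.
have LXDb b' x : LX (D b' x) = phi b' x + D b' (LX x) by rewrite /phi -LX_D subrK.
apply/eqP; rewrite -subr_eq0; apply/eqP.
apply: (Dindep (g := fun d => D a (brX b d) - D b (brX a d) - (LX (c a b d) +
  \sum_g c a b g * brX g d - \sum_g brX a g * c g b d - \sum_g brX b g * c a g d))) => x.
have H1 : LX (D a (D b x) - D b (D a x)) - (D a (D b (LX x)) - D b (D a (LX x))) =
    phi a (D b x) + D a (phi b x) - phi b (D a x) - D b (phi a x).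
  rewrite LXD !LXDb !DD; ring.
have H2 : LX (D a (D b x) - D b (D a x)) - (D a (D b (LX x)) - D b (D a (LX x))) =
    \sum_d LX (c a b d) * D d x + \sum_d (\sum_g c a b g * brX g d) * D d x.
  rewrite !Dcomm LXs -sumrB.
  have -> : \sum_d (\sum_g c a b g * brX g d) * D d x = \sum_g c a b g * phi g x.
    under eq_bigr do rewrite mulr_suml.
    rewrite exchange_big; apply: eq_bigr => g _; rewrite /phi mulr_sumr.
    by apply: eq_bigr => d' _; rewrite mulrA.
  rewrite -big_split; apply: eq_bigr => g _ /=.
  rewrite LXM LXDb; ring.
have H3 a' b' : D a' (phi b' x) - phi b' (D a' x) =
    \sum_d D a' (brX b' d) * D d x + \sum_d (\sum_g brX b' g * c a' g d) * D d x.
  have -> : \sum_d (\sum_g brX b' g * c a' g d) * D d x =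
      \sum_g brX b' g * (D a' (D g x) - D g (D a' x)).
    under eq_bigr do rewrite mulr_suml.
    rewrite exchange_big; apply: eq_bigr => g _; rewrite Dcomm mulr_sumr.
    by apply: eq_bigr => d' _; rewrite mulrA.
  rewrite /phi Dsum -sumrB -big_split; apply: eq_bigr => g _ /=.
  rewrite DM; ring.
have H4 := H3 a b; have H5 := H3 b a.
have H6 : \sum_d (\sum_g brX a g * c b g d) * D d x = - \sum_d (\sum_g brX a g * c g b d) * D d x.
  rewrite -sumrN; apply: eq_bigr => d' _; rewrite -mulNr -sumrN; congr (_ * _).
  by apply: eq_bigr => g _; rewrite (c_anti g b) mulrN.
have S (p q r s t u y : fidx -> K) :
    \sum_d (p d - q d - (r d + s d - t d - u d)) * y d =
    \sum_d p d * y d - \sum_d q d * y d - (\sum_d r d * y d + \sum_d s d * y d -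
      \sum_d t d * y d - \sum_d u d * y d).
  by rewrite -big_split -!sumrB; apply: eq_bigr => d' _ /=; ring.
rewrite S.
move: H1 H2 H4 H5; rewrite H6 => -> H1 H4 H5.
rewrite -H1.
have -> : phi a (D b x) + D a (phi b x) - phi b (D a x) - D b (phi a x) =
  (D a (phi b x) - phi b (D a x)) - (D b (phi a x) - phi a (D b x)) by ring.
rewrite H4 H5; ring.
Qed.

Hypotheses (Xee : forall i j, brX (e i) (f j) = 0) (XeT : forall i, brX (e i) T = 0)
  (Xff : forall i j, brX (f i) (e j) = 0) (XfT : forall i, brX (f i) T = 0).

Notation A i j := (brX (e i) (e j)).
Notation B i j := (brX (f i) (f j)).
Notation tau := (brX T T).
Notation s k := (brX T (e k)).
Notation t k := (brX T (f k)).
Notation rho := (D T (brX T T)).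

(** Jets of the field, weighted: [gen0] has its components and its action on the frame, [gen1] adds
    the contact components of its bracket with T, [gen2] adds the T-derivative of [tau]. Derivatives
    in contact directions lead from each ideal into the next. *)
Inductive gen0 : K -> Prop :=
| gen0X d : gen0 (X d)
| gen0A i j : gen0 (A i j)
| gen0tau : gen0 tau.

Inductive gen1 : K -> Prop :=
| gen1_0 x : gen0 x -> gen1 x
| gen1_s k : gen1 (s k)
| gen1_t k : gen1 (t k).

Inductive gen2 : K -> Prop :=
| gen2_1 x : gen1 x -> gen2 x
| gen2_rho : gen2 rho.

Let J0 := ideal gen0.
Let J1 := ideal gen1.
Let J2 := ideal gen2.

Let J01 x : J0 x -> J1 x.
Proof. by apply: ideal_bind => y /gen1_0; exact: ideal_gen. Qed.
Let J12 x : J1 x -> J2 x.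
Proof. by apply: ideal_bind => y /gen2_1; exact: ideal_gen. Qed.

(** The T-component of the Jacobi identity for e_i and f_j: the field rescales the pairing of the
    two bundles by [tau], so its action B on the second bundle is determined by [tau] and its action
    A on the first. *)
Let F0 i j : (i == j)%:R * tau = A i j + B j i.
Proof.
have := brX_jacobi (e i) (f j) T; rewrite XeT XfT !D0 subr0.
have -> : LX (c (e i) (f j) T) = 0.
  by rewrite cef /LX big1 // => d _; rewrite Dnat mulr0.
rewrite !big_fidx !big_sumType /=.
have z0 (F : 'I_n -> K) : (forall k, F k = 0) -> \sum_k F k = 0 by move=> F0; rewrite big1.
rewrite cef !(z0 (fun k => c _ _ _ * _)); [|by move=> k; rewrite ?XeT ?XfT mulr0..].
rewrite (z0 (fun k => brX _ (f k) * _)); last by move=> k; rewrite Xee mul0r.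
rewrite (z0 (fun k => brX _ (e k) * c (e i) (e k) T)); last by move=> k; rewrite Xff mul0r.
rewrite XeT XfT !mul0r !addr0 !add0r (bigD1 j) //= big1 => [|k /negbTE kj]; last first.
  by rewrite cef kj mulr0.
rewrite (bigD1 i) //= big1 => [|k /negbTE ki]; last by rewrite cef eq_sym ki mulr0.
by rewrite !cef !eqxx !mulr1 !addr0 => /eqP; rewrite eq_sym subr_eq0 subr_eq => /eqP ->; rewrite addrC.
Qed.

Let JX d : J0 (X d). Proof. exact/ideal_gen/gen0X. Qed.
Let JA i j : J0 (A i j). Proof. exact/ideal_gen/gen0A. Qed.
Let Jtau : J0 tau. Proof. exact/ideal_gen/gen0tau. Qed.
Let JB i j : J0 (B i j).
Proof.
by apply: ideal_eq (idealB (idealM (j == i)%:R Jtau) (JA j i)) _; rewrite F0; ring.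
Qed.
Let Js k : J1 (s k). Proof. exact/ideal_gen/gen1_s. Qed.
Let Jt k : J1 (t k). Proof. exact/ideal_gen/gen1_t. Qed.
Let Jrho : J2 rho. Proof. exact/ideal_gen/gen2_rho. Qed.

Let JM a d : J0 (brX (fd a) d).
Proof.
have Z : J0 0 by exact: ideal0.
case: a => i; case: d => [[j|j]|[]]; rewrite ?Xee ?Xff ?XeT ?XfT //.
Qed.

Let JM1 a d : J1 (brX a d).
Proof.
by case: a => [a|[]]; [exact/J01/JM|case: d => [[k|k]|[]] //; exact/J01/Jtau].
Qed.

Let JLX x : J0 (LX x).
Proof. by apply: ideal_sum => d _; exact/idealMr/JX. Qed.

(** Modulo [J0], the only term of the Jacobi identity surviving besides the derivatives comes from
    the T-component of the bracket of the two frame vectors. *)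
Let F1 a b d : J0 (D (fd a) (brX (fd b) d) - D (fd b) (brX (fd a) d) - c (fd a) (fd b) T * brX T d).
Proof.
rewrite brX_jacobi (big_fidx (fun g => c (fd a) (fd b) g * brX g d)).
set S1 := \sum_(g : _ + _) _; set S2 := \sum_g _; set S3 := \sum_g _.
have -> : LX (c (fd a) (fd b) d) + (S1 + c (fd a) (fd b) T * brX T d) - S2 - S3 -
  c (fd a) (fd b) T * brX T d = LX (c (fd a) (fd b) d) + S1 - S2 - S3 by ring.
apply: idealB; [apply: idealB; [apply: idealD; [exact: JLX|]|]|];
  apply: ideal_sum => g _; first [exact/idealM/JM|exact/idealMr/JM].
Qed.

(** The T-component of the Jacobi identity for a contact direction and T; it turns the derivatives
    of [tau] into the unknowns [s] and [t]. *)
Let F2 a : J0 (D (fd a) tau + \sum_g brX T (fd g) * c (fd a) (fd g) T).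
Proof.
have H := brX_jacobi (fd a) T T.
have E : brX (fd a) T = 0 by case: a {H} => i; [exact: XeT|exact: XfT].
rewrite E D0 subr0 in H; rewrite H.
rewrite (big_fidx (fun g => brX T g * c (fd a) g T)).
rewrite (big_fidx (fun g => c (fd a) T g * brX g T)).
set S1 := \sum_(g : _ + _) _; set S2 := \sum_g _; set S3 := \sum_(g : _ + _) _.
have -> : LX (c (fd a) T T) + (S1 + c (fd a) T T * tau) - S2 -
  (S3 + tau * c (fd a) T T) + S3 =
  LX (c (fd a) T T) + S1 - S2 by ring.
apply: idealB; [apply: idealD; [exact: JLX|]|];
  apply: ideal_sum => g _; rewrite ?mulr0; first [exact: ideal0|exact/idealM/JM|exact/idealMr/JM].
Qed.

Let sum_delta (F : 'I_n -> K) i : \sum_g F g * (i == g)%:R = F i.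
Proof.
rewrite (bigD1 i) //= eqxx mulr1 big1 ?addr0 // => g /negbTE gi.
by rewrite eq_sym gi mulr0.
Qed.

Let c_fe i j : c (f i) (e j) T = - (j == i)%:R.
Proof. by rewrite c_anti cef. Qed.

Let etau i : J0 (D (e i) tau + t i).
Proof.
apply: ideal_eq (F2 (inl i)) _; rewrite big_sumType /= big1 ?add0r => [|k _]; last by rewrite cee mulr0.
by under eq_bigr do rewrite cef; rewrite sum_delta.
Qed.

Let ftau i : J0 (D (f i) tau - s i).
Proof.
apply: ideal_eq (F2 (inr i)) _; rewrite big_sumType /= [X in _ + (_ + X)]big1 ?addr0 => [|k _]; last by rewrite cff mulr0.
under eq_bigr do rewrite c_fe eq_sym mulrN.
by rewrite sumrN sum_delta.
Qed.

Let fA i j k : J0 (D (f j) (A i k) + (i == j)%:R * s k).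
Proof.
have := F1 (inl i) (inr j) (e k); rewrite cef Xff D0 => /idealN H.
by apply: ideal_eq H _; ring.
Qed.

(** The identity for e_l and f_k controls the derivative of B along e_l, because the bracket of the
    field with e_l has no f-components; [F0] then converts B into A. *)
Let eA l i k : J0 (D (e l) (A i k) + (i == k)%:R * t l + (l == k)%:R * t i).
Proof.
have H1 := F1 (inl l) (inr k) (f i); rewrite cef Xee D0 in H1.
have H2 := idealM (i == k)%:R (etau l).
apply: ideal_eq (idealB H2 H1) _.
have -> : A i k = (i == k)%:R * tau - B k i by rewrite F0; ring.
by rewrite DB Dnatl; ring.
Qed.

Let DX a d : J1 (D a (X d)).
Proof.
have -> : D a (X d) = (\sum_g X g * c g a d) - brX a d by rewrite brXE; ring.
by apply: idealB; [apply: ideal_sum => g _; exact/idealMr/J01/JX|exact: JM1].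
Qed.

Let DA a i k : J1 (D (fd a) (A i k)).
Proof.
case: a => l.
  apply: ideal_eq (idealB (J01 (eA l i k)) (idealD (idealM (i == k)%:R (Jt l)) (idealM (l == k)%:R (Jt i)))) _.
  by ring.
by apply: ideal_eq (idealB (J01 (fA i l k)) (idealM (i == l)%:R (Js k))) _; ring.
Qed.

Let Dtau a : J1 (D (fd a) tau).
Proof.
case: a => l.
  by apply: ideal_eq (idealB (J01 (etau l)) (Jt l)) _; ring.
by apply: ideal_eq (idealD (J01 (ftau l)) (Js l)) _; ring.
Qed.

Let DJ0 a x : J0 x -> J1 (D (fd a) x).
Proof.
apply: ideal_derivation => // y; first by move/gen1_0; exact: ideal_gen.
by case=> [d|i k|]; [exact: DX|exact: DA|exact: Dtau].
Qed.

(** The Jacobi identity with T: modulo [J1], differentiating the bracket with T in a contact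
    direction amounts to a T-derivative of the lower unknowns. *)
Let F3 a d : J1 (D (fd a) (brX T d) - D T (brX (fd a) d)).
Proof.
rewrite brX_jacobi; apply: idealB; [apply: idealB; [apply: idealD; [exact/J01/JLX|]|]|];
  apply: ideal_sum => g _; first [exact/idealM/JM1|exact/idealMr/JM1].
Qed.

Let es i k : J1 (D (e i) (s k) - D T (A i k)). Proof. exact: (F3 (inl i)). Qed.
Let fs j k : J1 (D (f j) (s k)).
Proof. by have := F3 (inr j) (e k); rewrite Xff D0 subr0. Qed.
Let et j k : J1 (D (e j) (t k)).
Proof. by have := F3 (inl j) (f k); rewrite Xee D0 subr0. Qed.
Let ft j k : J1 (D (f j) (t k) - D T (B j k)). Proof. exact: (F3 (inr j)). Qed.

(** T is the commutator of e_i and f_i up to contact directions, since the T-component of their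
    bracket is 1; a T-derivative is traded for second derivatives in contact directions. The
    remainder [y] is named so that its membership in an ideal can be shown separately. *)
Let commT i x : exists2 y, y = \sum_g c (e i) (f i) (fd g) * D (fd g) x &
  D T x = D (e i) (D (f i) x) - D (f i) (D (e i) x) - y.
Proof.
exists (\sum_g c (e i) (f i) (fd g) * D (fd g) x) => //.
rewrite Dcomm (big_fidx (fun g => c (e i) (f i) g * D g x)).
by rewrite cef eqxx [true%:R]/(1 : K) mul1r [X in X - _]addrC addrK.
Qed.

Let half2 x : (half + half) * x = x.
Proof. by have := halfE => H; transitivity (2%:R * half * x); [ring|rewrite H mul1r]. Qed.

(** The T-derivative of A occurs again on the right of its own commutator formula: through [es] for
    s, and for t through [ft] and B = delta tau - A. Modulo [J1] the diagonal case reads 4 T(A_ii) =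
    2 rho, the other 2 T(A_ik) = 0. *)
Let TA i k : J1 (D T (A i k) - (i == k)%:R * half * rho).
Proof.
have [y yE E] := commT i (A i k).
have Jy : J1 y by rewrite yE; apply: ideal_sum => g _; apply/idealM/DA.
have H1 := DJ0 (inl i) (fA i i k); rewrite DD Dnatl eqxx mul1r in H1.
have H2 := DJ0 (inr i) (eA i i k); rewrite !DD !Dnatl in H2.
have BE : D T (B i i) = rho - D T (A i i).
  by rewrite -DB; congr (D T _); have := F0 i i; rewrite eqxx mul1r => ->; ring.
have H3 := ft i i; rewrite BE in H3.
(* modulo J1: T A_ik = - e_i s_k + 2 delta_ik f_i t_i = - T A_ik + 2 delta_ik (rho - T A_ii) *)
have H4 : J1 (2%:R * D T (A i k) - 2%:R * (i == k)%:R * (rho - D T (A i i))).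
  apply: ideal_eq (idealB (idealB (idealB H1 H2) (idealB (es i k)
    (idealM (2%:R * (i == k)%:R) H3))) Jy) _.
  by rewrite E; ring.
have tr : true%:R = 1 :> K by [].
case: eqP H4 => [<-|_] H4; rewrite ?tr ?mul1r ?mulr1 in H4 *.
  apply: ideal_eq (idealM (half * half) H4) _.
  transitivity ((half + half) * ((half + half) * D T (A i i)) - (half + half) * (half * rho)).
    by ring.
  by rewrite !half2.
apply: ideal_eq (idealM half H4) _; rewrite mulr0 !mul0r !subr0.
by rewrite -[RHS]half2; ring.
Qed.

Let TB i k : J1 (D T (B i k) - (i == k)%:R * half * rho).
Proof.
have -> : B i k = (k == i)%:R * tau - A k i by rewrite F0; ring.
rewrite DB Dnatl eq_sym; apply: ideal_eq (idealN (TA k i)) _.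
transitivity ((k == i)%:R * ((half + half) * rho) - D T (A k i) - (k == i)%:R * half * rho).
  by ring.
by rewrite half2 [k == i]eq_sym.
Qed.

Let Dhalf a : D a half = 0.
Proof. exact: (dvn_inv (DD a) (DM a) halfE). Qed.

Let Ds a k : J2 (D (fd a) (s k)).
Proof.
case: a => j; last exact/J12/fs.
apply: ideal_eq (idealD (J12 (idealD (es j k) (TA j k))) (idealM ((j == k)%:R * half) Jrho)) _.
ring.
Qed.

Let Dt a k : J2 (D (fd a) (t k)).
Proof.
case: a => j; first exact/J12/et.
apply: ideal_eq (idealD (J12 (idealD (ft j k) (TB j k))) (idealM ((j == k)%:R * half) Jrho)) _.
ring.
Qed.

Let DJ1 a x : J1 x -> J2 (D (fd a) x).
Proof.
apply: ideal_derivation => // y; first by move/gen2_1; exact: ideal_gen.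
by case=> [z Gz|k|k]; [apply/J12/DJ0/ideal_gen|exact: Ds|exact: Dt].
Qed.

Let TJ0 x : J0 x -> J2 (D T x).
Proof.
apply: ideal_derivation => // y; first by move/gen1_0/gen2_1; exact: ideal_gen.
case=> [d|i k|] //; first exact/J12/DX.
by apply: ideal_eq (idealD (J12 (TA i k)) (idealM ((i == k)%:R * half) Jrho)) _; ring.
Qed.

(** T is applied to the formula for the derivative of [tau] along f_j; exchanging the two
    derivations costs only first derivatives of [tau]. *)
Let frho j : J2 (D (f j) rho - D T (s j)).
Proof.
have H := TJ0 (ftau j); rewrite DB in H.
have -> : D (f j) rho = D T (D (f j) tau) + \sum_d c (f j) T d * D d tau.
  by rewrite -Dcomm; ring.
have S : J2 (\sum_d c (f j) T d * D d tau).
  by apply: ideal_sum => -[g|[]] _; apply: idealM => //; exact/J12/Dtau.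
by apply: ideal_eq (idealD H S) _; ring.
Qed.

Let erho j : J2 (D (e j) rho + D T (t j)).
Proof.
have H := TJ0 (etau j); rewrite DD in H.
have -> : D (e j) rho = D T (D (e j) tau) + \sum_d c (e j) T d * D d tau.
  by rewrite -Dcomm; ring.
have S : J2 (\sum_d c (e j) T d * D d tau).
  by apply: ideal_sum => -[g|[]] _; apply: idealM => //; exact/J12/Dtau.
by apply: ideal_eq (idealD H S) _; ring.
Qed.

Let three_half x : J2 ((1 + half) * x) -> J2 x.
Proof.
move=> /(idealM (2%:R * third)) H; apply: ideal_eq H _.
have -> : 2%:R * third * ((1 + half) * x) = (2%:R * third + third * (2%:R * half)) * x by ring.
rewrite halfE; have -> : 2%:R * third + third * 1 = 3%:R * third :> K by ring.
by rewrite thirdE mul1r.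
Qed.

(** In the commutator formula e_k f_k s_k is in [J2], while e_k s_k is half of [rho] modulo [J1], so
    that f_k e_k s_k is half of T s_k by [frho]. The result is 3/2 T s_k = 0 modulo [J2], which is
    why 3 must be invertible. *)
Let Ts k : J2 (D T (s k)).
Proof.
have [y yE E] := commT k (s k).
have Jy : J2 y by rewrite yE; apply: ideal_sum => g _; exact/idealM/Ds.
have H1 : J2 (D (e k) (D (f k) (s k))) by exact/DJ1/fs.
have H2 := DJ1 (inr k) (idealD (es k k) (TA k k)).
rewrite !DD !DN eqxx mul1r DM Dhalf mul0r add0r in H2.
apply: three_half.
apply: ideal_eq (idealB (idealB (idealB H1 H2) Jy) (idealM half (frho k))) _.
rewrite mulrDl mul1r [X in _ = X + _]E; ring.
Qed.

Let Tt k : J2 (D T (t k)).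
Proof.
have [y yE E] := commT k (t k).
have Jy : J2 y by rewrite yE; apply: ideal_sum => g _; exact/idealM/Dt.
have H1 : J2 (D (f k) (D (e k) (t k))) by exact/DJ1/et.
have H2 := DJ1 (inl k) (idealD (ft k k) (TB k k)).
rewrite !DD !DN eqxx mul1r DM Dhalf mul0r add0r in H2.
apply: three_half.
apply: ideal_eq (idealD (idealB (idealB H2 H1) Jy) (idealM half (erho k))) _.
rewrite mulrDl mul1r [X in _ = X + _]E; ring.
Qed.

Let Drho a : J2 (D (fd a) rho).
Proof.
case: a => j.
  by apply: ideal_eq (idealB (erho j) (Tt j)) _; ring.
by apply: ideal_eq (idealD (frho j) (Ts j)) _; ring.
Qed.

Let DJ2 a x : J2 x -> J2 (D (fd a) x).
Proof.
apply: ideal_derivation => // y; first exact: ideal_gen.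
by case=> [z Gz|]; [apply/DJ1/ideal_gen|exact: Drho].
Qed.

Let Trho : J2 (D T rho).
Proof.
(* An index must exist for T to be a commutator; this is where [n] has to be positive. *)
pose i := Ordinal n_gt0; have [y yE ->] := commT i rho; rewrite yE.
apply: idealB; first by apply: idealB; exact/DJ2/Drho.
by apply: ideal_sum => g _; exact/idealM/Drho.
Qed.

(** In this order: 2n + 1 components of the field, n^2 entries of A, 2n + 1 components of its
    bracket with T (the last being [tau]), and [rho]; in all n^2 + 4n + 3 = (n + 2)^2 - 1. *)
Definition jidx : finType := (fidx + 'I_n * 'I_n + fidx + unit)%type.

Definition jet (j : jidx) : K :=
  match j with
  | inl (inl (inl d)) => X d
  | inl (inl (inr ij)) => A ij.1 ij.2
  | inl (inr d) => brX T d
  | inr _ => rho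
  end.

Lemma jet_closed a j : exists C : jidx -> K, D a (jet j) = \sum_k C k * jet k.
Proof.
apply: ideal_finite; set P := fun y => _.
have P2 y : gen2 y -> ideal P y.
  move=> Gy; apply: ideal_gen; case: Gy => [_ [_ [d|i k|]|k|k]|].
  - by exists (inl (inl (inl d))).
  - by exists (inl (inl (inr (i, k)))).
  - by exists (inl (inr T)).
  - by exists (inl (inr (e k))).
  - by exists (inl (inr (f k))).
  - by exists (inr tt).
suff J : J2 (D a (jet j)) by exact: ideal_bind J.
have TJ x : gen2 x -> J2 (D T x).
  by case=> [_ [z /ideal_gen/TJ0|k|k]|].
have G : gen2 (jet j).
  case: j => [[[d|[i k]]|[[k|k]|[]]]|[]] /=; try by apply/gen2_1/gen1_0; constructor.
  - exact/gen2_1/gen1_s.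
  - exact/gen2_1/gen1_t.
  - exact: gen2_rho.
by case: a => [a|[]]; [exact/DJ2/ideal_gen|exact: TJ].
Qed.

End Prolongation.

Lemma card_jidx n : #|jidx n| = ((n + 2) ^ 2 - 1)%N.
Proof. by rewrite /jidx /fidx !card_sum card_prod !card_unit !card_ord; lia. Qed.

(** * Uniqueness for linear total differential systems *)

Section LinearSystems.
Context {R : realType} {m : nat}.
Implicit Types (A : set 'rV[R]_m) (x v : 'rV[R]_m).

(** The function exp(-L t) G(x + t v) has nonpositive derivative on [0, 1]. *)
Lemma gronwall_line (G : 'rV[R]_m -> R) x v (L : R) :
  (forall t, 0 <= t <= 1 -> differentiable G (x + t *: v)) ->
  (forall t, 0 <= t <= 1 -> 'D_v G (x + t *: v) <= L * G (x + t *: v)) ->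
  G x = 0 -> G (x + v) <= 0.
Proof.
move=> dG GL G0.
pose h (t : R) := G (x + t *: v) * expR (- L * t).
pose h' (t : R) := G (x + t *: v) * (expR (- L * t) * (- L)) + expR (- L * t) * 'D_v G (x + t *: v).
have dh (t : R) : 0 <= t <= 1 -> is_derive t 1 h (h' t).
  move=> t01; have d1 := derive1_line (dG t t01).
  have d2 : is_derive t 1 (fun s => - L * s) (- L).
    have := @is_deriveZ _ _ _ (fun s : R => s) (- L) t 1 1 (is_derive_id t 1).
    by rewrite /GRing.scale /= mulr1.
  have d3 := @is_derive1_comp _ expR (fun s => - L * s) t _ _ (is_derive_expR _) d2.
  have d4 := @is_deriveM _ _ _ _ t 1 _ _ d1 d3.
  have e : h' t = G (x + t *: v) *: (expR (- L * t) * - L) + expR (- L * t) *: 'D_v G (x + t *: v) by [].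
  rewrite e; exact: d4.
have [||c c01] := @MVT_segment R h h' 0 1 ler01.
- by move=> t; rewrite in_itv /= => /andP[t0 t1]; apply: dh; rewrite !ltW.
- apply: derivable_within_continuous => t; rewrite in_itv /= => t01.
  exact: (@ex_derive _ _ _ _ _ _ _ (dh t t01)).
rewrite /h scale0r addr0 G0 mul0r subr0 scale1r subr0 !mulr1 => H.
have : h' c <= 0.
  rewrite in_itv /= in c01.
  have -> : h' c = expR (- L * c) * ('D_v G (x + c *: v) - L * G (x + c *: v)) by rewrite /h'; ring.
  by apply: mulr_ge0_le0; [exact: expR_ge0|rewrite subr_le0 GL].
by rewrite -H pmulr_lle0 ?expR_gt0.
Qed.

(** Gronwall's estimate for the sum of the squares of all unknowns along the segments from [x0];
    continuity of the coefficients at [x0] bounds them nearby. *)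
Lemma linear_pd_unique (J : finType) A x0 (u : J -> 'rV[R]_m -> R)
    (C : 'I_m -> J -> J -> 'rV[R]_m -> R) : open A -> A x0 ->
  (forall j x, A x -> differentiable (u j) x) ->
  (forall i j k, {for x0, continuous (C i j k)}) ->
  (forall i j x, A x -> pd i (u j) x = \sum_k C i j k x * u k x) ->
  (forall j, u j x0 = 0) -> \forall x \near x0, forall j, u j x = 0.
Proof.
move=> oA Ax0 du cC E u0.
(* A single bound for all coefficients near [x0]; the 1 leaves room for their variation. *)
pose L := \sum_i \sum_j \sum_k (`|C i j k x0| + 1).
have CL i j k : `|C i j k x0| + 1 <= L.
  rewrite /L (bigD1 i) //= (bigD1 j) //= (bigD1 k) //= -!addrA lerD2l lerDl.
  by rewrite !addr_ge0 // ?sumr_ge0 // => *; rewrite ?sumr_ge0 // => *; rewrite ?sumr_ge0 // => *; rewrite addr_ge0.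
have bC : \forall x \near x0, forall ijk : 'I_m * J * J, `|C ijk.1.1 ijk.1.2 ijk.2 x| <= L.
  apply: (filter_forall (I := ('I_m * J * J)%type)
    (f := fun ijk x => `|C ijk.1.1 ijk.1.2 ijk.2 x| <= L) (nbhs_filter x0)) => -[[i j] k] /=.
  have /cvgr_dist_lt /(_ 1 ltr01) := cC i j k; apply: filterS => x H.
  apply: le_trans (CL i j k); rewrite -lerBlDl; apply: le_trans (ltW H).
  by rewrite (le_trans (lerB_dist _ _)) // distrC.
have /nbhs_ballP[r /= r0 rA] : \forall x \near x0, A x /\
    forall ijk : 'I_m * J * J, `|C ijk.1.1 ijk.1.2 ijk.2 x| <= L.
  by apply: filterI => //; exact: open_nbhs_nbhs.
have L0 : 0 <= L by rewrite /L; do 3 (apply: sumr_ge0 => ? _); rewrite addr_ge0.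
(* Radius at most 1, so that the direction [v] has entries bounded by 1 and drops out of the
   estimate. *)
apply/nbhs_ballP; exists (Num.min r 1) => /=; first by rewrite lt_min r0 ltr01.
move=> x /= xb j.
pose G (y : 'rV[R]_m) : R := \sum_j u j y * u j y.
pose v := x - x0.
have xb' (i : 'I_m) : `|x0 0 i - x 0 i| < Num.min r 1 by exact: (xb.2 ord0 i).
have seg t : 0 <= t <= 1 -> ball x0 r (x0 + t *: v).
  move=> /andP[t0 t1]; split=> [|i1 i]; [exact: r0|rewrite {i1}ord1 /ball /= !mxE opprD addNKr normrN normrM ger0_norm //].
  rewrite distrC; apply: le_lt_trans (_ : `|x0 0 i - x 0 i| < r); first by rewrite ler_piMl.
  by apply: lt_le_trans (xb' i) _; rewrite ge_min lexx.
have vi i : `|v 0 i| <= 1.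
  by rewrite !mxE distrC ltW // (lt_le_trans (xb' i)) // ge_min lexx orbT.
have x01 : x = x0 + v by rewrite /v addrC subrK.
have dG y : A y -> differentiable G y /\ 'D_v G y = \sum_j 2 * (u j y * 'D_v (u j) y).
  move=> Ay; have [j'|d e] := @derive_bigsum _ _ _ (index_enum J) xpredT (fun j y => u j y * u j y) v y.
    by apply: difM; exact: du.
  split; first exact: d.
  by rewrite e; apply: eq_bigr => j' _; rewrite derM; [ring|exact: du..].
have cJ : #|(xpredT : pred J)| = #|J| by [].
suff : G x <= 0.
  rewrite /G => H; have {H} : \sum_j u j x * u j x == 0.
    by rewrite eq_le H sumr_ge0 // => i _; rewrite -expr2 sqr_ge0.
  rewrite psumr_eq0 => [/allP/(_ j (mem_index_enum j))|i _]; last by rewrite -expr2 sqr_ge0.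
  by rewrite -expr2 sqrf_eq0 => /eqP.
(* The constant comes from 2 |u_j u_k| <= u_j^2 + u_k^2, summed over j, k and the [m] coordinate
   directions: each square occurs [#|J|] times from either index. *)
rewrite x01; apply: (@gronwall_line G x0 v (2 * (m * #|J|)%:R * L)).
- by move=> t /seg/rA[/dG[]].
- move=> t /seg/rA[At CLt]; set y := x0 + t *: v; rewrite (dG y At).2.
  have -> : \sum_j 2 * (u j y * 'D_v (u j) y) =
      \sum_j \sum_i \sum_k 2 * (u j y * u k y * (v 0 i * C i j k y)).
    apply: eq_bigr => j' _; rewrite derive_pd; last exact: du.
    rewrite !mulr_sumr; apply: eq_bigr => i _; rewrite E // !mulr_sumr.
    by apply: eq_bigr => k _; ring.
  apply: (@le_trans _ _ (\sum_j \sum_(i < m) \sum_k L * (u j y * u j y + u k y * u k y))).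
    apply: ler_sum => j' _; apply: ler_sum => i _; apply: ler_sum => k _.
    have : `|v 0 i * C i j' k y| <= L.
      by rewrite normrM (le_trans (ler_piMl _ (vi i))) // (CLt (i, j', k)).
    rewrite ler_norml; set a := u j' y; set b := u k y; set w := v 0 i * _ => /andP[w1 w2].
    have H1 : 0 <= (L + w) * ((a - b) * (a - b)).
      by rewrite mulr_ge0 -?expr2 ?sqr_ge0 //; lra.
    have H2 : 0 <= (L - w) * ((a + b) * (a + b)).
      by rewrite mulr_ge0 -?expr2 ?sqr_ge0 //; lra.
    nra.
  have -> : \sum_j \sum_(i < m) \sum_k L * (u j y * u j y + u k y * u k y) = 2 * (m * #|J|)%:R * L * G y.
    transitivity (\sum_j (m%:R * L * (#|J|%:R * (u j y * u j y) + G y))).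
      apply: eq_bigr => j' _.
      rewrite sumr_const card_ord -mulr_sumr big_split /= sumr_const -/(G y) cJ -[X in X = _]mulr_natl -[X in _ * (_ * (X + _)) = _]mulr_natl.
      by ring.
    rewrite -mulr_sumr big_split /= -mulr_sumr sumr_const -[G y *+ _]mulr_natl -/(G y) natrM.
    by rewrite cJ -/(G y); ring.
  by [].
- by rewrite /G big1 // => i _; rewrite u0 mul0r.
Qed.

End LinearSystems.

(** * The ring of smooth functions on an open set *)

Section SmoothFunctionRing.
Context {R : realType} {m : nat}.
Implicit Types (x : 'rV[R]_m).

(** The base point keeps the ring of functions nontrivial, with 1 different from 0, as the structure
    [comNzRingType] demands. *)
Record pointed_open := PointedOpen {
  po_set : set 'rV[R]_m; po_point : 'rV[R]_m;
  po_open : open po_set; po_in : po_set po_point }.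

Arguments po_open p : clear implicits.
Arguments po_in p : clear implicits.

Section Ring.
Variable P : pointed_open.
Notation A := (po_set P).

(* smooth functions on [A], extended by zero so that equality is equality on [A] *)
Record sfun := SFun { sfun_val :> 'rV[R]_m -> R;
  sfunP : `[< smooth_on A sfun_val /\ forall x, ~ A x -> sfun_val x = 0 >] }.

HB.instance Definition _ := gen_eqMixin sfun.
HB.instance Definition _ := gen_choiceMixin sfun.

Lemma sfun_smooth (f : sfun) : smooth_on A f.
Proof. by have /asboolP[] := sfunP f. Qed.

Lemma sfun_ext (f g : sfun) : (forall x, A x -> f x = g x) -> f = g.
Proof.
case: f g => [f pf] [g pg] /= fg; have E : f = g.
  apply/funext => x; have [/asboolP[_ f0] /asboolP[_ g0]] := (pf, pg).
  by have [/fg|nAx] := pselect (A x) => //; rewrite f0 // g0.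
by case: g / E pg {fg} => pg; congr SFun; exact: Prop_irrelevance.
Qed.

Definition srestr (f : 'rV[R]_m -> R) x := if pselect (A x) then f x else 0.

Lemma srestrE f x : A x -> srestr f x = f x.
Proof. by rewrite /srestr; case: pselect. Qed.

Lemma srestrP f : smooth_on A f ->
  `[< smooth_on A (srestr f) /\ forall x, ~ A x -> srestr f x = 0 >].
Proof.
move=> sf; apply/asboolP; split=> [|x]; last by rewrite /srestr; case: pselect.
by apply: (smooth_on_ext (po_open P) _ sf) => x Ax; rewrite srestrE.
Qed.

Definition mksfun f (sf : smooth_on A f) : sfun := SFun (srestrP sf).

Lemma mksfunE f (sf : smooth_on A f) x : A x -> mksfun sf x = f x.
Proof. exact: srestrE. Qed.

Let oA := po_open P.
Definition sfun_cst c := mksfun (@smooth_on_cst R m A c).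
Definition sfun_add (f g : sfun) := mksfun (smooth_onD oA (sfun_smooth f) (sfun_smooth g)).
Definition sfun_opp (f : sfun) := mksfun (smooth_onN oA (sfun_smooth f)).
Definition sfun_mul (f g : sfun) := mksfun (smooth_onM oA (sfun_smooth f) (sfun_smooth g)).

Lemma sfun_addA : associative sfun_add.
Proof. by move=> f g h; apply: sfun_ext => x Ax; rewrite !mksfunE // addrA. Qed.
Lemma sfun_addC : commutative sfun_add.
Proof. by move=> f g; apply: sfun_ext => x Ax; rewrite !mksfunE // addrC. Qed.
Lemma sfun_add0 : left_id (sfun_cst 0) sfun_add.
Proof. by move=> f; apply: sfun_ext => x Ax; rewrite !mksfunE // add0r. Qed.
Lemma sfun_addN : left_inverse (sfun_cst 0) sfun_opp sfun_add.
Proof. by move=> f; apply: sfun_ext => x Ax; rewrite !mksfunE // addNr. Qed.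
Lemma sfun_mulA : associative sfun_mul.
Proof. by move=> f g h; apply: sfun_ext => x Ax; rewrite !mksfunE // mulrA. Qed.
Lemma sfun_mulC : commutative sfun_mul.
Proof. by move=> f g; apply: sfun_ext => x Ax; rewrite !mksfunE // mulrC. Qed.
Lemma sfun_mul1 : left_id (sfun_cst 1) sfun_mul.
Proof. by move=> f; apply: sfun_ext => x Ax; rewrite !mksfunE // mul1r. Qed.
Lemma sfun_mulDl : left_distributive sfun_mul sfun_add.
Proof. by move=> f g h; apply: sfun_ext => x Ax; rewrite !mksfunE // mulrDl. Qed.
Lemma sfun_one_neq0 : sfun_cst 1 != sfun_cst 0.
Proof.
apply/eqP => /(congr1 (fun f : sfun => f (po_point P))).
by rewrite !mksfunE; [move/eqP; rewrite oner_eq0|exact: po_in..].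
Qed.

HB.instance Definition _ := GRing.isZmodule.Build sfun sfun_addA sfun_addC sfun_add0 sfun_addN.
HB.instance Definition _ := GRing.Zmodule_isComNzRing.Build sfun
  sfun_mulA sfun_mulC sfun_mul1 sfun_mulDl sfun_one_neq0.

Lemma sfunD (f g : sfun) x : A x -> (f + g) x = f x + g x.
Proof. by move=> Ax; rewrite -[f + g]/(sfun_add f g) mksfunE. Qed.
Lemma sfunN (f : sfun) x : A x -> (- f) x = - f x.
Proof. by move=> Ax; rewrite -[- f]/(sfun_opp f) mksfunE. Qed.
Lemma sfunM (f g : sfun) x : A x -> (f * g) x = f x * g x.
Proof. by move=> Ax; rewrite -[f * g]/(sfun_mul f g) mksfunE. Qed.
Lemma sfun0 x : A x -> (0 : sfun) x = 0.
Proof. by move=> Ax; rewrite -[0]/(sfun_cst 0) mksfunE. Qed.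
Lemma sfun1 x : A x -> (1 : sfun) x = 1.
Proof. by move=> Ax; rewrite -[1]/(sfun_cst 1) mksfunE. Qed.
Lemma sfun_sum I (r : seq I) (Q : pred I) (F : I -> sfun) x : A x ->
  (\sum_(i <- r | Q i) F i) x = \sum_(i <- r | Q i) F i x.
Proof.
by move=> Ax; apply: (big_morph (fun f : sfun => f x)) => [f g|]; [exact: sfunD|exact: sfun0].
Qed.
Lemma sfun_natr k x : A x -> (k%:R : sfun) x = k%:R.
Proof.
by move=> Ax; elim: k => [|k IH]; rewrite ?sfun0 // -!natr1 sfunD // IH sfun1.
Qed.

Definition sderive (W : 'rV[R]_m -> 'rV[R]_m) (sW : smooth_rv_on A W) (f : sfun) : sfun :=
  mksfun (smooth_on_derive oA (sfun_smooth f) sW).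

Lemma sfun_diff (f : sfun) x : A x -> differentiable f x.
Proof. by move=> Ax; exact: (smooth_on_diff (sfun_smooth f)). Qed.

Lemma near_eq_derive_on (f g : 'rV[R]_m -> R) x v : A x -> (forall y, A y -> f y = g y) ->
  'D_v f x = 'D_v g x.
Proof. by move=> Ax fg; apply: near_eq_derive; exact: (open_near oA). Qed.

Lemma sderiveE W (sW : smooth_rv_on A W) f x : A x -> sderive sW f x = 'D_(W x) f x.
Proof. exact: mksfunE. Qed.

Lemma sderiveD W (sW : smooth_rv_on A W) : {morph sderive sW : f g / f + g}.
Proof.
move=> f g; apply: sfun_ext => x Ax; rewrite sfunD // !sderiveE //.
rewrite -(derD _ (sfun_diff f Ax) (sfun_diff g Ax)).
by apply: near_eq_derive_on => // y Ay; rewrite sfunD.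
Qed.

Lemma sderiveM W (sW : smooth_rv_on A W) f g :
  sderive sW (f * g) = sderive sW f * g + f * sderive sW g.
Proof.
apply: sfun_ext => x Ax; rewrite sfunD // !sfunM // !sderiveE //.
rewrite [X in X + _]mulrC addrC -(derM _ (sfun_diff f Ax) (sfun_diff g Ax)).
apply: near_eq_derive_on => // y Ay; exact: sfunM.
Qed.

End Ring.

(** The second derivatives of [g] enter both iterated derivatives symmetrically and cancel. *)
Lemma derive_cbracket (A : set 'rV[R]_m) (X Y : 'rV[R]_m -> 'rV[R]_m) (g : 'rV[R]_m -> R) x :
  open A -> A x -> smooth_rv_on A X -> smooth_rv_on A Y -> smooth_on A g ->
  'D_(X x) (fun y => 'D_(Y y) g y) x - 'D_(Y x) (fun y => 'D_(X y) g y) x =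
  'D_(cbracket X Y x) g x.
Proof.
move=> oA Ax sX sY sg.
have H (V Z : 'rV[R]_m -> 'rV[R]_m) : smooth_rv_on A V -> smooth_rv_on A Z ->
    'D_(V x) (fun y => 'D_(Z y) g y) x =
    \sum_i 'D_(V x) (fun y => Z y 0 i) x * pd i g x +
    \sum_i \sum_j V x 0 i * Z x 0 j * pd i (pd j g) x.
  move=> sV sZ.
  have E y : A y -> 'D_(Z y) g y = \sum_i Z y 0 i * pd i g y.
    by move=> Ay; rewrite derive_pd //; exact: smooth_on_diff Ay.
  have -> : 'D_(V x) (fun y => 'D_(Z y) g y) x = 'D_(V x) (fun y => \sum_i Z y 0 i * pd i g y) x.
    by apply: near_eq_derive; exact: (open_near oA).
  have dpd j : differentiable (pd j g) x by exact: smooth_on_diff (smooth_on_pd j sg) Ax.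
  have dZ j : differentiable (fun y => Z y 0 j) x by exact: smooth_on_diff (sZ j) Ax.
  have [_ ->] := @derive_bigsum _ _ _ (index_enum 'I_m) xpredT
    (fun i y => Z y 0 i * pd i g y) (V x) x (fun i => difM (dZ i) (dpd i)).
  have -> : \sum_i 'D_(V x) (fun y => Z y 0 i * pd i g y) x =
     \sum_i (Z x 0 i * 'D_(V x) (pd i g) x + pd i g x * 'D_(V x) (fun y => Z y 0 i) x).
    by apply: eq_bigr => i _; exact: derM.
  rewrite big_split addrC /=; congr (_ + _); last by apply: eq_bigr => i _; exact: mulrC.
  rewrite exchange_big /=; apply: eq_bigr => j _; rewrite derive_pd // mulr_sumr.
  by apply: eq_bigr => i _; ring.
rewrite !H // derive_pd; last exact: smooth_on_diff Ax.
have -> : \sum_i \sum_j Y x 0 i * X x 0 j * pd i (pd j g) x =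
          \sum_i \sum_j X x 0 i * Y x 0 j * pd i (pd j g) x.
  rewrite exchange_big; apply: eq_bigr => i _; apply: eq_bigr => j _.
  by rewrite (pdC _ _ oA Ax sg); ring.
rewrite opprD addrACA subrr addr0 -sumrB; apply: eq_bigr => i _.
rewrite cbracket_coor; first by ring.
- exact: smooth_rv_diff sX Ax.
- exact: smooth_rv_diff sY Ax.
Qed.

End SmoothFunctionRing.

(** * Linear dependence of too many infinitesimal symmetries in coordinates *)

Section FieldsDependent.
Context {R : realType} {m n : nat}.
Implicit Types (x u : 'rV[R]_m) (A : set 'rV[R]_m).
Notation e i := (fd (inl i)).
Notation f i := (fd (inr i)).
Notation T := (@fT n).

Lemma smooth_cbracket A (X Y : 'rV[R]_m -> 'rV[R]_m) : open A ->
  smooth_rv_on A X -> smooth_rv_on A Y -> smooth_rv_on A (cbracket X Y).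
Proof.
move=> oA sX sY l.
have H : smooth_on A (fun x => 'D_(X x) (fun y => Y y 0 l) x - 'D_(Y x) (fun y => X y 0 l) x).
  by apply: smooth_onB => //; apply: smooth_on_derive.
apply: (smooth_on_ext oA _ H) => x Ax; rewrite cbracket_coor //.
- exact: smooth_rv_diff sX Ax.
- exact: smooth_rv_diff sY Ax.
Qed.

Definition coef (lam : 'rV[R]_m -> 'cV[R]_m) x u : R := (u *m lam x) 0 0.

Lemma smooth_coef A (lam : 'rV[R]_m -> 'cV[R]_m) (V : 'rV[R]_m -> 'rV[R]_m) : open A ->
  (forall i, smooth_on A (fun x => lam x i 0)) -> smooth_rv_on A V ->
  smooth_on A (fun x => coef lam x (V x)).
Proof.
by move=> oA sl sV; apply: smooth_on_mulmx => // i j; rewrite ord1; [exact: sV|exact: sl].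
Qed.

Variables (A : set 'rV[R]_m) (x0 : 'rV[R]_m) (W : fidx n -> 'rV[R]_m -> 'rV[R]_m)
  (lam : fidx n -> 'rV[R]_m -> 'cV[R]_m).
Hypotheses (n_gt0 : (0 < n)%N) (oA : open A) (Ax0 : A x0)
  (sW : forall a, smooth_rv_on A (W a)) (slam : forall d i, smooth_on A (fun x => lam d x i 0))
  (dual : forall b d x, A x -> coef (lam d) x (W b x) = (b == d)%:R)
  (span : forall x u, A x -> u = \sum_d coef (lam d) x u *: W d x).

Definition brcoef (X Y : 'rV[R]_m -> 'rV[R]_m) d x := coef (lam d) x (cbracket X Y x).

Hypotheses (Wee : forall i j x, A x -> brcoef (W (e i)) (W (e j)) T x = 0)
  (Wff : forall i j x, A x -> brcoef (W (f i)) (W (f j)) T x = 0)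
  (Wef : forall i j x, A x -> brcoef (W (e i)) (W (f j)) T x = (i == j)%:R).

Let P := PointedOpen oA Ax0.
Let K : comNzRingType := sfun P.
Let D (a : fidx n) : K -> K := sderive (P := P) (sW a).

Let sbr X Y d : smooth_rv_on A X -> smooth_rv_on A Y -> smooth_on A (brcoef X Y d).
Proof. by move=> sX sY; apply: smooth_coef => //; exact: smooth_cbracket. Qed.

Let c a b d : K := mksfun (P := P) (sbr d (sW a) (sW b)).

Lemma derive_span (g : 'rV[R]_m -> R) x u : differentiable g x -> A x ->
  'D_u g x = \sum_d coef (lam d) x u * 'D_(W d x) g x.
Proof.
move=> dg Ax; rewrite deriveE // {1}(span u Ax) linear_sum; apply: eq_bigr => d _.
by rewrite linearZ deriveE.
Qed.

Let DD a : {morph D a : g h / g + h}. Proof. exact: sderiveD. Qed.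
Let DM a (g h : K) : D a (g * h) = D a g * h + g * D a h. Proof. exact: sderiveM. Qed.

Let D_at a (g : K) x : A x -> D a g x = 'D_(W a x) g x. Proof. exact: (sderiveE (P := P)). Qed.

Let Kdiff (g : K) x : A x -> differentiable g x. Proof. exact: (@sfun_diff _ _ P). Qed.

Let Dcomm a b (g : K) : D a (D b g) - D b (D a g) = \sum_d c a b d * D d g.
Proof.
apply: sfun_ext => x Ax; rewrite sfunD // sfunN // sfun_sum // !D_at //.
rewrite (near_eq_derive_on (P := P) _ Ax (fun y => D_at b g (x := y))).
rewrite (near_eq_derive_on (P := P) _ Ax (fun y => D_at a g (x := y))).
rewrite (derive_cbracket oA Ax (sW a) (sW b) (sfun_smooth g)) derive_span //; last exact: Kdiff.
by apply: eq_bigr => d _; rewrite sfunM // D_at // mksfunE.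
Qed.

(** Tested on the coordinate functions: the combination of frame vectors vanishes at each point, and
    the dual frame extracts its coefficients. *)
Let Dindep (g : fidx n -> K) : (forall h, \sum_d g d * D d h = 0) -> forall d, g d = 0.
Proof.
move=> H d; apply: sfun_ext => x Ax; rewrite sfun0 //.
have E (l : 'I_m) : \sum_d g d x * W d x 0 l = 0.
  have := congr1 (fun h : K => h x) (H (mksfun (P := P) (@smooth_on_coor _ _ A l))).
  rewrite sfun_sum // sfun0 // => H0; apply: etrans H0; apply: eq_bigr => b _; rewrite sfunM // D_at //.
  rewrite (near_eq_derive_on (P := P) (g := fun y => y 0 l) _ Ax) ?derive_coor // => y Ay.
  exact: mksfunE.
have V0 : \sum_d g d x *: W d x = 0.
  apply/rowP => l; rewrite summxE [RHS]mxE; apply: etrans (E l).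
  by apply: eq_bigr => b _; rewrite mxE.
have : coef (lam d) x (\sum_b g b x *: W b x) = g d x.
  rewrite /coef mulmx_suml summxE (bigD1 d) //= -scalemxAl mxE -/(coef _ _ _) dual // eqxx mulr1.
  rewrite big1 ?addr0 // => b /negbTE bd.
  by rewrite -scalemxAl mxE -/(coef _ _ _) dual // bd mulr0.
by rewrite V0 /coef mul0mx mxE.
Qed.

Let cpt (s : R) : K := sfun_cst P s.

Let D_cst a s : D a (cpt s) = 0.
Proof.
apply: sfun_ext => x Ax; rewrite sfun0 // D_at //.
rewrite (near_eq_derive_on (P := P) (g := fun=> s) _ Ax) ?der_cst // => y Ay.
exact: mksfunE.
Qed.

Let cptE s x : A x -> cpt s x = s. Proof. exact: (mksfunE (P := P)). Qed.

Let halfE : 2%:R * cpt 2^-1 = 1.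
Proof.
apply: sfun_ext => x Ax; rewrite sfunM // sfun_natr // sfun1 // cptE //.
by rewrite mulfV // pnatr_eq0.
Qed.
Let thirdE : 3%:R * cpt 3^-1 = 1.
Proof.
apply: sfun_ext => x Ax; rewrite sfunM // sfun_natr // sfun1 // cptE //.
by rewrite mulfV // pnatr_eq0.
Qed.

Section OneField.
Variables (V : 'rV[R]_m -> 'rV[R]_m) (sV : smooth_rv_on A V).

Let X d : K := mksfun (P := P) (smooth_coef oA (slam d) sV).

Let LX_at (g : K) x : A x -> LX D X g x = 'D_(V x) g x.
Proof.
move=> Ax; rewrite sfun_sum // (derive_span _ (Kdiff g Ax) Ax).
by apply: eq_bigr => d _; rewrite sfunM // D_at // mksfunE.
Qed.

(** Links the algebraic bracket of the prolongation with the bracket of vector fields: both express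
    the same commutator of derivations, and [Dindep] identifies the coefficients. *)
Lemma brX_at b d x : A x -> brX D c X b d x = brcoef V (W b) d x.
Proof.
move=> Ax; pose g d : K := mksfun (P := P) (sbr d sV (sW b)).
suff -> : brX D c X b d = g d by rewrite mksfunE.
apply/eqP; rewrite -subr_eq0; apply/eqP.
apply: (Dindep (g := fun d => brX D c X b d - g d)) => h.
under eq_bigr do rewrite mulrBl.
rewrite sumrB -LX_D //; apply: sfun_ext => y Ay; rewrite sfun0 // !sfunD // !sfunN //.
rewrite LX_at // D_at // sfun_sum //.
rewrite (near_eq_derive_on (P := P) _ Ay (fun z => D_at b h (x := z))).
rewrite (near_eq_derive_on (P := P) _ Ay (fun z => LX_at h (x := z))).
rewrite (derive_cbracket oA Ay sV (sW b) (sfun_smooth h)) derive_span //; last exact: Kdiff.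
rewrite -sumrB big1 // => a _; rewrite sfunM // D_at // mksfunE // subrr.
by [].
Qed.

End OneField.

(** Preservation of the two Lagrangian bundles, in the form of the hypotheses [Xee], [XeT], [Xff],
    [XfT] of the prolongation. *)
Definition compatible (V : 'rV[R]_m -> 'rV[R]_m) := forall i j x, A x ->
  [/\ brcoef V (W (e i)) (f j) x = 0, brcoef V (W (e i)) T x = 0,
      brcoef V (W (f i)) (e j) x = 0 & brcoef V (W (f i)) T x = 0].

Section Family.
Variables (r : nat) (V : 'I_r -> 'rV[R]_m -> 'rV[R]_m).
Hypotheses (sV : forall k, smooth_rv_on A (V k)) (cV : forall k, compatible (V k)).

Let X k d : K := mksfun (P := P) (smooth_coef oA (slam d) (sV k)).

Let XK (al : 'I_r -> R) d : K := \sum_k cpt (al k) * X k d.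

Let D_cptM b s g : D b (cpt s * g) = cpt s * D b g.
Proof. by rewrite DM D_cst mul0r add0r. Qed.

Let Dsum b (g : 'I_r -> K) : D b (\sum_k g k) = \sum_k D b (g k).
Proof. exact: (dvn_sum (DD b)). Qed.

Let brX_XK al b d : brX D c (XK al) b d = \sum_k cpt (al k) * brX D c (X k) b d.
Proof.
transitivity (\sum_k (cpt (al k) * (\sum_a X k a * c a b d) - D b (cpt (al k) * X k d))).
  rewrite brXE /XK sumrB Dsum; congr (_ - _).
  under eq_bigr do rewrite mulr_suml.
  rewrite exchange_big; apply: eq_bigr => k _ /=; rewrite mulr_sumr.
  by apply: eq_bigr => a _; rewrite mulrA.
by apply: eq_bigr => k _; rewrite D_cptM brXE mulrBr.
Qed.

Let jet_XK al j : jet D c (XK al) j = \sum_k cpt (al k) * jet D c (X k) j.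
Proof.
case: j => [[[d|[i k]]|d]|[]] /=; rewrite ?brX_XK // Dsum.
by apply: eq_bigr => k _; rewrite D_cptM.
Qed.

(** The jets of the [r] fields at [x0] are vectors of length [#|jidx n| < r], hence dependent. The
    same constant combination of the fields has zero jet at [x0], and its jet satisfies a linear
    total system by [jet_closed], so it vanishes nearby. *)
Lemma fields_dependent : (#|jidx n| < r)%N ->
  exists al : 'I_r -> R, (exists k, al k != 0) /\ \forall x \near x0, \sum_k al k *: V k x = 0.
Proof.
move=> Nr; pose J := jidx n.
pose Mx : 'M[R]_(r, #|J|) := \matrix_(k, j) jet D c (X k) (enum_val j) x0.
have /rowV0Pn[v /sub_kermxP vM v0] : kermx Mx != 0.
  by rewrite -mxrank_eq0 mxrank_ker -lt0n subn_gt0 (leq_ltn_trans (rank_leq_col _)).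
pose al k := v 0 k; exists al; split.
  apply/existsP; apply: contraNT v0; rewrite negb_exists => /forallP v0.
  by apply/eqP/rowP => k; rewrite mxE; apply/eqP/negPn/v0.
have br0 b d : (forall k x, A x -> brcoef (V k) (W b) d x = 0) -> brX D c (XK al) b d = 0.
  move=> H; rewrite brX_XK big1 // => k _; apply: sfun_ext => x Ax.
  by rewrite sfunM // brX_at // H // mulr0 sfun0.
have n0 : 'I_n := Ordinal n_gt0.
have cC a j : exists C : jidx n -> K, D a (jet D c (XK al) j) = \sum_k C k * jet D c (XK al) k.
  apply: (jet_closed DD DM Dcomm Dindep _ _ _ halfE thirdE n_gt0).
  - by move=> i j'; apply: sfun_ext => x Ax; rewrite sfun0 // mksfunE // Wee.
  - by move=> i j'; apply: sfun_ext => x Ax; rewrite sfun0 // mksfunE // Wff.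
  - by move=> i j'; apply: sfun_ext => x Ax; rewrite sfun_natr // mksfunE // Wef.
  - by move=> i j'; apply: br0 => k x Ax; have [] := cV k i j' Ax.
  - by move=> i; apply: br0 => k x Ax; have [] := cV k i n0 Ax.
  - by move=> i j'; apply: br0 => k x Ax; have [] := cV k i j' Ax.
  - by move=> i; apply: br0 => k x Ax; have [] := cV k i n0 Ax.
have [C CE] := choice (fun aj : fidx n * jidx n => cC aj.1 aj.2).
pose u (j : jidx n) : 'rV[R]_m -> R := jet D c (XK al) j.
(* [C] describes derivatives along the frame; the dual frame turns them into partial derivatives. *)
pose E (i : 'I_m) (j k : jidx n) (x : 'rV[R]_m) : R :=
  \sum_a coef (lam a) x (delta_mx 0 i) * C (a, j) k x.
have sE i j k : smooth_on A (E i j k).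
  apply: smooth_on_sum => // a _; apply: smooth_onM => //; last exact: (@sfun_smooth _ _ P (C (a, j) k)).
  by apply: smooth_coef => // l; exact: smooth_on_cst.
have u0 j : u j x0 = 0.
  have := congr1 (fun w : 'rV[R]_#|J| => w 0 (enum_rank j)) vM; rewrite !mxE => H.
  rewrite /u jet_XK sfun_sum //; apply: etrans H; apply: eq_bigr => k _.
  by rewrite !mxE enum_rankK sfunM // cptE.
have H : \forall x \near x0, forall j, u j x = 0.
  apply: (linear_pd_unique (C := E) oA Ax0) => // [j x Ax|i j k|i j x Ax].
  - exact: Kdiff.
  - exact/differentiable_continuous/(smooth_on_diff (sE i j k)).
  rewrite /pd derive_span //; last exact: Kdiff.
  under eq_bigr => a _ do rewrite -D_at // (CE (a, j)) sfun_sum // mulr_sumr.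
  rewrite exchange_big; apply: eq_bigr => k _; rewrite mulr_suml.
  by apply: eq_bigr => a _; rewrite (@sfunM _ _ P (C (a, j) k)) // mulrA.
have nA : \forall x \near x0, A x by exact: open_nbhs_nbhs.
apply: filterS2 nA H => x Ax ux; rewrite (span (\sum_k al k *: V k x) Ax) big1 // => d _.
have := ux (inl (inl (inl d))); rewrite /u /= /XK sfun_sum // => H.
suff -> : coef (lam d) x (\sum_k al k *: V k x) = 0 by rewrite scale0r.
rewrite -[RHS]H /coef mulmx_suml summxE; apply: eq_bigr => k _.
by rewrite sfunM // cptE // mksfunE // -scalemxAl mxE.
Qed.

End Family.
End FieldsDependent.

(** * Infinitesimal automorphisms of a Lagrangian contact structure *)

Section DualFrame.
Context {R : realType} {m : nat}.
Implicit Types (A : set 'rV[R]_m).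

(** The dual frame consists of the columns of the inverse of the frame matrix; Cramer's formula
    keeps it smooth. *)
Lemma dual_frame (I : finType) A (W : I -> 'rV[R]_m -> 'rV[R]_m) : #|I| = m -> open A ->
  (forall a, smooth_rv_on A (W a)) ->
  (forall x, A x -> forall k : I -> R, \sum_d k d *: W d x = 0 -> forall d, k d = 0) ->
  exists lam : I -> 'rV[R]_m -> 'cV[R]_m,
    [/\ forall d i, smooth_on A (fun x => lam d x i 0),
        forall b d x, A x -> coef (lam d) x (W b x) = (b == d)%:R &
        forall x u, A x -> u = \sum_d coef (lam d) x u *: W d x].
Proof.
move=> cI oA sW fW.
pose idx (i : 'I_m) : I := enum_val (cast_ord (esym cI) i).
pose num (d : I) : 'I_m := cast_ord cI (enum_rank d).
have numK d : idx (num d) = d by rewrite /idx /num cast_ordK enum_rankK.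
have idxK i : num (idx i) = i by rewrite /idx /num enum_valK cast_ordKV.
pose Q x : 'M[R]_m := \matrix_i W (idx i) x.
have QU x : A x -> Q x \in unitmx.
  move=> Ax; rewrite -row_free_unit; apply/row_free_rows => k k0 i.
  have := fW x Ax (fun d => k (num d)) _ (idx i); rewrite idxK; apply.
  rewrite -[RHS]k0 (reindex idx) /=; last by exists num => d _.
  by apply: eq_bigr => j _; rewrite idxK.
have colM k (u : 'M[R]_(k, m)) d x : u *m col d (invmx (Q x)) = col d (u *m invmx (Q x)).
  by rewrite !colE mulmxA.
exists (fun d x => col (num d) (invmx (Q x))); split=> [d i|b d x Ax|x u Ax].
- apply: (smooth_on_ext oA (f := fun x => invmx (Q x) i (num d))) => [x _|]; first by rewrite mxE.
  apply: smooth_on_invmx => // i' j; apply: (smooth_on_ext oA _ (sW (idx i') j)) => x _.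
  by rewrite mxE.
- have -> : W b x = row (num b) (Q x) by rewrite rowK numK.
  rewrite /coef colM -row_mul mxE mxE.
  by rewrite mulmxV ?QU // mxE (can_eq numK).
- have {1}-> : u = u *m invmx (Q x) *m Q x by rewrite mulmxKV ?QU.
  rewrite mulmx_sum_row (reindex idx) /=; last by exists num => d _.
  by apply: eq_bigr => i _; rewrite rowK /coef colM idxK [X in _ = X *: _]mxE.
Qed.

End DualFrame.

Section CartanFormula.
Context {R : realType} {m : nat}.
Implicit Types (A : set 'rV[R]_m).

Lemma eform1_sum (th : eform R m) u : alternating th ->
  th 1%N u = \sum_l u 0 l * th 1%N 'e_l.
Proof.
move=> ath; have E w : th 1%N w = ector w th 0%N 0.
  rewrite /ector; apply: eform_cast => // i i' j ii'.
  have -> : i' = lshift 0 i by apply: val_inj; rewrite /= -ii'.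
  by rewrite col_mxEu.
by rewrite E alt_ector_sum //; apply: eq_bigr => l _; rewrite -E.
Qed.

Lemma ext_d2 (th : 'rV[R]_m -> eform R m) x (u v : 'rV[R]_m) :
  ext_d th x 2%N (col_mx u v) = 'D_u (fun y => th y 1%N v) x - 'D_v (fun y => th y 1%N u) x.
Proof.
rewrite /ext_d big_ord_recl big_ord1 /= expr0 mul1r expr1 mulN1r.
have r0 : row 0 (col_mx u v) = u by exact: (row0_col_mx u v).
have r1 : row (lift ord0 ord0) (col_mx u v) = v.
  by rewrite (rowS_col_mx u v ord0); apply/rowP => j; rewrite !mxE.
rewrite r0 r1; congr (_ - _); congr derive; apply/funext => y.
  by congr (th y _ _); exact: (row'0_col_mx u v).
congr (th y _ _); apply/rowP => j; rewrite !mxE.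
by case: splitP => // k; rewrite !ord1.
Qed.

(** Differentiating the two identities theta(X) = 0 and theta(Y) = 0 exchanges derivatives of the
    form for derivatives of the fields, and these make up the bracket. *)
Lemma ext_d2_bracket A (th : 'rV[R]_m -> eform R m) (X Y : 'rV[R]_m -> 'rV[R]_m) x :
  open A -> sform A th -> smooth_rv_on A X -> smooth_rv_on A Y -> A x ->
  (forall y, A y -> th y 1%N (X y) = 0) -> (forall y, A y -> th y 1%N (Y y) = 0) ->
  ext_d th x 2%N (col_mx (X x) (Y x)) = - th x 1%N (cbracket X Y x).
Proof.
move=> oA [ath sth] sX sY Ax X0 Y0.
have dt l : differentiable (fun y => th y 1%N 'e_l) x by exact: smooth_on_diff (sth _ _) Ax.
have dc (Z : 'rV[R]_m -> 'rV[R]_m) l : smooth_rv_on A Z -> differentiable (fun y => Z y 0 l) x.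
  by move=> sZ; exact: smooth_on_diff (sZ l) Ax.
have der0 (Z V : 'rV[R]_m -> 'rV[R]_m) : smooth_rv_on A Z ->
    (forall y, A y -> th y 1%N (Z y) = 0) ->
    \sum_l Z x 0 l * 'D_(V x) (fun y => th y 1%N 'e_l) x =
    - \sum_l th x 1%N 'e_l * 'D_(V x) (fun y => Z y 0 l) x.
  move=> sZ Z0; apply/eqP; rewrite -subr_eq0 opprK -big_split /=.
  have [_ E] := @derive_bigsum _ _ _ (index_enum 'I_m) xpredT
    (fun l y => Z y 0 l * th y 1%N 'e_l) (V x) x (fun l => difM (dc Z l sZ) (dt l)).
  apply/eqP; transitivity ('D_(V x) (fun y => \sum_l Z y 0 l * th y 1%N 'e_l) x).
    by rewrite E; apply: eq_bigr => l _; rewrite derM //; exact: dc.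
  rewrite (near_eq_derive (g := fun=> 0)) ?der_cst //; apply: (open_near oA Ax) => y Ay.
  by rewrite -eform1_sum ?Z0 //; exact: ath.
have E (u v : 'rV[R]_m) : 'D_u (fun y => th y 1%N v) x = \sum_l v 0 l * 'D_u (fun y => th y 1%N 'e_l) x.
  have [_ E] := @derive_bigsum _ _ _ (index_enum 'I_m) xpredT
    (fun l y => v 0 l * th y 1%N 'e_l) u x (fun l => difM (dif_cst (v 0 l) x) (dt l)).
  transitivity ('D_u (fun y => \sum_l v 0 l * th y 1%N 'e_l) x).
    apply: near_eq_derive; apply: (open_near oA Ax) => y Ay.
    by rewrite -eform1_sum //; exact: ath.
  by rewrite E; apply: eq_bigr => l _; rewrite derZ.
rewrite ext_d2 !E (der0 Y X) // (der0 X Y) // (eform1_sum _ (ath _ Ax)) opprK addrC -sumrB -sumrN.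
apply: eq_bigr => l _; rewrite cbracket_coor; first by ring.
- exact: smooth_rv_diff sX Ax.
- exact: smooth_rv_diff sY Ax.
Qed.

End CartanFormula.

(** * Frames adapted to a Lagrangian contact structure *)

Section AdaptedFrame.
Context {R : realType} (n : nat).
Notation dM := (n.*2.+1).
Notation e i := (fd (inl i)).
Notation f i := (fd (inr i)).
Notation T := (@fT n).

(** Gathers what the prolongation asks of a frame: the bracket normalisations [lf_ee], [lf_ff],
    [lf_ef], and, in view of [compatible], the coefficients that vanish on each of the two
    bundles. *)
Record lag_frame (D E1 E2 : 'rV[R]_dM -> 'rV[R]_dM -> Prop) (A : set 'rV[R]_dM)
    (W : fidx n -> 'rV[R]_dM -> 'rV[R]_dM) (lam : fidx n -> 'rV[R]_dM -> 'cV[R]_dM) : Prop :=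
  LagFrame {
  lf_open : open A;
  lf_smooth : forall a, smooth_rv_on A (W a);
  lf_lam : forall d i, smooth_on A (fun x => lam d x i 0);
  lf_dual : forall b d x, A x -> coef (lam d) x (W b x) = (b == d)%:R;
  lf_span : forall x u, A x -> u = \sum_d coef (lam d) x u *: W d x;
  lf_ee : forall i j x, A x -> brcoef lam (W (e i)) (W (e j)) T x = 0;
  lf_ff : forall i j x, A x -> brcoef lam (W (f i)) (W (f j)) T x = 0;
  lf_ef : forall i j x, A x -> brcoef lam (W (e i)) (W (f j)) T x = (i == j)%:R;
  lf_E1 : forall i x, A x -> E1 x (W (e i) x);
  lf_E2 : forall i x, A x -> E2 x (W (f i) x);
  lf_coef1 : forall i x u, A x -> E1 x u -> coef (lam (f i)) x u = 0 /\ coef (lam T) x u = 0;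
  lf_coef2 : forall i x u, A x -> E2 x u -> coef (lam (e i)) x u = 0 /\ coef (lam T) x u = 0
}.

Variables (M : premanifold R dM) (D E1 E2 : plane_field M).
Hypotheses (hM : is_manifold M) (hD : contact_structure D) (hL : lagrangian_pair D E1 E2).

Lemma eform2_bilinear (B : eform R dM) : alternating B ->
  (forall (a : R) (u w v : 'rV[R]_dM), B 2%N (col_mx (a *: u + w) v) = a * B 2%N (col_mx u v) + B 2%N (col_mx w v)) /\
  (forall u v : 'rV[R]_dM, B 2%N (col_mx u v) = - B 2%N (col_mx v u)).
Proof.
move=> aB; have lin (a : R) (u w v : 'rV[R]_dM) : B 2%N (col_mx (a *: u + w) v) =
    a * B 2%N (col_mx u v) + B 2%N (col_mx w v).
  by have := congr1 (fun h : eform R dM => h 1%N v) (alt_ext_lin a u w aB).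
split=> // u v; have sq (w : 'rV[R]_dM) : B 2%N (col_mx w w) = 0.
  apply: ((aB 2%N).2 ord0 (lift ord0 ord0)) => //.
  rewrite (row0_col_mx w w) (rowS_col_mx w w ord0).
  by apply/rowP => j; rewrite !mxE.
have linr (w a b : 'rV[R]_dM) : B 2%N (col_mx w (a + b)) = B 2%N (col_mx w a) + B 2%N (col_mx w b).
  have aw := alternating_ector w aB.
  have := eform1_sum (a + b) aw; rewrite /ector => ->.
  have := eform1_sum a aw; rewrite /ector => ->.
  have := eform1_sum b aw; rewrite /ector => ->.
  by rewrite -big_split; apply: eq_bigr => l _ /=; rewrite mxE mulrDl.
have := lin 1 u v (u + v); rewrite scale1r mul1r sq !linr !sq add0r addr0 => /esym/eqP.
by rewrite addr_eq0 => /eqP.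
Qed.

Lemma lag_frame_exists (c : chart M) p : cran c p ->
  exists A W lam, [/\ A (crd c p), A `<=` cdom M c &
    lag_frame (hat c D) (hat c E1) (hat c E2) A W lam].
Proof.
move=> cp; have [b1 b2 i1 i2 hDE] := hL.
have [U1 [X1 [oU1 U1p sX1 fX1]]] := frame_chart hM b1 cp.
have [U2 [X2 [oU2 U2p sX2 fX2]]] := frame_chart hM b2 cp.
have [U3 [theta [U3p ct]]] := hD.2 p; have [oU3 st _ tD] := ct.
have [stc tP] := contact_form_chart hM hD c ct.
set x0 := crd c p; set th := frep c theta in stc tP.
pose A0 := cpre c U1 `&` (cpre c U2 `&` cpre c U3).
have oA0 : open A0 by apply: openI; [exact: oU1|apply: openI; [exact: oU2|exact: oU3]].
have A0x0 : A0 x0 by split; [|split]; exact: cpre_crd.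
have [_ _ [u0 u00]] := tP x0 A0x0.2.2.
pose A := A0 `&` [set x | th x 1%N u0 != 0].
have oA : open A.
  by apply: open_nonzero => // x [_ [_ A3]]; exact: smooth_on_diff (stc.2 _ _) A3.
have Ax0 : A x0 by split.
have A1 x : A x -> cpre c U1 x by case=> [[]].
have A2 x : A x -> cpre c U2 x by case=> [[_ []]].
have A3 x : A x -> cpre c U3 x by case=> [[_ []]].
have sth : sform A th by apply: sform_sub stc => x; exact: A3.
pose E i := vrep c (X1 i); pose G i := vrep c (X2 i).
have sE i : smooth_rv_on A (E i) by move=> j; apply: smooth_on_sub (sX1 i j) => x; exact: A1.
have sG i : smooth_rv_on A (G i) by move=> j; apply: smooth_on_sub (sX2 i j) => x; exact: A2.
pose B x := ext_d th x.
have sB : sform A B by exact: sform_ext_d.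
have Bl x (Ax : A x) := (eform2_bilinear (sB.1 x Ax)).1.
have Ba x (Ax : A x) := (eform2_bilinear (sB.1 x Ax)).2.
have BE x (u v : 'rV[R]_dM) : A x -> B x 2%N (col_mx u v) = extd theta (par M c x) 2%N
    (col_mx (u *m of_chart c (par M c x)) (v *m of_chart c (par M c x))).
  by move=> Ax; rewrite /B -(frep_extd hM oU3 st (A3 _ Ax)) /frep (mul_col_mx u v).
have hatD x u : A x -> hat c D x u <-> th x 1%N u = 0 by move=> Ax; have [_ h _] := tP x (A3 _ Ax).
have ED x u : A x -> hat c E1 x u \/ hat c E2 x u -> th x 1%N u = 0.
  move=> Ax Eu; apply/(hatD x u Ax); move: Eu.
  by rewrite /hat -(hDE _).1 => -[]; apply/subvP; [exact: addvSl|exact: addvSr].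
have B11 x (u v : 'rV[R]_dM) : A x -> hat c E1 x u -> hat c E1 x v -> B x 2%N (col_mx u v) = 0.
  by move=> Ax u1 v1; rewrite BE //; exact: i1 ct _ (A3 _ Ax).2 _ _ u1 v1.
have B22 x (u v : 'rV[R]_dM) : A x -> hat c E2 x u -> hat c E2 x v -> B x 2%N (col_mx u v) = 0.
  by move=> Ax u1 v1; rewrite BE //; exact: i2 ct _ (A3 _ Ax).2 _ _ u1 v1.
have toof x (u : 'rV[R]_dM) : A x -> u *m to_chart c (par M c x) *m of_chart c (par M c x) = u.
  by move=> Ax; rewrite -mulmxA (to_of_chart hM (cran_par (A1 _ Ax).1)) mulmx1.
have ofto x (u : 'rV[R]_dM) : A x -> u *m of_chart c (par M c x) *m to_chart c (par M c x) = u.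
  by move=> Ax; rewrite -mulmxA (of_to_chart1 hM (cran_par (A1 _ Ax).1)) mulmx1.
have hE i x : A x -> hat c E1 x (E i x) by move=> Ax; have [h _ _] := fX1 x (A1 _ Ax); exact: h.
have hG i x : A x -> hat c E2 x (G i x) by move=> Ax; have [h _ _] := fX2 x (A2 _ Ax); exact: h.
have hat_sum (F : plane_field M) x (k : 'I_n -> R) (Z : 'I_n -> 'rV[R]_dM) :
    (forall i, hat c F x (Z i)) -> hat c F x (\sum_i k i *: Z i).
  move=> H; rewrite /hat mulmx_suml; apply: memv_suml => i _.
  by rewrite -scalemxAl; apply: memvZ; exact: H.
have nondeg x (u : 'rV[R]_dM) : A x -> th x 1%N u = 0 ->
    (forall v : 'rV[R]_dM, th x 1%N v = 0 -> B x 2%N (col_mx u v) = 0) -> u = 0.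
  move=> Ax u_0 H; rewrite -[u](ofto x) //.
  suff -> : u *m of_chart c (par M c x) = 0 by rewrite mul0mx.
  apply: (tD _ (A3 _ Ax).2).2; first exact/(hatD x u Ax).
  move=> v vD; rewrite -[v](toof x) // -BE //; apply: H; apply/(hatD x _ Ax).
  by rewrite /hat toof.
have Bsuml x (k : 'I_n -> R) (Z : 'I_n -> 'rV[R]_dM) (v : 'rV[R]_dM) : A x ->
    B x 2%N (col_mx (\sum_i k i *: Z i) v) = \sum_i k i * B x 2%N (col_mx (Z i) v).
  move=> Ax; elim/big_ind2: _ => [|y1 u1 y2 u2 <- <-|i _].
  - by have := Bl x Ax (-1) 0 0 v; rewrite scaler0 addr0 mulN1r addNr.
  - by have := Bl x Ax 1 u1 u2 v; rewrite scale1r mul1r.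
  - have := Bl x Ax (k i) (Z i) 0 v; rewrite addr0 => ->.
    by have := Bl x Ax (-1) 0 0 v; rewrite scaler0 addr0 mulN1r addNr => ->; rewrite addr0.
(* The matrix of d theta between frames of the two bundles. A vector in its left kernel gives a
   vector of [E1] orthogonal to [E2], and to [E1] by isotropy, hence 0 by nondegeneracy; so the
   matrix is invertible. *)
pose Gm x : 'M[R]_n := \matrix_(i, j) B x 2%N (col_mx (E i x) (G j x)).
have GU x : A x -> Gm x \in unitmx.
  move=> Ax; rewrite -row_free_unit; apply: inj_row_free => k k0.
  have [_ fE _] := fX1 x (A1 _ Ax); have := (row_free_rows _).1 fE (fun i => k 0 i) _ => H.
  apply/rowP => i; rewrite mxE; apply: H; apply: (nondeg x) => // [|v v_0].
    by apply: ED => //; left; apply: hat_sum => j; exact: hE.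
  have /memv_addP[a aE [b bE vab]] : v *m of_chart c (par M c x) \in (E1 (par M c x) + E2 (par M c x))%VS.
    by rewrite (hDE _).1; apply/(hatD x v Ax).
  have vE : v = a *m to_chart c (par M c x) + b *m to_chart c (par M c x).
    by rewrite -mulmxDl -vab ofto.
  have [_ _ /(_ (b *m to_chart c (par M c x)))] := fX2 x (A2 _ Ax); rewrite /hat toof // => /(_ bE)[kb bk].
  rewrite vE Ba // -[a *m _]scale1r Bl // mul1r bk Bsuml // [X in _ + X]big1 => [|j _].
    rewrite addr0 Ba // opprK B11 //; last by rewrite /hat toof.
    by apply: hat_sum => j; exact: hE.
  rewrite Ba // Bsuml //; suff -> : \sum_i k 0 i * B x 2%N (col_mx (vrep c (X1 i) x) (vrep c (X2 j) x)) = 0.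
    by rewrite oppr0 mulr0.
  have := congr1 (fun w : 'rV[R]_n => w 0 j) k0; rewrite !mxE => {2}<-.
  by apply: eq_bigr => l _; rewrite mxE.
have sGm i j : smooth_on A (fun x => Gm x i j).
  apply: (smooth_on_ext oA (f := fun x => B x 2%N (col_mx (E i x) (G j x)))) => [x _|]; first by rewrite mxE.
  apply: smooth_on_eval => // l k.
  have [l' ->|l' ->] := @split_ordP 1 1 l.
    apply: (smooth_on_ext oA (f := fun x => E i x 0 k)) => [x _|]; last exact: sE.
    by apply: etrans (esym (col_mxEu (E i x) (G j x) l' k)); rewrite [l']ord1.
  apply: (smooth_on_ext oA (f := fun x => G j x 0 k)) => [x _|]; last exact: sG.
  by apply: etrans (esym (col_mxEd (E i x) (G j x) l' k)); rewrite [l']ord1.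
(* the dual frame is chosen so that theta [e_i, f_j] = delta_ij *)
pose F j x := \sum_k (- invmx (Gm x) k j) *: G k x.
have sF j : smooth_rv_on A (F j).
  move=> l; apply: (smooth_on_ext oA (f := fun x => \sum_k (- invmx (Gm x) k j) * G k x 0 l)).
    by move=> x _; apply: esym; rewrite /F summxE; apply: eq_bigr => k _; rewrite mxE.
  apply: smooth_on_sum => // k _; apply: smooth_onM => //; last exact: sG.
  by apply: smooth_onN => //; exact: smooth_on_invmx.
have hF j x : A x -> hat c E2 x (F j x) by move=> Ax; apply: hat_sum => k; exact: hG.
(* Scaled so that theta is 1 on it; as the other fields lie in the kernel, the coefficient along T
   is theta itself. *)
pose Tf x := (th x 1%N u0)^-1 *: u0.
have sT : smooth_rv_on A Tf.
  move=> l; apply: (smooth_on_ext oA (f := fun x => (th x 1%N u0)^-1 * u0 0 l)).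
    by move=> x _; rewrite mxE.
  apply: smooth_onM => //; last exact: smooth_on_cst.
  apply: (smooth_onV oA); last exact: (sth.2 1%N u0).
  by move=> x [_ h]; exact: h.
pose W (a : fidx n) := match a with inl (inl i) => E i | inl (inr i) => F i | inr _ => Tf end.
have sW a : smooth_rv_on A (W a) by case: a => [[i|i]|[]]; [exact: sE|exact: sF|exact: sT].
have thL x : A x -> forall (a : R) u v, th x 1%N (a *: u + v) = a * th x 1%N u + th x 1%N v.
  move=> Ax a u v; rewrite !(eform1_sum _ (sth.1 x Ax)) mulr_sumr -big_split.
  by apply: eq_bigr => l _ /=; rewrite !mxE mulrDl mulrA.
have th0 x : A x -> th x 1%N 0 = 0.
  by move=> Ax; have := thL x Ax (-1) 0 0; rewrite scaler0 addr0 mulN1r addNr.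
have thsum x (I : finType) (k : I -> R) (Z : I -> 'rV[R]_dM) : A x ->
    th x 1%N (\sum_i k i *: Z i) = \sum_i k i * th x 1%N (Z i).
  move=> Ax; elim/big_ind2: _ => [|y1 u1 y2 u2 <- <-|i _]; first exact: th0.
  - by have := thL x Ax 1 u1 u2; rewrite scale1r mul1r.
  - by have := thL x Ax (k i) (Z i) 0; rewrite addr0 => ->; rewrite th0 // addr0.
have thE i x : A x -> th x 1%N (E i x) = 0 by move=> Ax; apply: ED => //; left; exact: hE.
have thF i x : A x -> th x 1%N (F i x) = 0 by move=> Ax; apply: ED => //; right; exact: hF.
have thT x : A x -> th x 1%N (Tf x) = 1.
  move=> Ax; have := thL x Ax (th x 1%N u0)^-1 u0 0; rewrite addr0 (th0 x Ax) addr0 => E1'.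
  by apply: (etrans E1'); apply: mulVf; have [_ h] := Ax; exact: h.
have thW x (k : fidx n -> R) : A x -> th x 1%N (\sum_d k d *: W d x) = k T.
  move=> Ax; rewrite thsum // big_fidx big_sumType /= !big1 ?addr0 ?add0r => [|i _|i _].
  - by rewrite thT // mulr1.
  - by rewrite thF // mulr0.
  - by rewrite thE // mulr0.
have fW x : A x -> forall k : fidx n -> R, \sum_d k d *: W d x = 0 -> forall d, k d = 0.
  move=> Ax k k0; have kT : k T = 0 by rewrite -(thW x) // k0 th0.
  have := k0; rewrite big_fidx big_sumType /= kT scale0r addr0 => /eqP.
  rewrite addr_eq0 => /eqP kEF.
  have zE : \sum_i k (e i) *: E i x = 0.
    rewrite -[LHS](ofto x) //; set z := _ *m of_chart _ _.
    suff -> : z = 0 by rewrite mul0mx.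
    apply/eqP; rewrite -memv0 -(hDE (par M c x)).2 memv_cap; apply/andP; split.
      by apply: (hat_sum E1) => i; exact: hE.
    rewrite /z kEF mulNmx memvN; apply: (hat_sum E2) => i; exact: hF.
  have zF : \sum_i k (f i) *: F i x = 0 by apply/eqP; rewrite -oppr_eq0 -kEF zE.
  have [_ fE _] := fX1 x (A1 _ Ax); have [_ fG _] := fX2 x (A2 _ Ax).
  have kE := (row_free_rows _).1 fE _ zE.
  have kF : forall i, k (f i) = 0.
    have : \sum_l (\sum_i k (f i) * - invmx (Gm x) l i) *: G l x = 0.
      rewrite -[RHS]zF; under eq_bigr do rewrite scaler_suml.
      rewrite exchange_big; apply: eq_bigr => i _; rewrite /F scaler_sumr.
      by apply: eq_bigr => l _; rewrite scalerA.
    move/((row_free_rows _).1 fG) => H.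
    have : invmx (Gm x) *m (\col_i k (f i)) = 0.
      apply/colP => l; rewrite !mxE; apply/eqP; rewrite -oppr_eq0 -sumrN; apply/eqP.
      rewrite -[RHS](H l); apply: eq_bigr => i _; rewrite mxE; ring.
    move/(congr1 (mulmx (Gm x))); rewrite mulmxA mulmxV ?GU // mul1mx mulmx0 => H0 i.
    by have := congr1 (fun w : 'cV[R]_n => w i 0) H0; rewrite !mxE.
  by move=> [[i|i]|[]]; [exact: kE|exact: kF|exact: kT].
have cI : #|fidx n| = dM by rewrite !card_sum card_unit card_ord; lia.
have [lam [slam dual span]] := dual_frame cI oA sW fW.
have lamT x u : A x -> coef (lam T) x u = th x 1%N u.
  by move=> Ax; rewrite {2}(span x u Ax) thW.
have coefs (k : fidx n -> R) x d : A x -> coef (lam d) x (\sum_b k b *: W b x) = k d.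
  move=> Ax; rewrite /coef mulmx_suml summxE (bigD1 d) //= -scalemxAl mxE -/(coef _ _ _) dual // eqxx mulr1.
  rewrite big1 ?addr0 // => b /negbTE bd.
  by rewrite -scalemxAl mxE -/(coef _ _ _) dual // bd mulr0.
have coefsum (Z : 'I_n -> 'rV[R]_dM) (k : 'I_n -> R) x d : A x ->
    (forall i, coef (lam d) x (Z i) = 0) -> coef (lam d) x (\sum_i k i *: Z i) = 0.
  move=> Ax H; rewrite /coef mulmx_suml summxE big1 // => i _.
  by rewrite -scalemxAl mxE -/(coef _ _ _) H mulr0.
have brT X Y x : smooth_rv_on A X -> smooth_rv_on A Y -> (forall y, A y -> th y 1%N (X y) = 0) ->
    (forall y, A y -> th y 1%N (Y y) = 0) -> A x ->
    brcoef lam X Y T x = - B x 2%N (col_mx (X x) (Y x)).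
  by move=> sX sY X0 Y0 Ax; rewrite /brcoef lamT // /B (ext_d2_bracket oA) // opprK.
exists A, W, lam; split; [exact: Ax0|by move=> x /A1[]|].
split; [exact: oA|exact: sW|exact: slam|exact: dual|exact: span|..].
- move=> i j x Ax; rewrite (brT _ _ _ (sE i) (sE j) (thE i) (thE j) Ax).
  by rewrite (B11 _ _ _ Ax (hE i x Ax) (hE j x Ax)) oppr0.
- move=> i j x Ax; rewrite (brT _ _ _ (sF i) (sF j) (thF i) (thF j) Ax).
  by rewrite (B22 _ _ _ Ax (hF i x Ax) (hF j x Ax)) oppr0.
- move=> i j x Ax; rewrite (brT _ _ _ (sE i) (sF j) (thE i) (thF j) Ax).
  rewrite Ba; last exact: Ax.
  rewrite opprK /F Bsuml; last exact: Ax.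
  have := congr1 (fun w : 'M[R]_n => w i j) (mulmxV (GU x Ax)); rewrite !mxE => <-.
  by apply: eq_bigr => k _; rewrite Ba ?mxE; [ring|exact: Ax].
- by move=> i x Ax; exact: hE.
- by move=> i x Ax; exact: hF.
- move=> i x u Ax hu; rewrite (lamT x u Ax) (ED x u Ax); last by left.
  split; last by []. have [_ _ /(_ u hu)[k ->]] := fX1 x (A1 _ Ax).
  by apply: (coefsum _ _ _ _ Ax) => j; exact: (dual (e j) (f i) x Ax).
- move=> i x u Ax hu; rewrite (lamT x u Ax) (ED x u Ax); last by right.
  split; last by []. have [_ _ /(_ u hu)[k ->]] := fX2 x (A2 _ Ax).
  apply: (coefsum _ _ _ _ Ax) => j.
  (* Vectors of [E2] are known in the original frame [G]; multiplying by [Gm] recovers [G] from the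
     normalised frame. *)
  have -> : vrep c (X2 j) x = \sum_l (- Gm x l j) *: W (f l) x.
    transitivity (\sum_k (invmx (Gm x) *m Gm x) k j *: G k x).
      rewrite (mulVmx (GU x Ax)) (bigD1 j) //= mxE eqxx scale1r big1 ?addr0 // => k' kj.
      by rewrite mxE (negbTE kj) scale0r.
    transitivity (\sum_k \sum_l (invmx (Gm x) k l * Gm x l j) *: G k x).
      by apply: eq_bigr => k' _; rewrite mxE scaler_suml.
    rewrite exchange_big; apply: eq_bigr => l _; rewrite /= /F scaler_sumr.
    by apply: eq_bigr => k' _; rewrite scalerA mulrNN mulrC.
  by apply: (coefsum _ _ _ _ Ax) => l; exact: (dual (f l) (e i) x Ax).
Qed.

End AdaptedFrame.

(** * The dimension bound for germs of infinitesimal automorphisms *)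

Section AutomorphismBound.
Context {R : realType} (n : nat).
Notation dM := (n.*2.+1).
Notation e i := (fd (inl i)).
Notation f i := (fd (inr i)).

Lemma near_eq_cbracket m (A : set 'rV[R]_m) (X Y F : 'rV[R]_m -> 'rV[R]_m) x :
  open A -> A x -> (forall y, A y -> Y y = F y) -> cbracket X Y x = cbracket X F x.
Proof.
move=> oA Ax YF; rewrite /cbracket (YF _ Ax); congr (_ - _).
by apply: near_eq_derive; exact: open_near YF.
Qed.

Section Compatible.
Variables (M : premanifold R dM) (hM : is_manifold M).

Lemma vrepK (c : chart M) (Z : vfield M) x : cdom M c x ->
  vrep c Z x *m of_chart c (par M c x) = Z (par M c x).
Proof. by move=> dx; rewrite /vrep -mulmxA (to_of_chart hM (cran_par dx)) mulmx1. Qed.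

Definition preserves (U : set M) (X : vfield M) (E : plane_field M) :=
  forall (V : set M) (Y : vfield M), mopen V -> V `<=` U -> section_on V E Y ->
  forall q, V q -> bracket X Y q \in E q.

(** Preservation is stated for sections over open subsets of the manifold; the coordinate field [F]
    is made into such a section over the image of [A]. *)
Lemma hat_bracket (c : chart M) (E : plane_field M) (U : set M) (X : vfield M)
    (A : set 'rV[R]_dM) (F : 'rV[R]_dM -> 'rV[R]_dM) x :
  mopen U -> smooth_vf U X -> preserves U X E -> open A -> A `<=` cpre c U ->
  smooth_rv_on A F -> (forall y, A y -> hat c E y (F y)) -> A x ->
  hat c E x (cbracket (vrep c X) F x).
Proof.
move=> oU sX pX oA AU sF hF Ax.
have Ad : A `<=` cdom M c by move=> y /AU[].
pose V := par M c @` A.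
have oV : mopen V by exact: mopen_par.
have Vc : V `<=` cran c by move=> _ [y Ay <-]; exact/cran_par/Ad.
pose Y : vfield M := fun q => F (crd c q) *m of_chart c q.
have cpV y : cpre c V y -> A y.
  by move=> [dy [z Az zy]]; have := crdK hM dy; rewrite -zy (crdK hM (Ad _ Az)) => <-.
have YE y : A y -> vrep c Y y = F y.
  move=> Ay; rewrite /vrep /Y (crdK hM (Ad _ Ay)) -mulmxA.
  by rewrite (of_to_chart1 hM (cran_par (Ad _ Ay))) mulmx1.
have sY : smooth_rv_on (cpre c V) (vrep c Y).
  apply: (smooth_rv_ext (oV c) (f := F)) => [y /cpV/YE ->//|].
  by move=> j; apply: smooth_on_sub (sF j) => y /cpV.
have secY : section_on V E Y.
  split; first exact: smooth_vf_chart sY.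
  move=> q [y Ay <-]; rewrite -(vrepK Y (Ad _ Ay)) YE //; exact: hF.
have VU : V `<=` U by move=> _ [y Ay <-]; exact: (AU _ Ay).2.
have Vx : V (par M c x) by exists x.
have := pX V Y oV VU secY _ Vx.
have cx : cpre c V x by split => //; exact: Ad.
rewrite -(vrepK _ (Ad _ Ax)) (vrep_bracket hM oV _ _ cx).
- rewrite /hat; suff -> : cbracket (vrep c X) (vrep c Y) x = cbracket (vrep c X) F x by [].
  exact: near_eq_cbracket oA Ax YE.
- by move=> c' j; apply: smooth_on_sub (sX c' j) => y [dy /VU].
- exact: secY.1.
Qed.

Lemma mopen_smooth_sub (U V : set M) (X : vfield M) : V `<=` U -> smooth_vf U X -> smooth_vf V X.
Proof. by move=> VU sX c j; apply: smooth_on_sub (sX c j) => y [dy /VU]. Qed.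

Lemma near_pt_chart (c : chart M) p (Q : M -> Prop) : cran c p ->
  (\forall x \near crd c p, cdom M c x -> Q (par M c x)) -> near_pt p Q.
Proof.
move=> cp nQ.
have [dp pp] := parK cp.
pose O := interior [set x | cdom M c x -> Q (par M c x)] `&` cdom M c.
have oO : open O by apply: openI; [exact: open_interior|exact: cdom_open].
exists (par M c @` O); split.
- by apply: mopen_par => // y [].
- by exists (crd c p).
- by move=> _ [y [/interior_subset + dy] <-]; apply.
Qed.

End Compatible.

Variables (M : premanifold R dM) (D E1 E2 : plane_field M).
Hypotheses (hM : is_manifold M) (hD : contact_structure D) (hL : lagrangian_pair D E1 E2).
Hypothesis n_gt0 : (0 < n)%N.

Definition lag_preserving p (X : vfield M) := exists U : set M,
  [/\ mopen U, U p, smooth_vf U X, preserves U X E1 & preserves U X E2].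

Lemma germs_dependent p r (X : 'I_r -> vfield M) : ((n + 2) ^ 2 - 1 < r)%N ->
  (forall k, lag_preserving p (X k)) ->
  exists a : 'I_r -> R, (exists k, a k != 0) /\ near_pt p (fun q => \sum_k a k *: X k q = 0).
Proof.
rewrite -card_jidx => Nr /choice[U UP].
set c := chart_at M p; have cp : cran c p by exact: cran_at.
have [A [W [lam [Ax0 Ad lf]]]] := lag_frame_exists hM hD hL cp.
set x0 := crd c p in Ax0.
(* Finitely many germs have a common domain; its interior provides an open one. *)
pose Z := [set x | forall k, cpre c (U k) x].
have nZ : nbhs x0 Z.
  apply: (filter_forall (f := fun k => cpre c (U k)) (nbhs_filter x0)) => k.
  have [oU Up _ _ _] := UP k.
  by apply: open_nbhs_nbhs; split; [exact: oU|exact: cpre_crd].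
pose B := A `&` interior Z.
have oB : open B by apply: openI; [exact: lf_open lf|exact: open_interior].
have Bx0 : B x0 by split.
have BA : B `<=` A by move=> x [].
have BU k : B `<=` cpre c (U k) by move=> x [_ /interior_subset]; exact.
have sW a : smooth_rv_on B (W a) by move=> j; apply: smooth_on_sub (lf_smooth lf a j).
have sl d i : smooth_on B (fun x => lam d x i 0) by apply: smooth_on_sub (lf_lam lf d i).
have sV k : smooth_rv_on B (vrep c (X k)).
  by have [_ _ sX _ _] := UP k; move=> j; apply: smooth_on_sub (sX c j); exact: BU.
have cV k : compatible B W lam (vrep c (X k)).
  have [oU _ sX p1 p2] := UP k; move=> i j x Bx.
  have h1 : hat c E1 x (cbracket (vrep c (X k)) (W (e i)) x).
    apply: (hat_bracket hM oU sX p1 oB (BU k) (sW _) _ Bx) => y /BA Ay; exact: (lf_E1 lf).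
  have h2 : hat c E2 x (cbracket (vrep c (X k)) (W (f i)) x).
    apply: (hat_bracket hM oU sX p2 oB (BU k) (sW _) _ Bx) => y /BA Ay; exact: (lf_E2 lf).
  have [a1 a2] := lf_coef1 lf j (BA _ Bx) h1; have [b1 b2] := lf_coef2 lf j (BA _ Bx) h2.
  by split; [exact: a1|exact: a2|exact: b1|exact: b2].
have [a [a0 H]] := @fields_dependent _ _ _ B x0 W lam n_gt0 oB Bx0 sW sl
  (fun b d x Bx => lf_dual lf b d (BA _ Bx)) (fun x u Bx => lf_span lf u (BA _ Bx))
  (fun i j x Bx => lf_ee lf i j (BA _ Bx)) (fun i j x Bx => lf_ff lf i j (BA _ Bx))
  (fun i j x Bx => lf_ef lf i j (BA _ Bx)) r (fun k => vrep c (X k)) sV cV Nr.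
exists a; split=> //; apply: (near_pt_chart hM cp); apply: filterS H => x H dx.
have := congr1 (mulmx^~ (of_chart c (par M c x))) H; rewrite mul0mx mulmx_suml => H'.
by apply: etrans H'; apply: eq_bigr => k _; rewrite -scalemxAl vrepK.
Qed.

End AutomorphismBound.

Section AutomorphismDim.
Context {R : realType} (n : nat) (S : lag_system R n).
Hypotheses (hS : decomposable_MA_system S) (n_gt0 : (0 < n)%N).

Definition germ_free (p : S) r (X : 'I_r -> vfield S) := forall a : 'I_r -> R,
  near_pt p (fun q => \sum_i a i *: X i q = 0) -> forall i, a i = 0.

Lemma near_ptW (p : S) (P Q : S -> Prop) : (forall q, P q -> Q q) -> near_pt p P -> near_pt p Q.
Proof. by move=> PQ [U [oU Up PU]]; exists U; split=> // q /PU/PQ. Qed.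

Lemma germ_free_bound (p : S) r (X : 'I_r -> vfield S) :
  (forall i, inf_automorphism_at p (X i)) -> germ_free p X -> (r <= (n + 2) ^ 2 - 1)%N.
Proof.
move=> aX fX; case: hS => hM hD hL _ _; rewrite leqNgt; apply/negP => Nr.
have [i|a [[k ak] /fX a0]] := germs_dependent (p := p) hM hD hL n_gt0 Nr (X := X).
  have [U [oU Up [sX [_ p1 p2 _]]]] := aX i.
  by exists U; split; [exact: oU|exact: Up|exact: sX|exact: p1|exact: p2].
by move: ak; rewrite a0 eqxx.
Qed.

(** In a nontrivial relation between the family and [Y] the coefficient of [Y] cannot be 0, and
    dividing by it expresses [Y]. *)
Lemma germ_free_basis (p : S) r (X : 'I_r -> vfield S) :
  (forall i, inf_automorphism_at p (X i)) -> germ_free p X ->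
  (forall X' : 'I_r.+1 -> vfield S, (forall i, inf_automorphism_at p (X' i)) -> ~ germ_free p X') ->
  automorphism_dim p r.
Proof.
move=> aX fX max; exists X; split=> // Y aY.
pose X' (i : 'I_r.+1) := if unlift ord_max i is Some j then X j else Y.
have XY (a : 'I_r.+1 -> R) q : \sum_i a i *: X' i q =
    \sum_(i < r) a (widen_ord (leqnSn r) i) *: X i q + a ord_max *: Y q.
  rewrite big_ord_recr /= {2}/X' unlift_none; congr (_ + _); apply: eq_bigr => i _.
  have -> : widen_ord (leqnSn r) i = lift ord_max i by apply: val_inj; rewrite /= /bump leqNgt ltn_ord.
  by rewrite /X' liftK.
have aX' i : inf_automorphism_at p (X' i) by rewrite /X'; case: unlift => [j|].
have /existsNP[a /not_implyP[na /existsNP[i ai]]] := max X' aX'.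
have aY0 : a ord_max != 0.
  apply/eqP => a0; apply: ai; have na' : near_pt p (fun q => \sum_(i < r) a (widen_ord (leqnSn r) i) *: X i q = 0).
    by apply: near_ptW na => q; rewrite XY a0 scale0r addr0.
  have {na'} := fX _ na'; case: (unliftP ord_max i) => [j ->|-> //].
  have -> : lift ord_max j = widen_ord (leqnSn r) j by apply: val_inj; rewrite /= /bump leqNgt ltn_ord.
  exact.
exists (fun i => - (a ord_max)^-1 * a (widen_ord (leqnSn r) i)).
apply: near_ptW na => q; rewrite XY => /eqP; rewrite addrC addr_eq0 => /eqP H.
rewrite -[Y q]scale1r -(mulVf aY0) -scalerA H scalerN -scaleNr scaler_sumr.
by apply: eq_bigr => j _; rewrite scalerA.
Qed.

(** Independent families have bounded size, so one of maximal size exists and is a basis; finiteness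
    of the dimension and the bound come together. *)
Lemma automorphism_dim_bounded (p : S) :
  exists d, automorphism_dim p d /\ (d <= (n + 2) ^ 2 - 1)%N.
Proof.
pose P r := exists X : 'I_r -> vfield S, (forall i, inf_automorphism_at p (X i)) /\ germ_free p X.
have exP : exists r, `[< P r >].
  by exists 0%N; apply/asboolP; exists (fun=> fun=> 0); split=> [[]|a _ []].
have bP r : `[< P r >] -> (r <= (n + 2) ^ 2 - 1)%N.
  by move=> /asboolP[X [aX fX]]; exact: germ_free_bound aX fX.
case: (ex_maxnP exP bP) => r /asboolP[X [aX fX]] max; exists r; split.
  apply: germ_free_basis aX fX _ => X' aX' fX'.
  by have := max r.+1; rewrite ltnn => H; apply/notF/H/asboolP; exists X'.
exact: germ_free_bound aX fX.
Qed.

Lemma automorphism_dim_max (p : S) (X : 'I_((n + 2) ^ 2 - 1) -> vfield S) :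
  (forall i, inf_automorphism_at p (X i)) -> germ_free p X -> automorphism_dim p ((n + 2) ^ 2 - 1).
Proof.
move=> aX fX; apply: germ_free_basis aX fX _ => X' aX' fX'.
by have := germ_free_bound aX' fX'; rewrite ltnn.
Qed.

End AutomorphismDim.

(** * Invariance under equivalences *)

Section Invariance.
Context {R : realType}.

Lemma cideal_pb m p (A : set 'rV[R]_m) (phi : 'rV[R]_m -> 'rV[R]_p)
    g1 g2 g3 x eta : open A -> smooth_rv_on A phi -> A x ->
  cideal g1 g2 g3 (phi x) eta -> cideal (pb phi g1) (pb phi g2) (pb phi g3) x (pb phi eta).
Proof.
move=> oA sphi Ax [W [b1 [b2 [b3 [oW Wx [s1 s2 s3] etaE]]]]].
pose Q := A `&` phi @^-1` W.
have oQ : open Q by apply: open_preimage_on => // y Ay; exact: smooth_rv_continuous sphi Ay.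
have sQ : smooth_rv_on Q phi by move=> j; apply: smooth_on_sub (sphi j) => y [].
have QW y : Q y -> W (phi y) by case.
exists Q, (pb phi b1), (pb phi b2), (pb phi b3); split=> //.
  by split; apply: (sform_pb oQ sQ QW).
by move=> y [_ Wy]; rewrite {1}/pb etaE // -!epull_wedge.
Qed.

Lemma jacobian_cancel m (A B : set 'rV[R]_m) (phi psi : 'rV[R]_m -> 'rV[R]_m) x :
  open A -> smooth_rv_on A phi -> smooth_rv_on B psi -> (forall z, A z -> B (phi z)) ->
  (forall z, A z -> psi (phi z) = z) -> A x -> jacobian phi x *m jacobian psi (phi x) = 1%:M.
Proof.
move=> oA sphi spsi AB K Ax.
have dphi : differentiable phi x by exact: smooth_rv_diff sphi Ax.
have dpsi : differentiable psi (phi x) by exact: smooth_rv_diff spsi (AB _ Ax).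
rewrite -(jacobian_comp dphi dpsi) -(jacobian_id x).
by apply: (near_eq_jacobian oA Ax) => [z Az|]; [exact: K|exact: differentiable_comp].
Qed.

Lemma pbK m (A B : set 'rV[R]_m) (phi psi : 'rV[R]_m -> 'rV[R]_m) (g : 'rV[R]_m -> eform R m) y :
  open B -> smooth_rv_on A phi -> smooth_rv_on B psi -> (forall z, B z -> A (psi z)) ->
  (forall z, B z -> phi (psi z) = z) -> B y -> pb psi (pb phi g) y = g y.
Proof.
move=> oB sphi spsi BA K By; apply: eform_ext => k v.
rewrite /pb /epull -mulmxA (jacobian_cancel oB spsi sphi BA K By) mulmx1.
by rewrite K.
Qed.

Section Diffeo.
Context {n : nat}.
Notation dM := (n.*2.+1).
Variables (S S' : premanifold R dM) (hS : is_manifold S) (hS' : is_manifold S').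
Variables (U : set S) (U' : set S') (f : S -> S') (g : S' -> S).
Hypotheses (oU : mopen U) (oU' : mopen U') (sf : smooth_map U f) (sg : smooth_map U' g)
  (fg : forall p, U p -> U' (f p) /\ g (f p) = p) (gf : forall q, U' q -> U (g q) /\ f (g q) = q).

Let dom (c : chart S) (c' : chart S') := cpre c (U `&` f @^-1` cran c').

Lemma smooth_at_diffeo (c : chart S) (c' : chart S') p : U p -> cran c p -> cran c' (f p) ->
  smooth_at f c c' p.
Proof.
move=> Up cp cp'; split=> //; have [oA sA] := sf c c'.
exists (dom c c'); split; [exact: oA|exact: cpre_crd|by move=> x [_ []]|exact: sA].
Qed.

Lemma of_chart_dmap (c : chart S) (c' : chart S') x : dom c c' x ->
  of_chart c (par S c x) *m dmap f (par S c x) =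
  jacobian (mrep f c c') x *m of_chart c' (f (par S c x)).
Proof.
move=> [dx [Up cp']]; set p := par S c x in Up cp' *.
have cp : cran c p by exact: cran_par.
have xE : crd c p = x by exact: crdK.
have ap := cran_at hS p; have ap' := cran_at hS' (f p).
have H1 := jacobian_mrep_comp (smooth_at_id hS cp ap) (smooth_at_diffeo Up ap ap').
have H2 := jacobian_mrep_comp (smooth_at_diffeo Up cp cp') (smooth_at_id hS' cp' ap').
by rewrite !of_chartE xE in H1 H2 *; exact: etrans (esym H1) H2.
Qed.

Lemma frep_pullback (c : chart S) (c' : chart S') eta x : dom c c' x ->
  frep c (pullback f eta) x = pb (mrep f c c') (frep c' eta) x.
Proof.
move=> dx; have [_ [Up cp']] := dx.
have pE : par S' c' (mrep f c c' x) = f (par S c x) := (parK cp').2.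
apply: eform_ext => k v; rewrite /frep /pullback /pb /epull pE.
have E := etrans (esym (mulmxA v _ _)) (etrans (congr1 (mulmx v) (of_chart_dmap dx)) (mulmxA v _ _)).
have E2 := congr1 (eta (f (par S c x)) k) E; exact: E2.
Qed.

End Diffeo.

(** Lets the generators of the target be pulled back to a chart of the source, where they can be
    compared with the given ones and uniqueness applies. *)
Lemma adapted_pb m n (A B : set 'rV[R]_m) (phi psi : 'rV[R]_m -> 'rV[R]_m)
    (D E1 E2 D' E1' E2' : 'rV[R]_m -> 'rV[R]_m -> Prop) theta om :
  open A -> smooth_rv_on A phi -> smooth_rv_on B psi ->
  (forall x, A x -> B (phi x)) -> (forall x, A x -> psi (phi x) = x) ->
  (forall x u, A x -> D x u <-> D' (phi x) (u *m jacobian phi x)) ->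
  (forall x u, A x -> E1 x u -> E1' (phi x) (u *m jacobian phi x)) ->
  (forall x u, A x -> E2 x u -> E2' (phi x) (u *m jacobian phi x)) ->
  adapted n B D' E1' E2' theta om ->
  adapted n A D E1 E2 (pb phi theta) (pb phi om).
Proof.
move=> oA sphi spsi AB K hD h1 h2 [[st tP] [so oP] vol].
have JU x (Ax : A x) := jacobian_cancel oA sphi spsi AB K Ax.
have JU' x : A x -> jacobian psi (phi x) *m jacobian phi x = 1%:M by move=> /JU/mulmx1C.
split; first split; first exact: (sform_pb oA sphi AB).
- move=> x Ax; have [dg tD [u0 u00]] := tP _ (AB _ Ax).
  split=> [k v k1|u|]; first exact: dg.
    by rewrite /pb /epull; apply: iff_trans (hD x u Ax) (tD _).
  by exists (u0 *m jacobian psi (phi x)); rewrite /pb /epull -mulmxA (JU' x Ax) mulmx1.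
- split; first exact: (sform_pb oA sphi AB).
  move=> x Ax; have [dg kl] := oP _ (AB _ Ax); split=> [k v kn|k v vD [i vi]]; first exact: dg.
  apply: kl => [j|]; first by rewrite row_mul; apply/(hD x _ Ax).
  by exists i; rewrite row_mul; exact: h1.
- move=> x Ax v vE fv; apply: (vol _ (AB _ Ax)); first by move=> i; rewrite row_mul; exact: h2.
  rewrite /row_free mxrankMfree //; apply/row_freeP.
  by exists (jacobian psi (phi x)); exact: JU.
Qed.

End Invariance.

(** Matrix bookkeeping for the injectivity of the differential of an equivalence: going through
    charts of both manifolds and back by the inverse Jacobian is the identity. *)
Lemma mulmx_conjK (R : pzRingType) m (z : 'rV[R]_m) (of1 to1 J J' dm of2 to2 : 'M[R]_m) :
  of1 *m dm = J *m of2 -> to1 *m of1 = 1%:M -> of2 *m to2 = 1%:M -> J *m J' = 1%:M ->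
  z *m dm *m to2 *m J' *m of1 = z.
Proof.
move=> E t1 t2 JJ; have -> : dm = to1 *m J *m of2 by rewrite -mulmxA -E mulmxA t1 mul1mx.
by rewrite -!mulmxA (mulmxA of2) t2 mul1mx (mulmxA J) JJ mul1mx t1 mulmx1.
Qed.

Section Equivalence.
Context {R : realType} (n : nat).
Notation dM := (n.*2.+1).
Variables (S S' : lag_system R n) (hS : decomposable_MA_system S) (hS' : decomposable_MA_system S').

(** In one chart around [q] the pulled-back generators and those of the source generate the same
    ideal. The converse implication pulls the membership back once more, by the inverse coordinate
    map, and the two pull-backs cancel. *)
Lemma equivalence_system (U : set S) (U' : set S') (f : S -> S') :
  diffeo U U' f -> maps_to U f (Dist S) (Dist S') -> maps_to U f (Lag1 S) (Lag1 S') ->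
  maps_to U f (Lag2 S) (Lag2 S') ->
  forall q, U q -> forall eta : dform S', System S' (f q) eta <-> System S q (pullback f eta).
Proof.
case: hS hS' => hM hD hL _ hI [hM' hD' hL' _ hI'].
move=> [oU [oU' [sf [g [sg [fg gf]]]]]] mD m1 m2 q Uq eta.
set c := chart_at S q; set c' := chart_at S' (f q).
have cq : cran c q := cran_at hM q; have cq' : cran c' (f q) := cran_at hM' (f q).
have [V' [th' [om' [oV' Vq' ad' ->]]]] := decomposable_chart hM' hD' hI' cq'.
have [V [th [om [oV Vq ad ->]]]] := decomposable_chart hM hD hI cq.
have [A1 [X [A1q [A1d [oA1 sX ED XE Ds]]]]] := framed_chart hM hL cq.
have [dq pq] := parK cq; have [dq' pq'] := parK cq'.
pose phi := mrep f c c'; pose psi := mrep g c' c.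
pose A0 := cpre c (U `&` f @^-1` cran c').
pose B0 := cpre c' (U' `&` g @^-1` cran c).
have oA0 : open A0 by exact: (sf c c').1.
have oB0 : open B0 by exact: (sg c' c).1.
have sphi0 : smooth_rv_on A0 phi by exact: (sf c c').2.
have spsi0 : smooth_rv_on B0 psi by exact: (sg c' c).2.
have par_phi x : A0 x -> cdom S' c' (phi x) /\ par S' c' (phi x) = f (par S c x).
  by move=> [_ [_ cf]]; exact: parK.
have A0B0 x : A0 x -> B0 (phi x).
  move=> A0x; have [d1 d2] := par_phi x A0x; have [dx [Ux _]] := A0x.
  split=> //; rewrite /preimage /= d2; have [h1 h2] := fg _ Ux.
  by split=> //=; rewrite h2; exact: cran_par.
have K0 x : A0 x -> psi (phi x) = x.
  move=> A0x; have [d1 d2] := par_phi x A0x; have [dx [Ux _]] := A0x.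
  by rewrite /psi /mrep d2 (fg _ Ux).2 (crdK hM).
have par_psi y : B0 y -> cdom S c (psi y) /\ par S c (psi y) = g (par S' c' y).
  by move=> [_ [_ cf]]; exact: parK.
have B0A0 y : B0 y -> A0 (psi y).
  move=> B0y; have [d1 d2] := par_psi y B0y; have [dy [Uy _]] := B0y.
  split=> //; rewrite /preimage /= d2; have [h1 h2] := gf _ Uy.
  by split=> //=; rewrite h2; exact: cran_par.
have K0' y : B0 y -> phi (psi y) = y.
  move=> B0y; have [d1 d2] := par_psi y B0y; have [dy [Uy _]] := B0y.
  by rewrite /phi /mrep d2 (gf _ Uy).2 (crdK hM').
set x := crd c q; have phix : phi x = crd c' (f q) by rewrite /phi /mrep pq.
have A0x : A0 x by split; rewrite ?pq.
pose A := A0 `&` (phi @^-1` cpre c' V' `&` (cpre c V `&` A1)).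
have AA0 : A `<=` A0 by move=> y [].
have oA : open A.
  have -> : A = (A0 `&` phi @^-1` cpre c' V') `&` (cpre c V `&` A1) by rewrite /A setIA.
  apply: openI; last by apply: openI => //; exact: oV.
  apply: open_preimage_on; [exact: oA0| |exact: oV'].
  by move=> y Ay; exact: smooth_rv_continuous sphi0 Ay.
have Ax : A x.
  split=> //; split; last by split=> //; exact: cpre_crd.
  by rewrite /preimage /= phix; exact: cpre_crd.
have sphi : smooth_rv_on A phi by move=> j; apply: smooth_on_sub (sphi0 j).
have AV' y : A y -> cpre c' V' (phi y) by move=> [_ []].
pose B := B0 `&` cpre c' V'.
have AB y : A y -> B (phi y) by move=> Ay; split; [exact/A0B0/AA0|exact: AV'].
have spsi : smooth_rv_on B psi by move=> j; apply: smooth_on_sub (spsi0 j) => y [].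
have ofdmap y (Ay : A y) := of_chart_dmap hM hM' sf (AA0 _ Ay).
have parE y : A y -> par S' c' (phi y) = f (par S c y) by move=> /AA0/par_phi[].
have Up y : A y -> U (par S c y) by move=> /AA0[_ []].
have hatmap (E : plane_field S) (E' : plane_field S') y u : maps_to U f E E' -> A y ->
    hat c E y u -> hat c' E' (phi y) (u *m jacobian phi y).
  move=> mE Ay; rewrite /hat (parE _ Ay) -(mE _ (Up _ Ay)) => uE.
  rewrite -mulmxA -(ofdmap _ Ay) mulmxA.
  by have := memv_img (linfun (mulmxr (dmap f (par S c y)))) uE; rewrite lfunE.
have hatD y u : A y -> hat c (Dist S) y u <-> hat c' (Dist S') (phi y) (u *m jacobian phi y).
  move=> Ay; split; first exact: hatmap.
  rewrite /hat (parE _ Ay) -(mD _ (Up _ Ay)) => /memv_imgP[w wD].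
  rewrite lfunE /= -mulmxA -(ofdmap _ Ay) mulmxA.
  have cy : cran c (par S c y) by apply: cran_par; have [] := AA0 _ Ay.
  have cfy : cran c' (f (par S c y)) by have [_ []] := AA0 _ Ay.
  have can (z : 'rV[R]_dM) := mulmx_conjK z (ofdmap _ Ay) (to_of_chart hM cy) (of_to_chart1 hM' cfy)
    (jacobian_cancel oA sphi spsi AB (fun z Az => K0 z (AA0 z Az)) Ay).
  move=> H; have H' := congr1 (fun z => z *m to_chart c' (f (par S c y)) *m jacobian psi (phi y) *m of_chart c (par S c y)) H.
  have uw : u *m of_chart c (par S c y) = w := etrans (esym (can _)) (etrans H' (can w)).
  by rewrite uw.
have ad1 : adapted n A (hat c (Dist S)) (hat c (Lag1 S)) (hat c (Lag2 S))
    (pb phi (frep c' th')) (pb phi (frep c' om')).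
  apply: (adapted_pb oA sphi spsi AB (fun z Az => K0 z (AA0 z Az)) hatD
     (fun y u => @hatmap _ _ y u m1) (fun y u => @hatmap _ _ y u m2)).
  by apply: adapted_sub ad' => y [].
have adA : adapted n A (hat c (Dist S)) (hat c (Lag1 S)) (hat c (Lag2 S)) (frep c th) (frep c om).
  by apply: adapted_sub ad => y [_ [_ []]].
have AA1 y : A y -> A1 y by move=> [_ [_ []]].
have frA : framed A (hat c (Dist S)) (hat c (Lag1 S)) (hat c (Lag2 S)) X.
  split; [exact: oA| | | |].
  - by move=> i j; apply: smooth_on_sub (sX i j); exact: AA1.
  - by move=> y u /AA1; exact: ED.
  - by move=> y /AA1; exact: XE.
  - by move=> y u /AA1; exact: Ds.
have sth' : sform (cpre c' V') (frep c' th') by case: ad' => -[].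
have E y : A y -> [/\ pb phi (frep c' th') y = pb phi (frep c' th') y,
    pb phi (ext_d (frep c' th')) y = ext_d (pb phi (frep c' th')) y,
    pb phi (frep c' om') y = pb phi (frep c' om') y &
    pb phi (frep c' eta) y = frep c (pullback f eta) y].
  move=> Ay; split; [by []| |by []|].
    by apply: esym; exact: (ext_d_pb oA (oV' c') sphi AV').
  by apply: esym; exact: (frep_pullback hM hM' sf _ (AA0 _ Ay)).
rewrite -phix; split=> [H|H].
  apply: (cideal_adapted frA ad1 adA Ax); apply: (cideal_ext oA Ax E).
  exact: (cideal_pb oA sphi Ax H).
have {}H := cideal_adapted frA adA ad1 Ax H.
have {}H : cideal (pb phi (frep c' th')) (pb phi (ext_d (frep c' th'))) (pb phi (frep c' om')) x
    (pb phi (frep c' eta)).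
  by apply: (cideal_ext oA Ax _ H) => y Ay; have [_ E2 _ E4] := E y Ay; split; [by []|exact: esym|by []|exact: esym].
rewrite -(K0 x A0x) in H.
have Bx := A0B0 x A0x; apply: (cideal_ext oB0 Bx _ (cideal_pb oB0 spsi0 Bx H)) => y By.
by split; exact: pbK oB0 sphi0 spsi0 B0A0 K0' By.
Qed.

Lemma equivalent_systems (U : set S) (U' : set S') :
  lag_contact_equivalent U U' -> MA_equivalent U U'.
Proof.
move=> [f [df mD m1 m2]]; exists f.
by split; [exact: df|exact: mD|exact: m1|exact: m2|exact: equivalence_system df mD m1 m2].
Qed.

End Equivalence.

(** * The flat model *)

Section FlagCoordinates.
Context {R : realType} {n : nat}.
Notation dM := (n.*2.+1).
Notation N := (n.+2).
Implicit Types (v : 'rV[R]_dM) (c : 'rV[R]_n.+1).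

(** The line of a flag is spanned by (z, 1, x): position [i0] carries z, [i1] the normalising 1,
    [ix k] the coordinate x_k. The covector of the hyperplane is normalised at [i0] instead. *)
Definition i0 : 'I_N := ord0.
Definition i1 : 'I_N := lift ord0 ord0.
Definition ix (k : 'I_n) : 'I_N := lift ord0 (lift ord0 k).
Notation zi := (z_idx n).
Notation xj := (@x_idx n).
Notation pj := (@p_idx n).

Lemma x_idxE i : xj i = i :> nat. Proof. by rewrite inordK //; have := ltn_ord i; lia. Qed.
Lemma z_idxE : zi = n :> nat. Proof. by rewrite inordK //; lia. Qed.
Lemma p_idxE i : pj i = (n.+1 + i)%N :> nat. Proof. by rewrite inordK //; have := ltn_ord i; lia. Qed.

Lemma idxP (j : 'I_dM) : [\/ exists i, j = xj i, j = zi | exists i, j = pj i].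
Proof.
have [jn|jn|jn] := ltngtP j n; last by apply: Or32; apply: val_inj; rewrite /= z_idxE.
  by apply: Or31; exists (Ordinal jn); apply: val_inj; rewrite /= x_idxE.
have lt : (j - n.+1 < n)%N by have := ltn_ord j; lia.
by apply: Or33; exists (Ordinal lt); apply: val_inj; rewrite /= p_idxE /=; lia.
Qed.

Lemma coordsP v v' : (forall i, v 0 (xj i) = v' 0 (xj i)) -> v 0 zi = v' 0 zi ->
  (forall i, v 0 (pj i) = v' 0 (pj i)) -> v = v'.
Proof. by move=> hx hz hp; apply/rowP => j; have [[i ->]|->|[i ->]] := idxP j. Qed.

(** The final default 0 is out of reach for indices below 2n + 1. *)
Definition mkv (z : R) (x p : 'I_n -> R) : 'rV[R]_dM := \row_j
  if insub (j : nat) is Some i then x i else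
  if j == n :> nat then z else if insub (j - n.+1)%N is Some i then p i else 0.

Lemma mkv_x z x p i : mkv z x p 0 (xj i) = x i.
Proof. by rewrite mxE x_idxE valK. Qed.

Lemma mkv_z z x p : mkv z x p 0 zi = z.
Proof. by rewrite mxE z_idxE insubF ?ltnn // eqxx. Qed.

Lemma mkv_p z x p i : mkv z x p 0 (pj i) = p i.
Proof.
rewrite mxE p_idxE insubF; last by apply/negbTE; lia.
by rewrite ifN ?addKn ?valK //; lia.
Qed.

Definition mkvE := (mkv_x, mkv_z, mkv_p).

Lemma sumN (V : nmodType) (F : 'I_N -> V) : \sum_j F j = F i0 + (F i1 + \sum_k F (ix k)).
Proof. by rewrite !big_ord_recl. Qed.

Lemma caseN (j : 'I_N) : [\/ j = i0, j = i1 | exists k, j = ix k].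
Proof.
case: (unliftP ord0 j) => [j' ->|->]; last exact: Or31.
case: (unliftP ord0 j') => [k ->|->]; last exact: Or32.
by apply: Or33; exists k.
Qed.

Lemma pt0 v : flag_pt v 0 i0 = v 0 zi.
Proof.
rewrite flag_ptE; have -> : i0 = @lshift 1 n.+1 ord0 by apply: val_inj.
by apply: etrans (@row_mxEl R 1 1 n.+1 _ _ 0 ord0) _; rewrite mxE.
Qed.

Lemma pt1 v : flag_pt v 0 i1 = 1.
Proof.
rewrite flag_ptE; have -> : i1 = @rshift 1 n.+1 (@lshift 1 n ord0) by apply: val_inj.
apply: etrans (@row_mxEr R 1 1 n.+1 _ _ 0 _) _.
by apply: etrans (@row_mxEl R 1 1 n _ _ 0 ord0) _; rewrite mxE.
Qed.

Lemma ptx v k : flag_pt v 0 (ix k) = v 0 (xj k).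
Proof.
rewrite flag_ptE; have -> : ix k = @rshift 1 n.+1 (@rshift 1 n k) by apply: val_inj.
apply: etrans (@row_mxEr R 1 1 n.+1 _ _ 0 _) _.
by apply: etrans (@row_mxEr R 1 1 n _ _ 0 k) _; rewrite mxE.
Qed.

(** The covector (1, -c), an equation of the hyperplane spanned by the rows of [hyp_mx c]. *)
Definition hcov c : 'cV[R]_N := col_mx (1%:M : 'M[R]_1) (- c^T).

Lemma hyp_hcov c : hyp_mx c *m hcov c = 0.
Proof.
apply: etrans (@mul_row_col R n.+1 1 n.+1 1 c^T 1%:M 1%:M (- c^T)) _.
by rewrite mulmx1 mul1mx subrr.
Qed.

Lemma hcov_ker c (u : 'rV[R]_N) : u *m hcov c = 0 -> exists w : 'rV[R]_n.+1, u = w *m hyp_mx c.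
Proof.
have -> : u = row_mx (@lsubmx R 1 1 n.+1 u) (@rsubmx R 1 1 n.+1 u) by rewrite hsubmxK.
set a := lsubmx _; set b := rsubmx _ => H.
have := etrans (esym (@mul_row_col R 1 1 n.+1 1 a b 1%:M (- c^T))) H.
rewrite mulmx1 mulmxN => /eqP; rewrite subr_eq0 => /eqP ->.
by exists b; apply: esym; apply: etrans (@mul_mx_row R 1 n.+1 1 n.+1 b c^T 1%:M) _; rewrite mulmx1.
Qed.

Definition flag_cov v : 'rV[R]_n.+1 :=
  row_mx ((v 0 zi)%:M - xs v *m (ps v)^T : 'M[R]_1) (ps v).

Definition xi v : 'cV[R]_N := hcov (flag_cov v).

Lemma hcov0 c : hcov c i0 0 = 1.
Proof.
have -> : i0 = @lshift 1 n.+1 ord0 by apply: val_inj.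
by apply: etrans (@col_mxEu R 1 n.+1 1 _ _ ord0 0) _; rewrite mxE.
Qed.

Lemma hcovS c j : hcov c (lift ord0 j) 0 = - c 0 j.
Proof.
have -> : lift ord0 j = @rshift 1 n.+1 j by apply: val_inj.
by apply: etrans (@col_mxEd R 1 n.+1 1 _ _ j 0) _; rewrite !mxE.
Qed.

Lemma xi0 v : xi v i0 0 = 1. Proof. exact: hcov0. Qed.

Lemma xi1 v : xi v i1 0 = - (v 0 zi - \sum_k v 0 (xj k) * v 0 (pj k)).
Proof.
rewrite /xi hcovS /flag_cov; have -> : ord0 = @lshift 1 n ord0 by apply: val_inj.
rewrite (@row_mxEl R 1 1 n) !mxE mulr1n; congr (- (_ - _)).
by apply: eq_bigr => k _; rewrite !mxE.
Qed.

Lemma xip v k : xi v (ix k) 0 = - v 0 (pj k).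
Proof.
rewrite /xi hcovS /flag_cov; have -> : lift ord0 k = @rshift 1 n k by apply: val_inj.
by rewrite (@row_mxEr R 1 1 n) mxE.
Qed.

Lemma pt_xi v : flag_pt v *m xi v = 0.
Proof. by rewrite /flag_pt -mulmxA hyp_hcov mulmx0. Qed.

(* [l] spans the line and [x] is an equation of the hyperplane of the flag [F] *)
Definition rep (F : flag R n) (l : 'rV[R]_N) (x : 'cV[R]_N) : Prop :=
  [/\ l != 0, x != 0, l *m x = 0, (forall u, u \in (val F).1 <-> exists a, u = a *: l) &
      (forall u, u \in (val F).2 <-> u *m x = 0)].

Lemma pt_neq0 v : flag_pt v != 0.
Proof. by apply/eqP => /rowP/(_ i1)/eqP; rewrite pt1 mxE oner_eq0. Qed.

Lemma hcov_neq0 c : hcov c != 0.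
Proof. by apply/eqP => /colP/(_ i0)/eqP; rewrite hcov0 mxE oner_eq0. Qed.

Lemma unitmx_inj k (g : 'M[R]_k) (u : 'rV[R]_k) : g \in unitmx -> u *m g = 0 -> u = 0.
Proof. by move=> gU /(congr1 (mulmx^~ (invmx g))); rewrite mul0mx mulmxK. Qed.

Lemma rowspaceP k j (A : 'M[R]_(k, j)) u : u \in rowspace A <-> exists w, u = w *m A.
Proof.
split=> [/memv_imgP[w _ ->]|[w ->]]; first by exists w; rewrite lfunE.
by apply/memv_imgP; exists w; rewrite ?memvf // lfunE.
Qed.

Lemma hyp_mem c (g : GL R n) u :
  u \in rowspace (hyp_mx c *m val g) <-> u *m (invmx (val g) *m hcov c) = 0.
Proof.
have gU := valP g; rewrite rowspaceP; split=> [[w ->]|].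
  by rewrite mulmxA -!mulmxA (mulmxA (val g)) mulmxV // mul1mx hyp_hcov mulmx0.
by rewrite mulmxA => /hcov_ker[w wE]; exists w; rewrite mulmxA -wE mulmxKV.
Qed.

Lemma rep_par (g : GL R n) v :
  rep (flag_par g v) (flag_pt v *m val g) (invmx (val g) *m xi v).
Proof.
have gU := valP g; split.
- by apply: contraNneq (pt_neq0 v) => /(unitmx_inj gU) ->.
- apply: contraNneq (hcov_neq0 (flag_cov v)) => /(congr1 (mulmx (val g))).
  by rewrite mulmx0 mulmxA mulmxV // mul1mx => /eqP.
- by rewrite mulmxA mulmxK // pt_xi.
- move=> u; rewrite rowspaceP; split=> [[w ->]|[a ->]].
    exists (w 0 0); rewrite [w]mx11_scalar mul_scalar_mx.
    by congr (_ *: _); rewrite mxE eqxx mulr1n.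
  by exists a%:M; rewrite mul_scalar_mx.
- exact: hyp_mem.
Qed.

(** At an entry j where [x] does not vanish, the vectors x_j e_i - x_i e_j lie in its kernel; the
    other covector kills them too, which forces proportionality. *)
Lemma cov_uniq (x x' : 'cV[R]_N) : x != 0 -> x' != 0 ->
  (forall u : 'rV[R]_N, u *m x = 0 -> u *m x' = 0) -> exists2 b, b != 0 & x' = b *: x.
Proof.
move=> x0 x0' H; have [j xj0] : exists j, x j 0 != 0.
  apply/existsP; apply: contraNT x0; rewrite negb_exists => /forallP x0.
  by apply/eqP/colP => j; rewrite mxE; apply/eqP/negPn/x0.
pose b := x' j 0 / x j 0.
suff xb : x' = b *: x by exists b => //; apply: contraNneq x0' => b0; rewrite xb b0 scale0r.
apply/colP => i; pose u : 'rV[R]_N := x j 0 *: delta_mx 0 i - x i 0 *: delta_mx 0 j.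
have uE (z : 'cV[R]_N) : (u *m z) 0 0 = x j 0 * z i 0 - x i 0 * z j 0.
  by rewrite mulmxBl -!scalemxAl -!rowE !mxE.
have ux : u *m x = 0 by apply/matrixP => i' j'; rewrite !ord1 uE mxE mulrC subrr.
have /(congr1 (fun w : 'M[R]_1 => w 0 0)) := H u ux.
rewrite uE mxE => /eqP; rewrite subr_eq0 => /eqP E; rewrite mxE /b.
by apply: (mulfI xj0); rewrite E; field.
Qed.

Lemma rep_uniq F l x l' x' : rep F l x -> rep F l' x' ->
  exists a b, [/\ a != 0, b != 0, l' = a *: l & x' = b *: x].
Proof.
move=> [l0 x0 lx hl hx] [l0' x0' lx' hl' hx'].
have /hl[a la] : l' \in (val F).1 by apply/hl'; exists 1; rewrite scale1r.
have [u /hx/hx'//|b b0 xb] := cov_uniq x0 x0'.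
exists a, b; split=> //; by apply: contraNneq l0' => a0; rewrite la a0 scale0r.
Qed.

Lemma rep_eq F F' l x a b : a != 0 -> b != 0 -> rep F l x -> rep F' (a *: l) (b *: x) -> F = F'.
Proof.
move=> a0 b0 [_ _ _ hl hx] [_ _ _ hl' hx'].
have E1 : (val F).1 = (val F').1.
  apply/vspaceP => u; apply/idP/idP => [/hl[c ->]|/hl'[c ->]].
    by apply/hl'; exists (c / a); rewrite scalerA divfK.
  by apply/hl; exists (c * a); rewrite scalerA.
have E2 : (val F).2 = (val F').2.
  apply/vspaceP => u; apply/idP/idP => [/hx ux|/hx'].
    by apply/hx'; rewrite -scalemxAr ux scaler0.
  rewrite -scalemxAr => /(congr1 (fun w => b^-1 *: w)); rewrite scaler0 scalerA mulVf // scale1r => ux.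
  exact/hx.
by apply: val_inj; case: (val F) (val F') E1 E2 => [L H] [L' H'] /= -> ->.
Qed.

(** The hyperplane is given as a subspace of dimension n + 1; an equation is found in the kernel of
    the transposed basis matrix, and a dimension count shows that the hyperplane is all of its zero
    set. *)
Lemma rep_exists F : exists l x, rep F l x.
Proof.
have /and3P[/eqP dL /eqP dH LH] := valP F; case e : (val F) dL dH LH => [L H] /= dL dH LH.
have [l l0 LE] : exists2 l, l != 0 & L = <[l]>%VS.
  exists (vpick L); first by rewrite vpick0 -dimv_eq0 dL.
  apply/eqP; rewrite eq_sym eqEdim -memvE memv_pick dL dim_vline.
  by rewrite vpick0 -dimv_eq0 dL.
pose B : 'M[R]_(n.+1, N) := \matrix_i (vbasis H)`_i.
have BH u : u \in H -> exists w, u = w *m B.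
  move=> /coord_vbasis ->; exists (\row_i coord (vbasis H) (cast_ord (esym dH) i) u).
  rewrite mulmx_sum_row (reindex (cast_ord dH)) /=; last first.
    by exists (cast_ord (esym dH)) => i _; rewrite ?cast_ordK ?cast_ordKV.
  by apply: eq_bigr => i _; rewrite rowK mxE cast_ordK.
have /rowV0Pn[y yB y0] : kermx B^T != 0.
  rewrite -mxrank_eq0 mxrank_ker -lt0n subn_gt0.
  by rewrite ltnS (leq_trans (rank_leq_col _)).
have Bx : B *m y^T = 0.
  by apply: trmx_inj; rewrite trmx_mul trmxK trmx0; exact: sub_kermxP.
have y0' : y^T != 0 by apply: contraNneq y0 => /(congr1 trmx); rewrite trmxK trmx0 => /eqP.
pose phi := linfun (mulmxr y^T : 'rV[R]_N -> 'rV[R]_1).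
have HE : H = lker phi.
  apply/eqP; rewrite eqEdim; apply/andP; split.
    by apply/subvP => u /BH[w ->]; rewrite memv_ker lfunE /= -mulmxA Bx mulmx0.
  have := limg_ker_dim phi fullv.
  rewrite capfv dimvf /dim /= mul1n dH => dk.
  have [j yj] : exists j, y 0 j != 0.
    apply/existsP; apply: contraNT y0; rewrite negb_exists => /forallP y0.
    by apply/eqP/rowP => j; rewrite mxE; apply/eqP/negPn/y0.
  suff : (0 < \dim (limg phi))%N.
    by case: (\dim (limg phi)) dk => // b; rewrite addnS => /eq_add_S e1 _; apply: leq_trans (leq_addr b _) _; rewrite e1.
  rewrite lt0n dimv_eq0; apply: contraNneq yj => /vspaceP/(_ ((delta_mx 0 j : 'rV[R]_N) *m y^T)).
  rewrite memv0 => H0; have : (delta_mx 0 j : 'rV[R]_N) *m y^T == 0.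
    by rewrite -H0; apply/memv_imgP; exists (delta_mx 0 j); rewrite ?memvf // lfunE.
  by move=> /eqP/matrixP/(_ 0 0); rewrite -rowE !mxE => ->.
have HP u : u \in H <-> u *m y^T = 0.
  by rewrite HE memv_ker lfunE /=; split=> [/eqP|->].
exists l, y^T; rewrite /rep e; split=> //=; first by apply/HP; apply: (subvP LH); rewrite LE memv_line.
by move=> u /=; rewrite LE; split=> [/vlineP[a ->]|[a ->]]; [exists a|apply/vlineP; exists a].
Qed.

(** Chart coordinates of a flag from any representing line vector [Y] and covector [X], by dividing
    by the entries that the chart normalises to 1; rescaling either of them changes nothing. *)
Definition vof (Y : 'rV[R]_N) (X : 'cV[R]_N) : 'rV[R]_dM :=
  mkv (Y 0 i0 / Y 0 i1) (fun k => Y 0 (ix k) / Y 0 i1) (fun k => - (X (ix k) 0 / X i0 0)).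

Lemma vof_pt (Y : 'rV[R]_N) X : Y 0 i1 != 0 -> flag_pt (vof Y X) = (Y 0 i1)^-1 *: Y.
Proof.
move=> Y1; apply/rowP => j; rewrite [RHS]mxE; have [->|->|[k ->]] := caseN j.
- by rewrite pt0 mkvE mulrC.
- by rewrite pt1 mulVf.
- by rewrite ptx mkvE mulrC.
Qed.

Lemma vof_xi (Y : 'rV[R]_N) (X : 'cV[R]_N) : Y 0 i1 != 0 -> X i0 0 != 0 -> Y *m X = 0 ->
  xi (vof Y X) = (X i0 0)^-1 *: X.
Proof.
move=> Y1 X0 YX; apply/colP => j; rewrite [RHS]mxE; have [->|->|[k ->]] := caseN j.
- by rewrite xi0 mulVf.
- rewrite xi1 mkvE; under eq_bigr do rewrite !mkvE.
  have := congr1 (fun w : 'M[R]_1 => w 0 0) YX; rewrite !mxE sumN => H.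
  have -> : \sum_k Y 0 (ix k) / Y 0 i1 * - (X (ix k) 0 / X i0 0) =
     - (Y 0 i1)^-1 * (X i0 0)^-1 * \sum_k Y 0 (ix k) * X (ix k) 0.
    by rewrite mulr_sumr; apply: eq_bigr => k _; ring.
  have -> : \sum_k Y 0 (ix k) * X (ix k) 0 = - (Y 0 i0 * X i0 0) - Y 0 i1 * X i1 0.
    by apply: (addIr (Y 0 i0 * X i0 0 + Y 0 i1 * X i1 0)); apply: etrans (etrans _ H) _; ring.
  by field; apply/andP.
- by rewrite xip mkvE opprK mulrC.
Qed.

Lemma par_rep g v F l x : flag_par g v = F -> rep F l x ->
  exists a b, [/\ a != 0, b != 0, l *m invmx (val g) = a *: flag_pt v & val g *m x = b *: xi v].
Proof.
move=> <- r; have gU := valP g; have [a [b [a0 b0 -> ->]]] := rep_uniq (rep_par g v) r.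
by exists a, b; split=> //; rewrite -?scalemxAl -?scalemxAr ?mulmxK // mulmxA mulmxV // mul1mx.
Qed.

Lemma vofK g v F l x : flag_par g v = F -> rep F l x ->
  [/\ (l *m invmx (val g)) 0 i1 != 0, (val g *m x) i0 0 != 0 &
      vof (l *m invmx (val g)) (val g *m x) = v].
Proof.
move=> e r; have [a [b [a0 b0 -> ->]]] := par_rep e r.
have mxZ k j (c : R) (A : 'M[R]_(k, j)) i' j' : (c *: A) i' j' = c * A i' j' by rewrite mxE.
split; [by rewrite mxZ pt1 mulr1|by rewrite mxZ xi0 mulr1|].
apply: coordsP => [i||i]; rewrite mkvE !mxZ.
- by rewrite pt1 ptx mulr1; field.
- by rewrite pt1 pt0 mulr1; field.
- by rewrite xi0 xip mulr1; field.
Qed.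

Lemma par_vof (g : GL R n) F l x : rep F l x -> (l *m invmx (val g)) 0 i1 != 0 -> (val g *m x) i0 0 != 0 ->
  flag_par g (vof (l *m invmx (val g)) (val g *m x)) = F.
Proof.
set Y := l *m _; set X := val g *m x => r Y1 X0; have gU := valP g.
have [_ _ lx _ _] := r.
have YX : Y *m X = 0 by rewrite /Y /X mulmxA mulmxKV.
have := rep_par g (vof Y X); rewrite vof_pt // vof_xi // => r'.
apply: esym; apply: (rep_eq (a := (Y 0 i1)^-1) (b := (X i0 0)^-1) _ _ r); rewrite ?invr_eq0 //.
rewrite -scalemxAl -scalemxAr in r'.
by rewrite /Y /X mulmxKV // mulmxA mulVmx // mul1mx in r'.
Qed.

Notation FM := (flag_space R n).

Lemma flag_cran (g : chart FM) (F : FM) l x : rep F l x ->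
  cran g F <-> (l *m invmx (val g)) 0 i1 != 0 /\ (val g *m x) i0 0 != 0.
Proof.
move=> r; split=> [[v _ e]|[h1 h2]]; first by have [h1 h2 _] := vofK e r.
by exists (vof (l *m invmx (val g)) (val g *m x)) => //; exact: par_vof.
Qed.

Lemma flag_crd (g : chart FM) (F : FM) l x : rep F l x -> cran g F ->
  crd g F = vof (l *m invmx (val g)) (val g *m x).
Proof. by move=> r /parK[_ e]; have [_ _ ->] := vofK e r. Qed.

Lemma flag_par_inj (g : chart FM) v v' : par FM g v = par FM g v' -> v = v'.
Proof.
move=> e; have [_ _ e1] := vofK e (rep_par g v').
by have [_ _ e2] := vofK (erefl (flag_par g v')) (rep_par g v'); exact: etrans (esym e1) e2.
Qed.

End FlagCoordinates.

(** * The flag space is a manifold *)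

Section FlagManifold.
Context {R : realType} {n : nat}.
Notation dM := (n.*2.+1).
Notation N := (n.+2).
Notation FM := (flag_space R n).
Implicit Types (v : 'rV[R]_dM) (A : set 'rV[R]_dM).
Notation zi := (z_idx n).
Notation xj := (@x_idx n).
Notation pj := (@p_idx n).

(** Permutation matrices give finitely many charts that already cover the flag space, as needed for
    a countable base. *)
Definition perm_chart (s : 'S_N) : chart FM := exist _ (perm_mx s) (unitmx_perm R s).

(** Since the line lies in the hyperplane, nonzero entries of the line and of the covector can be
    found at different positions i and j; a permutation matches them with the normalised
    positions. *)
Lemma perm_chart_cran (F : FM) : exists s, cran (perm_chart s) F.
Proof.
have [l [x r]] := rep_exists F; have [l0 x0 lx _ _] := r.
have [i li] : exists i, l 0 i != 0.
  apply/existsP; apply: contraNT l0; rewrite negb_exists => /forallP l0.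
  by apply/eqP/rowP => i; rewrite mxE; apply/eqP/negPn/l0.
have [j /andP[ji xj0]] : exists j, (j != i) && (x j 0 != 0).
  apply/existsP; apply: contraNT x0; rewrite negb_exists => /forallP x0.
  have x_0 k : k != i -> x k 0 = 0.
    by move=> ki; have := x0 k; rewrite ki /= negbK => /eqP.
  apply/eqP/colP => k; rewrite mxE; have [->|] := eqVneq k i; last exact: x_0.
  have := congr1 (fun w : 'M[R]_1 => w 0 0) lx; rewrite !mxE (bigD1 i) //= big1 ?addr0 => [/eqP|k' /x_0 ->].
    by rewrite mulf_eq0 (negbTE li) /= => /eqP.
  by rewrite mulr0.
(* The first transposition sends [i0] to j and [i1] to k; the second corrects k to i without
   touching j. *)
pose k := tperm i0 j i1; pose s : 'S_N := (tperm i0 j * tperm i k)%g.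
have s1 : s i1 = i by rewrite permM -/k tpermR.
have kj : k != j by rewrite /k -[X in _ != X](tpermL i0 j) (inj_eq perm_inj).
have s0 : s i0 = j by rewrite permM tpermL tpermD // eq_sym.
exists s; apply/(flag_cran _ r); split.
  have -> : invmx (val (perm_chart s)) = perm_mx s^-1 :> 'M[R]_N by exact: esym (perm_mxV _ s).
  by rewrite -col_permE mxE s1.
by rewrite /= -row_permE mxE s0.
Qed.

Lemma flag_cran_at (F : FM) : cran (chart_at FM F) F.
Proof.
have [s [v _ e]] := perm_chart_cran F.
have [v' e'] := @xgetPex _ (GL1 R n) [set g | exists v, flag_par g v = F] (ex_intro _ (perm_chart s) (ex_intro _ v e)).
by exists v'.
Qed.

Lemma smooth_pt A j : smooth_on A (fun v => flag_pt v 0 j).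
Proof.
have [->|->|[k ->]] := caseN j.
- have -> : (fun v => flag_pt v 0 i0) = fun v : 'rV[R]_dM => v 0 zi by apply/funext => v; exact: pt0.
  exact: smooth_on_coor.
- have -> : (fun v : 'rV[R]_dM => flag_pt v 0 i1) = fun=> 1 by apply/funext => v; exact: pt1.
  exact: smooth_on_cst.
- have -> : (fun v => flag_pt v 0 (ix k)) = fun v : 'rV[R]_dM => v 0 (xj k) by apply/funext => v; exact: ptx.
  exact: smooth_on_coor.
Qed.

Lemma smooth_xi A j : open A -> smooth_on A (fun v => xi v j 0).
Proof.
move=> oA; have [->|->|[k ->]] := caseN j.
- have -> : (fun v : 'rV[R]_dM => xi v i0 0) = fun=> 1 by apply/funext => v; exact: xi0.
  exact: smooth_on_cst.
- have -> : (fun v => xi v i1 0) = fun v : 'rV[R]_dM => - (v 0 zi - \sum_k v 0 (xj k) * v 0 (pj k)).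
    by apply/funext => v; exact: xi1.
  apply: smooth_onN => //; apply: smooth_onB => //; first exact: smooth_on_coor.
  by apply: smooth_on_sum => // k _; apply: smooth_onM => //; exact: smooth_on_coor.
- have -> : (fun v => xi v (ix k) 0) = fun v : 'rV[R]_dM => - v 0 (pj k) by apply/funext => v; exact: xip.
  by apply: smooth_onN => //; exact: smooth_on_coor.
Qed.

Lemma smooth_ptM A (h : 'M[R]_N) j : open A -> smooth_on A (fun v => (flag_pt v *m h) 0 j).
Proof.
move=> oA; apply: smooth_on_mulmx => // i k; last exact: smooth_on_cst.
by rewrite [i]ord1; exact: smooth_pt.
Qed.

Lemma smooth_xiM A (h : 'M[R]_N) j : open A -> smooth_on A (fun v => (h *m xi v) j 0).
Proof.
move=> oA; apply: smooth_on_mulmx => // i k; first exact: smooth_on_cst.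
by rewrite [k]ord1; exact: smooth_xi.
Qed.

Lemma smooth_vof A (Y : 'rV[R]_dM -> 'rV[R]_N) (X : 'rV[R]_dM -> 'cV[R]_N) : open A ->
  (forall j, smooth_on A (fun v => Y v 0 j)) -> (forall j, smooth_on A (fun v => X v j 0)) ->
  (forall v, A v -> Y v 0 i1 != 0 /\ X v i0 0 != 0) ->
  smooth_rv_on A (fun v => vof (Y v) (X v)).
Proof.
move=> oA sY sX YX j.
have V1 : smooth_on A (fun v => (Y v 0 i1)^-1) by apply: smooth_onV => // v /YX[].
have V2 : smooth_on A (fun v => (X v i0 0)^-1) by apply: smooth_onV => // v /YX[].
have [[k ->]|->|[k ->]] := idxP j.
- apply: (smooth_on_ext oA _ (smooth_onM oA (sY (ix k)) V1)) => v _; by rewrite mkvE.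
- apply: (smooth_on_ext oA _ (smooth_onM oA (sY i0) V1)) => v _; by rewrite mkvE.
- apply: (smooth_on_ext oA _ (smooth_onN oA (smooth_onM oA (sX (ix k)) V2))) => v _; by rewrite mkvE.
Qed.

(** On representatives a change of chart is multiplication by a constant matrix, of the line on the
    right and of the covector on the left, and [vof] is rational in both. *)
Lemma flag_transition (g g' : chart FM) :
  open (cpre g (cran g')) /\ smooth_rv_on (cpre g (cran g')) (crd g' \o par FM g).
Proof.
pose Y v := flag_pt v *m val g *m invmx (val g').
pose X v := val g' *m (invmx (val g) *m xi v).
have dE v : cpre g (cran g') v <-> Y v 0 i1 != 0 /\ X v i0 0 != 0.
  by split=> [[_ /(flag_cran _ (rep_par g v))]|/(flag_cran _ (rep_par g v))].
have sY A j : open A -> smooth_on A (fun v => Y v 0 j).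
  move=> oA; have -> : (fun v => Y v 0 j) = fun v => (flag_pt v *m (val g *m invmx (val g'))) 0 j.
    by apply/funext => v; rewrite mulmxA.
  exact: smooth_ptM.
have sX A j : open A -> smooth_on A (fun v => X v j 0).
  move=> oA; have -> : (fun v => X v j 0) = fun v => ((val g' *m invmx (val g)) *m xi v) j 0.
    by apply/funext => v; rewrite /X mulmxA.
  exact: smooth_xiM.
have oD : open (cpre g (cran g')).
  have -> : cpre g (cran g') = (setT `&` [set v | Y v 0 i1 != 0]) `&` (setT `&` [set v | X v i0 0 != 0]).
    by apply/seteqP; split=> v; [move/dE => []|move=> [[_ h1] [_ h2]]; exact/dE].
  by apply: openI; apply: open_nonzero => [|v _]; first [exact: openT|
    apply: (smooth_on_diff (A := setT)) => //; [exact: sY openT|exact: sX openT] |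
    exact: (smooth_on_diff (sY setT _ openT)) | exact: (smooth_on_diff (sX setT _ openT))].
split=> //; apply: (smooth_rv_ext oD (f := fun v => vof (Y v) (X v))) => [v Dv|].
  by apply: esym; exact: flag_crd (rep_par g v) Dv.2.
by apply: smooth_vof => // [j|j|v /dE]; [exact: sY|exact: sX|].
Qed.

Lemma flag_mopen_par (g : chart FM) (O : set 'rV[R]_dM) : open O -> mopen (par FM g @` O).
Proof.
move=> oO g'; have [oD sD] := flag_transition g' g.
have -> : cpre g' (par FM g @` O) = cpre g' (cran g) `&` (crd g \o par FM g') @^-1` O.
  apply/seteqP; split=> [v [_ [u Ou uv]]|v [[_ /parK[_ e]] Ov]].
    have c : cran g (par FM g' v) by exists u.
    split=> //; have [_ e] := parK c.
    by rewrite /preimage /= (flag_par_inj (etrans e (esym uv))).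
  by split=> //; exists (crd g (par FM g' v)).
by apply: open_preimage_on => // v Dv; exact: smooth_rv_continuous sD Dv.
Qed.

Lemma mopen_function (h : FM -> R) (O : set R) :
  (forall g, smooth_on setT (fun v => h (par FM g v))) -> open O -> mopen (h @^-1` O).
Proof.
move=> sh oO g.
have -> : cpre g (h @^-1` O) = setT `&` (fun v => h (par FM g v)) @^-1` O.
  by apply/seteqP; split=> v [].
apply: open_preimage_on => // [|v _]; first exact: openT.
exact/differentiable_continuous/(smooth_on_diff (sh g)).
Qed.

Definition lrep (F : FM) := projT1 (cid (rep_exists F)).
Definition xrep (F : FM) := projT1 (cid (projT2 (cid (rep_exists F)))).
Lemma lxrep (F : FM) : rep F (lrep F) (xrep F). Proof. exact: projT2 (cid _). Qed.

(* entries of the orthogonal projection onto the line spanned by [u] *)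
Definition pline (u : 'I_N -> R) i j := u i * u j / \sum_k u k * u k.

Lemma norm_neq0 (u : 'I_N -> R) k : u k != 0 -> \sum_k u k * u k != 0.
Proof.
move=> uk; rewrite psumr_eq0 => [|i _]; last by rewrite -expr2 sqr_ge0.
by apply/allPn; exists k; rewrite ?mem_index_enum //= mulf_neq0.
Qed.

Lemma pline_scale u a i j : a != 0 -> pline (fun k => a * u k) i j = pline u i j.
Proof.
move=> a0; rewrite /pline.
have -> : \sum_k a * u k * (a * u k) = a * a * \sum_k u k * u k.
  by rewrite mulr_sumr; apply: eq_bigr => k _; ring.
have -> : a * u i * (a * u j) = a * a * (u i * u j) by ring.
by rewrite -mulf_div divff ?mul1r // mulf_neq0.
Qed.

(** The projection onto a line determines the line; the factor is found from a column in which
    neither vector vanishes. *)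
Lemma pline_inj u u' k k' : u k != 0 -> u' k' != 0 -> (forall i j, pline u i j = pline u' i j) ->
  exists2 a, a != 0 & forall i, u' i = a * u i.
Proof.
move=> uk uk' E; have n0 := norm_neq0 uk; have n0' := norm_neq0 uk'.
set s := \sum_k _ in n0; set s' := \sum_k _ in n0'.
have E' i j : u i * u j * s' = u' i * u' j * s.
  by have := E i j; rewrite /pline -/s -/s' => /eqP; rewrite eqr_div // => /eqP.
have u'k : u' k != 0.
  apply: contraTneq (mulf_neq0 (mulf_neq0 uk uk) n0') => u'0.
  by rewrite E' u'0 !mul0r eqxx.
exists (u k * s' / (u' k * s)) => [|i]; first by rewrite !mulf_neq0 ?invr_neq0 ?mulf_neq0.
have /(congr1 (fun z => z / (u' k * s))) := E' i k.
have -> : u' i * u' k * s / (u' k * s) = u' i by field; apply/andP.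
by move=> <-; ring.
Qed.

(** Entries of the projections onto the line and onto the span of the covector are smooth functions
    independent of the representatives, and together they determine the flag. Distinct flags are
    separated by one of them, at the mean of its two values. *)
Lemma flag_hausdorff (F F' : FM) : F <> F' -> exists U V : set FM,
  [/\ mopen U, mopen V, U F, V F' & U `&` V = set0].
Proof.
move=> FF'; pose h1 ij (F : FM) := pline (fun k => lrep F 0 k) ij.1 ij.2.
pose h2 ij (F : FM) := pline (fun k => xrep F k 0) ij.1 ij.2.
have nz1 (F1 : FM) : exists k, lrep F1 0 k != 0.
  have [l0 _ _ _ _] := lxrep F1.
  apply/existsP; apply: contraNT l0; rewrite negb_exists => /forallP l0.
  by apply/eqP/rowP => i; rewrite mxE; apply/eqP/negPn/l0.
have nz2 (F1 : FM) : exists k, xrep F1 k 0 != 0.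
  have [_ l0 _ _ _] := lxrep F1.
  apply/existsP; apply: contraNT l0; rewrite negb_exists => /forallP l0.
  by apply/eqP/colP => i; rewrite mxE; apply/eqP/negPn/l0.
have mxZ k j (c : R) (A : 'M[R]_(k, j)) i' j' : (c *: A) i' j' = c * A i' j' by rewrite mxE.
have spl (u : 'rV[R]_dM -> 'I_N -> R) i j : (forall k, smooth_on setT (fun v => u v k)) ->
    (forall v, exists k, u v k != 0) -> smooth_on setT (fun v => pline (u v) i j).
  move=> su nu; apply: smooth_onM; [exact: openT|by apply: smooth_onM => //; exact: openT|].
  apply: smooth_onV; [exact: openT|by move=> v _; have [k uk] := nu v; exact: norm_neq0 uk|].
  by apply: smooth_on_sum => [|k _]; [exact: openT|apply: smooth_onM => //; exact: openT].
have s1 ij g : smooth_on setT (fun v => h1 ij (par FM g v)).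
  apply: (smooth_on_ext openT (f := fun v => pline (fun k => (flag_pt v *m val g) 0 k) ij.1 ij.2)).
    move=> v _; have [a [b [a0 b0 e _]]] := rep_uniq (rep_par g v) (lxrep (par FM g v)).
    rewrite /h1 e -(pline_scale _ _ _ a0); congr pline.
    by apply/funext => k; rewrite mxZ.
  apply: spl => [k|v]; first exact: smooth_ptM openT.
  apply/existsP; have [l0 _ _ _ _] := rep_par g v; apply: contraNT l0.
  rewrite negb_exists => /forallP l0; apply/eqP/rowP => i; rewrite [RHS]mxE; exact/eqP/negPn/l0.
have s2 ij g : smooth_on setT (fun v => h2 ij (par FM g v)).
  apply: (smooth_on_ext openT (f := fun v => pline (fun k => (invmx (val g) *m xi v) k 0) ij.1 ij.2)).
    move=> v _; have [a [b [a0 b0 _ e]]] := rep_uniq (rep_par g v) (lxrep (par FM g v)).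
    rewrite /h2 e -(pline_scale _ _ _ b0); congr pline.
    by apply/funext => k; rewrite mxZ.
  apply: spl => [k|v]; first exact: smooth_xiM openT.
  apply/existsP; have [_ l0 _ _ _] := rep_par g v; apply: contraNT l0.
  rewrite negb_exists => /forallP l0; apply/eqP/colP => i; rewrite [RHS]mxE; exact/eqP/negPn/l0.
have sep (h : FM -> R) : (forall g, smooth_on setT (fun v => h (par FM g v))) -> h F < h F' ->
    exists U V : set FM, [/\ mopen U, mopen V, U F, V F' & U `&` V = set0].
  move=> sh lt; pose mid := (h F + h F') / 2.
  exists (h @^-1` [set y | y < mid]), (h @^-1` [set y | mid < y]); split.
  - by apply: mopen_function => //; exact: open_lt.
  - by apply: mopen_function => //; exact: open_gt.
  - by rewrite /preimage /= /mid; lra.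
  - by rewrite /preimage /= /mid; lra.
  - by apply/seteqP; split=> // G [/= a b]; have := lt_trans a b; rewrite ltxx.
have sep' (h : FM -> R) : (forall g, smooth_on setT (fun v => h (par FM g v))) -> h F != h F' ->
    exists U V : set FM, [/\ mopen U, mopen V, U F, V F' & U `&` V = set0].
  move=> sh; rewrite neq_lt => /orP[/(sep h sh)//|lt].
  have [||U [V [oU oV UF VF UV]]] := sep (fun G => - h G); [|by rewrite ltrN2|by exists U, V].
  by move=> g; apply: smooth_onN; [exact: openT|exact: sh].
apply: contrapT => nsep; apply: FF'.
have E1 ij : h1 ij F = h1 ij F' by apply/eqP/negPn/negP => /(sep' _ (s1 ij)).
have E2 ij : h2 ij F = h2 ij F' by apply/eqP/negPn/negP => /(sep' _ (s2 ij)).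
have [k lk] := nz1 F; have [k' lk'] := nz1 F'.
have [a a0 la] := pline_inj (u := fun k => lrep F 0 k) (u' := fun k => lrep F' 0 k) lk lk' (fun i j => E1 (i, j)).
have [q xq] := nz2 F; have [q' xq'] := nz2 F'.
have [b b0 xb] := pline_inj (u := fun k => xrep F k 0) (u' := fun k => xrep F' k 0) xq xq' (fun i j => E2 (i, j)).
apply: (rep_eq a0 b0 (lxrep F)).
have <- : lrep F' = a *: lrep F by apply/rowP => i; rewrite mxZ.
have <- : xrep F' = b *: xrep F by apply/colP => i; rewrite mxZ.
exact: lxrep.
Qed.

Lemma flag_countable : exists B : nat -> set FM, (forall k, mopen (B k)) /\
  forall (U : set FM) p, mopen U -> U p -> exists k, B k p /\ B k `<=` U.
Proof.
pose C : Type := ('S_N * 'rV[rat]_dM * rat)%type.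
pose bx (t : C) : set FM := par FM (perm_chart t.1.1) @`
  interior (ball (map_mx ratr t.1.2 : 'rV[R]_dM) (ratr t.2 : R)).
pose B k := if unpickle k is Some t then bx t else set0.
exists B; split=> [k|U p oU Up].
  rewrite /B; case: unpickle => [t|]; first exact/flag_mopen_par/open_interior.
  by move=> g; have -> : cpre g set0 = set0 by [apply/seteqP; split=> v []]; exact: open0.
have [s cp] := perm_chart_cran p; set g := perm_chart s in cp.
have [_ e] := parK cp; set x := crd g p in e.
have /nbhs_ballP[r /= r0 rU] : nbhs x (cpre g U).
  by apply: open_nbhs_nbhs; split; [exact: oU|split; rewrite ?e].
(* A rational centre within [q] of [x] and a radius [q] below r / 2 keep the ball inside the one of
   radius [r], while it still contains [x]. *)
have r2 : 0 < r / 2 by rewrite divr_gt0.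
have [q] := @rat_in_itvoo R 0 (r / 2) r2; rewrite in_itv /= => /andP[q0 qr].
have /choice[a aP] (j : 'I_dM) : exists a : rat, `|x 0 j - ratr a| < ratr q :> R.
  have [|a] := @rat_in_itvoo R (x 0 j - ratr q) (x 0 j + ratr q); first by lra.
  by rewrite in_itv /= => /andP[a1 a2]; exists a; rewrite ltr_norml; lra.
pose av : 'rV[rat]_dM := \row_j a j.
have bP y : ball (map_mx ratr av : 'rV[R]_dM) (ratr q) y <-> forall j, `|ratr (a j) - y 0 j| < ratr q :> R.
  split=> [[_ h] j|h]; first by have := h 0 j; rewrite /ball /= !mxE.
  by split=> // i j; rewrite [i]ord1 /ball /= !mxE.
exists (pickle (s, av, q)); rewrite /B pickleK /bx /=; split.
  exists x => //; apply: open_nbhs_nbhs; split; first exact: ball_open.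
  by apply/bP => j; rewrite distrC.
move=> _ [y /interior_subset/bP yb <-].
suff [_ h] : cpre g U y by exact: h.
apply: rU; split=> [|i j]; first exact: r0.
rewrite [i]ord1 /ball /=; have := yb j; have := aP j; rewrite !ltr_norml; lra.
Qed.

Lemma flag_manifold : is_manifold FM.
Proof.
split; first by move=> g; exact: openT.
split; first by move=> g v v' _ _; exact: flag_par_inj.
split; first exact: flag_cran_at.
split; first exact: flag_transition.
by split; [exact: flag_hausdorff|exact: flag_countable].
Qed.

End FlagManifold.

(** * The distributions of the flag space in coordinates *)

Section FlagPlanes.
Context {R : realType} {n : nat}.
Notation dM := (n.*2.+1).
Notation N := (n.+2).
Notation FM := (flag_space R n).
Notation PM := (proj_space R n).
Notation QM := (dual_proj_space R n).
Implicit Types (v : 'rV[R]_dM) (A : set 'rV[R]_dM).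
Notation zi := (z_idx n).
Notation xj := (@x_idx n).
Notation pj := (@p_idx n).

(** Affine coordinates of the point of projective space with homogeneous coordinates [y]. *)
Definition quo (y : 'rV[R]_N) : 'rV[R]_n.+1 := \row_j (y 0 (lift ord0 j) / y 0 i0).

Lemma pt_mx0 (w : 'rV[R]_n.+1) : pt_mx w 0 i0 = 1.
Proof.
have -> : i0 = @lshift 1 n.+1 ord0 by apply: val_inj.
by apply: etrans (@row_mxEl R 1 1 n.+1 _ _ 0 ord0) _; rewrite mxE.
Qed.

Lemma pt_mxS (w : 'rV[R]_n.+1) j : pt_mx w 0 (lift ord0 j) = w 0 j.
Proof.
have -> : lift ord0 j = @rshift 1 n.+1 j by apply: val_inj.
exact: (@row_mxEr R 1 1 n.+1).
Qed.

Lemma quo_pt (w : 'rV[R]_n.+1) a : a != 0 -> quo (a *: pt_mx w) = w.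
Proof.
move=> a0; apply/rowP => j; rewrite mxE.
have mxZ i : (a *: pt_mx w) 0 i = a * pt_mx w 0 i by rewrite mxE.
by rewrite !mxZ pt_mx0 pt_mxS mulr1 mulrAC divff ?mul1r.
Qed.

Lemma pt_quo (y : 'rV[R]_N) : y 0 i0 != 0 -> pt_mx (quo y) = (y 0 i0)^-1 *: y.
Proof.
move=> y0; apply/rowP => j; rewrite [RHS]mxE; case: (unliftP ord0 j) => [k ->|->].
  by rewrite pt_mxS mxE mulrC.
by rewrite pt_mx0 mulVf.
Qed.

Lemma proj_crd (g : chart PM) (L : PM) l : l != 0 -> (forall u, u \in val L <-> exists a, u = a *: l) ->
  (cran g L <-> (l *m invmx (val g)) 0 i0 != 0) /\
  (cran g L -> crd g L = quo (l *m invmx (val g))).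
Proof.
move=> l0 hl; have gU := valP g.
have H w : par PM g w = L -> exists2 a, a != 0 & l *m invmx (val g) = a *: pt_mx w.
  move=> e; have : l \in val L by apply/hl; exists 1; rewrite scale1r.
  rewrite -e => /rowspaceP[b lb]; exists (b 0 0).
    apply: contraNneq l0 => b0; rewrite lb [b]mx11_scalar b0 mul_scalar_mx scale0r.
    by [].
  by rewrite lb [b]mx11_scalar mul_scalar_mx -scalemxAl mulmxK // mxE eqxx mulr1n.
split=> [|/parK[_ /H[a a0 ->]]]; last by rewrite quo_pt.
split=> [[w _ /H[a a0 ->]]|h].
  have -> : (a *: pt_mx w) 0 i0 = a * pt_mx w 0 i0 by rewrite mxE.
  by rewrite pt_mx0 mulr1.
exists (quo (l *m invmx (val g))) => //; apply: val_inj => /=.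
rewrite pt_quo // -scalemxAl mulmxKV //; apply/vspaceP => u; apply/idP/idP.
  move=> /rowspaceP[w ->]; apply/hl; exists (w 0 0 / (l *m invmx (val g)) 0 i0).
  rewrite [w]mx11_scalar mul_scalar_mx scalerA; congr (_ *: _); congr (_ * _).
  by rewrite mxE eqxx mulr1n.
move=> /hl[a ->]; apply/rowspaceP; exists (a * (l *m invmx (val g)) 0 i0)%:M.
by rewrite mul_scalar_mx scalerA mulfK.
Qed.

(** The chart records the coefficients c of a graph while the covector is (1, -c), hence the
    sign. *)
Lemma dual_crd (g : chart QM) (H : QM) x : x != 0 -> (forall u, u \in val H <-> u *m x = 0) ->
  (cran g H <-> (val g *m x) i0 0 != 0) /\
  (cran g H -> crd g H = - quo (val g *m x)^T).
Proof.
move=> x0 hx; have gU := valP g.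
have mxZ k j (c : R) (A : 'M[R]_(k, j)) i' j' : (c *: A) i' j' = c * A i' j' by rewrite mxE.
have hE (w : 'rV[R]_n.+1) : (hcov w)^T = pt_mx (- w).
  apply/rowP => j; rewrite [LHS]mxE; case: (unliftP ord0 j) => [k ->|->].
    by rewrite hcovS pt_mxS mxE.
  by rewrite hcov0 pt_mx0.
have H1 w : par QM g w = H -> exists2 a, a != 0 & val g *m x = a *: hcov w.
  move=> e; apply: cov_uniq; [exact: hcov_neq0| |].
    by apply: contraNneq x0 => X0; rewrite -[x](mulKmx gU) X0 mulmx0.
  by move=> u u0; rewrite mulmxA; apply/hx; rewrite -e; apply/hyp_mem; rewrite mulmxA mulmxK.
have qE w a : a != 0 -> - quo (a *: hcov w)^T = w.
  by move=> a0; rewrite linearZ /= hE quo_pt // opprK.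
split=> [|/parK[_ /H1[a a0 ->]]]; last by rewrite qE.
split=> [[w _ /H1[a a0 ->]]|h]; first by rewrite mxZ hcov0 mulr1.
exists (- quo (val g *m x)^T) => //; apply: val_inj => /=; apply/vspaceP => u.
have xE : hcov (- quo (val g *m x)^T) = ((val g *m x) i0 0)^-1 *: (val g *m x).
  apply: trmx_inj; rewrite hE opprK pt_quo; last by rewrite mxE.
  by rewrite [in RHS]linearZ /= [X in X^-1 *: _]mxE.
apply/idP/idP.
  move=> /hyp_mem; rewrite xE -!scalemxAr => /(congr1 (fun w => (val g *m x) i0 0 *: w)).
  by rewrite scaler0 scalerA divff // scale1r mulKmx // => /hx.
by move=> /hx ux; apply/hyp_mem; rewrite xE -!scalemxAr mulKmx // ux scaler0.
Qed.


Lemma proj_cran_at (L : PM) l : l != 0 -> (forall u, u \in val L <-> exists a, u = a *: l) ->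
  cran (chart_at PM L) L.
Proof.
move=> l0 hl; have [i li] : exists i, l 0 i != 0.
  apply/existsP; apply: contraNT l0; rewrite negb_exists => /forallP l0.
  by apply/eqP/rowP => i; rewrite mxE; apply/eqP/negPn/l0.
pose s := tperm i0 i.
have : cran (perm_chart s : chart PM) L.
  apply/(proj_crd _ l0 hl).1.
  have -> : invmx (val (perm_chart s)) = perm_mx s^-1 :> 'M[R]_N by exact: esym (perm_mxV _ s).
  by rewrite -col_permE mxE tpermL.
move=> [w _ e].
have [w' e'] := @xgetPex _ (GL1 R n) [set g | exists w, proj_par g w = L] (ex_intro _ (perm_chart s) (ex_intro _ w e)).
by exists w'.
Qed.

Lemma dual_cran_at (H : QM) (x : 'cV[R]_N) : x != 0 -> (forall u, u \in val H <-> u *m x = 0) ->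
  cran (chart_at QM H) H.
Proof.
move=> x0 hx; have [i xi] : exists i, x i 0 != 0.
  apply/existsP; apply: contraNT x0; rewrite negb_exists => /forallP x0.
  by apply/eqP/colP => i; rewrite mxE; apply/eqP/negPn/x0.
pose s := tperm i0 i.
have : cran (perm_chart s : chart QM) H.
  by apply/(dual_crd _ x0 hx).1; rewrite -row_permE mxE tpermL.
move=> [w _ e].
have [w' e'] := @xgetPex _ (GL1 R n) [set g | exists w, dual_par g w = H] (ex_intro _ (perm_chart s) (ex_intro _ w e)).
by exists w'.
Qed.

Lemma eq_derive m (f1 f2 : 'rV[R]_m -> R) (u v : 'rV[R]_m) : f1 =1 f2 -> 'D_u f1 v = 'D_u f2 v.
Proof. by move=> /funext ->. Qed.

Section QuoDerivative.
Variables (A : set 'rV[R]_dM) (Y : 'rV[R]_dM -> 'rV[R]_N).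
Hypotheses (oA : open A) (sY : forall j, smooth_on A (fun v => Y v 0 j))
  (Y0 : forall v, A v -> Y v 0 i0 != 0).

Lemma smooth_quo : smooth_rv_on A (fun v => quo (Y v)).
Proof.
move=> j; have V1 : smooth_on A (fun v => (Y v 0 i0)^-1) by exact: smooth_onV.
by apply: (smooth_on_ext oA _ (smooth_onM oA (sY (lift ord0 j)) V1)) => v _; rewrite mxE.
Qed.

Lemma derive_quo v (u : 'rV[R]_dM) j : A v ->
  Y v 0 i0 * 'D_u (fun v => quo (Y v) 0 j) v =
  'D_u (fun v => Y v 0 (lift ord0 j)) v - quo (Y v) 0 j * 'D_u (fun v => Y v 0 i0) v.
Proof.
move=> Av; have dq : differentiable (fun v => quo (Y v) 0 j) v by exact: smooth_on_diff (smooth_quo j) Av.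
have d0 : differentiable (fun v => Y v 0 i0) v by exact: smooth_on_diff (sY i0) Av.
have -> : 'D_u (fun v => Y v 0 (lift ord0 j)) v = 'D_u (fun v => Y v 0 i0 * quo (Y v) 0 j) v.
  apply: near_eq_derive; apply: (open_near oA Av) => w Aw.
  by rewrite mxE mulrCA divff ?mulr1 ?Y0.
by rewrite (derM u d0 dq); ring.
Qed.

(** A moving homogeneous vector is stationary in projective space to first order exactly when its
    velocity is proportional to it; the factor is read off at the normalising entry. *)
Lemma quo_derive0 v (u : 'rV[R]_dM) : A v ->
  'D_u (fun v => quo (Y v)) v = 0 <->
  exists kap, forall j, 'D_u (fun v => Y v 0 j) v = kap * Y v 0 j.
Proof.
move=> Av; have dq : differentiable (fun v => quo (Y v)) v by exact: smooth_rv_diff smooth_quo Av.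
have E j : ('D_u (fun v => quo (Y v)) v) 0 j = 'D_u (fun v => quo (Y v) 0 j) v by exact: derive_rV.
split=> [H|[kap H]].
  exists ('D_u (fun v => Y v 0 i0) v / Y v 0 i0) => j; have [k ->|->] := unliftP ord0 j.
    have := derive_quo u k Av; rewrite -E H mxE mulr0 => /esym/eqP; rewrite subr_eq0 => /eqP ->.
    by rewrite mxE; ring.
  by rewrite divfK ?Y0.
apply/rowP => j; rewrite E [RHS]mxE; apply: (mulfI (Y0 Av)); rewrite derive_quo // !H mulr0 mxE.
by rewrite mulrCA divfK ?Y0 // subrr.
Qed.

End QuoDerivative.

(** The linear part of the affine map [flag_pt], hence its derivative at every point: the constant
    entry at [i1] is removed. *)
Definition dpt (u : 'rV[R]_dM) : 'rV[R]_N := flag_pt u - delta_mx 0 i1.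

Lemma dpt0 u : dpt u 0 i0 = u 0 zi.
Proof. by rewrite /dpt [LHS]mxE pt0 !mxE /= subr0. Qed.
Lemma dpt1 u : dpt u 0 i1 = 0.
Proof. by rewrite /dpt [LHS]mxE pt1 !mxE /= subrr. Qed.
Lemma dptx u k : dpt u 0 (ix k) = u 0 (xj k).
Proof. by rewrite /dpt [LHS]mxE ptx !mxE /= subr0. Qed.

Lemma derive_pt (v u : 'rV[R]_dM) j : 'D_u (fun v => flag_pt v 0 j) v = dpt u 0 j.
Proof.
have [->|->|[k ->]] := caseN j.
- rewrite dpt0 -(derive_coor zi v u); apply: eq_derive => w; exact: pt0.
- rewrite dpt1 -(der_cst 1 u v); apply: eq_derive => w; exact: pt1.
- rewrite dptx -(derive_coor (xj k) v u); apply: eq_derive => w; exact: ptx.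
Qed.

Definition dxi (v u : 'rV[R]_dM) : 'cV[R]_N := \col_j 'D_u (fun v => xi v j 0) v.

Lemma dxi0 v u : dxi v u i0 0 = 0.
Proof.
rewrite mxE -(der_cst 1 u v); apply: eq_derive => w; exact: xi0.
Qed.
Lemma dxip v u k : dxi v u (ix k) 0 = - u 0 (pj k).
Proof.
rewrite mxE -(derive_coor (pj k) v u) -derN; last exact: differentiable_coor.
by apply: eq_derive => w; exact: xip.
Qed.
Lemma dxi1 v u : dxi v u i1 0 =
  - u 0 zi + \sum_k (v 0 (pj k) * u 0 (xj k) + v 0 (xj k) * u 0 (pj k)).
Proof.
rewrite mxE; have dc i : differentiable (fun w : 'rV[R]_dM => w 0 i) v by exact: differentiable_coor.
have dx k : differentiable (fun w : 'rV[R]_dM => w 0 (xj k) * w 0 (pj k)) v by exact: difM.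
have [ds es] := @derive_bigsum _ _ _ (index_enum 'I_n) xpredT
  (fun k (w : 'rV[R]_dM) => w 0 (xj k) * w 0 (pj k)) u v dx.
transitivity ('D_u (fun w : 'rV[R]_dM => - w 0 zi + \sum_k w 0 (xj k) * w 0 (pj k)) v).
  by apply: eq_derive => w; rewrite xi1 opprB addrC.
have dN : differentiable (fun w : 'rV[R]_dM => - w 0 zi) v by exact: differentiableN.
rewrite (derD u dN ds) es (derN u (dc zi)) derive_coor; congr (_ + _).
by apply: eq_bigr => k _; rewrite (derM u (dc _) (dc _)) !derive_coor; ring.
Qed.

Lemma derive_ptM (h : 'M[R]_N) v u j :
  'D_u (fun v => (flag_pt v *m h) 0 j) v = (dpt u *m h) 0 j.
Proof.
have dp i : differentiable (fun w => flag_pt w 0 i * h i j) v.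
  by apply: difM; [exact: (smooth_on_diff (smooth_pt (A := setT) i))|exact: dif_cst].
have [_ es] := @derive_bigsum _ _ _ (index_enum 'I_N) xpredT (fun i w => flag_pt w 0 i * h i j) u v dp.
transitivity ('D_u (fun w => \sum_i flag_pt w 0 i * h i j) v).
  by apply: eq_derive => w; rewrite [LHS]mxE.
rewrite es [RHS]mxE; apply: eq_bigr => i _.
have dpi : differentiable (fun w => flag_pt w 0 i) v by exact: (smooth_on_diff (smooth_pt (A := setT) i)).
by rewrite (derM u dpi (dif_cst _ _)) der_cst derive_pt; ring.
Qed.

Lemma derive_xiM (h : 'M[R]_N) v u j :
  'D_u (fun v => (h *m xi v) j 0) v = (h *m dxi v u) j 0.
Proof.
have dpi i : differentiable (fun w => xi w i 0) v by exact: (smooth_on_diff (smooth_xi (A := setT) i openT)).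
have dp i : differentiable (fun w => h j i * xi w i 0) v by apply: difM; [exact: dif_cst|exact: dpi].
have [_ es] := @derive_bigsum _ _ _ (index_enum 'I_N) xpredT (fun i w => h j i * xi w i 0) u v dp.
transitivity ('D_u (fun w => \sum_i h j i * xi w i 0) v).
  by apply: eq_derive => w; rewrite [LHS]mxE.
rewrite es [RHS]mxE; apply: eq_bigr => i _.
by rewrite (derM u (dif_cst _ _) (dpi i)) der_cst [dxi v u i 0]mxE; ring.
Qed.

End FlagPlanes.

Section FlagPlanes2.
Context {R : realType} {n : nat}.
Notation dM := (n.*2.+1).
Notation N := (n.+2).
Notation FM := (flag_space R n).
Notation PM := (proj_space R n).
Notation QM := (dual_proj_space R n).
Implicit Types (v u : 'rV[R]_dM) (A : set 'rV[R]_dM).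
Notation zi := (z_idx n).
Notation xj := (@x_idx n).
Notation pj := (@p_idx n).

(** Homogeneous coordinates of the line ([Yp]) and of the hyperplane ([Yq]) in a chart of projective
    space or of its dual; the projections [pi1] and [pi2] are obtained from them by [quo], up to
    sign. *)
Let Yp (g : chart FM) (c' : chart PM) v : 'rV[R]_N := flag_pt v *m (val g *m invmx (val c')).
Let Yq (g : chart FM) (c' : chart QM) v : 'rV[R]_N := ((val c' *m invmx (val g)) *m xi v)^T.

Let sYp g c' j A : open A -> smooth_on A (fun v => Yp g c' v 0 j). Proof. exact: smooth_ptM. Qed.
Let sYq g c' j A : open A -> smooth_on A (fun v => Yq g c' v 0 j).
Proof.
move=> oA; apply: (smooth_on_ext oA _ (smooth_xiM (val c' *m invmx (val g)) j oA)) => v _.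
by rewrite [RHS]mxE.
Qed.

Let domp (g : chart FM) (c' : chart PM) : set 'rV[R]_dM := setT `&` [set v | Yp g c' v 0 i0 != 0].
Let domq (g : chart FM) (c' : chart QM) : set 'rV[R]_dM := setT `&` [set v | Yq g c' v 0 i0 != 0].

Let open_domp g c' : open (domp g c').
Proof. by apply: open_nonzero => [|v _]; [exact: openT|exact: (smooth_on_diff (sYp g c' i0 openT))]. Qed.
Let open_domq g c' : open (domq g c').
Proof. by apply: open_nonzero => [|v _]; [exact: openT|exact: (smooth_on_diff (sYq g c' i0 openT))]. Qed.

Let pi1E (g : chart FM) (c' : chart PM) v :
  (cran c' (pi1 (par FM g v)) <-> Yp g c' v 0 i0 != 0) /\
  (cran c' (pi1 (par FM g v)) -> mrep (@pi1 R n) g c' v = quo (Yp g c' v)).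
Proof.
have [l0 _ _ hl _] := rep_par g v; have [h1 h2] := proj_crd (L := pi1 (par FM g v)) c' l0 hl.
by rewrite /mrep /Yp mulmxA.
Qed.

Let pi2E (g : chart FM) (c' : chart QM) v :
  (cran c' (pi2 (par FM g v)) <-> Yq g c' v 0 i0 != 0) /\
  (cran c' (pi2 (par FM g v)) -> mrep (@pi2 R n) g c' v = - quo (Yq g c' v)).
Proof.
have [_ l0 _ _ hl] := rep_par g v; have [h1 h2] := dual_crd (H := pi2 (par FM g v)) c' l0 hl.
by rewrite /mrep /Yq -mulmxA [X in X != 0]mxE.
Qed.

Lemma smooth_at_pi1 (g : chart FM) (c' : chart PM) (F : FM) :
  cran g F -> cran c' (pi1 F) -> smooth_at (@pi1 R n) g c' F.
Proof.
move=> cF cF'; split=> //; have [_ e] := parK cF.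
exists (domp g c'); split; first exact: open_domp.
- by split=> //; apply/(pi1E g c' (crd g F)).1; rewrite e.
- by move=> v [_ h]; apply/(pi1E g c' v).1.
- apply: (@smooth_rv_ext _ _ _ _ (fun v => quo (Yp g c' v)) (mrep (@pi1 R n) g c') (@open_domp g c')) => [v [_ h]|].
    by apply: esym; apply: (pi1E g c' v).2; apply/(pi1E g c' v).1.
  by apply: smooth_quo; [exact: open_domp|move=> j; exact/sYp/open_domp|move=> v []].
Qed.

Lemma smooth_at_pi2 (g : chart FM) (c' : chart QM) (F : FM) :
  cran g F -> cran c' (pi2 F) -> smooth_at (@pi2 R n) g c' F.
Proof.
move=> cF cF'; split=> //; have [_ e] := parK cF.
exists (domq g c'); split; first exact: open_domq.
- by split=> //; apply/(pi2E g c' (crd g F)).1; rewrite e.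
- by move=> v [_ h]; apply/(pi2E g c' v).1.
- apply: (@smooth_rv_ext _ _ _ _ (fun v => - quo (Yq g c' v)) (mrep (@pi2 R n) g c') (@open_domq g c')) => [v [_ h]|].
    by apply: esym; apply: (pi2E g c' v).2; apply/(pi2E g c' v).1.
  move=> j; have s : smooth_rv_on (domq g c') (fun v => quo (Yq g c' v)).
    by apply: smooth_quo; [exact: open_domq|move=> k; exact/sYq/open_domq|move=> v []].
  apply: (smooth_on_ext (@open_domq g c') _ (smooth_onN (@open_domq g c') (s j))) => v _.
  by rewrite [RHS]mxE.
Qed.

Lemma jacobian_derive m k (phi : 'rV[R]_m -> 'rV[R]_k) (x u : 'rV[R]_m) : differentiable phi x ->
  u *m jacobian phi x = 'D_u phi x.
Proof. by move=> d; rewrite mul_jacobian deriveE. Qed.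

Let pi1_at (F : FM) : cran (chart_at PM (pi1 F)) (pi1 F).
Proof. by have [l [x [l0 _ _ hl _]]] := rep_exists F; exact: (proj_cran_at (L := pi1 F) l0 hl). Qed.
Let pi2_at (F : FM) : cran (chart_at QM (pi2 F)) (pi2 F).
Proof. by have [l [x [_ l0 _ _ hl]]] := rep_exists F; exact: (dual_cran_at (H := pi2 F) l0 hl). Qed.

Let FMm := @flag_manifold R n.

Let dmap1 (g : chart FM) v u : let F := par FM g v in
  u *m of_chart g F *m dmap (@pi1 R n) F = 'D_u (fun v => quo (Yp g (chart_at PM (pi1 F)) v)) v.
Proof.
set F := par FM g v => /=; set c' := chart_at PM (pi1 F).
have gF : cran g F by exact: cran_par.
have aF := cran_at FMm F; have cF := pi1_at F; have vE : crd g F = v by exact: (crdK FMm).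
have H := jacobian_mrep_comp (smooth_at_id FMm gF aF) (smooth_at_pi1 aF cF).
rewrite vE -/c' in H.
have E : of_chart g F *m dmap (@pi1 R n) F = jacobian (mrep (@pi1 R n) g c') v.
  by rewrite of_chartE vE; exact: esym H.
have dv : domp g c' v by split=> //; exact/(pi1E g c' v).1.
have sq : smooth_rv_on (domp g c') (fun v => quo (Yp g c' v)).
  by apply: smooth_quo; [exact: open_domp|move=> k; exact/sYp/open_domp|move=> w []].
have dq : differentiable (fun v => quo (Yp g c' v)) v by exact: smooth_rv_diff sq dv.
apply: etrans (etrans (esym (mulmxA u _ _)) (congr1 (mulmx u) E)) _.
apply: etrans (jacobian_derive u dq); apply: (congr1 (mulmx u)); apply: esym.
apply: (near_eq_jacobian (@open_domp g c') dv _ dq) => w [_ h].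
by apply: esym; apply: (pi1E g c' w).2; apply/(pi1E g c' w).1.
Qed.

Let dmap2 (g : chart FM) v u : let F := par FM g v in
  u *m of_chart g F *m dmap (@pi2 R n) F = - 'D_u (fun v => quo (Yq g (chart_at QM (pi2 F)) v)) v.
Proof.
set F := par FM g v => /=; set c' := chart_at QM (pi2 F).
have gF : cran g F by exact: cran_par.
have aF := cran_at FMm F; have cF := pi2_at F; have vE : crd g F = v by exact: (crdK FMm).
have H := jacobian_mrep_comp (smooth_at_id FMm gF aF) (smooth_at_pi2 aF cF).
rewrite vE -/c' in H.
have E : of_chart g F *m dmap (@pi2 R n) F = jacobian (mrep (@pi2 R n) g c') v.
  by rewrite of_chartE vE; exact: esym H.
have dv : domq g c' v by split=> //; exact/(pi2E g c' v).1.
have sq : smooth_rv_on (domq g c') (fun v => quo (Yq g c' v)).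
  by apply: smooth_quo; [exact: open_domq|move=> k; exact/sYq/open_domq|move=> w []].
have dq : differentiable (fun v => quo (Yq g c' v)) v by exact: smooth_rv_diff sq dv.
have dN : differentiable (fun v => - quo (Yq g c' v)) v by exact: differentiableN.
have -> : - 'D_u (fun v => quo (Yq g c' v)) v = 'D_u (fun v => - quo (Yq g c' v)) v.
  by apply: esym; apply: deriveN; exact: diff_derivable.
apply: etrans (etrans (esym (mulmxA u _ _)) (congr1 (mulmx u) E)) _.
apply: etrans (jacobian_derive u dN); apply: (congr1 (mulmx u)); apply: esym.
apply: (near_eq_jacobian (@open_domq g c') dv _ dN) => w [_ h].
by apply: esym; apply: (pi2E g c' w).2; apply/(pi2E g c' w).1.
Qed.

(** Vectors killed by the differential of [pi1] move the line proportionally to itself; as its entry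
    at [i1] stays 1, the factor is 0 and the representing vector does not move to first order. *)
Lemma flag_hatE2 (g : chart FM) v u :
  hat g (flag_E2 (R := R) (n := n)) v u <-> u 0 zi = 0 /\ forall k, u 0 (xj k) = 0.
Proof.
set F := par FM g v; set c' := chart_at PM (pi1 F).
have gF : cran g F by exact: cran_par.
have dv : domp g c' v by split=> //; apply/(pi1E g c' v).1; exact: pi1_at.
have nz w : domp g c' w -> Yp g c' w 0 i0 != 0 by case.
have qd := quo_derive0 (@open_domp g c') (fun j => sYp g c' j (@open_domp g c')) nz u dv.
apply: (@iff_trans _ ('D_u (fun v => quo (Yp g c' v)) v = 0)).
  rewrite /hat /flag_E2 memv_ker lfunE -(dmap1 g v u).
  by split=> [/eqP|H] //; apply/eqP.
apply: (iff_trans qd); have hU : val g *m invmx (val c') \in unitmx.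
  by rewrite unitmx_mul unitmx_inv; apply/andP; split; exact: valP.
split=> [[kap H]|[uz ux]].
  have E : dpt u = kap *: flag_pt v.
    apply: (can_inj (mulmxK hU)); rewrite -scalemxAl; apply/rowP => j.
    by rewrite -(derive_ptM _ v) [RHS]mxE; exact: H.
  have k0 : kap = 0.
    by have := congr1 (fun w : 'rV[R]_N => w 0 i1) E; rewrite dpt1 [RHS]mxE pt1 mulr1.
  have E0 j : dpt u 0 j = 0 by rewrite E k0 scale0r mxE.
  by split=> [|k]; [rewrite -dpt0|rewrite -dptx].
exists 0 => j; rewrite mul0r derive_ptM.
suff -> : dpt u = 0 by rewrite mul0mx mxE.
apply/rowP => i; rewrite [RHS]mxE; have [->|->|[k ->]] := caseN i.
- by rewrite dpt0.
- by rewrite dpt1.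
- by rewrite dptx.
Qed.

(** As for [flag_hatE2], with the covector in place of the line and its constant entry at [i0]. *)
Lemma flag_hatE1 (g : chart FM) v u :
  hat g (flag_E1 (R := R) (n := n)) v u <->
  u 0 zi = \sum_k v 0 (pj k) * u 0 (xj k) /\ forall k, u 0 (pj k) = 0.
Proof.
set F := par FM g v; set c' := chart_at QM (pi2 F).
have gF : cran g F by exact: cran_par.
have dv : domq g c' v by split=> //; apply/(pi2E g c' v).1; exact: pi2_at.
have nz w : domq g c' w -> Yq g c' w 0 i0 != 0 by case.
have qd := quo_derive0 (@open_domq g c') (fun j => sYq g c' j (@open_domq g c')) nz u dv.
apply: (@iff_trans _ ('D_u (fun v => quo (Yq g c' v)) v = 0)).
  rewrite /hat /flag_E1 memv_ker lfunE.
  have e := dmap2 g v u; split=> [/eqP H|H].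
    by have := etrans (esym e) H => /eqP; rewrite oppr_eq0 => /eqP.
  by apply/eqP; apply: (etrans e); rewrite H oppr0.
apply: (iff_trans qd); have hU : val c' *m invmx (val g) \in unitmx.
  by rewrite unitmx_mul unitmx_inv; apply/andP; split; exact: valP.
have DY j : 'D_u (fun w => Yq g c' w 0 j) v = ((val c' *m invmx (val g)) *m dxi v u) j 0.
  by rewrite -derive_xiM; apply: eq_derive => w; rewrite [LHS]mxE.
split=> [[kap H]|[uz up]].
  have E : dxi v u = kap *: xi v.
    apply: (can_inj (mulKmx hU)); rewrite -scalemxAr; apply/colP => j.
    by rewrite -DY H [RHS]mxE [Yq _ _ _ _ _]mxE.
  have k0 : kap = 0.
    by have := congr1 (fun w : 'cV[R]_N => w i0 0) E; rewrite dxi0 [RHS]mxE xi0 mulr1.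
  have E0 j : dxi v u j 0 = 0 by rewrite E k0 scale0r mxE.
  have up k : u 0 (pj k) = 0 by apply/eqP; rewrite -oppr_eq0 -(dxip v) E0.
  split=> //; have := E0 i1; rewrite dxi1 => /eqP; rewrite addrC subr_eq0 => /eqP <-.
  by apply: eq_bigr => k _; rewrite up mulr0 addr0.
exists 0 => j; rewrite mul0r DY; suff -> : dxi v u = 0 by rewrite mulmx0 mxE.
apply/colP => i; rewrite [RHS]mxE; have [->|->|[k ->]] := caseN i.
- by rewrite dxi0.
- rewrite dxi1 uz addrC -sumrB big1 // => k _; by rewrite up mulr0 addr0 subrr.
- by rewrite dxip up oppr0.
Qed.

(** The canonical contact form: the covector evaluated on the velocity of the line. *)
Lemma dpt_xi v u : (dpt u *m xi v) 0 0 = u 0 zi - \sum_k v 0 (pj k) * u 0 (xj k).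
Proof.
rewrite [LHS]mxE sumN dpt0 dpt1 xi0 mulr1 mul0r add0r -sumrN; congr (_ + _).
by apply: eq_bigr => k _; rewrite dptx xip mulrN mulrC.
Qed.

(** [proj_lift] represents the velocity of the line up to a multiple of the line itself and a
    nonzero factor; the covector kills the line, so membership in the hyperplane reduces to
    [dpt_xi]. *)
Lemma flag_hatD (g : chart FM) v u :
  hat g (flag_D (R := R) (n := n)) v u <-> u 0 zi = \sum_k v 0 (pj k) * u 0 (xj k).
Proof.
set F := par FM g v; set c' := chart_at PM (pi1 F).
have gF : cran g F by exact: cran_par.
have dv : domp g c' v by split=> //; apply/(pi1E g c' v).1; exact: pi1_at.
have nz w : domp g c' w -> Yp g c' w 0 i0 != 0 by case.
have [_ _ _ _ hx] := rep_par g v.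
pose q : 'rV[R]_n.+1 := 'D_u (fun v => quo (Yp g c' v)) v.
have sq : smooth_rv_on (domp g c') (fun v => quo (Yp g c' v)).
  by apply: smooth_quo; [exact: open_domp|move=> k; exact/sYp/open_domp|move=> w []].
have qE j : Yp g c' v 0 i0 * q 0 j = 'D_u (fun w => Yp g c' w 0 (lift ord0 j)) v
    - quo (Yp g c' v) 0 j * 'D_u (fun w => Yp g c' w 0 i0) v.
  rewrite /q derive_rV; last exact: smooth_rv_diff sq dv.
  exact: (derive_quo (@open_domp g c') (fun j => sYp g c' j (@open_domp g c')) nz).
have liftE (w : 'rV[R]_n.+1) : w *m proj_lift (pi1 F) = row_mx (0 : 'M[R]_1) w *m val c'.
  rewrite /proj_lift mulmxA; congr (_ *m _).
  by apply: etrans (@mul_mx_row R 1 n.+1 1 n.+1 w 0 1%:M) _; rewrite mulmx0 mulmx1.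
have cU := valP c'; have gU := valP g.
have subZE (C B : 'rV[R]_N) (k : R) j : (C - k *: B) 0 j = C 0 j - k * B 0 j by rewrite !mxE.
(* The multiple of the line that cancels the entry [i0] of its velocity in the chart of projective
   space. *)
pose kap := 'D_u (fun w => Yp g c' w 0 i0) v / Yp g c' v 0 i0.
have rowE : Yp g c' v 0 i0 *: (row_mx (0 : 'M[R]_1) q : 'rV[R]_N) =
    (dpt u - kap *: flag_pt v) *m (val g *m invmx (val c')).
  apply/rowP => j; rewrite [LHS]mxE mulmxBl -scalemxAl subZE -(derive_ptM _ v); have [k ->|->] := unliftP ord0 j.
    have -> : (row_mx (0 : 'M[R]_1) q : 'rV[R]_N) 0 (lift ord0 k) = q 0 k.
      have -> : lift ord0 k = @rshift 1 n.+1 k by apply: val_inj.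
      exact: (@row_mxEr R 1 1 n.+1).
    by rewrite qE mxE /kap; congr (_ - _); ring.
  have -> : (row_mx (0 : 'M[R]_1) q : 'rV[R]_N) 0 ord0 = 0.
    have -> : ord0 = @lshift 1 n.+1 ord0 by apply: val_inj.
    by apply: etrans (@row_mxEl R 1 1 n.+1 _ _ 0 ord0) _; rewrite mxE.
  by rewrite mulr0 /kap divfK ?subrr ?(nz v dv).
have kE : Yp g c' v 0 i0 *: (q *m proj_lift (pi1 F) *m (invmx (val g) *m xi v)) = dpt u *m xi v.
  rewrite liftE !scalemxAl rowE; set z := dpt u - _.
  have -> : z *m (val g *m invmx (val c')) *m val c' = z *m val g by rewrite (mulmxA z) mulmxKV.
  by rewrite mulmxA mulmxK // /z mulmxBl -scalemxAl pt_xi scaler0 subr0.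
rewrite /hat /flag_D -memv_preim lfunE.
have e : mulmxr (dmap (@pi1 R n) F *m proj_lift (pi1 F)) (u *m of_chart g F) = q *m proj_lift (pi1 F).
  have d : u *m of_chart g F *m dmap (@pi1 R n) F = q := dmap1 g v u.
  exact: etrans (mulmxA _ _ _) (f_equal (fun z : 'rV[R]_n.+1 => z *m proj_lift (pi1 F)) d).
apply: (@iff_trans _ (q *m proj_lift (pi1 F) *m (invmx (val g) *m xi v) = 0)).
  by rewrite -e; exact: hx.
split=> [H|H].
  have := congr1 (fun w : 'M[R]_1 => w 0 0) kE; rewrite H scaler0 dpt_xi [LHS]mxE => /esym/eqP.
  by rewrite subr_eq0 => /eqP.
have Z : dpt u *m xi v = 0 by apply/matrixP => i j; rewrite !ord1 dpt_xi H subrr mxE.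
apply/eqP; have := congr1 (fun w => w == 0) kE; rewrite Z eqxx scaler_eq0 (negbTE (nz v dv)) /=.
by [].
Qed.

End FlagPlanes2.

Section ChartFields.
Context {R : realType} {m : nat} (M : premanifold R m) (hM : is_manifold M).
Implicit Types (c : chart M).

Definition vf_of_chart c (F : 'rV[R]_m -> 'rV[R]_m) : vfield M :=
  fun q => F (crd c q) *m of_chart c q.

Lemma vrep_of_chart c F x : cdom M c x -> vrep c (vf_of_chart c F) x = F x.
Proof.
move=> dx; rewrite /vrep /vf_of_chart (crdK hM dx) -mulmxA.
by rewrite (of_to_chart1 hM (cran_par dx)) mulmx1.
Qed.

Lemma smooth_vf_of_chart c F : smooth_rv_on (cdom M c) F -> smooth_vf (cran c) (vf_of_chart c F).
Proof.
move=> sF; have oc : mopen (cran c) by exact: cran_mopen.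
apply: (smooth_vf_chart hM (c := c)); [exact: oc|by []|].
apply: (smooth_rv_ext (oc c) (f := F)) => [x [dx _]|]; first by rewrite vrep_of_chart.
by move=> j; apply: smooth_on_sub (sF j) => x [].
Qed.

End ChartFields.

(** * The flat Lagrangian contact structure *)

Section FlagContact.
Context {R : realType} {n : nat}.
Notation dM := (n.*2.+1).
Notation FM := (flag_space R n).
Implicit Types (v : 'rV[R]_dM) (A : set 'rV[R]_dM).
Notation zi := (z_idx n).
Notation xj := (@x_idx n).
Notation pj := (@p_idx n).
Notation fD := (@flag_D R n).
Notation fE1 := (@flag_E1 R n).
Notation fE2 := (@flag_E2 R n).

Let FMm := @flag_manifold R n.

(** The coordinate field d/dx_i + p_i d/dz; [ff] is d/dp_i. *)
Definition ef (i : 'I_n) v : 'rV[R]_dM := mkv (v 0 (pj i)) (fun k => (k == i)%:R) (fun=> 0).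
Definition ff (i : 'I_n) v : 'rV[R]_dM := mkv 0 (fun=> 0) (fun k => (k == i)%:R).

Lemma smooth_ef i A : smooth_rv_on A (ef i).
Proof.
move=> j; have [[k ->]|->|[k ->]] := idxP j.
- by have -> : (fun v => ef i v 0 (xj k)) = fun=> (k == i)%:R; [apply/funext => v; rewrite mkvE|exact: smooth_on_cst].
- by have -> : (fun v => ef i v 0 zi) = fun v => v 0 (pj i); [apply/funext => v; rewrite mkvE|exact: smooth_on_coor].
- by have -> : (fun v => ef i v 0 (pj k)) = fun=> 0; [apply/funext => v; rewrite mkvE|exact: smooth_on_cst].
Qed.

Lemma smooth_ff i A : smooth_rv_on A (ff i).
Proof. by move=> j; exact: smooth_on_cst. Qed.

Lemma sum_delta_n (a : 'I_n -> R) k : \sum_i a i * (k == i)%:R = a k.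
Proof.
rewrite (bigD1 k) //= eqxx mulr1 big1 ?addr0 // => i /negbTE ik.
by rewrite eq_sym ik mulr0.
Qed.

Lemma sum_efE (a : 'I_n -> R) v : \sum_i a i *: ef i v =
  mkv (\sum_i a i * v 0 (pj i)) a (fun=> 0).
Proof.
apply: coordsP => [k||k]; rewrite summxE mkvE.
- by rewrite -[RHS]sum_delta_n; apply: eq_bigr => i _; rewrite mxE mkvE.
- by apply: eq_bigr => i _; rewrite mxE mkvE.
- by rewrite big1 // => i _; rewrite mxE mkvE mulr0.
Qed.

Lemma sum_ffE (a : 'I_n -> R) v : \sum_i a i *: ff i v = mkv 0 (fun=> 0) a.
Proof.
apply: coordsP => [k||k]; rewrite summxE mkvE.
- by rewrite big1 // => i _; rewrite mxE mkvE mulr0.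
- by rewrite big1 // => i _; rewrite mxE mkvE mulr0.
- by rewrite -[RHS]sum_delta_n; apply: eq_bigr => i _; rewrite mxE mkvE.
Qed.

Lemma hatE1_span (g : chart FM) v u : hat g fE1 v u <-> exists a, u = \sum_i a i *: ef i v.
Proof.
rewrite flag_hatE1; split=> [[uz up]|[a ->]].
  exists (fun i => u 0 (xj i)); rewrite sum_efE; apply: coordsP => [k||k]; rewrite mkvE ?up //.
  by rewrite uz; apply: eq_bigr => k _; rewrite mulrC.
rewrite sum_efE; split=> [|k]; rewrite !mkvE //.
by apply: eq_bigr => k _; rewrite mkvE mulrC.
Qed.

Lemma hatE2_span (g : chart FM) v u : hat g fE2 v u <-> exists a, u = \sum_i a i *: ff i v.
Proof.
rewrite flag_hatE2; split=> [[uz ux]|[a ->]].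
  by exists (fun i => u 0 (pj i)); rewrite sum_ffE; apply: coordsP => [k||k]; rewrite mkvE.
by rewrite sum_ffE; split=> [|k]; rewrite mkvE.
Qed.

Lemma hatD_span (g : chart FM) v u : hat g fD v u <->
  exists a b, u = \sum_i a i *: ef i v + \sum_i b i *: ff i v.
Proof.
rewrite flag_hatD; split=> [uz|[a [b ->]]].
  exists (fun i => u 0 (xj i)), (fun i => u 0 (pj i)); rewrite sum_efE sum_ffE.
  apply: coordsP => [k||k]; rewrite [RHS]mxE !mkvE ?addr0 ?add0r // uz.
  by apply: eq_bigr => k _; rewrite mulrC.
rewrite sum_efE sum_ffE [LHS]mxE !mkvE addr0.
by apply: eq_bigr => k _; rewrite [in RHS]mxE !mkvE addr0 mulrC.
Qed.

Lemma flag_subbundle r (E : plane_field FM) (F : 'I_r -> 'rV[R]_dM -> 'rV[R]_dM) :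
  (forall i, smooth_rv_on setT (F i)) ->
  (forall (g : chart FM) v u, hat g E v u <-> exists a, u = \sum_i a i *: F i v) ->
  (forall v a, \sum_i a i *: F i v = 0 -> forall i, a i = 0) -> subbundle r E.
Proof.
move=> sF hE fF q0; set g := chart_at FM q0; have gq := cran_at FMm q0.
exists (cran g), (fun i => vf_of_chart g (F i)); split=> //.
- exact: cran_mopen.
- by move=> i; apply: smooth_vf_of_chart; [exact: FMm|exact: sF].
move=> q cq; have [_ pq] := parK cq.
have hq u : hat g E (crd g q) u <-> u *m of_chart g q \in E q by rewrite /hat pq.
have E0 (a : 'I_r -> R) : \sum_i a i *: vf_of_chart g (F i) q = (\sum_i a i *: F i (crd g q)) *m of_chart g q.
  by rewrite mulmx_suml; apply: eq_bigr => i _; rewrite -scalemxAl.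
apply/basis_enumP; split=> [i|u uE|a].
- have h : hat g E (crd g q) (F i (crd g q)).
    apply/hE; exists (fun k => (k == i)%:R).
    rewrite (bigD1 i) //= eqxx scale1r big1 ?addr0 // => k /negbTE ->.
    by rewrite scale0r.
  exact: (hq _).1 h.
- have toK : u *m to_chart g q *m of_chart g q = u by rewrite -mulmxA (to_of_chart FMm cq) mulmx1.
  have h : hat g E (crd g q) (u *m to_chart g q) by apply: (hq _).2; rewrite toK.
  have [a ua] := (hE _ _ _).1 h; exists a.
  by rewrite E0 -ua toK.
- rewrite E0 => /(congr1 (mulmx^~ (to_chart g q))); rewrite mul0mx -mulmxA (of_to_chart1 FMm cq) mulmx1.
  exact: fF.
Qed.

Lemma flag_subbundle1 : subbundle n fE1.
Proof.
apply: (flag_subbundle (F := ef)) => [i|g v u|v a]; [exact: smooth_ef|exact: hatE1_span|].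
by rewrite sum_efE => H i; have := congr1 (fun w : 'rV[R]_dM => w 0 (xj i)) H; rewrite mkvE mxE.
Qed.

Lemma flag_subbundle2 : subbundle n fE2.
Proof.
apply: (flag_subbundle (F := ff)) => [i|g v u|v a]; [exact: smooth_ff|exact: hatE2_span|].
by rewrite sum_ffE => H i; have := congr1 (fun w : 'rV[R]_dM => w 0 (pj i)) H; rewrite mkvE mxE.
Qed.

Lemma flag_subbundleD : subbundle n.*2 fD.
Proof.
pose F (i : 'I_n.*2) := match fintype.split (cast_ord (esym (addnn n)) i) with inl a => ef a | inr b => ff b end.
pose l (i : 'I_n) : 'I_n.*2 := cast_ord (addnn n) (lshift n i).
pose r (i : 'I_n) : 'I_n.*2 := cast_ord (addnn n) (rshift n i).
have sumF (a : 'I_n.*2 -> R) v : \sum_i a i *: F i v = \sum_i a (l i) *: ef i v + \sum_i a (r i) *: ff i v.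
  rewrite (reindex (cast_ord (addnn n))) /=; last first.
    by exists (cast_ord (esym (addnn n))) => i _; rewrite ?cast_ordK ?cast_ordKV.
  rewrite big_split_ord /=; congr (_ + _); apply: eq_bigr => i _; rewrite /F cast_ordK.
    by rewrite (unsplitK (inl i)).
  by rewrite (unsplitK (inr i)).
apply: (flag_subbundle (F := F)) => [i|g v u|v a].
- by rewrite /F; case: fintype.split => k; [exact: smooth_ef|exact: smooth_ff].
- rewrite hatD_span; split=> [[a [b ->]]|[a ->]]; last by rewrite sumF; exists (a \o l), (a \o r).
  pose ab (i : 'I_n.*2) := match fintype.split (cast_ord (esym (addnn n)) i) with inl k => a k | inr k => b k end.
  exists ab; rewrite sumF; congr (_ + _); apply: eq_bigr => i _; rewrite /ab /l /r cast_ordK.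
    by rewrite (unsplitK (inl i)).
  by rewrite (unsplitK (inr i)).
- rewrite sumF sum_efE sum_ffE => H i.
  have Hx k : a (l k) = 0.
    by have := congr1 (fun w : 'rV[R]_dM => w 0 (xj k)) H; rewrite [LHS]mxE [RHS]mxE !mkvE addr0.
  have Hp k : a (r k) = 0.
    by have := congr1 (fun w : 'rV[R]_dM => w 0 (pj k)) H; rewrite [LHS]mxE [RHS]mxE !mkvE add0r.
  have -> : i = cast_ord (addnn n) (cast_ord (esym (addnn n)) i) by rewrite cast_ordKV.
  by case: (split_ordP (cast_ord (esym (addnn n)) i)) => k ->; [exact: Hx|exact: Hp].
Qed.

Definition th v : eform R dM :=
  covector (delta_mx zi 0 - \sum_(i < n) v 0 (pj i) *: delta_mx (xj i) 0).

Arguments th v k _ : clear implicits.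

Lemma thE v (u : 'rV[R]_dM) : th v 1%N u = u 0 zi - \sum_k v 0 (pj k) * u 0 (xj k).
Proof.
have dE (i : 'I_dM) : (u *m (delta_mx i 0 : 'cV[R]_dM)) 0 0 = u 0 i by rewrite -colE mxE.
rewrite /th covector1 mulmxBr [LHS]mxE dE [X in _ + X]mxE mulmx_sumr summxE; congr (_ - _).
by apply: eq_bigr => k _; rewrite -scalemxAr mxE dE.
Qed.

Lemma smooth_covector A (a : 'rV[R]_dM -> 'cV[R]_dM) : open A ->
  (forall i, smooth_on A (fun v => a v i 0)) -> sform A (fun v => covector (a v)).
Proof.
move=> oA sa; split=> [v _|k w]; first exact: alternating_covector.
rewrite /covector; case: (k == 1%N); last exact: smooth_on_cst.
apply: smooth_on_sum => // i _; apply: smooth_on_mulmx => // i' j; first exact: smooth_on_cst.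
by rewrite [j]ord1.
Qed.

Lemma sform_th A : open A -> sform A th.
Proof.
move=> oA; apply: smooth_covector => // i.
apply: (smooth_on_ext oA (f := fun v => (delta_mx zi 0 : 'cV[R]_dM) i 0 -
  \sum_k v 0 (pj k) * (delta_mx (xj k) 0 : 'cV[R]_dM) i 0)) => [v _|].
  rewrite [RHS]mxE; congr (_ + _); rewrite [RHS]mxE summxE; congr (- _).
  by apply: eq_bigr => k _; rewrite [RHS]mxE.
apply: smooth_onB => //; first exact: smooth_on_cst.
by apply: smooth_on_sum => // k _; apply: smooth_onM => //; [exact: smooth_on_coor|exact: smooth_on_cst].
Qed.

Lemma frep_theta (g : chart FM) v : frep g (flag_theta g) v = th v.
Proof. exact: (frep_form_of_chart FMm). Qed.

Lemma dthE v (u w : 'rV[R]_dM) : ext_d th v 2%N (col_mx u w) =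
  \sum_k (w 0 (pj k) * u 0 (xj k) - u 0 (pj k) * w 0 (xj k)).
Proof.
have H (a b : 'rV[R]_dM) : 'D_a (fun y => th y 1%N b) v = - \sum_k a 0 (pj k) * b 0 (xj k).
  have dx k : differentiable (fun y : 'rV[R]_dM => y 0 (pj k) * b 0 (xj k)) v.
    by apply: difM; [exact: differentiable_coor|exact: dif_cst].
  have [ds es] := @derive_bigsum _ _ _ (index_enum 'I_n) xpredT
    (fun k (y : 'rV[R]_dM) => y 0 (pj k) * b 0 (xj k)) a v dx.
  have dN : differentiable (fun y : 'rV[R]_dM => - \sum_k y 0 (pj k) * b 0 (xj k)) v by exact: differentiableN.
  transitivity ('D_a (fun y : 'rV[R]_dM => b 0 zi + - \sum_k y 0 (pj k) * b 0 (xj k)) v).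
    by apply: eq_derive => y; exact: thE.
  rewrite (derD a (dif_cst _ _) dN) der_cst add0r (derN a ds) es; congr (- _).
  apply: eq_bigr => k _; rewrite (derM a (differentiable_coor _ _) (dif_cst _ _)) der_cst derive_coor.
  by ring.
rewrite ext_d2 !H opprK addrC -sumrB; apply: eq_bigr => k _; ring.
Qed.

(** Nondegeneracy is tested on [ef], which detects the p-entries, and on [ff], which detects the
    x-entries; the z-entry then vanishes because the vector is in [D]. *)
Lemma flag_contact_form (g : chart FM) : contact_form (cran g) fD (flag_theta g).
Proof.
have oc : mopen (cran g) by exact: cran_mopen.
have sT : smooth_form (cran g) (flag_theta g).
  apply: (smooth_form_chart FMm (c := g) oc); first by [].
  by apply: (sform_ext (oc g) (eta := th)) => [v _|]; [rewrite frep_theta|exact: sform_th (oc g)].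
have tE q k (u : 'M[R]_(k, dM)) : (flag_theta g : dform FM) q k u = th (crd g q) k (u *m to_chart g q) by [].
split=> //.
  by move=> q _ k u k1; rewrite tE /th /covector (negbTE k1).
move=> q cq; have [_ pq] := parK cq; set v := crd g q.
have hq u : u \in fD q <-> th v 1%N (u *m to_chart g q) = 0.
  rewrite thE; have := flag_hatD g v (u *m to_chart g q).
  rewrite /hat pq -mulmxA (to_of_chart FMm cq) mulmx1 => H; rewrite H.
  by split=> [->|/eqP]; [rewrite subrr|rewrite subr_eq0 => /eqP].
split=> [u|u uD H]; first exact: hq.
have dE (a b : 'rV[R]_dM) : extd (flag_theta g) q 2%N (col_mx a b) =
    ext_d th v 2%N (col_mx (a *m to_chart g q) (b *m to_chart g q)).
  rewrite (form_frep FMm (extd (flag_theta g)) cq) /epull (mul_col_mx a b).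
  rewrite (frep_extd FMm oc sT); last exact: cpre_crd.
  have -> : frep g (flag_theta g) = th by apply/funext => y; exact: frep_theta.
  exact: erefl.
set u' := u *m to_chart g q.
have H' w : th v 1%N w = 0 -> ext_d th v 2%N (col_mx u' w) = 0.
  move=> w0; have wE : w *m of_chart g q *m to_chart g q = w by rewrite -mulmxA (of_to_chart1 FMm cq) mulmx1.
  have wD : w *m of_chart g q \in fD q by apply: (hq _).2; rewrite wE.
  by have := H _ wD; rewrite dE wE.
have up i : u' 0 (pj i) = 0.
  have /H' : th v 1%N (ef i v) = 0.
    rewrite thE mkvE; apply/eqP; rewrite subr_eq0; apply/eqP.
    rewrite -[LHS](sum_delta_n (fun k => v 0 (pj k))); apply: eq_bigr => k _.
    by rewrite mkvE eq_sym.
  rewrite dthE => /eqP; under eq_bigr do rewrite !mkvE mul0r sub0r eq_sym.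
  by rewrite sumrN sum_delta_n oppr_eq0 => /eqP.
have ux i : u' 0 (xj i) = 0.
  have /H' : th v 1%N (ff i v) = 0 by rewrite thE mkvE big1 ?subr0 // => k _; rewrite mkvE mulr0.
  rewrite dthE; under eq_bigr do rewrite !mkvE mulr0 subr0 mulrC eq_sym.
  by rewrite sum_delta_n.
have uz : u' 0 zi = 0.
  by have /hq := uD; rewrite thE -/u' big1 ?subr0 // => k _; rewrite ux mulr0.
have : u' = 0 by apply: coordsP => [k||k]; rewrite [RHS]mxE.
move/(congr1 (mulmx^~ (of_chart g q))); rewrite /u' -mulmxA (to_of_chart FMm cq) mulmx1 mul0mx.
by [].
Qed.

Lemma flag_contact : contact_structure fD.
Proof.
split; first exact: flag_subbundleD.
move=> q; exists (cran (chart_at FM q)), (flag_theta (chart_at FM q)).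
by split; [exact: (cran_at FMm)|exact: flag_contact_form].
Qed.

(** Isotropy is required for every contact form, not just the standard one; a bundle spanned by
    commuting fields in [D] has it because d theta(X, Y) = -theta([X, Y]). *)
Let isotropic_fields (E : plane_field FM) (X : ('I_n -> R) -> 'rV[R]_dM -> 'rV[R]_dM) :
  (forall a, smooth_rv_on setT (X a)) ->
  (forall (g : chart FM) v u, hat g E v u <-> exists a, u = X a v) ->
  (forall (g : chart FM) v a, hat g fD v (X a v)) ->
  (forall a b v, cbracket (X a) (X b) v = 0) -> isotropic fD E.
Proof.
move=> sX hE hD br U theta ct q Uq u w uE wE; set g := chart_at FM q.
have gq : cran g q by exact: (cran_at FMm).
have [_ pq] := parK gq; have [oU sT _ _] := ct.
have [st tP] := contact_form_chart FMm flag_contact g ct; set v := crd g q.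
have hq z : z \in E q -> exists a, z *m to_chart g q = X a v.
  by move=> zE; apply: (hE g v _).1; rewrite /hat pq -mulmxA (to_of_chart FMm gq) mulmx1.
have [a ua] := hq _ uE; have [b wb] := hq _ wE.
have Uv : cpre g U v by exact: cpre_crd.
rewrite (form_frep FMm (extd theta) gq) /epull (mul_col_mx u w) (frep_extd FMm oU sT) // ua wb.
have s c : smooth_rv_on (cpre g U) (X c) by move=> j; apply: smooth_on_sub (sX c j).
have th0 c y : cpre g U y -> frep g theta y 1%N (X c y) = 0.
  by move=> Uy; have [_ h _] := tP y Uy; apply/h; exact: hD.
rewrite (ext_d2_bracket (oU g) st (s a) (s b) Uv (th0 a) (th0 b)) br.
rewrite (eform1_sum _ (st.1 v Uv)) big1 ?oppr0 // => l _.
by rewrite mxE mul0r.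
Qed.

Lemma flag_isotropic1 : isotropic fD fE1.
Proof.
apply: (isotropic_fields (X := fun a v => \sum_i a i *: ef i v)) => [a|g v u|g v a|a b v].
- move=> j; apply: (smooth_on_ext openT (f := fun v => \sum_i a i * ef i v 0 j)).
    by move=> v _; rewrite summxE; apply: eq_bigr => i _; rewrite [RHS]mxE.
  apply: smooth_on_sum => [|i _]; first exact: openT.
  by apply: smooth_onM; [exact: openT|exact: smooth_on_cst|exact: smooth_ef].
- exact: hatE1_span.
- apply/hatD_span; exists a, (fun=> 0); rewrite [X in _ + X]big1 ?addr0 // => i _.
  by rewrite scale0r.
have sX c : (fun v => \sum_i c i *: ef i v) = fun v => mkv (\sum_i c i * v 0 (pj i)) c (fun=> 0).
  by apply/funext => y; rewrite sum_efE.
rewrite !sX; pose X c (v : 'rV[R]_dM) := mkv (\sum_i c i * v 0 (pj i)) c (fun=> 0).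
have dX c k : differentiable (fun v : 'rV[R]_dM => c k * v 0 (pj k)) v.
  by apply: difM; [exact: dif_cst|exact: differentiable_coor].
have dz c := @derive_bigsum _ _ _ (index_enum 'I_n) xpredT
    (fun k (y : 'rV[R]_dM) => c k * y 0 (pj k)) _ v (dX c).
have D c d l : differentiable (fun y => X c y 0 l) v /\ 'D_(X d v) (fun y => X c y 0 l) v = 0.
  have [[k ->]|->|[k ->]] := idxP l.
  - have -> : (fun y => X c y 0 (xj k)) = fun=> c k by apply/funext => y; rewrite mkvE.
    by split; [exact: dif_cst|exact: der_cst].
  - have -> : (fun y => X c y 0 zi) = fun y => \sum_i c i * y 0 (pj i) by apply/funext => y; rewrite mkvE.
    have [h1 h2] := dz (X d v) c; split; first exact: h1.
    rewrite h2 big1 // => k _; rewrite (derM _ (dif_cst _ _) (differentiable_coor _ _)) der_cst derive_coor.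
    by rewrite mkvE !mulr0 addr0.
  - have -> : (fun y => X c y 0 (pj k)) = fun=> 0 by apply/funext => y; rewrite mkvE.
    by split; [exact: dif_cst|exact: der_cst].
have dv c : differentiable (X c) v by apply: differentiable_rV => l; exact: (D c c l).1.
apply/rowP => l; rewrite (cbracket_coor l (dv a) (dv b)) (D b a l).2 (D a b l).2 subrr.
by rewrite mxE.
Qed.

Lemma flag_isotropic2 : isotropic fD fE2.
Proof.
apply: (isotropic_fields (X := fun a v => \sum_i a i *: ff i v)) => [a|g v u|g v a|a b v].
- by have -> : (fun v => \sum_i a i *: ff i v) = fun=> mkv 0 (fun=> 0) a; [apply/funext => v; rewrite sum_ffE|move=> j; exact: smooth_on_cst].
- exact: hatE2_span.
- apply/hatD_span; exists (fun=> 0), a; rewrite [X in X + _]big1 ?add0r // => i _.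
  by rewrite scale0r.
have sX c : (fun v => \sum_i c i *: ff i v) = fun=> mkv 0 (fun=> 0) c.
  by apply/funext => y; rewrite sum_ffE.
by rewrite !sX /cbracket !derive_cst subrr.
Qed.

Lemma flag_lagrangian : lagrangian_pair fD fE1 fE2.
Proof.
split; [exact: flag_subbundle1|exact: flag_subbundle2|exact: flag_isotropic1|exact: flag_isotropic2|].
move=> q; set g := chart_at FM q; have gq : cran g q by exact: (cran_at FMm).
have [_ pq] := parK gq; set v := crd g q.
have hq (E : plane_field FM) u : hat g E v (u *m to_chart g q) <-> u \in E q.
  by rewrite /hat pq -mulmxA (to_of_chart FMm gq) mulmx1.
have ofE u : u *m of_chart g q *m to_chart g q = u by rewrite -mulmxA (of_to_chart1 FMm gq) mulmx1.
split; apply/vspaceP => u; apply/idP/idP.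
- move=> /memv_addP[a /hq/hatE1_span[ka ae] [b /hq/hatE2_span[kb be] ->]].
  by apply/hq/hatD_span; exists ka, kb; rewrite mulmxDl ae be.
- move=> /hq/hatD_span[a [b uab]].
  apply/memv_addP; exists ((\sum_i a i *: ef i v) *m of_chart g q).
    by apply/hq/hatE1_span; rewrite ofE; exists a.
  exists ((\sum_i b i *: ff i v) *m of_chart g q); first by apply/hq/hatE2_span; rewrite ofE; exists b.
  by rewrite -mulmxDl -uab -mulmxA (to_of_chart FMm gq) mulmx1.
- rewrite memv_cap => /andP[/hq/flag_hatE1[uz up] /hq/flag_hatE2[uz' ux]].
  have : u *m to_chart g q = 0 by apply: coordsP => [k||k]; rewrite [RHS]mxE.
  move/(congr1 (mulmx^~ (of_chart g q))); rewrite -mulmxA (to_of_chart FMm gq) mulmx1 mul0mx => ->.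
  exact: mem0v.
- by rewrite memv0 => /eqP ->; exact: mem0v.
Qed.

End FlagContact.

(** * The system Hess = 0 *)

Section DegreeParts.
Local Close Scope classical_set_scope.
Context {R : realType} {m : nat}.
Implicit Types (f g : eform R m) (A : set 'rV[R]_m).

Lemma eform1_scalar : @eform1 R m = escalar 1.
Proof. by apply: eform_ext => k v; rewrite /eform1 /escalar; case: (k == 0%N). Qed.

Lemma card_setC k (S : {set 'I_k}) : (#|S| + #|~: S|)%N = k.
Proof. by rewrite cardsC card_ord. Qed.

Lemma degree_wedge d e f g : degree d f -> degree e g -> degree (d + e) (wedge f g).
Proof.
move=> df dg k v kde; rewrite /wedge big1 // => S _.
have [Sd|Sd] := eqVneq #|S| d; last by rewrite df // mulr0 mul0r.
have [Se|Se] := eqVneq #|~: S| e; last by rewrite [X in _ * X]dg ?mulr0.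
by case/eqP: kde; rewrite -Sd -Se; exact: esym (card_setC S).
Qed.

(** A homogeneous second factor turns the projection of the product to degree [d] into a projection
    of the first factor to degree d - e. *)
Lemma wedge_part d e f g k v : degree e g ->
  (if k == d then wedge f g k v else 0) = wedge (fun j w => (j + e == d)%:R * f j w) g k v.
Proof.
move=> dg; transitivity ((k == d)%:R * wedge f g k v).
  by case: (k == d); rewrite ?mul1r ?mul0r.
rewrite /wedge big_distrr; apply: eq_bigr => S _ /=.
have [Se|Se] := eqVneq #|~: S| e; last by rewrite !(dg _ _ Se) !mulr0.
have -> : (k == d) = (#|S| + e == d)%N.
  by rewrite -Se; congr (_ == _); exact: esym (card_setC S).
by ring.
Qed.

Lemma sform_degree A (c : nat -> R) eta : open A -> sform A eta -> sform A (fun y k v => c k * eta y k v).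
Proof.
move=> oA [ae se]; split=> [y Ay|k v]; first exact/alternating_degree/ae.
by apply: smooth_onM; [exact: oA|exact: smooth_on_cst|exact: se].
Qed.

Lemma sform_cst A f : alternating f -> sform A (fun=> f).
Proof. by move=> af; split=> // k v; exact: smooth_on_cst. Qed.

End DegreeParts.

Section HessForm.
Context {R : realType} {n : nat}.
Notation dM := (n.*2.+1).
Notation pj := (@p_idx n).
Implicit Types (s : seq 'I_n) (u : 'rV[R]_dM).

Definition pform s : eform R dM := \big[wedge/eform1]_(i <- s) dcoord (pj i).

Arguments pform s k _ : clear implicits.

Lemma pform_nil : pform [::] = escalar 1.
Proof. by rewrite /pform big_nil eform1_scalar. Qed.

Lemma pform_cons i s : pform (i :: s) = wedge (dcoord (pj i)) (pform s).
Proof. by rewrite /pform big_cons. Qed.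

Lemma alternating_pform s : alternating (pform s).
Proof.
elim: s => [|i s IH]; first by rewrite pform_nil; exact: alternating_scalar.
by rewrite pform_cons; apply: alternating_wedge => //; exact: alternating_covector.
Qed.

Lemma degree_pform s : degree (size s) (pform s).
Proof.
elim: s => [|i s IH]; first by rewrite pform_nil => k v /negbTE k0; rewrite /escalar k0.
rewrite pform_cons; apply: (@degree_wedge _ _ 1 (size s)) IH => k v /negbTE k1.
by rewrite /dcoord /covector k1.
Qed.

Lemma ector_dcoord u i : ector u (dcoord i) = escalar (u 0 i).
Proof. by rewrite /dcoord ector_covector -colE mxE. Qed.

Lemma ector_pform0 s u : (forall i, i \in s -> u 0 (pj i) = 0) -> ector u (pform s) = ezero.
Proof.
elim: s => [|i s IH] u0.
  by rewrite pform_nil; apply: eform_ext => k v.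
rewrite pform_cons ector_wedge ector_dcoord u0 ?mem_head // IH => [|j js]; last first.
  by apply: u0; rewrite in_cons js orbT.
apply: eform_ext => k v; rewrite /eadd wedge_scalar /escale mul0r add0r /wedge big1 // => S _.
by rewrite /ezero mulr0.
Qed.

Lemma ector_pform s i u : i \notin s -> (forall j, u 0 (pj j) = (j == i)%:R) ->
  ector u (pform (i :: s)) = pform s.
Proof.
move=> si u0; rewrite pform_cons ector_wedge ector_dcoord u0 eqxx.
rewrite ector_pform0 => [|j js]; last by rewrite u0; case: eqP js si => // -> ->.
apply: eform_ext => k v; rewrite /eadd wedge_scalar /escale mul1r [X in _ + X]big1 ?addr0 // => S _.
by rewrite /ezero mulr0.
Qed.

(** The dual basis vectors in the order of [s], contracted one after the other, give the value 1
    without a sign. *)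
Lemma pform_ff s k : uniq s -> k = size s -> exists B : 'M[R]_(k, dM),
  (forall i, exists j, row i B = ff j 0) /\ pform s k B = 1.
Proof.
move=> + ->; elim: s => [_|i s IH /= /andP[si /IH[B [BF B1]]]].
  by exists 0; split=> [[]|]; rewrite // pform_nil.
exists (col_mx (ff i 0 : 'rV[R]_dM) B); split=> [l|].
  have [->|[j ->]] := ord1kP l; first by exists i; exact: row0_col_mx.
  by rewrite rowS_col_mx.
rewrite -[LHS]/(ector (ff i 0) (pform (i :: s)) (size s) B) ector_pform // => j.
by rewrite mkvE.
Qed.

Definition hessform : eform R dM := pform (index_enum 'I_n).

Arguments hessform k _ : clear implicits.

Lemma size_index_ord : size (index_enum 'I_n) = n.
Proof. by rewrite -[RHS]card_ord cardE enumT. Qed.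

Lemma degree_hessform : degree n hessform.
Proof. by rewrite -[X in degree X]size_index_ord; exact: degree_pform. Qed.

(** If the value on [v] were 0, it would be 0 on all tuples of combinations of its rows, in
    particular on a standard tuple where it is 1. *)
Lemma hessform_neq0 (v : 'M[R]_(n, dM)) : row_free v ->
  (forall i, exists a : 'I_n -> R, row i v = \sum_j a j *: ff j 0) -> hessform n v != 0.
Proof.
move=> fv /choice[a va]; apply/eqP => v0.
have af : alternating hessform := alternating_pform _.
have [B [BF B1]] := pform_ff (index_enum_uniq _) (esym size_index_ord).
suff : hessform n B = 0 by move=> H; move: B1; rewrite -/hessform H => /esym/eqP; rewrite oner_eq0.
pose A : 'M[R]_n := \matrix_(i, j) a i j.
have vA : v = A *m \matrix_j ff j 0.
  apply/row_matrixP => i; rewrite va row_mul mulmx_sum_row; apply: eq_bigr => j _.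
  by rewrite rowK !mxE.
have uA : A \in unitmx.
  rewrite -row_free_unit; apply/eqP/anti_leq; rewrite rank_leq_row /=.
  by move/eqP: fv => {1}<-; rewrite vA; exact: mxrankM_maxl.
have fE j : ff j (0 : 'rV[R]_dM) = \sum_i invmx A j i *: row i v.
  rewrite vA; transitivity (row j (invmx A *m (A *m \matrix_j ff j 0)) : 'rV[R]_dM).
    by rewrite mulmxA mulVmx // mul1mx rowK.
  by rewrite row_mul mulmx_sum_row; apply: eq_bigr => i _; rewrite mxE.
apply: (@alt_span _ _ hessform n (fun u => exists i, u = row i v) B (af n)) => [i|C Cv].
  have [j ->] := BF i; exists n, (invmx A j), (fun i => row i v); split; last exact: fE.
  by move=> l; exists l.
have -> : C = \matrix_i row i C by apply/row_matrixP => i; rewrite rowK.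
apply: (@alt_tuple _ _ hessform n (fun i => row i v)) => //.
by rewrite -[RHS]v0; congr (hessform n _); apply/row_matrixP => i; rewrite rowK.
Qed.

End HessForm.
Arguments hessform {R n} k v.

Arguments th {R n} v k _.
Section HessSystem.
Context {R : realType} {n : nat}.
Notation dM := (n.*2.+1).
Notation FM := (flag_space R n).
Notation fD := (@flag_D R n).
Notation fE1 := (@flag_E1 R n).
Notation fE2 := (@flag_E2 R n).
Notation th := (@th R n).
Notation dth := (ext_d th).
Notation om := (fun _ : 'rV[R]_dM => @hessform R n).

Let FMm := @flag_manifold R n.

Lemma frep_omega (g : chart FM) v : frep g (flag_omega g) v = hessform.
Proof. exact: (frep_form_of_chart FMm). Qed.

Let smooth_theta (g : chart FM) : smooth_form (cran g) (flag_theta g).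
Proof. by have [] := flag_contact_form g. Qed.

Lemma frep_extd_theta (g : chart FM) v : frep g (extd (flag_theta g)) v = dth v.
Proof.
have oc : mopen (cran g) by exact: cran_mopen.
have h : cpre g (cran g) v by split=> //; exact: cran_par.
rewrite (frep_extd FMm oc (smooth_theta g) h).
by have -> : frep g (flag_theta g) = th by apply/funext => y; exact: frep_theta.
Qed.

Lemma smooth_omega (g : chart FM) : smooth_form (cran g) (flag_omega g).
Proof.
have oc : mopen (cran g) by exact: cran_mopen.
apply: (smooth_form_chart FMm (c := g) oc); first by [].
apply: (sform_ext (oc g) (eta := om)) => [v _|]; first by rewrite frep_omega.
by apply: sform_cst; exact: alternating_pform.
Qed.

Let omE (g : chart FM) q k (u : 'M[R]_(k, dM)) :
  (flag_omega g : dform FM) q k u = hessform k (u *m to_chart g q).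
Proof. by []. Qed.

Lemma homog_omega (g : chart FM) : homog n (cran g) (flag_omega g).
Proof. by move=> q _ k v kn; rewrite omE (degree_hessform _ kn). Qed.

Lemma omega_volume (g : chart FM) q : cran g q ->
  (forall (u : 'rV[R]_dM) k (v : 'M[R]_(k, dM)), u \in fE1 q ->
          (flag_omega g : dform FM) q (1 + k)%N (col_mx u v) = 0) /\
  (forall v : 'M[R]_(n, dM), (forall i, row i v \in fE2 q) -> row_free v ->
          (flag_omega g : dform FM) q n v != 0).
Proof.
move=> gq; have [_ pq] := parK gq; set y := crd g q.
have hq (E : plane_field FM) u : hat g E y (u *m to_chart g q) <-> u \in E q.
  by rewrite /hat pq -mulmxA (to_of_chart FMm gq) mulmx1.
split=> [u k v /hq/flag_hatE1[_ up]|v vE fv]; rewrite omE.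
  by rewrite mul_col_mx -[LHS]/(ector _ _ _ _) /hessform ector_pform0.
apply: hessform_neq0 => [|i].
  rewrite /row_free mxrankMfree //; apply/row_freeP; exists (of_chart g q).
  by rewrite (to_of_chart FMm gq).
by have /hq/hatE2_span := vE i; rewrite row_mul.
Qed.

Lemma hess_adapted (c g : chart FM) : adapted n (cpre c (cran g)) (hat c fD) (hat c fE1) (hat c fE2)
  (frep c (flag_theta g)) (frep c (flag_omega g)).
Proof.
apply: adapted_chart; [exact: FMm|exact: flag_contact|exact: flag_contact_form|exact: smooth_omega|exact: homog_omega|].
by move=> q; exact: omega_volume.
Qed.

Definition hess_ideal (g : chart FM) : eds FM :=
  gen_ideal3 (flag_theta g) (extd (flag_theta g)) (flag_omega g).

(** [Hess_system] uses the chart selected at each point. Independence of this choice is not computed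
    from transition maps: the generators from both charts are adapted to the same Lagrangian pair,
    so they generate the same ideal. *)
Lemma hess_ideal_chart (g g' : chart FM) q eta : cran g q -> cran g' q ->
  hess_ideal g q eta -> hess_ideal g' q eta.
Proof.
move=> gq gq'; pose c := g'.
have [A [X [Ax [Ad [oA sX ED XE Ds]]]]] := framed_chart FMm flag_lagrangian gq'.
rewrite /hess_ideal !(gen_ideal3_chart FMm _ _ _ _ gq').
have oc (h : chart FM) : mopen (cran h) by exact: cran_mopen.
have ogc (h : chart FM) : open (cpre c (cran h)) by exact: oc.
have E h y : cpre c (cran h) y -> frep c (extd (flag_theta h)) y = ext_d (frep c (flag_theta h)) y.
  by move=> hy; exact: (frep_extd FMm (oc h) (smooth_theta h)).
have x1 : cpre c (cran g) (crd c q) by exact: cpre_crd.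
have x2 : cpre c (cran g') (crd c q) by exact: cpre_crd.
move=> H; apply: (cideal_ext (ogc g') x2 (f1 := frep c (flag_theta g'))
   (f2 := ext_d (frep c (flag_theta g'))) (f3 := frep c (flag_omega g')) (eta := frep c eta)).
  by move=> y hy; rewrite E.
pose B := A `&` (cpre c (cran g) `&` cpre c (cran g')).
have oB : open B := openI oA (openI (ogc g) (ogc g')).
apply: (cideal_adapted (n := n) (A := B) (D := hat c fD) (E1 := hat c fE1) (E2 := hat c fE2) (X := X)
  (theta := frep c (flag_theta g)) (om := frep c (flag_omega g))).
- split=> // [i|y u [Ay _]|y [Ay _]|y u [Ay _]]; [|exact: ED|exact: XE|exact: Ds].
  by move=> j; apply: smooth_on_sub (sX i j) => y [].
- by apply: adapted_sub (hess_adapted c g) => y [_ []].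
- by apply: adapted_sub (hess_adapted c g') => y [_ []].
- by split=> //; split.
apply: (cideal_ext (ogc g) x1 _ H) => y hy; rewrite E //.
Qed.

Lemma hess_idealE (g : chart FM) q eta : cran g q -> @Hess_system R n q eta <-> hess_ideal g q eta.
Proof.
move=> gq; have g0q : cran (chart_at FM q) q by exact: (cran_at FMm).
by split; apply: hess_ideal_chart.
Qed.

(** In every chart the system is generated by the same three coordinate forms, so all calculations
    reduce to one ideal on R^(2n+1). *)
Lemma hess_cideal (g : chart FM) q eta : cran g q ->
  @Hess_system R n q eta <-> cideal th dth om (crd g q) (frep g eta).
Proof.
move=> gq; rewrite (hess_idealE _ gq) /hess_ideal (gen_ideal3_chart FMm _ _ _ _ gq).
by split; apply: (cideal_ext openT I) => y _; rewrite frep_theta frep_extd_theta frep_omega.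
Qed.

End HessSystem.

(** * The coordinate ideal is a homogeneous differential ideal *)

Section IdealOps.
Context {R : realType} {n : nat}.
Notation dM := (n.*2.+1).
Notation th := (@th R n).
Notation dth := (ext_d th).
Notation om := (fun _ : 'rV[R]_dM => @hessform R n).
Implicit Types (x y : 'rV[R]_dM) (eta zeta : 'rV[R]_dM -> eform R dM).
Notation hI := (cideal th dth om).

Lemma wedge0l (f : eform R dM) : wedge ezero f = ezero.
Proof. by apply: eform_ext => k v; rewrite /wedge big1 // => S _; rewrite /ezero mulr0 mul0r. Qed.

Lemma wedge0r (f : eform R dM) : wedge f ezero = ezero.
Proof. by apply: eform_ext => k v; rewrite /wedge big1 // => S _; rewrite /ezero mulr0. Qed.

Lemma eadd0 : eadd ezero ezero = ezero :> eform R dM.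
Proof. by apply: eform_ext => k v; rewrite /eadd /ezero addr0. Qed.

Lemma cideal0 x : hI x (fun=> ezero).
Proof.
exists setT, (fun=> ezero), (fun=> ezero), (fun=> ezero); split=> //; first exact: openT.
  by split; apply: sform_cst; exact: alternating0.
by move=> y _; rewrite !wedge0l !eadd0.
Qed.

Lemma cidealD x eta zeta : hI x eta -> hI x zeta -> hI x (fun y => eadd (eta y) (zeta y)).
Proof.
move=> [ O [b1 [b2 [b3 [oO Ox [s1 s2 s3] E]]]]] [ O' [c1 [c2 [c3 [oO' Ox' [s1' s2' s3'] E']]]]].
have W1 : O `&` O' `<=` O by move=> y [].
have W2 : O `&` O' `<=` O' by move=> y [].
have oW : open (O `&` O') by exact: openI.
exists (O `&` O'), (fun y => eadd (b1 y) (c1 y)), (fun y => eadd (b2 y) (c2 y)), (fun y => eadd (b3 y) (c3 y)).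
split=> //.
  by split; [exact: sform_add oW (sform_sub W1 s1) (sform_sub W2 s1')|
    exact: sform_add oW (sform_sub W1 s2) (sform_sub W2 s2')|
    exact: sform_add oW (sform_sub W1 s3) (sform_sub W2 s3')].
move=> y [Oy Oy']; rewrite E // E' // !wedgeDl.
by apply: eform_ext => k v; rewrite /eadd; ring.
Qed.

Lemma cidealM x (al eta : 'rV[R]_dM -> eform R dM) A : open A -> A x -> sform A al -> hI x eta ->
  hI x (fun y => wedge (al y) (eta y)).
Proof.
move=> oA Ax sa [ O [b1 [b2 [b3 [oO Ox [s1 s2 s3] E]]]]].
have W1 : A `&` O `<=` A by move=> y [].
have W2 : A `&` O `<=` O by move=> y [].
have oW : open (A `&` O) by exact: openI.
exists (A `&` O), (fun y => wedge (al y) (b1 y)), (fun y => wedge (al y) (b2 y)), (fun y => wedge (al y) (b3 y)).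
split=> //.
  by split; [exact: sform_wedge oW (sform_sub W1 sa) (sform_sub W2 s1)|
    exact: sform_wedge oW (sform_sub W1 sa) (sform_sub W2 s2)|
    exact: sform_wedge oW (sform_sub W1 sa) (sform_sub W2 s3)].
by move=> y [Ay Oy]; rewrite E // !wedgeDr !wedgeA.
Qed.

Lemma degree_th y : degree 1 (th y).
Proof. by move=> k v /negbTE k1; rewrite /th /covector k1. Qed.

Lemma degree_dth y : degree 2 (dth y).
Proof.
case=> [|k] v k2; first exact: ext_d0.
rewrite /ext_d big1 // => i _.
have -> : (fun z => th z k.+1.-1 (row' i v)) = fun=> 0.
  by apply/funext => z; apply: degree_th; apply/eqP => /= k1; case/eqP: k2; rewrite k1.
by rewrite der_cst mulr0.
Qed.

(** The generators have degrees 1, 2 and n, so the part of degree [d] needs the coefficients in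
    degrees d - 1, d - 2 and d - n; the test [k + e == d] avoids truncated subtraction. *)
Lemma cideal_part x eta d : hI x eta -> hI x (fun y k v => if k == d then eta y k v else 0).
Proof.
move=> [ O [b1 [b2 [b3 [oO Ox [s1 s2 s3] E]]]]].
pose sh e (b : 'rV[R]_dM -> eform R dM) y := (fun k v => (k + e == d)%:R * b y k v) : eform R dM.
exists O, (sh 1 b1), (sh 2 b2), (sh n b3); split=> //.
  by split; apply: sform_degree.
move=> y Oy; apply: eform_ext => k v; rewrite E //.
have H (a b c : R) : (if k == d then a + (b + c) else 0) =
   (if k == d then a else 0) + ((if k == d then b else 0) + (if k == d then c else 0)).
  by case: (k == d); rewrite ?addr0.
rewrite /eadd H (wedge_part d _ v (@degree_th y)) (wedge_part d _ v (@degree_dth y)).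
by rewrite (wedge_part d _ v degree_hessform).
Qed.

Lemma cideal_d x eta : hI x eta -> hI x (ext_d eta).
Proof.
move=> [ O [b1 [b2 [b3 [oO Ox [s1 s2 s3] E]]]]].
have st : sform O th by exact: sform_th.
have sdt : sform O dth by exact: sform_ext_d.
have so : sform O om by apply: sform_cst; exact: alternating_pform.
(* The derivative of b1 /\ theta also produces [ebar] of b1 times d theta, which joins the second
   coefficient; d theta and the constant [hessform] are closed. *)
exists O, (ext_d b1), (fun y => eadd (ebar (b1 y)) (ext_d b2 y)), (ext_d b3); split=> //.
  split; [exact: sform_ext_d| |exact: sform_ext_d].
  by apply: sform_add => //; [exact: sform_bar|exact: sform_ext_d].
move=> y Oy; rewrite (near_eq_ext_d oO Oy E).
have w1 : smooth_e O (fun y => wedge (b1 y) (th y)) := (sform_wedge oO s1 st).2.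
have w2 : smooth_e O (fun y => wedge (b2 y) (dth y)) := (sform_wedge oO s2 sdt).2.
have w3 : smooth_e O (fun y => wedge (b3 y) (om y)) := (sform_wedge oO s3 so).2.
have w23 : smooth_e O (fun y => eadd (wedge (b2 y) (dth y)) (wedge (b3 y) (om y))).
  exact: (sform_add oO (sform_wedge oO s2 sdt) (sform_wedge oO s3 so)).2.
rewrite (ext_dD w1 w23 Oy) (ext_dD w2 w3 Oy).
rewrite (ext_d_wedge oO s1.2 st.2 Oy) (ext_d_wedge oO s2.2 sdt.2 Oy) (ext_d_wedge oO s3.2 so.2 Oy).
rewrite (ext_d_ext_d oO st.2 Oy) (ext_d_cst (eta := om) y (a := hessform)) // !wedge0r wedgeDl.
by apply: eform_ext => k v; rewrite /eadd /ezero; ring.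
Qed.

End IdealOps.

Section FlatSystem.
Context {R : realType} {n : nat}.
Notation dM := (n.*2.+1).
Notation FM := (flag_space R n).
Notation fD := (@flag_D R n).
Notation fE1 := (@flag_E1 R n).
Notation fE2 := (@flag_E2 R n).
Notation th := (@th R n).
Notation dth := (ext_d th).
Notation om := (fun _ : 'rV[R]_dM => @hessform R n).
Notation hess := (@Hess_system R n).

Let FMm := @flag_manifold R n.

Let sth (O : set 'rV[R]_dM) : open O -> sform O th.
Proof. exact: sform_th. Qed.

(** Passage from the stalk at one point to a neighbourhood: the same coefficients serve at all
    nearby points once the system there is expressed in the same chart. *)
Lemma hess_smooth (q : FM) eta : hess q eta ->
  exists U : set FM, [/\ mopen U, U q, smooth_form U eta & forall q', U q' -> hess q' eta].
Proof.
move=> H; set g := chart_at FM q; have gq : cran g q by exact: (cran_at FMm).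
have oc : mopen (cran g) by exact: cran_mopen.
have [V [a1 [a2 [a3 [oV Vq [s1 s2 s3] etaE]]]]] := (hess_idealE eta gq).1 H.
have oU : mopen (V `&` cran g) by exact: mopenI.
exists (V `&` cran g); split; [exact: oU|by split| |]; last first.
  move=> q' [Vq' gq']; apply/(hess_idealE eta gq').
  by exists V, a1, a2, a3; split.
apply: (smooth_form_chart FMm (c := g) oU) => [q' []//|].
set O := cpre g _; have oO : open O by exact: oU.
have OV : O `<=` cpre g V by move=> y [dy []].
have s' a : smooth_form V a -> sform O (frep g a).
  by move=> sa; apply: sform_sub OV _; exact: smooth_form_sform.
have so : sform O om by apply: sform_cst; exact: alternating_pform.
have sdt : sform O dth := sform_ext_d oO (sth oO).
apply: (sform_ext oO (eta := fun y => eadd (wedge (frep g a1 y) (th y))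
         (eadd (wedge (frep g a2 y) (dth y)) (wedge (frep g a3 y) hessform)))).
  move=> y [dy [Vy gy]]; apply: eform_ext => k v.
  rewrite [RHS]etaE // /eadd -(frep_theta g) -(frep_extd_theta g) -(frep_omega g y).
  by rewrite -!frep_dwedge.
exact: sform_add oO (sform_wedge oO (s' _ s1) (sth oO))
  (sform_add oO (sform_wedge oO (s' _ s2) sdt) (sform_wedge oO (s' _ s3) so)).
Qed.

Lemma hess_eds : is_eds hess.
Proof.
move=> q; set g := chart_at FM q; have gq : cran g q by exact: (cran_at FMm).
have hc := fun eta => hess_cideal eta gq.
split; first by move=> eta; exact: hess_smooth.
split; first move=> eta zeta [U [oU Uq E]] /hc H.
  apply/hc; apply: (cideal_ext (oU g) (cpre_crd gq Uq) _ H) => y [dy Uy]; split=> //.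
  by apply: eform_ext => k v; rewrite /frep E.
split; first by apply/hc; exact: cideal0.
split; first by move=> eta zeta /hc h1 /hc h2; apply/hc; exact: cidealD h1 h2.
split; first by move=> d eta /hc h; apply/hc; exact: cideal_part h.
split.
  move=> U al eta oU Uq sa /hc h; apply/hc.
  apply: (cideal_ext (oU g) (cpre_crd gq Uq) _ (cidealM (oU g) (cpre_crd gq Uq) (smooth_form_sform g sa) h)).
  by move=> y _; rewrite frep_dwedge.
move=> eta He; have [U [oU Uq se _]] := hess_smooth He; apply/hc.
apply: (cideal_ext (oU g) (cpre_crd gq Uq) _ (cideal_d ((hc eta).1 He))) => y Uy.
by rewrite (frep_extd FMm oU se Uy).
Qed.

Lemma hess_generator (g : chart FM) :
  local_generator fD hess (cran g) (flag_theta g) (flag_omega g).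
Proof.
split; [exact: flag_contact_form|exact: smooth_omega|exact: homog_omega|].
by move=> q gq eta; exact: hess_idealE.
Qed.

Lemma flat_model_decomposable : decomposable_MA_system (flat_model R n).
Proof.
split; [exact: FMm|exact: flag_contact|exact: flag_lagrangian| |].
  split; first exact: hess_eds.
  move=> q; exists (cran (chart_at FM q)), (flag_theta (chart_at FM q)), (flag_omega (chart_at FM q)).
  by split; [exact: (cran_at FMm)|exact: hess_generator].
move=> q; exists (cran (chart_at FM q)), (flag_theta (chart_at FM q)), (flag_omega (chart_at FM q)).
split; [exact: (cran_at FMm)|exact: hess_generator|].
by move=> q' cq'; exact: omega_volume.
Qed.

End FlatSystem.

(** * Infinitesimal automorphisms of the flat model *)

Section LieForms.
Context {R : realType} {m : nat}.
Implicit Types (A : set 'rV[R]_m) (x y u : 'rV[R]_m) (eta zeta : 'rV[R]_m -> eform R m)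
  (X : 'rV[R]_m -> 'rV[R]_m) (f : eform R m).

(** The Lie derivative in coordinates by Cartan's formula, parallel to [lie_form]. *)
Definition clie X eta x : eform R m :=
  eadd (ector (X x) (ext_d eta x)) (ext_d (fun y => ector (X y) (eta y)) x).

#[global] Arguments clie X eta x k v : clear implicits.

Lemma degree_ext_d d eta x : (forall y, degree d (eta y)) -> degree d.+1 (ext_d eta x).
Proof.
move=> de [|k] v kd; first exact: ext_d0.
rewrite /ext_d big1 // => i _; rewrite (_ : 'D_ _ _ _ = 0) ?mulr0 //.
rewrite -(der_cst 0 (row i v) x); apply: eq_derive => y; apply: de => /=.
by move: kd; rewrite eqSS.
Qed.

Lemma degree_ector d f u : degree d.+1 f -> degree d (ector u f).
Proof. by move=> df k v kd; apply: df; rewrite add1n eqSS. Qed.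

Lemma degree_clie d X eta x : (forall y, degree d.+1 (eta y)) -> degree d.+1 (clie X eta x).
Proof.
move=> de k v kd; rewrite /clie /eadd (degree_ector (X x) (degree_ext_d x de) v kd) add0r.
by apply: degree_ext_d kd => y; exact: degree_ector.
Qed.

Lemma sform_clie A X eta : open A -> smooth_rv_on A X -> sform A eta -> sform A (clie X eta).
Proof.
move=> oA sX se; apply: sform_add => //.
  by apply: sform_ector_vf => //; exact: sform_ext_d.
by apply: sform_ext_d => //; exact: sform_ector_vf.
Qed.

Lemma near_eq_clie A X eta zeta x : open A -> A x -> (forall y, A y -> eta y = zeta y) ->
  clie X eta x = clie X zeta x.
Proof.
move=> oA Ax E; rewrite /clie (near_eq_ext_d oA Ax E); congr eadd.
by apply: (near_eq_ext_d oA Ax) => y Ay; rewrite E.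
Qed.

Lemma clieD A X eta zeta x : open A -> smooth_rv_on A X -> sform A eta -> sform A zeta -> A x ->
  clie X (fun y => eadd (eta y) (zeta y)) x = eadd (clie X eta x) (clie X zeta x).
Proof.
move=> oA sX se sz Ax; rewrite /clie (ext_dD se.2 sz.2 Ax) ectorD.
have -> : ext_d (fun y => ector (X y) (eadd (eta y) (zeta y))) x =
  eadd (ext_d (fun y => ector (X y) (eta y)) x) (ext_d (fun y => ector (X y) (zeta y)) x).
  exact: ext_dD (sform_ector_vf oA sX se).2 (sform_ector_vf oA sX sz).2 Ax.
by apply: eform_ext => k v; rewrite /eadd; ring.
Qed.

(** The Lie derivative is the graded commutator of two antiderivations, contraction and [ext_d]; the
    terms carrying a grading sign cancel. *)
Lemma clie_wedge A X eta zeta x : open A -> smooth_rv_on A X -> sform A eta -> sform A zeta -> A x ->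
  clie X (fun y => wedge (eta y) (zeta y)) x =
  eadd (wedge (clie X eta x) (zeta x)) (wedge (eta x) (clie X zeta x)).
Proof.
move=> oA sX se sz Ax; rewrite /clie.
have sXe := sform_ector_vf oA sX se; have sXz := sform_ector_vf oA sX sz.
have sb := sform_bar oA se.
rewrite (ext_d_wedge oA se.2 sz.2 Ax) ectorD !ector_wedge ebarK ector_ebar.
rewrite (near_eq_ext_d oA Ax (eta := fun y => ector (X y) (wedge (eta y) (zeta y))) (zeta := fun y => eadd (wedge (ector (X y) (eta y)) (zeta y))
   (wedge (ebar (eta y)) (ector (X y) (zeta y))))); last by move=> y _; exact: ector_wedge.
rewrite (ext_dD (sform_wedge oA sXe sz).2 (sform_wedge oA sb sXz).2 Ax).
rewrite (ext_d_wedge oA sXe.2 sz.2 Ax) (ext_d_wedge oA sb.2 sXz.2 Ax) ebarK (ext_d_bar se.2 Ax).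
rewrite !(wedgeDl, wedgeDr, wedgeZl).
by apply: eform_ext => k v; rewrite /eadd /escale; ring.
Qed.

Lemma clie_d A X eta x : open A -> smooth_rv_on A X -> sform A eta -> A x ->
  clie X (ext_d eta) x = ext_d (clie X eta) x.
Proof.
move=> oA sX se Ax; have sXe := sform_ector_vf oA sX se.
have sXde := sform_ector_vf oA sX (sform_ext_d oA se).
rewrite /clie (ext_dD sXde.2 (sform_ext_d oA sXe).2 Ax).
by rewrite (ext_d_ext_d oA se.2 Ax) (ext_d_ext_d oA sXe.2 Ax); apply: eform_ext => k v; rewrite /eadd /ector /ezero addrC.
Qed.

Lemma clie_cst X f x : clie X (fun=> f) x = ext_d (fun y => ector (X y) f) x.
Proof.
rewrite /clie (ext_d_cst (eta := fun=> f) x (a := f)) //.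
by apply: eform_ext => k v; rewrite /eadd /ector /ezero add0r.
Qed.

Lemma clie1 X eta x u : (forall y, degree 1 (eta y)) ->
  clie X eta x 1%N u = 'D_(X x) (fun y => eta y 1%N u) x - 'D_u (fun y => eta y 1%N (X x)) x
    + 'D_u (fun y => eta y 1%N (X y)) x.
Proof.
move=> de; rewrite /clie /eadd -ext_d2; congr (_ + _).
have -> : (fun y => ector (X y) (eta y)) = fun y => escalar (eta y 1%N (X y)).
  by apply/funext => y; exact: ector_degree1.
have e : ext_d (fun y => escalar (eta y 1%N (X y))) x 1%N u = ector u (dscalar (fun y => eta y 1%N (X y)) x) 0%N 0.
  rewrite /ector /dscalar; apply: eform_cast => // i i' j ii'.
  by rewrite !ord1 mxE; case: splitP => a ia; [rewrite !ord1|case: a ia].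
by rewrite e ector_dscalar.
Qed.

End LieForms.
Arguments clie {R m} X eta x k v.

(** * Infinitesimal projective transformations in flag coordinates *)

Section ProjectiveFields.
Context {R : realType} {n : nat}.
Notation dM := (n.*2.+1).
Notation N := (n.+2).
Notation zi := (z_idx n).
Notation xj := (@x_idx n).
Notation pj := (@p_idx n).
Notation th := (@th R n).
Implicit Types (u v w : 'rV[R]_dM) (A : set 'rV[R]_dM).
Variable B : 'M[R]_N.

(** Rate at which the unnormalised flow changes the entry 1 of the line at [i1]; [fld_mu] plays this
    role for the covector at [i0], with opposite sign because the covector moves by -B. *)
Definition fld_lam v := (flag_pt v *m B) 0 i1.
Definition fld_mu v := (B *m xi v) i0 0.

(* The vector field of the flow [l, x |-> l exp(tB), exp(-tB) x] on the pairs representing a flag,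
   renormalised so that [l 0 i1 = 1] and [x i0 0 = 1]. *)
Definition fld v : 'rV[R]_dM := mkv ((flag_pt v *m B) 0 i0 - fld_lam v * v 0 zi)
  (fun k => (flag_pt v *m B) 0 (ix k) - fld_lam v * v 0 (xj k))
  (fun k => (B *m xi v) (ix k) 0 + fld_mu v * v 0 (pj k)).

Lemma smooth_fld A : open A -> smooth_rv_on A fld.
Proof.
move=> oA j; have sl : smooth_on A fld_lam by exact: smooth_ptM.
have sm : smooth_on A fld_mu by exact: smooth_xiM.
have sc i : smooth_on A (fun v : 'rV[R]_dM => v 0 i) by exact: smooth_on_coor.
have [[k ->]|->|[k ->]] := idxP j.
- apply: (smooth_on_ext oA (f := fun v => (flag_pt v *m B) 0 (ix k) - fld_lam v * v 0 (xj k))) => [v _|].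
    by rewrite mkvE.
  by apply: (smooth_onB oA); [exact: smooth_ptM|exact: smooth_onM].
- apply: (smooth_on_ext oA (f := fun v => (flag_pt v *m B) 0 i0 - fld_lam v * v 0 zi)) => [v _|].
    by rewrite mkvE.
  by apply: (smooth_onB oA); [exact: smooth_ptM|exact: smooth_onM].
- apply: (smooth_on_ext oA (f := fun v => (B *m xi v) (ix k) 0 + fld_mu v * v 0 (pj k))) => [v _|].
    by rewrite mkvE.
  by apply: (smooth_onD oA); [exact: smooth_xiM|exact: smooth_onM].
Qed.

Let mxB p q (a b : 'M[R]_(p, q)) i j : (a - b) i j = a i j - b i j.
Proof. by rewrite !mxE. Qed.
Let mxD p q (a b : 'M[R]_(p, q)) i j : (a + b) i j = a i j + b i j.
Proof. by rewrite !mxE. Qed.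
Let mxZ p q c (a : 'M[R]_(p, q)) i j : (c *: a) i j = c * a i j.
Proof. by rewrite !mxE. Qed.

Let d_pt j v : differentiable (fun y => flag_pt y 0 j) v.
Proof. exact: (smooth_on_diff (smooth_pt (A := setT) j)). Qed.
Let d_xi j v : differentiable (fun y => xi y j 0) v.
Proof. exact: (smooth_on_diff (smooth_xi (A := setT) j openT)). Qed.
Let d_ptM j v : differentiable (fun y => (flag_pt y *m B) 0 j) v.
Proof. exact: (smooth_on_diff (smooth_ptM (A := setT) B j openT)). Qed.
Let d_xiM j v : differentiable (fun y => (B *m xi y) j 0) v.
Proof. exact: (smooth_on_diff (smooth_xiM (A := setT) B j openT)). Qed.
Let d_fld v : differentiable fld v.
Proof. exact: (smooth_rv_diff (smooth_fld openT)). Qed.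

Lemma dpt_fld v j : dpt (fld v) 0 j = (flag_pt v *m B) 0 j - fld_lam v * flag_pt v 0 j.
Proof.
have [->|->|[k ->]] := caseN j.
- by rewrite dpt0 mkvE pt0.
- by rewrite dpt1 pt1 mulr1 subrr.
- by rewrite dptx mkvE ptx.
Qed.

Lemma dpt_derive (F : 'rV[R]_dM -> 'rV[R]_dM) u v j : differentiable F v ->
  differentiable (fun y => dpt (F y) 0 j) v /\ dpt ('D_u F v) 0 j = 'D_u (fun y => dpt (F y) 0 j) v.
Proof.
move=> dF; have dFl := @differentiable_rVP R _ _ F v dF; have [->|->|[k ->]] := caseN j.
- have E : (fun y => dpt (F y) 0 i0) = fun y => F y 0 zi by apply/funext => y; exact: dpt0.
  by rewrite E dpt0 derive_rV.
- have E : (fun y => dpt (F y) 0 i1) = fun=> 0 by apply/funext => y; exact: dpt1.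
  by rewrite E dpt1 der_cst; split; [exact: dif_cst|].
- have E : (fun y => dpt (F y) 0 (ix k)) = fun y => F y 0 (xj k) by apply/funext => y; exact: dptx.
  by rewrite E dptx derive_rV.
Qed.

Lemma dpt_derive_fld u v j : dpt ('D_u fld v) 0 j =
  (dpt u *m B) 0 j - ((dpt u *m B) 0 i1 * flag_pt v 0 j + fld_lam v * dpt u 0 j).
Proof.
rewrite (dpt_derive u j (d_fld v)).2.
transitivity ('D_u (fun y => (flag_pt y *m B) 0 j + - (fld_lam y * flag_pt y 0 j)) v).
  by apply: eq_derive => y; exact: dpt_fld.
have dM : differentiable (fun y => fld_lam y * flag_pt y 0 j) v by exact: difM (d_ptM i1 v) (d_pt j v).
have dN : differentiable (fun y => - (fld_lam y * flag_pt y 0 j)) v by exact: differentiableN.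
rewrite (derD u (d_ptM j v) dN) (derN u dM) (derM u (d_ptM i1 v) (d_pt j v)).
rewrite (derive_ptM B v u i1 : 'D_u fld_lam v = _) derive_pt derive_ptM /fld_lam; ring.
Qed.

Lemma derive_fld_p u v k : ('D_u fld v) 0 (pj k) =
  (B *m dxi v u) (ix k) 0 + ((B *m dxi v u) i0 0 * v 0 (pj k) + fld_mu v * u 0 (pj k)).
Proof.
rewrite (derive_rV u (pj k) (d_fld v)).
transitivity ('D_u (fun y => (B *m xi y) (ix k) 0 + fld_mu y * y 0 (pj k)) v).
  by apply: eq_derive => y; rewrite mkvE.
have dc : differentiable (fun y : 'rV[R]_dM => y 0 (pj k)) v by exact: differentiable_coor.
have dM : differentiable (fun y => fld_mu y * y 0 (pj k)) v by exact: difM (d_xiM i0 v) dc.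
rewrite (derD u (d_xiM _ v) dM) (derM u (d_xiM i0 v) dc) derive_coor.
by rewrite (derive_xiM B v u i0 : 'D_u fld_mu v = _) derive_xiM /fld_mu; ring.
Qed.

(** The derivative of [pt_xi], the incidence of line and hyperplane. *)
Lemma pt_dxi v u : flag_pt v *m dxi v u = - (dpt u *m xi v).
Proof.
have Es : \sum_k flag_pt v 0 (ix k) * dxi v u (ix k) 0 = - \sum_k v 0 (xj k) * u 0 (pj k).
  by rewrite -sumrN; apply: eq_bigr => k _; rewrite ptx dxip mulrN.
apply/matrixP => i j; rewrite !ord1 [RHS]mxE dpt_xi [LHS]mxE sumN pt1 dxi0 dxi1 Es.
by rewrite mulr0 add0r mul1r big_split /=; ring.
Qed.

(** The field was built from the entries of the covector at [i0] and [ix k]; the entry at [i1]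
    follows because both sides have the same pairing with the line, by the differentiated incidence
    relation. *)
Lemma dxi_fld v : dxi v (fld v) = fld_mu v *: xi v - B *m xi v.
Proof.
set r := RHS; have r0 : r i0 0 = 0 by rewrite /r mxB mxZ xi0 mulr1 subrr.
have rx k : r (ix k) 0 = dxi v (fld v) (ix k) 0.
  by rewrite dxip mkvE /r mxB mxZ xip; ring.
have E : flag_pt v *m dxi v (fld v) = flag_pt v *m r.
  rewrite pt_dxi /r mulmxBr -scalemxAr pt_xi scaler0 sub0r mulmxA; congr (- _).
  have -> : dpt (fld v) = flag_pt v *m B - fld_lam v *: flag_pt v.
    by apply/rowP => j; rewrite dpt_fld mxB mxZ.
  by rewrite mulmxBl -scalemxAl pt_xi scaler0 subr0.
have := congr1 (fun a : 'M[R]_1 => a 0 0) E.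
rewrite [X in X = _ -> _]mxE [X in _ = X -> _]mxE !sumN r0 dxi0 !pt1 !mul1r => H.
apply/colP => j; have [->|->|[k ->]] := caseN j; [by rewrite r0 dxi0| |by rewrite rx].
have Es : \sum_k flag_pt v 0 (ix k) * dxi v (fld v) (ix k) 0 = \sum_k flag_pt v 0 (ix k) * r (ix k) 0.
  by apply: eq_bigr => k _; rewrite rx.
by move: H; rewrite Es !mulr0 !add0r => /addIr.
Qed.

Lemma th_pairing v u : th v 1%N u = (dpt u *m xi v) 0 0.
Proof. by rewrite thE dpt_xi. Qed.

Lemma derive_th (Y : 'rV[R]_dM -> 'rV[R]_dM) u v : differentiable Y v ->
  'D_u (fun y => th y 1%N (Y y)) v = (dpt ('D_u Y v) *m xi v) 0 0 + (dpt (Y v) *m dxi v u) 0 0.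
Proof.
move=> dY; have dYj j := (dpt_derive u j dY).1.
have dP j : differentiable (fun y => dpt (Y y) 0 j * xi y j 0) v by exact: difM (dYj j) (d_xi j v).
have [_ es] := @derive_bigsum _ _ _ (index_enum 'I_N) xpredT (fun j y => dpt (Y y) 0 j * xi y j 0) u v dP.
transitivity ('D_u (fun y => \sum_j dpt (Y y) 0 j * xi y j 0) v).
  by apply: eq_derive => y; rewrite th_pairing [LHS]mxE.
rewrite es [X in _ = X + _]mxE [X in _ = _ + X]mxE -big_split; apply: eq_bigr => j _ /=.
rewrite (derM u (dYj j) (d_xi j v)) -(dpt_derive u j dY).2.
by rewrite [dxi v u j 0]mxE; ring.
Qed.

Lemma th_derive_fld u v :
  th v 1%N ('D_u fld v) = (dpt u *m B *m xi v) 0 0 - fld_lam v * th v 1%N u.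
Proof.
rewrite !th_pairing.
have -> : dpt ('D_u fld v) = dpt u *m B - ((dpt u *m B) 0 i1 *: flag_pt v + fld_lam v *: dpt u).
  by apply/rowP => j; rewrite dpt_derive_fld [RHS]mxB [X in _ = _ - X]mxD ![in RHS](mxZ _ _ 0 j).
move: (dpt u) => d; rewrite mulmxBl mulmxDl -!scalemxAl pt_xi scaler0 add0r mxB mxZ.
by [].
Qed.

Lemma dpt_dxi_fld u v : (dpt u *m dxi v (fld v)) 0 0 = fld_mu v * th v 1%N u - (dpt u *m B *m xi v) 0 0.
Proof.
rewrite dxi_fld mulmxBr -scalemxAr mulmxA mxB mxZ.
by rewrite th_pairing.
Qed.

(** Differentiating theta(Y) = 0 along the field X of [B] evaluates theta(D_X Y), and
    [th_derive_fld] evaluates theta(D_Y X): both are the pairing of the covector with B applied to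
    the velocity of the line under Y. *)
Lemma th_bracket_fld A Y x : open A -> A x -> smooth_rv_on A Y ->
  (forall y, A y -> th y 1%N (Y y) = 0) -> th x 1%N (cbracket fld Y x) = 0.
Proof.
move=> oA Ax sY Y0; have dY := smooth_rv_diff sY Ax.
have : 'D_(fld x) (fun y => th y 1%N (Y y)) x = 0.
  rewrite -(der_cst 0 (fld x) x); apply: near_eq_derive; exact: open_near Y0.
rewrite (derive_th _ dY) dpt_dxi_fld Y0 // mulr0 sub0r => /eqP; rewrite subr_eq0 => /eqP E.
have lin a b : th x 1%N (a - b) = th x 1%N a - th x 1%N b.
  rewrite !thE mxB (eq_bigr (fun k => x 0 (pj k) * a 0 (xj k) - x 0 (pj k) * b 0 (xj k))).
    by rewrite sumrB; ring.
  by move=> k _; rewrite mxB mulrBr.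
by rewrite /cbracket lin th_derive_fld Y0 // mulr0 subr0 -E th_pairing subrr.
Qed.

End ProjectiveFields.

Section LieIdeal.
Context {R : realType} {n : nat} (n_gt0 : (0 < n)%N).
Notation dM := (n.*2.+1).
Notation N := (n.+2).
Notation FM := (flag_space R n).
Notation zi := (z_idx n).
Notation xj := (@x_idx n).
Notation pj := (@p_idx n).
Notation th := (@th R n).
Notation dth := (ext_d th).
Notation om := (fun _ : 'rV[R]_dM => @hessform R n).
Notation hI := (cideal th dth om).
Implicit Types (u v : 'rV[R]_dM) (A : set 'rV[R]_dM).
Variable B : 'M[R]_N.
Notation X := (fld B).

Let FMm := @flag_manifold R n.
Let d_fld v : differentiable X v.
Proof. exact: (smooth_rv_diff (smooth_fld B openT)). Qed.

(** The p-components of the field depend on the flag only through its hyperplane, so they are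
    constant in directions that do not move the hyperplane. *)
Lemma derive_fld0 u v : dxi v u = 0 -> (forall k, u 0 (pj k) = 0) -> forall k, 'D_u X v 0 (pj k) = 0.
Proof.
move=> d0 up k; rewrite derive_fld_p d0 mulmx0 up [X in X + _]mxE [X in _ + (X * _ + _)]mxE.
by rewrite mulr0 mul0r !addr0.
Qed.

Lemma hatE1_dxi (g : chart FM) v u : hat g (@flag_E1 R n) v u -> dxi v u = 0.
Proof.
move=> /flag_hatE1[uz up]; apply/colP => j; rewrite [RHS]mxE; have [->|->|[k ->]] := caseN j.
- exact: dxi0.
- rewrite dxi1 uz [X in _ + X](eq_bigr (fun k => v 0 (pj k) * u 0 (xj k))) ?addNr // => k _.
  by rewrite up mulr0 addr0.
- by rewrite dxip up oppr0.
Qed.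

(** The actions of B on line and covector cancel in their pairing; only the renormalisations, at
    rates -[fld_lam] and [fld_mu], contribute. *)
Lemma clie_th v : clie X th v = escale (fld_mu B v - fld_lam B v) (th v).
Proof.
apply: eform_ext => k u; have [k1|k1] := eqVneq k 1%N; last first.
  by rewrite (degree_clie X v (@degree_th R n) u k1) /escale (degree_th v u k1) mulr0.
subst k; rewrite (clie1 X v u (@degree_th R n)) /escale.
have Dc a b : 'D_b (fun y => th y 1%N a) v = (dpt a *m dxi v b) 0 0.
  have da : differentiable (fun _ : 'rV[R]_dM => a) v by exact: differentiable_cst.
  have H := derive_th b da; apply: etrans H _.
  rewrite (_ : (dpt _ *m xi v) 0 0 = 0) ?add0r //.
  by rewrite derive_cst dpt_xi mxE big1 ?subr0 // => k _; rewrite mxE mulr0.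
have e4 := etrans (esym (th_pairing v ('D_u X v))) (th_derive_fld B u v).
have e5 := dpt_dxi_fld B u v.
have e3 := etrans (derive_th u (d_fld v)) (congr1 (fun z => z + (dpt (X v) *m dxi v u) 0 0) e4).
have e1 := etrans (Dc u (X v)) e5.
apply: etrans (congr2 +%R (congr2 (fun a b : R => a - b) e1 (Dc (X v) u)) e3) _.
move: ((dpt (X v) *m dxi v u) 0 0) ((dpt u *m B *m xi v) 0 0) (th v 1%N u) => p q r.
by ring.
Qed.

(** By the Leibniz rule only the Lie derivatives of the single factors dp_i matter; these are the
    differentials of the p-components of the field, which vanish in the direction [u] by
    [derive_fld0]. *)
Lemma ector_clie_pform s v u : dxi v u = 0 -> (forall k, u 0 (pj k) = 0) ->
  ector u (clie X (fun=> pform s) v) = ezero.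
Proof.
move=> d0 up; elim: s => [|i s IH].
  rewrite clie_cst pform_nil (@ext_d_cst _ _ _ v ezero (fun y => erefl)).
  by [].
have sd : sform setT (fun _ : 'rV[R]_dM => dcoord (pj i) : eform R dM).
  by apply: sform_cst; exact: alternating_covector.
have sp : sform setT (fun _ : 'rV[R]_dM => pform s) by apply: sform_cst; exact: alternating_pform.
rewrite pform_cons.
rewrite (clie_wedge openT (smooth_fld B openT) sd sp I) ectorD !ector_wedge IH.
rewrite (ector_pform0 (s := s) (u := u)); last by move=> k _; exact: up.
rewrite ector_dcoord up.
have -> : ector u (clie X (fun _ : 'rV[R]_dM => dcoord (pj i)) v) = escalar 0.
  rewrite clie_cst.
  have -> : (fun y => ector (X y) (dcoord (pj i))) = fun y => escalar (X y 0 (pj i)).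
    by apply/funext => y; exact: ector_dcoord.
  rewrite ector_dscalar; congr escalar.
  by rewrite -(derive_rV u (pj i) (d_fld v)); exact: derive_fld0.
rewrite !wedge0r !wedge_scalar; apply: eform_ext => k w; rewrite /eadd /escale /ezero; ring.
Qed.

Lemma clie_om_mod x : exists O (g : 'rV[R]_dM -> R) (bet : 'rV[R]_dM -> eform R dM),
  [/\ open O, O x, smooth_on O g & sform O bet] /\
  forall y, O y -> clie X om y = eadd (escale (g y) hessform) (wedge (bet y) (th y)).
Proof.
pose g := chart_at FM (flag_par (GL1 R n) 0).
have so : sform setT om by apply: sform_cst; exact: alternating_pform.
have E1D y u : setT y -> hat g (@flag_E1 R n) y u -> hat g (@flag_D R n) y u.
  move=> _ /hatE1_span[a ->]; apply/hatD_span; exists a, (fun=> 0).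
  by rewrite [X in _ + X]big1 ?addr0 // => k _; rewrite scale0r.
have ffD y i : setT y -> hat g (@flag_D R n) y (ff i y).
  move=> _; apply/hatD_span; exists (fun=> 0), (fun k => (k == i)%:R).
  rewrite big1 ?add0r => [|k _]; last by rewrite scale0r.
  rewrite (bigD1 i) //= eqxx scale1r big1 ?addr0 // => k /negbTE ->.
  by rewrite scale0r.
have Ds y u : setT y -> hat g (@flag_D R n) y u ->
    exists a (c : 'I_n -> R), hat g (@flag_E1 R n) y a /\ u = a + \sum_i c i *: ff i y.
  move=> _ /hatD_span[a [b ->]]; exists (\sum_i a i *: ef i y), b; split=> //.
  by apply/hatE1_span; exists a.
have ct : ctheta setT (hat g (@flag_D R n)) th.
  have := contact_form_chart FMm flag_contact g (flag_contact_form g).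
  have -> : frep g (flag_theta g) = th by apply/funext => y; exact: frep_theta.
  by apply: ctheta_sub => y _; split=> //; exact: cran_par.
have kill (om' : 'rV[R]_dM -> eform R dM) : sform setT om' -> (forall y, degree n (om' y)) ->
    (forall y u, hat g (@flag_E1 R n) y u -> ector u (om' y) = ezero) ->
    cform n setT (hat g (@flag_D R n)) (hat g (@flag_E1 R n)) om'.
  move=> so' d0 e0; split=> // y _; split; first exact: d0.
  move=> k w _ [i Ei]; apply: (@alt_front _ _ (om' y) k _ _ i (so'.1 _ I k) _ erefl) => k' C.
  by rewrite e0.
have co : cform n setT (hat g (@flag_D R n)) (hat g (@flag_E1 R n)) om.
  apply: kill => // [y|y u /flag_hatE1[_ up]]; first exact: degree_hessform.
  by apply: ector_pform0 => k _; exact: up.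
have col : cform n setT (hat g (@flag_D R n)) (hat g (@flag_E1 R n)) (clie X om).
  apply: kill => [|y|y u hu].
  - exact: (sform_clie openT (smooth_fld B openT)).
  (* [degree_clie] speaks of successor degrees, hence [n.-1] and the positivity of [n]. *)
  - have := @degree_clie _ _ n.-1 X om y; rewrite prednK //; apply=> _; exact: degree_hessform.
  - have /flag_hatE1[_ up] := hu; apply: ector_clie_pform; [exact: hatE1_dxi hu|exact: up].
have vo : cvolume setT (fun i => @ff R n i) om.
  move=> y _; apply: hessform_neq0 => [|i].
    by apply/row_free_rows => c; rewrite sum_ffE => H i; have := congr1 (fun w : 'rV[R]_dM => w 0 (pj i)) H; rewrite mkvE mxE.
  exists (fun k => (k == i)%:R); rewrite rowK (bigD1 i) //= eqxx scale1r big1 ?addr0 // => k /negbTE ->.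
  by rewrite scale0r.
have [ O [h [bet [[oO Ox _ sh sb] E]]]] := cform_mod openT (fun i => @smooth_ff R n i setT) E1D (fun y i => ffD y i) Ds ct col co vo (x := x) I.
by exists O, h, bet; split.
Qed.

Lemma cideal_th x : hI x th.
Proof.
exists setT, (fun=> escalar 1), (fun=> ezero), (fun=> ezero); split=> //; first exact: openT.
  by split; apply: sform_cst; [exact: alternating_scalar|exact: alternating0|exact: alternating0].
move=> y _; rewrite !wedge0l eadd0 wedge_scalar.
by apply: eform_ext => k v; rewrite /eadd /escale /ezero addr0 mul1r.
Qed.

Lemma cideal_om x : hI x om.
Proof.
exists setT, (fun=> ezero), (fun=> ezero), (fun=> escalar 1); split=> //; first exact: openT.
  by split; apply: sform_cst; [exact: alternating0|exact: alternating0|exact: alternating_scalar].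
move=> y _; rewrite !wedge0l wedge_scalar.
by apply: eform_ext => k v; rewrite /eadd /escale /ezero !add0r mul1r.
Qed.

Lemma cideal_clie_th x : hI x (clie X th).
Proof.
have sf : smooth_on setT (fun v => fld_mu B v - fld_lam B v).
  by apply: (smooth_onB openT); [exact: smooth_xiM openT|exact: smooth_ptM openT].
apply: (cideal_ext openT I _ (cidealM openT I (sform_scalar sf) (cideal_th x))) => y _; split=> //.
by rewrite wedge_scalar clie_th.
Qed.

Lemma cideal_clie_dth x : hI x (clie X dth).
Proof.
apply: (cideal_ext openT I _ (cideal_d (cideal_clie_th x))) => y _; split=> //.
by rewrite (clie_d openT (smooth_fld B openT) (sform_th openT) I).
Qed.

Lemma cideal_clie_om x : hI x (clie X om).
Proof.
have [ O [g [bet [[oO Ox sg sb] E]]]] := clie_om_mod x.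
have h1 := cidealM oO Ox (sform_scalar sg) (cideal_om x).
have h2 := cidealM oO Ox sb (cideal_th x).
apply: (cideal_ext oO Ox _ (cidealD h1 h2)) => y Oy; split=> //.
by rewrite E // wedge_scalar.
Qed.

(** Stability is known for the generators; the derivation property of [clie] extends it to their
    combinations. *)
Lemma cideal_clie x eta : hI x eta -> hI x (clie X eta).
Proof.
move=> [ O [b1 [b2 [b3 [oO Ox [s1 s2 s3] E]]]]].
have sX := smooth_fld B oO.
have st : sform O th by exact: sform_th.
have sdt : sform O dth by exact: sform_ext_d.
have so : sform O om by apply: sform_cst; exact: alternating_pform.
have H b f : sform O b -> sform O f -> hI x f -> hI x (clie X f) ->
    hI x (fun y => eadd (wedge (clie X b y) (f y)) (wedge (b y) (clie X f y))).
  move=> sb sf hf hf'; apply: cidealD; first exact: cidealM oO Ox (sform_clie oO sX sb) hf.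
  exact: cidealM oO Ox sb hf'.
have h1 := H _ _ s1 st (cideal_th x) (cideal_clie_th x).
have h2 := H _ _ s2 sdt (cideal_d (cideal_th x)) (cideal_clie_dth x).
have h3 := H _ _ s3 so (cideal_om x) (cideal_clie_om x).
apply: (cideal_ext oO Ox _ (cidealD h1 (cidealD h2 h3))) => y Oy; split=> //.
have w1 := sform_wedge oO s1 st; have w2 := sform_wedge oO s2 sdt; have w3 := sform_wedge oO s3 so.
rewrite (near_eq_clie X oO Oy E) (clieD oO sX w1 (sform_add oO w2 w3) Oy) (clieD oO sX w2 w3 Oy).
by rewrite (clie_wedge oO sX s1 st Oy) (clie_wedge oO sX s2 sdt Oy) (clie_wedge oO sX s3 so Oy).
Qed.

End LieIdeal.

Section FlatAutomorphisms.
Context {R : realType} {n : nat} (n_gt0 : (0 < n)%N).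
Notation dM := (n.*2.+1).
Notation N := (n.+2).
Notation FM := (flag_space R n).
Notation zi := (z_idx n).
Notation xj := (@x_idx n).
Notation pj := (@p_idx n).
Notation th := (@th R n).
Notation fD := (@flag_D R n).
Notation fE1 := (@flag_E1 R n).
Notation fE2 := (@flag_E2 R n).
Implicit Types (u v : 'rV[R]_dM) (A : set 'rV[R]_dM).
Variables (B : 'M[R]_N) (g : chart FM).
Notation X := (fld B).

Let FMm := @flag_manifold R n.

(** The coordinate field carried to the manifold by the chart [g]; its values outside the range of
    [g] carry no meaning, and all statements are restricted to that range. *)
Let XM : vfield FM := vf_of_chart g X.

Let vrepXM : vrep g XM = X.
Proof. by apply/funext => y; exact: (vrep_of_chart FMm). Qed.

Let sXM : smooth_vf (cran g) XM.
Proof. by apply: smooth_vf_of_chart; [exact: FMm|apply: smooth_fld; exact: openT]. Qed.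

Let ocg : mopen (cran g).
Proof. exact: (cran_mopen FMm). Qed.

Lemma hatD_th v u : hat g fD v u <-> th v 1%N u = 0.
Proof. by rewrite flag_hatD thE; split=> [->|/eqP]; [rewrite subrr|rewrite subr_eq0 => /eqP]. Qed.

Lemma fld_preserves (E : plane_field FM) :
  (forall A Y x, open A -> A x -> smooth_rv_on A Y -> (forall y, A y -> hat g E y (Y y)) ->
    hat g E x (cbracket X Y x)) -> @preserves_dist R n (flat_model R n) (cran g) XM E.
Proof.
move=> H V Y oV Vg [sY YE] q Vq; have gq := Vg q Vq; have [_ pq] := parK gq.
have Ax : cpre g V (crd g q) by exact: cpre_crd.
have hY y : cpre g V y -> hat g E y (vrep g Y y).
  move=> [dy Vy]; rewrite /hat /vrep -mulmxA (to_of_chart FMm (cran_par dy)) mulmx1; exact: YE.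
have := H _ _ _ (oV g) Ax (sY g) hY.
have sXV := mopen_smooth_sub Vg sXM.
rewrite -[X in cbracket X]vrepXM -(vrep_bracket FMm oV sXV sY Ax).
by rewrite /hat /vrep pq -mulmxA (to_of_chart FMm gq) mulmx1.
Qed.

(** A coordinate of Y that vanishes identically contributes nothing to D_X Y, so only D_Y X has to
    be examined. *)
Let coord0 A (Y : 'rV[R]_dM -> 'rV[R]_dM) x l : open A -> A x -> smooth_rv_on A Y ->
  (forall y, A y -> Y y 0 l = 0) -> 'D_(Y x) X x 0 l = 0 -> cbracket X Y x 0 l = 0.
Proof.
move=> oA Ax sY Y0 D0; have dY := smooth_rv_diff sY Ax.
have e : 'D_(X x) Y x 0 l = 0.
  rewrite (derive_rV _ _ dY) -(der_cst 0 (X x) x); apply: near_eq_derive; exact: open_near Y0.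
apply: etrans (_ : 'D_(X x) Y x 0 l - 'D_(Y x) X x 0 l = 0); last by rewrite e D0 subrr.
by rewrite /cbracket; move: ('D_(X x) Y x) ('D_(Y x) X x) => a b; rewrite !mxE.
Qed.

Lemma fld_preservesD : @preserves_dist R n (flat_model R n) (cran g) XM fD.
Proof.
apply: fld_preserves => A Y x oA Ax sY hY; apply/hatD_th.
by apply: th_bracket_fld oA Ax sY _ => y Ay; apply/hatD_th; exact: hY.
Qed.

Lemma fld_preserves1 : @preserves_dist R n (flat_model R n) (cran g) XM fE1.
Proof.
apply: fld_preserves => A Y x oA Ax sY hY.
have hY' y : A y -> Y y 0 zi = \sum_k y 0 (pj k) * Y y 0 (xj k) /\ forall k, Y y 0 (pj k) = 0.
  by move=> Ay; apply/(flag_hatE1 g); exact: hY.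
apply/flag_hatE1; split.
  apply/(flag_hatD g)/hatD_th; apply: th_bracket_fld oA Ax sY _ => y Ay.
  by apply/hatD_th/flag_hatD; have [] := hY' y Ay.
move=> k; apply: (coord0 oA Ax sY) => [y Ay|]; first exact: (hY' y Ay).2.
apply: derive_fld0; last exact: (hY' x Ax).2.
exact: hatE1_dxi (hY x Ax).
Qed.

Lemma fld_preserves2 : @preserves_dist R n (flat_model R n) (cran g) XM fE2.
Proof.
apply: fld_preserves => A Y x oA Ax sY hY.
have hY' y : A y -> Y y 0 zi = 0 /\ forall k, Y y 0 (xj k) = 0.
  by move=> Ay; apply/(flag_hatE2 g); exact: hY.
have d0 : dpt (Y x) = 0.
  have [yz yx] := hY' x Ax; apply/rowP => j; rewrite [RHS]mxE.
  by have [->|->|[k ->]] := caseN j; rewrite ?dpt0 ?dpt1 ?dptx.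
have D0 j : dpt ('D_(Y x) X x) 0 j = 0.
  by rewrite dpt_derive_fld d0 mul0mx ![(0 : 'rV[R]_N) _ _]mxE mul0r mulr0 addr0 subrr.
apply/flag_hatE2; split=> [|k]; apply: (coord0 oA Ax sY).
- by move=> y /hY'[].
- by rewrite -dpt0.
- by move=> y /hY'[].
- by rewrite -dptx.
Qed.

Lemma fld_preserves_hess q eta : cran g q ->
  @Hess_system R n q eta -> @Hess_system R n q (lie_form XM eta).
Proof.
move=> gq H; have [V [oV Vq sV _]] := hess_smooth H.
have oU : mopen (V `&` cran g) by exact: mopenI.
have gU : cpre g (V `&` cran g) (crd g q) by apply: cpre_crd => //; split.
have seta : smooth_form (V `&` cran g) eta.
  split=> [q' [Vq' _]|c k w]; first exact: sV.1.
  by apply: smooth_on_sub (sV.2 c k w) => y [dy []].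
have Ug : V `&` cran g `<=` cran g by move=> ? [].
have sce : smooth_form (V `&` cran g) (contract XM eta).
  apply: (smooth_form_chart FMm oU Ug).
  apply: (sform_ext (oU g) (eta := fun y => ector (X y) (frep g eta y))) => [y [dy _]|].
    by rewrite (frep_contract FMm _ _ dy) vrepXM.
  apply: sform_ector_vf; [exact: oU|exact: smooth_fld (oU g)|exact: smooth_form_sform].
apply/(hess_cideal _ gq).
apply: (cideal_ext (oU g) gU _ (cideal_clie n_gt0 B ((hess_cideal _ gq).1 H))) => y Uy; split=> //.
have e : frep g (lie_form XM eta) y = eadd (frep g (contract XM (extd eta)) y) (frep g (extd (contract XM eta)) y).
  by [].
rewrite e (frep_contract FMm _ _ Uy.1) (frep_extd FMm oU seta Uy) (frep_extd FMm oU sce Uy) vrepXM.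
rewrite /clie; congr eadd; apply: (near_eq_ext_d (oU g) Uy) => z [dz _].
by rewrite (frep_contract FMm _ _ dz) vrepXM.
Qed.

Lemma fld_inf_automorphism (p : flat_model R n) : cran g p ->
  inf_automorphism_at p (XM : vfield (flat_model R n)).
Proof.
move=> gp; exists (cran g); split; [exact: ocg|exact: gp|split; first exact: sXM].
split; [exact: fld_preservesD|exact: fld_preserves1|exact: fld_preserves2|].
by move=> q gq eta; exact: fld_preserves_hess.
Qed.

End FlatAutomorphisms.

(** * Independence of the projective fields and the dimension of the flat model *)

Section FlatIndependence.
Context {R : realType} {n : nat} (n_gt0 : (0 < n)%N).
Notation dM := (n.*2.+1).
Notation N := (n.+2).
Notation FM := (flag_space R n).
Notation zi := (z_idx n).
Notation xj := (@x_idx n).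
Notation pj := (@p_idx n).
Implicit Types (u v : 'rV[R]_dM) (A : set 'rV[R]_dM) (B C : 'M[R]_N).

Let FMm := @flag_manifold R n.

Let mxD p q (a b : 'M[R]_(p, q)) i j : (a + b) i j = a i j + b i j.
Proof. by rewrite !mxE. Qed.
Let mxZ p q c (a : 'M[R]_(p, q)) i j : (c *: a) i j = c * a i j.
Proof. by rewrite !mxE. Qed.

Lemma fld_lin a B C v : fld (a *: B + C) v = a *: fld B v + fld C v.
Proof.
have lp j : (flag_pt v *m (a *: B + C)) 0 j = a * (flag_pt v *m B) 0 j + (flag_pt v *m C) 0 j.
  by rewrite mulmxDr -scalemxAr mxD mxZ.
have lx j : ((a *: B + C) *m xi v) j 0 = a * (B *m xi v) j 0 + (C *m xi v) j 0.
  by rewrite mulmxDl -scalemxAl mxD mxZ.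
apply: coordsP => [k||k]; rewrite mxD mxZ !mkvE /fld_lam /fld_mu ?lp ?lx; ring.
Qed.

Lemma fld_sum r (a : 'I_r -> R) (B : 'I_r -> 'M[R]_N) v :
  fld (\sum_i a i *: B i) v = \sum_i a i *: fld (B i) v.
Proof.
have f0 : fld 0 v = 0.
  by have := fld_lin (-1) 0 0 v; rewrite scaler0 addr0 scaleN1r addNr.
elim/big_rec2: _ => [|i w C _ <-]; first exact: f0.
by rewrite fld_lin.
Qed.

(** Both signs of [t] are wanted: their comparison in [fld_inj] isolates the term linear in [t]. *)
Lemma line_near A v u : open A -> A v -> exists t : R, [/\ t != 0, A (v + t *: u) & A (v - t *: u)].
Proof.
move=> oA Av.
have c (w : 'rV[R]_dM) : \forall t \near (0 : R), A (v + t *: w).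
  have h : (fun t : R => v + t *: w) @ (0 : R) --> v + (0 : R) *: w.
    by apply: cvgD; [exact: cvg_cst|apply: cvgZl; exact: cvg_id].
  apply: h; rewrite scale0r addr0; exact: open_nbhs_nbhs.
have : \forall t \near (0 : R), A (v + t *: u) /\ A (v + t *: (- u)).
  by apply: filterI; exact: c.
move=> /nbhs_ballP[e /= e0 H]; exists (e / 2).
have he : ball (0 : R) e (e / 2).
  by rewrite /ball /= sub0r normrN gtr0_norm ?divr_gt0 // ltr_pdivrMr // mulr_natr mulr2n ltrDl.
have [h1 h2] := H _ he; split; [by rewrite gt_eqF // divr_gt0|exact: h1|].
by move: h2; rewrite scalerN.
Qed.

(** Where the field vanishes, the line is an eigenline of [B]. Moving the line near [v0] by
    multiples of e_i shows that e_i is an eigenvector with the same eigenvalue as the line at [v0];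
    this gives the rows [i0] and [ix k], and the eigenvalue is the entry at (i0, i0), assumed 0. Row
    [i1] then follows from the line at [v0] itself. *)
Lemma fld_inj B A v0 : open A -> A v0 -> (forall v, A v -> fld B v = 0) -> B i0 i0 = 0 -> B = 0.
Proof.
move=> oA Av0 f0 B00.
have yB v : A v -> forall j, (flag_pt v *m B) 0 j = fld_lam B v * flag_pt v 0 j.
  move=> Av j; apply/eqP; rewrite -subr_eq0 -dpt_fld f0 //.
  have [->|->|[k ->]] := caseN j; by rewrite ?dpt0 ?dpt1 ?dptx ?mxE.
pose y0 := flag_pt v0; pose l0 := fld_lam B v0.
have ei i : (delta_mx 0 i : 'rV[R]_N) *m B = row i B by rewrite rowE.
have rowB (i : 'I_N) (u : 'rV[R]_dM) : i != i1 -> (forall t, flag_pt (v0 + t *: u) = y0 + t *: delta_mx 0 i) ->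
    forall j, B i j = l0 * (i == j)%:R.
  move=> ii1 hu.
  (* The moved line still has entry 1 at [i1], so that entry shows its eigenvalue: it is l0 + t
     B_(i,i1). *)
  have key t : t != 0 -> A (v0 + t *: u) -> forall j, B i j = B i i1 * y0 0 j + (l0 + t * B i i1) * (i == j)%:R.
    move=> t0 At j.
    have e k : (y0 *m B) 0 k + t * B i k = fld_lam B (v0 + t *: u) * (y0 0 k + t * (i == k)%:R).
      have := yB _ At k; rewrite hu mulmxDl -scalemxAl ei mxD mxZ [row i B 0 k]mxE => ->.
      by rewrite mxD mxZ [(delta_mx _ _) _ _]mxE eqxx /= eq_sym.
    have h0 k : (y0 *m B) 0 k = l0 * y0 0 k by exact: yB.
    have := e i1; rewrite h0 /y0 pt1 (negbTE ii1) mulr0 addr0 !mulr1 => e1.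
    have := e j; rewrite h0 -e1 => e2; apply: (mulfI t0).
    by apply: (addrI (l0 * y0 0 j)); rewrite e2; ring.
  have [t [t0 At Am]] := line_near u oA Av0.
  have Am' : A (v0 + (- t) *: u) by rewrite scaleNr.
  have k1 := key t t0 At; have k2 := key (- t) _ Am'.
  (* At j = i the formulas for t and -t differ by 2 t B_(i,i1). *)
  have c0 : B i i1 = 0.
    have := k1 i; rewrite k2 ?oppr_eq0 // eqxx !mulr1 => /addrI/addrI/eqP.
    by rewrite mulNr eq_sym -subr_eq0 opprK -mulr2n mulrn_eq0 /= mulf_eq0 (negbTE t0) => /eqP.
  by move=> j; rewrite k1 c0 mul0r add0r mulr0 addr0.
have Bz j : B i0 j = l0 * (i0 == j)%:R.
  apply: (rowB i0 (mkv 1 (fun=> 0) (fun=> 0))) => // t.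
  apply/rowP => k; rewrite mxD mxZ [(delta_mx _ _) _ _]mxE eqxx /=.
  by have [->|->|[l ->]] := caseN k; rewrite ?pt0 ?pt1 ?ptx ?mxD ?mxZ ?mkvE ?eqxx ?mulr1 ?mulr0 ?addr0.
have Bx i j : B (ix i) j = l0 * (ix i == j)%:R.
  apply: (rowB (ix i) (mkv 0 (fun k => (k == i)%:R) (fun=> 0))) => // t.
  apply/rowP => k; rewrite mxD mxZ [(delta_mx _ _) _ _]mxE eqxx /=.
  by have [->|->|[l ->]] := caseN k; rewrite ?pt0 ?pt1 ?ptx ?mxD ?mxZ ?mkvE ?mulr0 ?addr0.
have l00 : l0 = 0 by move: B00; rewrite Bz eqxx mulr1.
have B1 j : B i1 j = 0.
  have := yB _ Av0 j; rewrite -/l0 l00 mul0r [LHS]mxE sumN Bz l00 mul0r mulr0 add0r pt1 mul1r.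
  by rewrite big1 ?addr0 // => k _; rewrite Bx l00 mul0r mulr0.
apply/matrixP => i j; rewrite [RHS]mxE.
by have [->|->|[k ->]] := caseN i; rewrite ?B1 ?Bz ?Bx ?l00 ?mul0r.
Qed.

Lemma flat_automorphism_dim (p : flat_model R n) : automorphism_dim p ((n + 2) ^ 2 - 1).
Proof.
set g := chart_at FM p; have gp : cran g p by exact: (cran_at FMm).
(* All positions of matrix units except (i0, i0): there are (n + 2)^2 - 1 of them, and they span a
   complement of the scalar matrices. *)
pose P := [set~ (i0, i0) : 'I_N * 'I_N]%SET.
have cP : #|P| = ((n + 2) ^ 2 - 1)%N.
  by rewrite cardsC1 card_prod card_ord addn2 subn1.
pose ij (k : 'I_((n + 2) ^ 2 - 1)) := enum_val (cast_ord (esym cP) k).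
pose E k : 'M[R]_N := delta_mx (ij k).1 (ij k).2.
apply: (automorphism_dim_max (@flat_model_decomposable R n) n_gt0
  (X := fun k => vf_of_chart g (fld (E k)) : vfield (flat_model R n))).
  by move=> k; exact: fld_inf_automorphism.
move=> a [U [oU Up H]] k0; pose B := \sum_k a k *: E k.
have BE i j : B i j = \sum_k a k * (ij k == (i, j))%:R.
  rewrite summxE; apply: eq_bigr => k _; rewrite mxZ [(delta_mx _ _) _ _]mxE.
  by rewrite [i == _]eq_sym [j == _]eq_sym -xpair_eqE -surjective_pairing.
have Ug : cpre g U (crd g p) by exact: cpre_crd.
have B0 : B = 0.
  apply: (fld_inj (oU g) Ug) => [v [dv Uv]|].
    have gv : cran g (par FM g v) by exact: cran_par.
    have := H _ Uv; rewrite /vf_of_chart.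
    have -> : \sum_k a k *: (fld (E k) (crd g (par FM g v)) *m of_chart g (par FM g v)) =
       fld B v *m of_chart g (par FM g v).
      rewrite /B fld_sum mulmx_suml (crdK FMm dv); apply: eq_bigr => k _.
      exact: scalemxAl.
    move/(congr1 (mulmx^~ (to_chart g (par FM g v)))); rewrite mul0mx -mulmxA (of_to_chart1 FMm gv) mulmx1.
    exact.
  rewrite BE big1 // => k _; have : ij k \in P by exact: enum_valP.
  by rewrite finset.in_setC1 => /negbTE ->; rewrite mulr0.
have := BE (ij k0).1 (ij k0).2; rewrite B0 mxE -surjective_pairing (bigD1 k0) //= eqxx mulr1.
rewrite big1 ?addr0 // => k kk0; rewrite (_ : (ij k == ij k0) = false) ?mulr0 //.
apply/negbTE; apply: contraNneq kk0 => /enum_val_inj/cast_ord_inj ->.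
exact: eqxx.
Qed.

End FlatIndependence.

Theorem proposition4p2 (R : realType) (n : nat) (n_gt0 : (0 < n)%N) :
  (* (1) *)
  ((forall (S S' : lag_system R n) (U : set S) (U' : set S'),
      decomposable_MA_system S -> decomposable_MA_system S' ->
      lag_contact_equivalent U U' -> MA_equivalent U U') /\
   (forall (M : premanifold R n.*2.+1) (D E1 E2 : plane_field M) (I I' : eds M),
      decomposable_MA_system (LagSystem M D E1 E2 I) ->
      decomposable_MA_system (LagSystem M D E1 E2 I') ->
      forall (p : M) (eta : dform M), I p eta <-> I' p eta)) /\
  (* (2) *)
  ((forall S : lag_system R n, decomposable_MA_system S ->
      forall p : S, exists d : nat,
        automorphism_dim p d /\ (d <= (n + 2) ^ 2 - 1)%N) /\
   (decomposable_MA_system (flat_model R n) /\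
    forall p : flat_model R n, automorphism_dim p ((n + 2) ^ 2 - 1)%N)).
Proof.
split; split.
- by move=> S S' U U' hS hS'; exact: equivalent_systems.
- move=> M D E1 E2 I I' [hM hD hL hI1 hI] [_ _ _ hI1' hI'] p eta.
  by split; apply: (system_unique hM hD hL).
- by move=> S hS p; exact: automorphism_dim_bounded.
- by split; [exact: flat_model_decomposable|move=> p; exact: flat_automorphism_dim].
Qed.
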